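(* Let $A\in\mathcal R_{1/2}$ and write $A(x)=L(x)\sqrt x$, where $L\in\mathcal R_0$ is slowly varying. Set $L^*(x):=\sup_{1\le s\le x}L(s)$ for $x\ge 1$. Say that the strong renewal theorem (SRT) holds for a probability $F$ on $[0,\infty)$ satisfying $$(\ast)\qquad F((x,\infty))\sim\frac1{A(x)}\quad\text{as }x\to\infty$$ if $$U((x-h,x])\sim\mathsf C\,h\,\frac{A(x)}{x}\quad\text{as }x\to\infty,\qquad \mathsf C=\frac{\sin(\pi/2)}{\pi}=\frac1\pi,$$ where $h$ is the arithmetic span of $F$ if $F$ is arithmetic, and $h$ is any fixed positive number if $F$ is non-arithmetic. \begin{itemize} \item If $L^*(x)=O(L(x))$ as $x\to\infty$, then the SRT holds for every probability $F$ on $[0,\infty)$ satisfying $(\ast)$. \item If the condition $L^*(x)=O(L(x))$ as $x\to\infty$ fails, then there are probabilities $F$ on $[0,\infty)$ satisfying $(\ast)$ for which the SRT fails. \end{itemize}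
   Context: For positive functions, $f\sim g$ means $\lim_{s\to\infty}f(s)/g(s)=1$. $\mathcal R_\gamma$ is the class of regularly varying functions of index $\gamma$: $f:[0,\infty)\to(0,\infty)$ with $\lim_{x\to\infty}f(\lambda x)/f(x)=\lambda^\gamma$ for all $\lambda>0$; functions in $\mathcal R_0$ are called slowly varying. Throughout, $A:[0,\infty)\to(0,\infty)$ is taken differentiable, strictly increasing, with $A'(s)\sim\frac12A(s)/s$ as $s\to\infty$ (always possible up to asymptotic equivalence). A probability $F$ is arithmetic if it is supported by $h\mathbb Z$ for some $h>0$; the maximal such $h$ is its arithmetic span. Given $F$, let $(X_i)_{i\ge1}$ be i.i.d. with law $F$, $S_0:=0$, $S_n:=X_1+\dots+X_n$. The renewal measure is $U(B):=\sum_{n\ge0}\mathrm P(S_n\in B)$ for Borel $B\subseteq\mathbb R$. *)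

(* Defs.v *)
From HB Require Import structures.
From mathcomp Require Import all_boot all_order all_algebra finmap.
From mathcomp Require Import all_classical all_reals all_analysis.

Set Implicit Arguments.
Unset Strict Implicit.
Unset Printing Implicit Defensive.

Import Order.TTheory GRing.Theory Num.Theory.
Import numFieldNormedType.Exports.

Local Open Scope classical_set_scope.
Local Open Scope ring_scope.

Definition asymp_equiv (R : realType) (f g : R -> R) : Prop :=
  f s / g s @[s --> +oo] --> (1 : R).

(* A function on [0, +oo[ is encoded as a total function on R; nothing is ever
   required of its values at negative arguments. *)
Definition regularly_varying (R : realType) (gamma : R) (f : R -> R) : Prop :=
  (forall x : R, 0 <= x -> 0 < f x) /\
  (forall lambda : R, 0 < lambda ->
     f (lambda * x) / f x @[x --> +oo] --> lambda `^ gamma).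

Definition slowly_varying (R : realType) (f : R -> R) : Prop :=
  regularly_varying 0 f.

(* At the endpoint 0 differentiability is one-sided. *)
Definition differentiable_on_nonneg (R : realType) (f : R -> R) : Prop :=
  (forall s : R, 0 < s -> derivable f s 1) /\
  cvg ((f t - f 0) / t @[t --> 0^'+]).

Definition running_sup (R : realType) (f : R -> R) (x : R) : R :=
  sup [set f s | s in `[1, x]].

(* Makes [f =O_+oo g] available: the library declares no such instance for the
   filter +oo of a real field. *)
Canonical pinfty_filter_on (R : realType) : filter_on R :=
  FilterType (pinfty_nbhs R) proper_pinfty_nbhs.

Definition tail (R : realType) (F : probability (measurableTypeR R) R) (x : R)
  : R := fine (F `]x, +oo[%classic).

Definition lattice (R : realType) (h : R) : set R :=
  [set k%:~R * h | k in [set: int]].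

Definition supported_by_lattice (R : realType)
    (F : probability (measurableTypeR R) R) (h : R) : Prop :=
  F (lattice h) = 1%E.

Definition is_arithmetic (R : realType)
    (F : probability (measurableTypeR R) R) : Prop :=
  exists2 h : R, 0 < h & supported_by_lattice F h.

Definition is_arithmetic_span (R : realType)
    (F : probability (measurableTypeR R) R) (h : R) : Prop :=
  [/\ 0 < h, supported_by_lattice F h &
      forall h' : R, 0 < h' -> supported_by_lattice F h' -> h' <= h].

Definition mutually_independent (R : realType) (d : measure_display)
    (Omega : measurableType d) (P : probability Omega R)
    (X : nat -> {RV P >-> measurableTypeR R}) : Prop :=
  forall (J : {fset nat}) (B : nat -> set (measurableTypeR R)),
    (forall i, measurable (B i)) ->
    P (\bigcap_(i in [set` J]) (X i @^-1` B i)) =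
    (\prod_(i <- J) P (X i @^-1` B i))%E.

(* The two laws are compared on Borel sets only: the value of a library measure
   on a non-measurable set carries no meaning. *)
Definition iid_with_law (R : realType) (d : measure_display)
    (Omega : measurableType d) (P : probability Omega R)
    (X : nat -> {RV P >-> measurableTypeR R})
    (F : probability (measurableTypeR R) R) : Prop :=
  mutually_independent X /\
  (forall i (B : set (measurableTypeR R)),
     measurable B -> distribution P (X i) B = F B).

(* The step X_(i+1) of the random walk is [X i]. *)
Definition random_walk (R : realType) (d : measure_display)
    (Omega : measurableType d) (P : probability Omega R)
    (X : nat -> {RV P >-> measurableTypeR R}) (n : nat) (w : Omega) : R :=
  \sum_(i < n) (X i w : R).

Definition renewal_measure (R : realType) (d : measure_display)
    (Omega : measurableType d) (P : probability Omega R)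
    (X : nat -> {RV P >-> measurableTypeR R}) (B : set R) : \bar R :=
  (\sum_(0 <= n <oo) P (random_walk X n @^-1` B))%E.

(* If U charges ]x - h, x] infinitely, [fine] returns 0, so the equivalence
   below then fails, as it should. *)
Definition renewal_asymptotics (R : realType) (A : R -> R) (h : R)
    (U : set R -> \bar R) : Prop :=
  asymp_equiv (fun x => fine (U `]x - h, x]%classic))
              (fun x => sin (pi / 2) / pi * h * (A x / x)).

(* The renewal measure depends only on the law F, not on the i.i.d. sequence
   realising it; such a sequence always exists. *)
Definition SRT (R : realType) (A : R -> R)
    (F : probability (measurableTypeR R) R) : Prop :=
  forall (d : measure_display) (Omega : measurableType d)
         (P : probability Omega R) (X : nat -> {RV P >-> measurableTypeR R}),
    iid_with_law X F ->
    (forall h, is_arithmetic_span F h ->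
       renewal_asymptotics A h (renewal_measure X)) /\
    (~ is_arithmetic F ->
       forall h : R, 0 < h -> renewal_asymptotics A h (renewal_measure X)).

(* Main.v *)
(** Replace F by the lazy law (delta_0 + F)/2, whose renewal measure is twice
    that of F, whose tail is ~ 1/(2A), and whose atom at 0 keeps its
    characteristic function away from the unit circle off 2 pi Z / span. Let Q be
    convolution with it; P(S_n in ]x-h,x]) is Q^n 1_[0,h) at x.

    Sum over n in three ranges. For n >= A(x)/eta an exponential tilt, and for
    n <= eta A(x) a decomposition on the jumps larger than x/4 (none, after
    tilting, costs little; one, or a jump close to x, leaves a renewal sum in a
    short window) bound the contribution by a small multiple of A(x)/x. The jump
    close to x is where L^* = O(L) enters: it contributes sums of n Q^n 1_[0,h)(z)
    ~ A(z)^2/z = L(z)^2 over z <= x, to be compared with L(x)^2. In the middle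
    range the sum is flat in x at scale eps x by Fourier inversion, so it is
    determined by its averages over such windows, and these follow from
    sum_n P(S_n <= x) ~ (4/pi) A(x). That asymptotics needs no Tauberian theorem:
    the convolution square of the tail is ~ (pi/4) x/A(x)^2, because the integral
    of 1/sqrt(s(x-s)) over ]0,x[ is pi, while its potential is the integrated
    tail, ~ x/A(x).

    Conversely, if L^* is not O(L), choose windows [X_k - Z_k, X_k] with
    L(Z_k) > 2^k L(X_k) and add to a tail ~ 1/A the mass 2^-k/A(X_k), spread
    uniformly over the k-th window. The tail remains ~ 1/A, but a single jump into
    the window followed or preceded by a walk of displacement at most Z_k gives
    U({X_k}) >= c 2^-k L(Z_k)^2/A(X_k) >= c 2^k A(X_k)/X_k. *)

Require Import Defs.
From HB Require Import structures.
From mathcomp Require Import all_boot all_order all_algebra finmap.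
From mathcomp Require Import all_classical all_reals all_analysis.
From mathcomp Require Import measurable_realfun.
From mathcomp Require Import ring lra.

Set Implicit Arguments.
Unset Strict Implicit.
Unset Printing Implicit Defensive.

Import Order.TTheory GRing.Theory Num.Theory.
Import numFieldNormedType.Exports.

Local Open Scope classical_set_scope.
Local Open Scope ring_scope.

(** * Integrals of bounded measurable functions and convolution operators *)

(** Index 1/2 is critical in the Fourier estimates. Near 0 the modulus of the lazy characteristic
    function is at most [expR (- c / A th^-1)], so summing its powers with weight [n ^+ k] gives a
    multiple of [A th^-1 ^+ k.+1]. The integral of this is governed by its lower end if [k >= 2],
    while for [k = 1] the index is exactly -1. Hence the tilt for small n is set to gain two powers
    of [n / A x], and sums of [n Q^n] are brought back to weight [n ^+ 2].

    The tail is [1 - Q] applied to the indicator of [0, +oo[, so its potential telescopes.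
    Convolving once more with the tail gives a function that is nearly constant on [d x, x] with a
    known potential; dividing by that constant yields the renewal function.

    In passing from averages to single windows the constants are fixed in this order: the share of
    the extreme ranges, hence [eta]; the flatness constant, which depends on [eta]; the relative
    length eps; then the accuracy of the averages, small against eps.

    The lazy and original sums are compared through [Q = (1 + C) / 2], where C is convolution with
    F. *)

Section bounded_measurable.
Context {R : realType}.

(** All functions are kept bounded and measurable on the whole space, and all measures finite, so
    that linearity, monotonicity and Fubini hold with no integrability side condition. *)
Definition bm d (T : measurableType d) (f : T -> R) : Prop :=
  measurable_fun [set: T] f /\ exists M : R, forall x, `|f x| <= M.

Section closure.
Context d (T : measurableType d).
Implicit Types f g : T -> R.

Lemma bm_bound f : bm f -> exists2 M : R, 0 < M & forall x, `|f x| <= M.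
Proof.
move=> [_ [M fM]]; exists (`|M| + 1) => [|x]; first exact: ltr_wpDl.
by rewrite (le_trans (fM x))// (le_trans (ler_norm M))// lerDl.
Qed.

Lemma bm_cst (c : R) : bm (fun _ : T => c).
Proof. by split; [exact: measurable_cst|exists `|c|]. Qed.

Lemma bmD f g : bm f -> bm g -> bm (fun x => f x + g x).
Proof.
move=> [mf [M fM]] [mg [N gN]]; split; first exact: measurable_funD.
by exists (M + N) => x; rewrite (le_trans (ler_normD _ _))// lerD.
Qed.

Lemma bmN f : bm f -> bm (fun x => - f x).
Proof.
move=> [mf [M fM]]; split; first exact: measurableT_comp.
by exists M => x; rewrite normrN.
Qed.

Lemma bmB f g : bm f -> bm g -> bm (fun x => f x - g x).
Proof. by move=> bf bg; apply: bmD => //; exact: bmN. Qed.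

Lemma bmM f g : bm f -> bm g -> bm (fun x => f x * g x).
Proof.
move=> [mf [M fM]] [mg [N gN]]; split; first exact: measurable_funM.
by exists (M * N) => x; rewrite normrM ler_pM.
Qed.

Lemma bmZ (c : R) f : bm f -> bm (fun x => c * f x).
Proof. by move=> bf; apply: bmM => //; exact: bm_cst. Qed.

Lemma bm_sum I (s : seq I) (P : pred I) (F : I -> T -> R) :
  (forall i, bm (F i)) -> bm (fun x => \sum_(i <- s | P i) F i x).
Proof.
move=> bF; elim: s => [|i s IH].
  by under eq_fun do rewrite big_nil; exact: bm_cst.
under eq_fun do rewrite big_cons.
by case: (P i) => //; apply: bmD.
Qed.

Lemma bm_indic (A : set T) : measurable A -> bm (\1_A : T -> R).
Proof.
move=> mA; split; first exact: measurable_indic.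
by exists 1 => x; rewrite indicE; case: (x \in A); rewrite ?normr1 ?normr0.
Qed.

Lemma bm_comp d' (T' : measurableType d') (u : T' -> T) f :
  measurable_fun [set: T'] u -> bm f -> bm (fun x => f (u x)).
Proof.
move=> mu [mf [M fM]]; split; first exact: measurableT_comp mf mu.
by exists M => x; exact: fM.
Qed.

Lemma bmX f n : bm f -> bm (fun x => f x ^+ n).
Proof.
move=> bf; elim: n => [|n IH].
  by under eq_fun do rewrite expr0; exact: bm_cst.
by under eq_fun do rewrite exprS; exact: bmM.
Qed.

End closure.

Section functional.
Context d (T : measurableType d) (mu : {finite_measure set T -> \bar R}).
Implicit Types f g : T -> R.

(* Real-valued, hence junk for non-integrable f; used on bounded measurable f only. *)
Definition J f : R := \int[mu]_x f x.

Lemma bm_integrable f : bm f -> mu.-integrable setT (EFin \o f).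
Proof.
move=> [mf [M fM]]; apply: measurable_bounded_integrable => //.
  by rewrite -ge0_fin_numE//; exact: fin_num_measure.
by exists M; split; [exact: num_real|move=> x Mx y _ /=; rewrite (le_trans (fM y))// ltW].
Qed.

Lemma JD f g : bm f -> bm g -> J (fun x => f x + g x) = J f + J g.
Proof. by move=> bf bg; rewrite /J RintegralD//; exact: bm_integrable. Qed.

Lemma JB f g : bm f -> bm g -> J (fun x => f x - g x) = J f - J g.
Proof. by move=> bf bg; rewrite /J RintegralB//; exact: bm_integrable. Qed.

Lemma JZ c f : bm f -> J (fun x => c * f x) = c * J f.
Proof. by move=> bf; rewrite /J RintegralZl//; exact: bm_integrable. Qed.

Lemma J_cst c : J (fun=> c) = c * J (fun=> 1).
Proof. by rewrite /J !Rintegral_cst// mul1r. Qed.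

Lemma J_sum I (s : seq I) (P : pred I) (F : I -> T -> R) :
  (forall i, bm (F i)) ->
  J (fun x => \sum_(i <- s | P i) F i x) = \sum_(i <- s | P i) J (F i).
Proof.
move=> bF; elim: s => [|i s IH].
  by under eq_fun do rewrite big_nil; rewrite J_cst mul0r big_nil.
under eq_fun do rewrite big_cons.
rewrite big_cons; case: (P i) => //; rewrite -IH -JD//; exact: bm_sum.
Qed.

Lemma J_ge0 f : (forall x, 0 <= f x) -> 0 <= J f.
Proof. by move=> f0; apply: Rintegral_ge0. Qed.

Lemma J_le f g : bm f -> bm g -> (forall x, f x <= g x) -> J f <= J g.
Proof. by move=> bf bg fg; apply: le_Rintegral => //; exact: bm_integrable. Qed.

Lemma J_norm f : bm f -> `|J f| <= J (fun x => `|f x|).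
Proof. by move=> bf; apply: le_normr_Rintegral => //; exact: bm_integrable. Qed.

Lemma bm_norm f : bm f -> bm (fun x => `|f x|).
Proof.
move=> [mf [M fM]]; split; first exact: measurableT_comp.
by exists M => x; rewrite normr_id.
Qed.

Lemma EFin_J f : bm f -> (J f)%:E = (\int[mu]_x (f x)%:E)%E.
Proof.
move=> bf; rewrite /J /Rintegral fineK//.
by apply: integrable_fin_num => //; exact: bm_integrable.
Qed.

End functional.

Section fubini.
Context d1 d2 (T1 : measurableType d1) (T2 : measurableType d2).
Context (m1 : {finite_measure set T1 -> \bar R}).
Context (m2 : {finite_measure set T2 -> \bar R}).

Lemma bm_pair1 (f : T1 * T2 -> R) x : bm f -> bm (fun y => f (x, y)).
Proof. by move=> bf; apply: bm_comp bf; exact: pair1_measurable. Qed.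

Lemma bm_pair2 (f : T1 * T2 -> R) y : bm f -> bm (fun x => f (x, y)).
Proof. by move=> bf; apply: bm_comp bf; exact: pair2_measurable. Qed.


Lemma bm_J (f : T1 * T2 -> R) : bm f -> bm (fun x => J m2 (fun y => f (x, y))).
Proof.
move=> bf; have [M M0 fM] := bm_bound bf; split; last first.
  exists (M * J m2 (fun=> 1)) => x.
  have bx := bm_pair1 x bf.
  rewrite (le_trans (J_norm m2 bx))// -J_cst; apply: J_le; last by move=> y; exact: fM.
    exact: bm_norm.
  exact: bm_cst.
(* Adding the bound [M] makes the integrand nonnegative, so that measurability of the partial
   integral is that of Tonelli's theorem. *)
have bfM : bm (fun z => f z + M) by apply: bmD => //; exact: bm_cst.
have -> : (fun x => J m2 (fun y => f (x, y))) =
   (fun x => fine (\int[m2]_y (f (x, y) + M)%:E)%E - M * J m2 (fun=> 1)).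
  apply/funext => x.
  have bx := bm_pair1 x bf; have bxM := bmD bx (bm_cst T2 M).
  have h : J m2 (fun y => f (x, y) + M) = J m2 (fun y => f (x, y)) + M * J m2 (fun=> 1).
    by rewrite (JD m2 bx (bm_cst T2 M)) [J _ (fun=> M)]J_cst.
  have <- : J m2 (fun y => f (x, y) + M) = fine (\int[m2]_y (f (x, y) + M)%:E)%E by [].
  by rewrite h addrK.
apply: measurable_funB => //.
apply: (@measurableT_comp _ _ _ _ _ _ fine) => //.
apply: (measurable_fun_fubini_tonelli_F (fun z : T1 * T2 => (f z + M)%:E)).
  by apply/measurable_EFinP; case: bfM.
by move=> z; rewrite lee_fin; have := fM z; rewrite ler_norml => /andP[]; lra.
Qed.

Lemma J_fubini (f : T1 * T2 -> R) : bm f ->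
  J m1 (fun x => J m2 (fun y => f (x, y))) =
  J m2 (fun y => J m1 (fun x => f (x, y))).
Proof.
move=> bf; have [M M0 fM] := bm_bound bf.
have fi : (m1 \x m2)%E.-integrable setT (EFin \o f).
  apply/integrable12ltyP; first by apply/measurable_EFinP; case: bf.
  apply: (@le_lt_trans _ _ (\int[m1]_x (J m2 (fun=> M))%:E)%E).
    apply: ge0_le_integral => //.
    - by move=> x _; apply: integral_ge0.
    - apply: (measurable_fun_fubini_tonelli_F (fun z : T1 * T2 => `|(EFin \o f) z|%E)) => //.
      by apply: (@measurableT_comp _ _ _ _ _ _ abse) => //; apply/measurable_EFinP; case: bf.
    - move=> x _; rewrite (EFin_J m2 (bm_cst T2 M)); apply: ge0_le_integral => //.
      + apply: (@measurableT_comp _ _ _ _ _ _ abse) => //.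
        by apply/measurable_EFinP; case: (bm_pair1 x bf).
      + by move=> y _; rewrite /= lee_fin.
  rewrite -(EFin_J m1 (bm_cst T1 _)); exact: ltry.
have h1 : (fun x => (J m2 (fun y => f (x, y)))%:E) = (fun x => \int[m2]_y (EFin \o f) (x, y))%E.
  by apply/funext => x; rewrite EFin_J//; exact: bm_pair1.
have h2 : (fun y => (J m1 (fun x => f (x, y)))%:E) = (fun y => \int[m1]_x (EFin \o f) (x, y))%E.
  by apply/funext => y; rewrite EFin_J//; exact: bm_pair2.
rewrite {1}/J /Rintegral h1 (Fubini fi) -h2//.
Qed.

End fubini.
End bounded_measurable.

(** * Integrals over segments and comparison with approximate primitives *)

Section interval.
Context {R : realType}.
Implicit Types (f g : R -> R) (a b : R).

Let lty a b : (@lebesgue_measure R `[a, b]%classic < +oo)%E.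
Proof. by rewrite lebesgue_measure_itv/=; case: ifP => _ //; rewrite -EFinB ltry. Qed.

(** Lebesgue measure on a segment as a finite measure: integrals in frequency or in space fall under
    the same calculus as integrals against laws, including Fubini and the operators below. *)
Definition leb a b : {finite_measure set (measurableTypeR R) -> \bar R} := 
  @mfrestr _ (measurableTypeR R) R `[a, b]%classic lebesgue_measure (measurable_itv `[a, b]) (lty a b).

Definition LI a b f : R := \int[@lebesgue_measure R]_(t in `[a, b]) f t.

Lemma LI_J a b f : bm f -> LI a b f = J (leb a b) f.
Proof.
move=> bf; have mab : @measurable _ (measurableTypeR R) `[a, b]%classic by exact: (@measurable_itv R).
have fi := bm_integrable (leb a b) bf.
have fi2 : (leb a b).-integrable `[a, b]%classic (EFin \o f).
  exact: integrableS fi.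
have n0 : leb a b (~` `[a, b]%classic) = 0%E.
  change (@lebesgue_measure R (~` `[a, b]%classic `&` `[a, b]%classic) = 0%E).
  by rewrite setICl measure0.
rewrite /J /LI /Rintegral; congr fine.
rewrite (negligible_integral (measurableC mab) _ fi n0)// setTD setCK.
apply: eq_measure_integral => A mA Aab.
change (@lebesgue_measure R A = @lebesgue_measure R (A `&` `[a, b]%classic)).
by rewrite setIidl.
Qed.

Lemma bm_integrable_itv a b f : bm f ->
  (@lebesgue_measure R).-integrable `[a, b] (EFin \o f).
Proof.
move=> [mf [M fM]]; apply: measurable_bounded_integrable => //; first exact: lty.
  exact: measurable_funTS.
by exists M; split; [exact: num_real|move=> x Mx y _ /=; rewrite (le_trans (fM y))// ltW].
Qed.

Lemma LI_le a b f g : bm f -> bm g -> (forall x, a <= x <= b -> f x <= g x) ->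
  LI a b f <= LI a b g.
Proof.
move=> bf bg fg; apply: le_Rintegral; [by []|exact: bm_integrable_itv..|].
by move=> x /=; rewrite in_itv/=; exact: fg.
Qed.

Lemma LI_cst a b c : a <= b -> LI a b (fun=> c) = c * (b - a).
Proof.
move=> ab; rewrite /LI Rintegral_cst; last exact: measurable_itv.
have := @lebesgue_measure_itv R `[a, b]; rewrite /= lte_fin => ->.
by case: ltP => // ba; rewrite (le_anti (introT andP (conj ab ba))) subrr.
Qed.

Lemma LI_ge0 a b f : (forall x, a <= x <= b -> 0 <= f x) -> 0 <= LI a b f.
Proof. by move=> f0; apply: Rintegral_ge0 => x /=; rewrite in_itv/=; exact: f0. Qed.

Lemma LI_norm a b f : bm f -> `|LI a b f| <= LI a b (fun x => `|f x|).
Proof. by move=> bf; apply: le_normr_Rintegral => //; exact: bm_integrable_itv. Qed.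

Lemma LIB a b f g : bm f -> bm g -> LI a b (fun x => f x - g x) = LI a b f - LI a b g.
Proof. by move=> bf bg; rewrite /LI RintegralB//; exact: bm_integrable_itv. Qed.

Lemma LIZ a b c f : bm f -> LI a b (fun x => c * f x) = c * LI a b f.
Proof. by move=> bf; rewrite /LI RintegralZl//; exact: bm_integrable_itv. Qed.

Lemma LI_sum a b I (s : seq I) (P : pred I) (F : I -> R -> R) :
  (forall i, bm (F i)) ->
  LI a b (fun x => \sum_(i <- s | P i) F i x) = \sum_(i <- s | P i) LI a b (F i).
Proof.
move=> bF; rewrite LI_J; last exact: bm_sum.
by rewrite J_sum//; apply: eq_bigr => i _; rewrite LI_J.
Qed.

Lemma LI_eq a b f g : (forall x, a <= x <= b -> f x = g x) -> LI a b f = LI a b g.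
Proof.
move=> fg; apply: eq_Rintegral => x; rewrite inE/= in_itv/=; exact: fg.
Qed.

Lemma LI_split a b c f : bm f -> a <= c -> c <= b ->
  LI a b f = LI a c f + LI c b f.
Proof.
move=> bf ac cb.
have := @Rintegral_itvB R f (BLeft a) (BRight b) c (bm_integrable_itv a b bf).
rewrite !bnd_simp => /(_ ac cb); rewrite -/(LI a b f) -/(LI a c f) => e.
rewrite Rintegral_itv_obnd_cbnd in e; last first.
  by apply: integrableS (bm_integrable_itv c b bf) => //; apply: subset_itv; rewrite bnd_simp.
by move: e; rewrite -/(LI c b f); lra.
Qed.

(** [P x - LI a x g] has derivative [dP x - g x >= 0]. Only an inequality links [g] to [dP], so
    approximate primitives such as [s / A s] can serve: every estimate of Karamata type below is
    obtained in this way. *)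
Lemma LI_le_primitive a b g (P dP : R -> R) : a <= b -> bm g ->
  (forall x, a < x < b -> {for x, continuous g}) ->
  (forall x, a < x < b -> is_derive x 1 P (dP x)) ->
  {within `[a, b], continuous P} ->
  (forall x, a < x < b -> g x <= dP x) ->
  LI a b g <= P b - P a.
Proof.
rewrite le_eqVlt => /predU1P[-> bg _ _ _ _|ab bg cg dPP cP gP].
  by rewrite subrr /LI set_itv1 Rintegral_set1.
have ig u : a < u -> (@lebesgue_measure R).-integrable `[a, u] (EFin \o g).
  by move=> _; exact: bm_integrable_itv.
pose H x := P x - LI a x g.
have dL x : x \in `]a, b[ -> is_derive x 1 (fun y => LI a y g) (g x).
  rewrite in_itv/= => axb; have /andP[ax xb] := axb.
  have [d1 d2] := continuous_FTC1_closed xb (ig _ ab) ax (cg x axb).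
  by rewrite -d2 derive1E; exact/derivableP.
have dH x : x \in `]a, b[ -> is_derive x 1 H (dP x - g x).
  move=> xab; have h := dL x xab.
  have h2 : is_derive x 1 P (dP x) by apply: dPP; move: xab; rewrite in_itv.
  exact: is_deriveB.
have cH : {within `[a, b], continuous H}.
  move=> x; apply: cvgB; first exact: cP.
  by apply: (parameterized_integral_continuous (ltW ab)); exact: ig.
have : H a <= H b.
  apply: (@ger0_derive1_le_cc _ H a b _ _ cH) => //.
  - by move=> x /dH ?; exact: ex_derive.
  - move=> x xab; have h := dH x xab.
    by rewrite derive1E derive_val subr_ge0 gP//; move: xab; rewrite in_itv.
  - by rewrite in_itv/= lexx ltW.
  - by rewrite in_itv/= lexx ltW.
  - exact: ltW.
have -> : H a = P a by rewrite /H /LI set_itv1 Rintegral_set1 subr0.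
by rewrite /H; lra.
Qed.

Lemma LI_ge_primitive a b g (P dP : R -> R) : a <= b -> bm g ->
  (forall x, a < x < b -> {for x, continuous g}) ->
  (forall x, a < x < b -> is_derive x 1 P (dP x)) ->
  {within `[a, b], continuous P} ->
  (forall x, a < x < b -> dP x <= g x) ->
  P b - P a <= LI a b g.
Proof.
move=> ab bg cg dPP cP gP.
have := @LI_le_primitive a b (fun x => - g x) (fun x => - P x) (fun x => - dP x) ab (bmN bg).
have -> : LI a b (fun x => - g x) = - LI a b g.
  rewrite -mulN1r -LIZ//; apply: LI_eq => x _; by rewrite mulN1r.
move=> h; rewrite -lerN2 opprB.
suff : - LI a b g <= - P b - - P a by clear; lra.
apply: h.
- by move=> x axb; apply: continuousN; exact: cg.
- by move=> x axb; apply: is_deriveN; exact: dPP.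
- by move=> x; apply: continuousN; exact: cP.
- by move=> x axb; rewrite lerN2; exact: gP.
Qed.

End interval.

(** * Weighted convolution operators and their iterates *)

Section operator.
Context {R : realType}.
Implicit Types (mu nu : {finite_measure set (measurableTypeR R) -> \bar R}).
Implicit Types (f g p q : R -> R).

(* E[p(X) f(x - X)] for X of law mu. The weight p restricts or tilts the steps:
   iterating n times at chi h gives E[prod_i p(X_i); S_n in ]x - h, x]]. *)
Definition Op mu p f (x : R) : R := J mu (fun y => p y * f (x - y)).

Lemma bm_shift f x : bm f -> bm (fun y : R => f (x - y)).
Proof. by move=> bf; apply: bm_comp bf; exact: measurable_funB. Qed.

Lemma bm_sub2 f : bm f -> bm (fun z : R * R => f (z.1 - z.2)).
Proof. by move=> bf; apply: bm_comp bf; exact: measurable_funB. Qed.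

Lemma bm_Op mu p f : bm p -> bm f -> bm (Op mu p f).
Proof.
move=> bp bf; apply: (@bm_J _ _ _ _ _ mu (fun z : R * R => p z.2 * f (z.1 - z.2))).
by apply: bmM; [apply: bm_comp bp; exact: measurable_snd|exact: bm_sub2].
Qed.

Lemma bm_Op_body p f x : bm p -> bm f -> bm (fun y : R => p y * f (x - y)).
Proof. by move=> bp bf; apply: bmM => //; exact: bm_shift. Qed.

Lemma Op_le mu p f g x : bm p -> bm f -> bm g -> (forall y, 0 <= p y) ->
  (forall y, f y <= g y) -> Op mu p f x <= Op mu p g x.
Proof.
move=> bp bf bg p0 fg; apply: J_le; try exact: bm_Op_body.
by move=> y; rewrite ler_wpM2l.
Qed.

Lemma Op_lep mu p q f x : bm p -> bm q -> bm f -> (forall y, 0 <= f y) ->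
  (forall y, p y <= q y) -> Op mu p f x <= Op mu q f x.
Proof.
move=> bp bq bf f0 pq; apply: J_le; try exact: bm_Op_body.
by move=> y; rewrite ler_wpM2r.
Qed.

Lemma Op_ge0 mu p f x : (forall y, 0 <= p y) -> (forall y, 0 <= f y) -> 0 <= Op mu p f x.
Proof. by move=> p0 f0; apply: J_ge0 => y; rewrite mulr_ge0. Qed.

Lemma OpD mu p f g : bm p -> bm f -> bm g ->
  Op mu p (fun x => f x + g x) = fun x => Op mu p f x + Op mu p g x.
Proof.
move=> bp bf bg; apply/funext => x; rewrite /Op -JD; try exact: bm_Op_body.
by congr J; apply/funext => y; rewrite mulrDr.
Qed.

Lemma OpZ mu p c f : bm p -> bm f ->
  Op mu p (fun x => c * f x) = fun x => c * Op mu p f x.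
Proof.
move=> bp bf; apply/funext => x; rewrite /Op -JZ; last exact: bm_Op_body.
by congr J; apply/funext => y; rewrite mulrCA.
Qed.

Lemma OpB mu p f g : bm p -> bm f -> bm g ->
  Op mu p (fun x => f x - g x) = fun x => Op mu p f x - Op mu p g x.
Proof.
move=> bp bf bg; apply/funext => x; rewrite /Op -JB; try exact: bm_Op_body.
by congr J; apply/funext => y; rewrite mulrBr.
Qed.

Lemma Op_sum mu p I (s : seq I) (P : pred I) (F : I -> R -> R) :
  bm p -> (forall i, bm (F i)) ->
  Op mu p (fun x => \sum_(i <- s | P i) F i x) =
  fun x => \sum_(i <- s | P i) Op mu p (F i) x.
Proof.
move=> bp bF; apply/funext => x; rewrite /Op -J_sum; last by move=> i; exact: bm_Op_body.
by congr J; apply/funext => y; rewrite mulr_sumr.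
Qed.

Lemma OpDp mu p q f : bm p -> bm q -> bm f ->
  Op mu (fun y => p y + q y) f = fun x => Op mu p f x + Op mu q f x.
Proof.
move=> bp bq bf; apply/funext => x; rewrite /Op -JD; try exact: bm_Op_body.
by congr J; apply/funext => y; rewrite mulrDl.
Qed.

(** The two measures may differ. With [leb] as one of them, averaging over a window, or convolving
    with the tail, passes through the steps of the walk. *)
Lemma Op_comm mu nu p q f : bm p -> bm q -> bm f ->
  Op mu p (Op nu q f) = Op nu q (Op mu p f).
Proof.
move=> bp bq bf; apply/funext => x; rewrite /Op.
have b3 : bm (fun z : R * R => p z.1 * (q z.2 * f (x - z.1 - z.2))).
  apply: bmM; first by apply: bm_comp bp; exact: measurable_fst.
  apply: bmM; first by apply: bm_comp bq; exact: measurable_snd.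
  by apply: bm_comp bf; apply: measurable_funB => //; exact: measurable_funB.
transitivity (J mu (fun y => J nu (fun z => p y * (q z * f (x - y - z))))).
  congr J; apply/funext => y; rewrite -JZ//.
  by apply: bmM => //; exact: bm_shift.
rewrite (J_fubini mu nu b3); congr J; apply/funext => z; rewrite -JZ.
  by congr J; apply/funext => y; rewrite mulrCA [x - z - y]addrAC.
by apply: bmM => //; exact: bm_shift.
Qed.

Lemma Op_shift mu p f a : Op mu p (fun x => f (x + a)) = fun x => Op mu p f (x + a).
Proof. by apply/funext => x; congr J; apply/funext => y; rewrite addrAC. Qed.

Lemma bm_iter mu p f n : bm p -> bm f -> bm (iter n (Op mu p) f).
Proof. by move=> bp bf; elim: n => //= n; exact: bm_Op. Qed.

Lemma iter_ge0 mu p f n x : (forall y, 0 <= p y) -> (forall y, 0 <= f y) ->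
  0 <= iter n (Op mu p) f x.
Proof. by move=> p0 f0; elim: n x => //= n IH x; exact: Op_ge0. Qed.

Lemma iter_le mu p f g n x : bm p -> bm f -> bm g -> (forall y, 0 <= p y) ->
  (forall y, f y <= g y) -> iter n (Op mu p) f x <= iter n (Op mu p) g x.
Proof.
by move=> bp bf bg p0 fg; elim: n x => //= n IH x; apply: Op_le => //; exact: bm_iter.
Qed.

Lemma iter_opD mu p f g n : bm p -> bm f -> bm g ->
  iter n (Op mu p) (fun x => f x + g x) =
  fun x => iter n (Op mu p) f x + iter n (Op mu p) g x.
Proof. by move=> bp bf bg; elim: n => //= n ->; rewrite OpD//; exact: bm_iter. Qed.

Lemma iterB mu p f g n : bm p -> bm f -> bm g ->
  iter n (Op mu p) (fun x => f x - g x) =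
  fun x => iter n (Op mu p) f x - iter n (Op mu p) g x.
Proof. by move=> bp bf bg; elim: n => //= n ->; rewrite OpB//; exact: bm_iter. Qed.

Lemma iterZ mu p c f n : bm p -> bm f ->
  iter n (Op mu p) (fun x => c * f x) = fun x => c * iter n (Op mu p) f x.
Proof. by move=> bp bf; elim: n => //= n ->; rewrite OpZ//; exact: bm_iter. Qed.

Lemma iter_sum mu p I (s : seq I) (P : pred I) (F : I -> R -> R) n :
  bm p -> (forall i, bm (F i)) ->
  iter n (Op mu p) (fun x => \sum_(i <- s | P i) F i x) =
  fun x => \sum_(i <- s | P i) iter n (Op mu p) (F i) x.
Proof. by move=> bp bF; elim: n => //= n ->; rewrite Op_sum// => i; exact: bm_iter. Qed.

Lemma iter_shift mu p f a n : iter n (Op mu p) (fun x => f (x + a)) =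
  fun x => iter n (Op mu p) f (x + a).
Proof. by elim: n => //= n ->; rewrite Op_shift. Qed.

Lemma iter_comm mu nu p q f n : bm p -> bm q -> bm f ->
  iter n (Op mu p) (Op nu q f) = Op nu q (iter n (Op mu p) f).
Proof. by move=> bp bq bf; elim: n => //= n ->; rewrite Op_comm//; exact: bm_iter. Qed.

End operator.

Section monotone_bm.
Context {R : realType}.
Implicit Types f : R -> R.

Lemma bm_nondecreasing f (M : R) : {homo f : x y / x <= y} ->
  (forall x, `|f x| <= M) -> bm f.
Proof.
move=> mf fM; split; last by exists M.
by apply: nondecreasing_measurable => // x y _ _; exact: mf.
Qed.

Lemma bm_nonincreasing f (M : R) : {homo f : x y /~ x <= y} ->
  (forall x, `|f x| <= M) -> bm f.
Proof.
move=> mf fM; rewrite (_ : f = fun x => - - f x); last by apply/funext => x; rewrite opprK.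
apply/bmN/(@bm_nondecreasing _ M) => [x y xy|x]; first by rewrite lerN2; exact: mf.
by rewrite normrN.
Qed.

End monotone_bm.

(** * Regularly varying functions of index 1/2 *)

Section regular_variation.
Context {R : realType}.

(** Every comparison of [A] at two scales will come from [A_der], by integrating the logarithmic
    derivative of [A]. *)
Record rv_half (A : R -> R) : Prop := {
  A_gt0 : forall x : R, 0 <= x -> 0 < A x ;
  A_incr : forall x y : R, 0 <= x -> x < y -> A x < A y ;
  A_der : forall e : R, 0 < e -> exists2 s0 : R, 1 <= s0 &
    forall s : R, s0 <= s -> derivable A s 1 /\
    (2^-1 - e) * (A s / s) <= derive1 A s <= (2^-1 + e) * (A s / s) }.

Lemma A_le A (rA : rv_half A) (x y : R) : 0 <= x -> x <= y -> A x <= A y.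
Proof. by move=> x0; rewrite le_eqVlt => /predU1P[->//|xy]; rewrite ltW// A_incr. Qed.

(** Potter bounds in logarithmic form: [ln A - p * ln] increases for [p = 1/2 - e] and decreases for
    [p = 1/2 + e], the sign of the derivative being read off [A_der]. *)
Lemma log_A_mono A (rA : rv_half A) (e : R) : 0 < e -> exists2 s0 : R, 1 <= s0 &
  forall z w : R, s0 <= z -> z <= w ->
    (2^-1 - e) * (ln w - ln z) <= ln (A w) - ln (A z) <= (2^-1 + e) * (ln w - ln z).
Proof.
move=> e0; have [s0 s01 H] := A_der rA e0; exists s0 => // z w s0z zw.
have s00 : 0 < s0 by lra.
have dh p x : s0 <= x -> is_derive x 1 (fun y => ln (A y) - p * ln y) (derive1 A x / A x - p / x).
  move=> sx; have [dA _] := H x sx; have x0 : 0 < x by lra.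
  have dA' : is_derive x 1 A (derive1 A x) by rewrite derive1E; exact/derivableP.
  have d1 : is_derive x 1 (@ln R \o A) ((A x)^-1 * derive1 A x).
    have := @is_derive1_comp R (@ln R) A x (A x)^-1 (derive1 A x).
    by apply; apply: is_derive1_ln; exact: (A_gt0 rA (ltW x0)).
  have d2 : is_derive x 1 (fun y => p * ln y) (p / x).
    have := @is_deriveZ _ _ _ (@ln R) p x 1 x^-1; apply.
    exact: is_derive1_ln.
  by rewrite [derive1 A x / A x]mulrC; exact: is_deriveB.
have ch p : {within `[z, w], continuous (fun y => ln (A y) - p * ln y)}.
  apply: derivable_within_continuous => x; rewrite in_itv/= => /andP[zx xw].
  by have h := dh p x (le_trans s0z zx); exact: ex_derive.
have dd p x : s0 <= x -> derivable (fun y => ln (A y) - p * ln y) x 1.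
  by move=> sx; have h := dh p x sx; exact: ex_derive.
have dv p x : s0 <= x -> derive1 (fun y => ln (A y) - p * ln y) x = derive1 A x / A x - p / x.
  by move=> sx; have h := dh p x sx; rewrite derive1E derive_val.
have zin : z \in `[z, w] by rewrite in_itv/= lexx.
have win : w \in `[z, w] by rewrite in_itv/= lexx zw.
have key x : s0 <= x -> (2^-1 - e) / x <= derive1 A x / A x <= (2^-1 + e) / x.
  move=> sx; have [_ /andP[h1 h2]] := H x sx.
  have x0 : 0 < x by clear -s00 sx; lra.
  have Ax : 0 < A x by apply: (A_gt0 rA); clear -x0; lra.
  rewrite (ler_pdivlMr _ _ Ax) (ler_pdivrMr _ _ Ax).
  have e1 c : c / x * A x = c * (A x / x) by rewrite mulrAC mulrA.
  by rewrite !e1 h1.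
apply/andP; split.
  have : ln (A z) - (2^-1 - e) * ln z <= ln (A w) - (2^-1 - e) * ln w.
    apply: (@ger0_derive1_le_cc _ (fun y => ln (A y) - (2^-1 - e) * ln y) z w _ _ (ch _) z w zin win zw).
    - by move=> x; rewrite in_itv/= => /andP[zx xw]; apply: dd; lra.
    - move=> x; rewrite in_itv/= => /andP[zx xw]; rewrite dv ?subr_ge0; last by lra.
      by have /andP[] := key x (ltac:(clear -s0z zx; lra)).
  by clear; lra.
have : ln (A w) - (2^-1 + e) * ln w <= ln (A z) - (2^-1 + e) * ln z.
  apply: (@ler0_derive1_le_cc _ (fun y => ln (A y) - (2^-1 + e) * ln y) z w _ _ (ch _) w z win zin zw).
  - by move=> x; rewrite in_itv/= => /andP[zx xw]; apply: dd; lra.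
  - move=> x; rewrite in_itv/= => /andP[zx xw]; rewrite dv ?subr_le0; last by lra.
    by have /andP[] := key x (ltac:(clear -s0z zx; lra)).
by clear; lra.
Qed.

(** Uniform slow variation of L(x)^2, which is [A x ^+ 2 / x]. On [d x, x] the logarithms of the
    arguments differ by at most [D], so a Potter error [E / (2 * D)] moves the logarithm of the
    ratio, where [ln A] counts twice, by at most [E]. *)
Lemma ell_unif A (rA : rv_half A) (d e : R) : 0 < d -> d < 1 -> 0 < e -> exists2 x1 : R, 1 <= x1 &
  forall x z : R, x1 <= x -> d * x <= z -> z <= x ->
  (1 - e) * (A x ^+ 2 / x) <= A z ^+ 2 / z <= (1 + e) * (A x ^+ 2 / x).
Proof.
move=> d0 d1 e0.
pose D := ln (d^-1); pose E := ln (1 + e).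
have D0 : 0 < D by rewrite /D ln_gt0// invf_gt1.
have E0 : 0 < E by rewrite /E ln_gt0//; lra.
have q0 : 0 < E / (2 * D) by rewrite divr_gt0//; lra.
have [s0 s01 H] := log_A_mono rA q0.
exists (s0 / d) => [|x z x1x dz zx].
  by rewrite ler_pdivlMr//; clear -d1 s01; lra.
have s0dx : s0 <= d * x by move: x1x; rewrite ler_pdivrMr// mulrC.
have x0 : 0 < x by rewrite -(pmulr_rgt0 _ d0); clear -s01 s0dx; lra.
have z0 : 0 < z by clear -s01 dz s0dx; lra.
have Ax := A_gt0 rA (ltW x0); have Az := A_gt0 rA (ltW z0).
have /andP[h1 h2] := H z x (le_trans s0dx dz) zx.
have lzx : 0 <= ln x - ln z <= D.
  rewrite -ln_div ?posrE//; apply/andP; split.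
    by rewrite ln_ge0// ler_pdivlMr// mul1r.
  rewrite /D ler_ln ?posrE ?divr_gt0 ?invr_gt0//.
  by rewrite ler_pdivrMr// mulrC ler_pdivlMr// mulrC.
have qD : E / (2 * D) * (ln x - ln z) <= E / 2.
  have -> : E / 2 = E / (2 * D) * D by field; clear -D0; lra.
  by apply: ler_wpM2l; clear -q0 lzx; lra.
have q : - E <= ln (A z ^+ 2 / z) - ln (A x ^+ 2 / x) <= E.
  rewrite !ln_div ?posrE ?exprn_gt0// !lnXn//.
  move: h1 h2 qD; set q := E / (2 * D).
  move: (ln x) (ln z) (ln (A x)) (ln (A z)) => lx lz ax az; clear.
  by rewrite mulrBl mulrDl; set w := q * _; move=> *; apply/andP; split; lra.
have e10 : 0 < 1 + e by clear -e0; lra.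
have p1 : 0 < A z ^+ 2 / z by rewrite divr_gt0// exprn_gt0.
have p2 : 0 < A x ^+ 2 / x by rewrite divr_gt0// exprn_gt0.
have p3 : 0 < (1 + e) * (A x ^+ 2 / x) by rewrite mulr_gt0//; clear -e0; lra.
have p4 : 0 < (1 + e) * (A z ^+ 2 / z) by rewrite mulr_gt0//; clear -e0; lra.
have k1 : A z ^+ 2 / z <= (1 + e) * (A x ^+ 2 / x).
  rewrite -ler_ln ?posrE// [ln ((1 + e) * _)]lnM ?posrE//.
  by rewrite -/E; clear -q; lra.
have k2 : A x ^+ 2 / x <= (1 + e) * (A z ^+ 2 / z).
  rewrite -ler_ln ?posrE// [ln ((1 + e) * _)]lnM ?posrE//.
  by rewrite -/E; clear -q; lra.
rewrite k1 andbT; have [e1|e1] := leP 1 e.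
  by apply: le_trans (ltW p1); rewrite mulr_le0_ge0 ?(ltW p2)//; clear -e1; lra.
have : (1 - e) * (A x ^+ 2 / x) <= (1 - e) * ((1 + e) * (A z ^+ 2 / z)).
  by rewrite ler_wpM2l//; clear -e1; lra.
move/le_trans; apply; rewrite -subr_ge0.
have -> : A z ^+ 2 / z - (1 - e) * ((1 + e) * (A z ^+ 2 / z)) = e ^+ 2 * (A z ^+ 2 / z).
  by move: (A z ^+ 2 / z) => X; ring.
by rewrite mulr_ge0 ?sqr_ge0// ltW.
Qed.

(** Potter bounds with the exponents [1/2 - 1/12 = 5/12] and [1/2 + 1/12 = 7/12], raised to the
    power 12 so that only integer powers occur. *)
Lemma A_growth A (rA : rv_half A) : exists c s0 : R, [/\ 0 < c, 1 <= s0 &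
  forall x : R, s0 <= x -> c * x ^+ 5 <= A x ^+ 12 /\ c * A x ^+ 12 <= x ^+ 7].
Proof.
have [s0 s01 H] := @log_A_mono A rA (12^-1) (ltac:(lra)).
have As0 : 0 < A s0 by apply: (A_gt0 rA); lra.
pose u := A s0 ^+ 12 / s0 ^+ 5; pose v := s0 ^+ 7 / A s0 ^+ 12.
have s00 : 0 < s0 by lra.
have u0 : 0 < u by rewrite divr_gt0// exprn_gt0.
have v0 : 0 < v by rewrite divr_gt0// exprn_gt0.
exists (Num.min u v), s0; split => //; first by rewrite lt_min u0.
move=> x sx; have x0 : 0 < x by lra.
have Ax := A_gt0 rA (ltW x0).
have /andP[h1 h2] := H s0 x (lexx _) sx.
split.
  apply: (@le_trans _ _ (u * x ^+ 5)).
    by rewrite ler_pM2r ?exprn_gt0// ge_min lexx.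
  have p1 : 0 < u * x ^+ 5 by rewrite mulr_gt0// exprn_gt0.
  have p2 : 0 < A x ^+ 12 by rewrite exprn_gt0.
  rewrite -ler_ln ?posrE// lnM ?posrE ?exprn_gt0//.
  rewrite /u ln_div ?posrE ?exprn_gt0// !lnXn//; clear -h1 h2; lra.
apply: (@le_trans _ _ (v * A x ^+ 12)).
  by rewrite ler_pM2r ?exprn_gt0// ge_min lexx orbT.
have p1 : 0 < v * A x ^+ 12 by rewrite mulr_gt0// exprn_gt0.
have p2 : 0 < x ^+ 7 by rewrite exprn_gt0.
rewrite -ler_ln ?posrE// lnM ?posrE ?exprn_gt0//.
rewrite /v ln_div ?posrE ?exprn_gt0// !lnXn//; clear -h1 h2; lra.
Qed.

(* A(1/th), cut off at th <= d to be bounded. *)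
Definition ainv (A : R -> R) (d : R) (th : R) : R := A (Num.max th d)^-1.

Lemma ainv_bounds A (rA : rv_half A) (d th : R) : 0 < d -> A 0 <= ainv A d th <= A d^-1.
Proof.
move=> d0; have m0 : 0 < Num.max th d by rewrite lt_max d0 orbT.
apply/andP; split; apply: (A_le rA) => //; first by rewrite invr_ge0 ltW.
  by rewrite invr_ge0 ltW.
by rewrite lef_pV2 ?posrE// le_max lexx orbT.
Qed.

Lemma ainv_gt0 A (rA : rv_half A) (d th : R) : 0 < d -> 0 < ainv A d th.
Proof.
by move=> d0; have /andP[h _] := ainv_bounds rA th d0; apply: lt_le_trans h; exact: (A_gt0 rA).
Qed.

Lemma bm_ainv A (rA : rv_half A) (d : R) : 0 < d -> bm (ainv A d).
Proof.
move=> d0; apply: (@bm_nonincreasing _ _ (A d^-1)) => [x y xy|x].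
  have m0 : 0 < Num.max x d by rewrite lt_max d0 orbT.
  have m0' : 0 < Num.max y d by rewrite lt_max d0 orbT.
  apply: (A_le rA); first by rewrite invr_ge0 ltW.
  rewrite lef_pV2 ?posrE//.
  by rewrite ge_max !le_max xy lexx orbT.
by rewrite ger0_norm ?(ltW (ainv_gt0 rA x d0))//; case/andP: (ainv_bounds rA x d0).
Qed.

Lemma ainvE A (d th : R) : d <= th -> ainv A d th = A th^-1.
Proof. by rewrite /ainv => /max_idPl ->. Qed.

(** Stands for the identity under integrals over [0, T], since the identity itself is not bounded on
    the line. It also serves as the truncated jump min(y, T) for nonnegative y. *)
Definition clamp (T th : R) : R := Num.min (Num.max th 0) T.

Lemma clampE (T th : R) : 0 <= th <= T -> clamp T th = th.
Proof. by rewrite /clamp => /andP[/max_idPl -> /min_idPl ->]. Qed.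

Lemma clamp_bounds (T th : R) : 0 <= T -> 0 <= clamp T th <= T.
Proof. by move=> T0; rewrite /clamp le_min le_max lexx T0 orbT/= ge_min lexx orbT. Qed.

Lemma bm_clamp (T : R) : 0 <= T -> bm (clamp T).
Proof.
move=> T0; apply: (@bm_nondecreasing _ _ T) => [x y xy|x].
  rewrite /clamp; apply: le_min2 => //; exact: le_max2.
by rewrite ger0_norm; case/andP: (clamp_bounds x T0).
Qed.

Lemma is_derive_Ainv (A : R -> R) (s0 th : R) : 0 < s0 ->
  (forall s : R, s0 <= s -> derivable A s 1) -> 0 < th -> th <= s0^-1 ->
  is_derive th 1 (fun t => A t^-1) (- th^-2 * derive1 A th^-1).
Proof.
move=> s00 dA th0 ths.
have sth : s0 <= th^-1 by rewrite -(invrK s0) lef_pV2 ?posrE ?invr_gt0.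
have dA' : is_derive th^-1 1 A (derive1 A th^-1).
  by rewrite derive1E; exact/derivableP/dA.
have dV : is_derive th 1 (@GRing.inv R) (- th^-2).
  by have := is_deriveV (lt0r_neq0 th0) (is_derive_id th (1:R)); rewrite /= => h; rewrite -[- th^-2]mulr1; exact: h.
have := @is_derive1_comp R A (@GRing.inv R) th (derive1 A th^-1) (- th^-2) dA' dV.
by rewrite mulrC.
Qed.


Lemma is_derive_monomial (g : R -> R) (dg t : R) j k : is_derive t 1 g dg ->
  is_derive t 1 (fun x => x ^+ j * g x ^+ k)
    (j%:R * t ^+ j.-1 * g t ^+ k + t ^+ j * (k%:R * g t ^+ k.-1 * dg)).
Proof.
move=> hg; have h1 := is_deriveX j (is_derive_id t (1 : R)).
have h2 := is_deriveX k hg.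
have := is_deriveM h1 h2.
have -> : ((fun x : R => x) ^+ j * g ^+ k) = (fun x => x ^+ j * g x ^+ k).
  by apply/funext => x; rewrite /GRing.mul /= !fctE.
move=> h; apply: is_derive_eq.
by rewrite !fctE /GRing.scale /=; ring.
Qed.

(** These quantities, all of index 1/2, absorb constants. In particular [M <= A x ^+ 3 / x] means
    that [M / A x] is at most [A x ^+ 2 / x]. *)
Lemma A_large A (rA : rv_half A) (M : R) : exists2 x1 : R, 1 <= x1 &
  forall x : R, x1 <= x -> [/\ M <= A x, M <= x / A x & M <= A x ^+ 3 / x].
Proof.
have [c [s0 [c0 s01 H]]] := A_growth rA.
pose N := Num.max M 1; have N1 : 1 <= N by rewrite le_max lexx orbT.
exists (Num.max s0 (N ^+ 12 / c)); first by rewrite le_max s01.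
move=> x; rewrite ge_max => /andP[sx]; rewrite ler_pdivrMr// => Nx.
have x1 : 1 <= x by lra.
have x0 : 0 < x by lra.
have [h1 h2] := H x sx; have Ax := A_gt0 rA (ltW x0).
have MN : M <= N by rewrite le_max lexx.
have cx n : (0 < n)%N -> N ^+ 12 <= c * x ^+ n.
  move=> n0; apply: le_trans Nx _; rewrite mulrC ler_pM2l//.
  by rewrite -{1}(expr1 x) ler_weXn2l.
have N0 : 0 <= N by clear -N1; lra.
split; apply: le_trans MN _.
- by rewrite -(@ler_pXn2r _ 12)// ?nnegrE ?(ltW Ax)//; apply: le_trans h1; exact: cx.
- rewrite -(@ler_pXn2r _ 12)// ?nnegrE ?divr_ge0 ?(ltW Ax) ?(ltW x0)// expr_div_n.
  rewrite ler_pdivlMr ?exprn_gt0//.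
  have -> : x ^+ 12 = x ^+ 7 * x ^+ 5 by rewrite -exprD.
  apply: (@le_trans _ _ (c * A x ^+ 12 * x ^+ 5)).
    have -> : c * A x ^+ 12 * x ^+ 5 = c * x ^+ 5 * A x ^+ 12 by ring.
    by rewrite ler_pM2r ?exprn_gt0//; exact: cx.
  by rewrite ler_pM2r ?exprn_gt0.
- rewrite -(@ler_pXn2r _ 4)// ?nnegrE ?divr_ge0 ?exprn_ge0 ?(ltW Ax) ?(ltW x0)// expr_div_n -exprM.
  rewrite ler_pdivlMr ?exprn_gt0//; apply: le_trans h1.
  have -> : x ^+ 5 = x * x ^+ 4 by rewrite -exprS.
  rewrite mulrA ler_pM2r ?exprn_gt0//; apply: le_trans (cx 1%N isT).
  by rewrite ler_weXn2l.
Qed.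

Lemma bm_clamp_ainv A (rA : rv_half A) (T d : R) i k : 0 <= T -> 0 < d ->
  bm (fun th => clamp T th ^+ i * ainv A d th ^+ k).
Proof. by move=> T0 d0; apply: bmM; apply: bmX; [exact: bm_clamp|exact: bm_ainv]. Qed.

Lemma continuous_Ainv (A : R -> R) (s0 th : R) : 0 < s0 ->
  (forall s : R, s0 <= s -> derivable A s 1) -> 0 < th -> th <= s0^-1 ->
  {for th, continuous (fun t : R => A t^-1)}.
Proof.
move=> s00 dA th0 ths; apply/differentiable_continuous/derivable1_diffP.
by have h := is_derive_Ainv s00 dA th0 ths; exact: ex_derive.
Qed.

Lemma near_eq_continuous (f g : R -> R) (a b t : R) : a < t < b ->
  (forall x, a < x < b -> f x = g x) -> {for t, continuous g} -> {for t, continuous f}.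
Proof.
move=> tab fg cg; rewrite /prop_for /continuous_at fg//.
apply: cvg_trans cg; apply: near_eq_cvg; near=> x.
rewrite fg//; near: x.
have : t \in `]a, b[ by rewrite in_itv.
by move=> /(near_in_itvoo)/filterS; apply => x; rewrite in_itv.
Unshelve. all: by end_near. Qed.

(** Karamata's theorem in frequency. If [j < 9/20 * k] then [t ^+ j * A t^-1 ^+ k] decreases near 0,
    minus its derivative being at least [c] times the integrand, so the integral is of the order of
    the value at [t = w^-1]. The 9/20 is 1/2 less the error 1/20 taken in [A_der]. Beyond [s0^-1]
    the integrand is bounded, and its contribution is absorbed because the value at [w^-1] is at
    least the value at [s0^-1]. *)
Lemma J_high A (rA : rv_half A) (T : R) j k : (0 < j)%N -> (20 * j < 9 * k)%N -> 1 <= T ->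
  exists C w1 : R, [/\ 0 < C, 1 <= w1 & forall w d : R, w1 <= w -> 0 < d -> d <= w^-1 ->
   LI w^-1 T (fun th => clamp T th ^+ j.-1 * ainv A d th ^+ k) <= C * (A w ^+ k / w ^+ j)].
Proof.
move=> j0 jk T1; have [s0 s01 H] := A_der rA (ltac:(lra) : 0 < 20^-1 :> R).
have s00 : 0 < s0 by lra.
have As0 := A_gt0 rA (ltW s00).
pose c : R := 9 / 20 * k%:R - j%:R.
have c0 : 0 < c.
  have : (20 * j)%:R < (9 * k)%:R :> R by rewrite ltr_nat.
  by rewrite !natrM /c; clear; lra.
pose C0 := T ^+ j.-1 * A s0 ^+ k * T / (A s0 ^+ k / s0 ^+ j).
have C00 : 0 <= C0.
  rewrite /C0; apply: divr_ge0; last by apply: divr_ge0; apply: exprn_ge0; exact: ltW.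
  by apply: mulr_ge0; [apply: mulr_ge0; apply: exprn_ge0|]; clear -T1 As0; lra.
exists (c^-1 + C0), s0; split => //.
  by rewrite ltr_pwDl// invr_gt0.
move=> w d s0w d0 dw; have w0 : 0 < w by clear -s00 w d s0w d0 dw; lra.
have Aw := A_gt0 rA (ltW w0).
have ws : w^-1 <= s0^-1 by rewrite lef_pV2.
have s0T : s0^-1 <= T by apply: le_trans T1; rewrite invf_le1.
have T0 : 0 <= T by clear -d0 dw ws s0T; lra.
have w0' : 0 < w^-1 by rewrite invr_gt0.
have bJ := bm_clamp_ainv rA j.-1 k T0 d0.
rewrite (LI_split bJ ws s0T).
have dA s : s0 <= s -> derivable A s 1 by move=> /H[].
pose g (t : R) := A t^-1; pose Phi (t : R) := - (t ^+ j * g t ^+ k).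
pose dg (t : R) := - t^-2 * derive1 A t^-1.
pose dPhi (t : R) := - (j%:R * t ^+ j.-1 * g t ^+ k + t ^+ j * (k%:R * g t ^+ k.-1 * dg t)).
have dP t : w^-1 <= t <= s0^-1 -> is_derive t 1 Phi (dPhi t).
  move=> /andP[wt ts]; apply: is_deriveN; apply: is_derive_monomial.
  by apply: (is_derive_Ainv s00) => //; clear -w0' wt; lra.
have gE t : w^-1 <= t -> ainv A d t = g t by move=> wt; rewrite ainvE// (le_trans dw).
have k0 : (0 < k)%N by move: jk; case: (k) => //; rewrite muln0.
have key t : w^-1 <= t <= s0^-1 -> c * (t ^+ j.-1 * g t ^+ k) <= dPhi t.
  move=> /andP[wt ts]; have t0 : 0 < t by lra.
  have st : s0 <= t^-1 by rewrite -(invrK s0) lef_pV2 ?posrE ?invr_gt0.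
  have [_ /andP[h1 _]] := H _ st.
  have gt0 : 0 < g t by apply: (A_gt0 rA); rewrite invr_ge0 ltW.
  have e1 : t * (- dg t) = t^-1 * derive1 A t^-1.
    rewrite /dg; field; exact: lt0r_neq0.
  have e2 : 9 / 20 * g t <= t * (- dg t).
    rewrite e1; have -> : 9 / 20 * g t = t^-1 * ((2^-1 - 20^-1) * (A t^-1 / t^-1)).
      rewrite /g; field; exact: lt0r_neq0.
    by rewrite ler_pM2l ?invr_gt0.
  have -> : dPhi t = t ^+ j.-1 * g t ^+ k.-1 * (k%:R * (t * (- dg t)) - j%:R * g t).
    have e3 : t ^+ j = t * t ^+ j.-1 by rewrite -exprS prednK.
    have e4 : g t ^+ k = g t * g t ^+ k.-1 by rewrite -exprS prednK.
    by rewrite /dPhi e3 e4; move: (t ^+ j.-1) (g t ^+ k.-1) => a b; ring.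
  have -> : c * (t ^+ j.-1 * g t ^+ k) = t ^+ j.-1 * g t ^+ k.-1 * (c * g t).
    have e4 : g t ^+ k = g t * g t ^+ k.-1 by rewrite -exprS prednK.
    by rewrite e4; move: (t ^+ j.-1) (g t ^+ k.-1) => a b; ring.
  apply: ler_wpM2l; first by rewrite mulr_ge0// exprn_ge0// ltW.
  by rewrite /c mulrBl lerB// [9 / 20 * _]mulrC -mulrA; apply: ler_wpM2l.
have P1 : c * LI w^-1 s0^-1 (fun th => clamp T th ^+ j.-1 * ainv A d th ^+ k) <=
   Phi s0^-1 - Phi w^-1.
  rewrite -LIZ//; apply: (LI_le_primitive (dP := dPhi)) => //.
  - exact: bmZ.
  - move=> t wts; apply: (@near_eq_continuous _ (fun t => c * (t ^+ j.-1 * g t ^+ k)) w^-1 s0^-1) => //.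
      move=> x /andP[wx xs]; rewrite clampE ?gE ?(ltW wx)//.
      by apply/andP; split; clear -s0T w0' wx xs; lra.
    have cg : {for t, continuous g}.
      by move: wts => /andP[wt ts]; apply: (continuous_Ainv s00) => //; lra.
    apply: cvgM; first exact: cvg_cst.
    apply: cvgM; [apply: exprn_continuous|].
    exact: (continuous_comp cg (@exprn_continuous _ k _)).
  - by move=> t /andP[wt ts]; apply: dP; rewrite !ltW.
  - apply: derivable_within_continuous => t; rewrite in_itv/= => wts.
    by have h := dP t wts; exact: ex_derive.
  - move=> t /andP[wt ts]; rewrite clampE ?gE ?(ltW wt)//; last by apply/andP; split; lra.
    by apply: key; rewrite !ltW.
have Phiw : - Phi w^-1 = A w ^+ k / w ^+ j by rewrite /Phi /g opprK invrK exprVn mulrC.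
have Phis : - Phi s0^-1 = A s0 ^+ k / s0 ^+ j by rewrite /Phi /g opprK invrK exprVn mulrC.
have LI0 : 0 <= LI w^-1 s0^-1 (fun th => clamp T th ^+ j.-1 * ainv A d th ^+ k).
  apply: LI_ge0 => t _; rewrite mulr_ge0// exprn_ge0//.
    by case/andP: (clamp_bounds t T0).
  exact: ltW (ainv_gt0 rA t d0).
have Phi0 : 0 < A s0 ^+ k / s0 ^+ j by rewrite divr_gt0// exprn_gt0.
have P2 : LI s0^-1 T (fun th => clamp T th ^+ j.-1 * ainv A d th ^+ k) <= C0 * (A s0 ^+ k / s0 ^+ j).
  apply: (@le_trans _ _ (LI s0^-1 T (fun=> T ^+ j.-1 * A s0 ^+ k))).
    apply: LI_le => //; first exact: bm_cst.
    move=> t /andP[st tT]; have /andP[c1 c2] := clamp_bounds t T0.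
    have t0 : 0 < t by apply: lt_le_trans st; rewrite invr_gt0.
    apply: ler_pM; rewrite ?exprn_ge0 ?(ltW (ainv_gt0 rA t d0))//.
      by rewrite lerXn2r ?nnegrE.
    rewrite lerXn2r ?nnegrE ?(ltW (ainv_gt0 rA t d0)) ?(ltW As0)// gE; last by rewrite (le_trans ws).
    apply: (A_le rA); first by rewrite invr_ge0 ltW.
    by rewrite -(invrK s0) lef_pV2 ?posrE ?invr_gt0.
  rewrite LI_cst// /C0 divfK ?lt0r_neq0//; apply: ler_wpM2l; last first.
    by rewrite lerBlDr lerDl invr_ge0 ltW.
  by rewrite mulr_ge0// exprn_ge0// ltW.
have q : c^-1 * (Phi s0^-1 - Phi w^-1) <= c^-1 * (A w ^+ k / w ^+ j).
  by rewrite ler_pM2l ?invr_gt0// -Phiw; move: Phi0; rewrite -Phis; clear; lra.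
have Phisw : A s0 ^+ k / s0 ^+ j <= A w ^+ k / w ^+ j.
  rewrite -Phiw -Phis; move: (mulr_ge0 (ltW c0) LI0) P1; clear; lra.
rewrite mulrDl lerD//.
  apply: le_trans q; rewrite mulrC ler_pdivlMr// mulrC; exact: P1.
by apply: le_trans P2 _; rewrite ler_wpM2l.
Qed.

(** Low frequencies: [t ^+ 2 * A t^-1] increases, with derivative about 3/2 times the integrand, so
    its value at [w^-1] bounds the integral. *)
Lemma J_low A (rA : rv_half A) : exists2 w1 : R, 1 <= w1 &
  forall w d : R, w1 <= w -> 0 < d -> d <= w^-1 ->
   LI d w^-1 (fun th => clamp w^-1 th * ainv A d th) <= A w / w ^+ 2.
Proof.
have [s0 s01 H] := A_der rA (ltac:(lra) : 0 < 20^-1 :> R).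
have s00 : 0 < s0 by lra.
exists s0 => // w d s0w d0 dw; have w0 : 0 < w by lra.
have ws : w^-1 <= s0^-1 by rewrite lef_pV2.
have w0' : 0 < w^-1 by rewrite invr_gt0.
have dA s : s0 <= s -> derivable A s 1 by move=> /H[].
pose g (t : R) := A t^-1; pose Phi (t : R) := t ^+ 2 * g t ^+ 1.
pose dg (t : R) := - t^-2 * derive1 A t^-1.
pose dPhi (t : R) := 2%:R * t ^+ 1 * g t ^+ 1 + t ^+ 2 * (1%:R * g t ^+ 0 * dg t).
have dP t : d <= t <= w^-1 -> is_derive t 1 Phi (dPhi t).
  move=> /andP[dt tw]; apply: is_derive_monomial.
  by apply: (is_derive_Ainv s00) => //; clear -d0 ws dt tw; lra.
have bJ : bm (fun th => clamp w^-1 th * ainv A d th).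
  by apply: bmM; [apply: bm_clamp; exact: ltW|exact: bm_ainv].
have gE t : d <= t -> ainv A d t = g t by move=> wt; rewrite ainvE.
have := @LI_le_primitive R d w^-1 _ Phi dPhi dw bJ.
have -> : Phi w^-1 = A w / w ^+ 2 by rewrite /Phi /g invrK exprVn mulrC expr1.
have Phid : 0 <= Phi d.
  by rewrite /Phi mulr_ge0 ?exprn_ge0 ?(ltW d0)// ltW// (A_gt0 rA)// invr_ge0 ltW.
move=> h; apply: le_trans (h _ _ _ _) _; last by clear -Phid; lra.
- move=> t wts; apply: (@near_eq_continuous _ (fun t => t * g t) d w^-1) => //.
    by move=> x /andP[dx xs]; rewrite clampE ?gE ?(ltW dx)// !ltW// (lt_trans d0).
  have cg : {for t, continuous g}.
    by move: wts => /andP[wt ts]; apply: (continuous_Ainv s00) => //; lra.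
  by apply: cvgM => //; exact: cvg_id.
- by move=> t /andP[wt ts]; apply: dP; rewrite !ltW.
- apply: derivable_within_continuous => t; rewrite in_itv/= => wts.
  by have h' := dP t wts; exact: ex_derive.
- move=> t /andP[wt ts]; have t0 : 0 < t by lra.
  rewrite clampE ?gE ?(ltW wt)//; last by rewrite !ltW.
  have st : s0 <= t^-1 by rewrite -(invrK s0) lef_pV2 ?posrE ?invr_gt0//; clear -ws ts; lra.
  have [_ /andP[_ h1]] := H _ st.
  have gt0 : 0 < g t by apply: (A_gt0 rA); rewrite invr_ge0 ltW.
  have -> : dPhi t = 2 * (t * g t) - derive1 A t^-1.
    rewrite /dPhi /dg !expr1 expr0; field; exact: lt0r_neq0.
  move: h1; have -> : (2^-1 + 20^-1) * (A t^-1 / t^-1) = 11/20 * (t * g t).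
    by rewrite /g invrK; field.
  have : 0 < t * g t by rewrite mulr_gt0.
  by clear; lra.
Qed.

End regular_variation.

(** * The lazy law and its characteristic function *)

Section null_sets.
Context {R : realType} (mu : {finite_measure set (measurableTypeR R) -> \bar R}).
Implicit Types (f g p : R -> R) (N : set R).

Lemma J_indic (B : set R) : measurable B -> J mu \1_B = fine (mu B).
Proof. by move=> mB; rewrite /J /Rintegral integral_indic// setIT. Qed.

(** Adding [(M + M') * \1_N] to [g] leaves its integral unchanged and makes the inequality hold at
    every point. *)
Lemma J_le_ae N f g : measurable N -> mu N = 0%E -> bm f -> bm g ->
  (forall y, ~ N y -> f y <= g y) -> J mu f <= J mu g.
Proof.
move=> mN N0 bf bg fg.
have [M M0 fM] := bm_bound bf; have [M' M'0 gM] := bm_bound bg.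
have b1 : bm (\1_N : R -> R) by exact: bm_indic.
have -> : J mu g = J mu (fun y => g y + (M + M') * \1_N y).
  rewrite JD//; last exact: bmZ.
  by rewrite JZ// J_indic// N0 mulr0 addr0.
apply: J_le => //; first by apply: bmD => //; exact: bmZ.
move=> y; rewrite indicE; have [yN|yN] := boolP (y \in N); last first.
  by rewrite mulr0 addr0; apply: fg => Ny; move/negP: yN; apply; rewrite inE.
rewrite mulr1; move: (fM y) (gM y); rewrite !ler_norml => /andP[_ h1] /andP[h2 _].
by clear -h1 h2; lra.
Qed.

Lemma J_eq_ae N f g : measurable N -> mu N = 0%E -> bm f -> bm g ->
  (forall y, ~ N y -> f y = g y) -> J mu f = J mu g.
Proof.
by move=> mN N0 bf bg fg; apply: le_anti; rewrite !(J_le_ae mN N0)// => y Ny; rewrite fg.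
Qed.

End null_sets.

Section nonneg_support.
Context {R : realType} (mu : {finite_measure set (measurableTypeR R) -> \bar R}).
Context (mu0 : mu `]-oo, 0[%classic = 0%E).
Implicit Types (f g p : R -> R).

Let mneg : @measurable _ (measurableTypeR R) `]-oo, (0:R)[%classic.
Proof. exact: (@measurable_itv R). Qed.

Lemma J_le0 f g : bm f -> bm g -> (forall y, 0 <= y -> f y <= g y) -> J mu f <= J mu g.
Proof.
move=> bf bg fg; apply: (J_le_ae mneg mu0) => // y /= /negP; rewrite in_itv/= -leNgt.
exact: fg.
Qed.

Lemma J_eq0 f g : bm f -> bm g -> (forall y, 0 <= y -> f y = g y) -> J mu f = J mu g.
Proof. by move=> bf bg fg; apply: le_anti; rewrite !J_le0// => y /fg ->. Qed.

Lemma Op_le_loc p f g x : bm p -> bm f -> bm g -> (forall y, 0 <= p y) ->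
  (forall v, v <= x -> f v <= g v) -> Op mu p f x <= Op mu p g x.
Proof.
move=> bp bf bg p0 fg; apply: J_le0; try exact: bm_Op_body.
by move=> y y0; rewrite ler_wpM2l// fg// gerBl.
Qed.

Lemma iter_le_loc p f g n x : bm p -> bm f -> bm g -> (forall y, 0 <= p y) ->
  (forall v, v <= x -> f v <= g v) -> iter n (Op mu p) f x <= iter n (Op mu p) g x.
Proof.
move=> bp bf bg p0; elim: n x => [x h|n IH x h]; first exact: h.
apply: Op_le_loc => //; try exact: bm_iter.
by move=> v vx; apply: IH => w wv; apply: h; exact: le_trans vx.
Qed.

Lemma iter_neg p f n x : bm p -> bm f -> (forall y, 0 <= p y) ->
  (forall v, v < 0 -> f v = 0) -> x < 0 -> iter n (Op mu p) f x = 0.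
Proof.
move=> bp bf p0 f0 x0.
have z : iter n (Op mu p) (fun=> 0) x = 0.
  elim: n x {x0} => // n IH x /=; rewrite /Op.
  under eq_fun do rewrite IH mulr0.
  by rewrite J_cst mul0r.
have b0 := bm_cst R (0 : R).
have h1 : iter n (Op mu p) f x <= iter n (Op mu p) (fun=> 0) x.
  by apply: iter_le_loc => // v vx; rewrite f0// (le_lt_trans vx).
have h2 : iter n (Op mu p) (fun=> 0) x <= iter n (Op mu p) f x.
  by apply: iter_le_loc => // v vx; rewrite f0// (le_lt_trans vx).
by rewrite z in h1 h2; apply: le_anti; rewrite h1 h2.
Qed.

End nonneg_support.

Section lazy.
Context {R : realType} (F : probability (measurableTypeR R) R).

Let h0 : 0 <= 2^-1 :> R. Proof. by rewrite invr_ge0. Qed.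

Definition lazyF : set (measurableTypeR R) -> \bar R :=
  measure_add (mscale (NngNum h0) (@dirac _ (measurableTypeR R) 0 R)) (mscale (NngNum h0) F).

HB.instance Definition _ := Measure.on lazyF.

Lemma lazyFE B : lazyF B = (2^-1%:E * @dirac _ (measurableTypeR R) 0%R R B + 2^-1%:E * F B)%E.
Proof. by rewrite /lazyF measure_addE. Qed.

Let lazyF_fin : fin_num_fun lazyF.
Proof.
move=> B mB; rewrite lazyFE fin_numD !fin_numM//.
exact: fin_num_measure.
Qed.

HB.instance Definition _ := Measure_isFinite.Build _ (measurableTypeR R) R lazyF lazyF_fin.

Lemma J_lazy (f : R -> R) : bm f ->
  J lazyF f = 2^-1 * f 0 + 2^-1 * J F f.
Proof.
move=> bf; have [M M0 fM] := bm_bound bf.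
have bM : bm (fun _ : R => M) by exact: bm_cst.
have nn (g : R -> R) : bm g -> (forall y, 0 <= g y) -> J lazyF g = 2^-1 * g 0 + 2^-1 * J F g.
  move=> bg g0; have mg : measurable_fun [set: measurableTypeR R] (EFin \o g).
    by apply/measurable_EFinP; case: bg.
  have g0' (y : measurableTypeR R) : [set: measurableTypeR R] y -> (0 <= (EFin \o g) y)%E.
    by move=> _; rewrite lee_fin.
  apply: EFin_inj; rewrite EFinD !EFinM !EFin_J//.
  rewrite ge0_integral_measure_add// !ge0_integral_mscale//.
  by rewrite integral_dirac//= diracT mul1e.
have h : J lazyF (fun y => f y + M) = 2^-1 * (f 0 + M) + 2^-1 * J F (fun y => f y + M).
  apply: nn; first exact: bmD.
  by move=> y; have := fM y; rewrite ler_norml => /andP[h _]; clear -h; lra.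
have h1 : J lazyF (fun=> M) = 2^-1 * M + 2^-1 * J F (fun=> M) by apply: nn => // y; exact: ltW.
have h3 : J lazyF f + J lazyF (fun=> M) = 2^-1 * (f 0 + M) + 2^-1 * (J F f + J F (fun=> M)).
  by rewrite -!JD.
move: (J lazyF f) (J lazyF _) (J F f) (J F _) h3 h1 => a b c d; clear; lra.
Qed.

End lazy.

Section trigonometry.
Context {R : realType}.

Lemma measurable_cos : measurable_fun [set: R] (@cos R).
Proof. by apply: continuous_measurable_fun; exact: continuous_cos. Qed.

Lemma measurable_sin : measurable_fun [set: R] (@sin R).
Proof. by apply: continuous_measurable_fun; exact: continuous_sin. Qed.

Lemma bm_cos d (T : measurableType d) (u : T -> R) : measurable_fun [set: T] u ->
  bm (fun x => cos (u x)).
Proof.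
move=> mu; split; first exact: measurableT_comp measurable_cos mu.
by exists 1 => x; exact: cos_max.
Qed.

Lemma bm_sin d (T : measurableType d) (u : T -> R) : measurable_fun [set: T] u ->
  bm (fun x => sin (u x)).
Proof.
move=> mu; split; first exact: measurableT_comp measurable_sin mu.
by exists 1 => x; exact: sin_max.
Qed.

Lemma lipschitz_MVT (f df : R -> R) : (forall x : R, is_derive x 1 f (df x)) ->
  (forall x, `|df x| <= 1) -> forall a b : R, `|f a - f b| <= `|a - b|.
Proof.
move=> fdf df1.
suff h (a b : R) : a <= b -> `|f b - f a| <= b - a.
  move=> a b; have [ab|ba] := leP a b.
    by rewrite distrC [leRHS]distrC [leRHS]ger0_norm ?subr_ge0//; exact: h.
  by rewrite [leRHS]ger0_norm ?subr_ge0 ?(ltW ba)//; apply: h; exact: ltW.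
move=> ab; have cf : {within `[a, b], continuous f}.
  apply: derivable_within_continuous => x _.
  by have h := fdf x; exact: ex_derive.
have [c _ ->] := @MVT_segment R f df a b ab (fun x _ => fdf x) cf.
by rewrite normrM [X in _ * X]ger0_norm ?subr_ge0// ler_piMl// subr_ge0.
Qed.

Lemma cos_lip (a b : R) : `|cos a - cos b| <= `|a - b|.
Proof.
apply: (@lipschitz_MVT _ (fun x => - sin x) _ _ a b) => x.
by rewrite normrN sin_max.
Qed.

Lemma sin_lip (a b : R) : `|sin a - sin b| <= `|a - b|.
Proof.
by apply: (@lipschitz_MVT _ (fun x => cos x) _ _ a b) => x; exact: cos_max.
Qed.

Lemma norm_lincomb (a b c s r : R) : 0 <= r -> a ^+ 2 + b ^+ 2 <= r ^+ 2 ->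
  c ^+ 2 + s ^+ 2 = 1 -> `|a * c + b * s| <= r.
Proof.
move=> r0 ab cs; rewrite -(@ler_pXn2r _ 2)// ?nnegrE// real_normK ?num_real//.
apply: le_trans ab.
have -> : a ^+ 2 + b ^+ 2 = (a ^+ 2 + b ^+ 2) * (c ^+ 2 + s ^+ 2) by rewrite cs mulr1.
rewrite -subr_ge0.
have -> : (a ^+ 2 + b ^+ 2) * (c ^+ 2 + s ^+ 2) - (a * c + b * s) ^+ 2 =
  (a * s - b * c) ^+ 2 by ring.
exact: sqr_ge0.
Qed.

End trigonometry.

(** * Fourier representation of the iterates on band-limited functions *)

Section fourier.
Context {R : realType}.
Implicit Types (mu : {finite_measure set (measurableTypeR R) -> \bar R}) (p f w : R -> R).

Definition ctr mu p (th : R) : R := J mu (fun y => p y * cos (th * y)).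
Definition str mu p (th : R) : R := J mu (fun y => p y * sin (th * y)).

(** Real and imaginary parts of the n-th power of [ctr + i str], the Fourier transform of the
    weighted measure. *)
Fixpoint powtr mu p (n : nat) (th : R) : R * R :=
  if n is n'.+1 then
    let: (a, b) := powtr mu p n' th in
    (a * ctr mu p th - b * str mu p th, a * str mu p th + b * ctr mu p th)
  else (1, 0).

Lemma powtr_norm mu p n th :
  (powtr mu p n th).1 ^+ 2 + (powtr mu p n th).2 ^+ 2 =
  (ctr mu p th ^+ 2 + str mu p th ^+ 2) ^+ n.
Proof.
elim: n => [|n IH] /=; first by rewrite expr0 expr1n expr0n addr0.
case: (powtr mu p n th) IH => a b /= IH.
by rewrite [RHS]exprS -IH; ring.
Qed.

Lemma measurable_mul_fst_snd : measurable_fun [set: R * R] (fun z : R * R => z.1 * z.2).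
Proof. by apply: measurable_funM; [exact: measurable_fst|exact: measurable_snd]. Qed.

Lemma bm_ctr mu p : bm p -> bm (ctr mu p).
Proof.
move=> bp; change (bm (fun th : R => J mu (fun y => p y * cos (th * y)))).
apply: (@bm_J _ _ _ _ _ mu (fun z : R * R => p z.2 * cos (z.1 * z.2))).
apply: bmM; first by apply: bm_comp bp; exact: measurable_snd.
by apply: bm_cos; exact: measurable_mul_fst_snd.
Qed.

Lemma bm_str mu p : bm p -> bm (str mu p).
Proof.
move=> bp; change (bm (fun th : R => J mu (fun y => p y * sin (th * y)))).
apply: (@bm_J _ _ _ _ _ mu (fun z : R * R => p z.2 * sin (z.1 * z.2))).
apply: bmM; first by apply: bm_comp bp; exact: measurable_snd.
by apply: bm_sin; exact: measurable_mul_fst_snd.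
Qed.

Lemma bm_powtr mu p n : bm p ->
  bm (fun th => (powtr mu p n th).1) /\ bm (fun th => (powtr mu p n th).2).
Proof.
move=> bp; have bc := bm_ctr mu bp; have bs := bm_str mu bp.
elim: n => [|n [IH1 IH2]] /=; first by split; exact: bm_cst.
have e1 : (fun th => (let '(a, b) := powtr mu p n th in
    (a * ctr mu p th - b * str mu p th, a * str mu p th + b * ctr mu p th)).1) =
    fun th => (powtr mu p n th).1 * ctr mu p th - (powtr mu p n th).2 * str mu p th.
  by apply/funext => th; case: (powtr mu p n th).
have e2 : (fun th => (let '(a, b) := powtr mu p n th in
    (a * ctr mu p th - b * str mu p th, a * str mu p th + b * ctr mu p th)).2) =
    fun th => (powtr mu p n th).1 * str mu p th + (powtr mu p n th).2 * ctr mu p th.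
  by apply/funext => th; case: (powtr mu p n th).
rewrite e1 e2; split; [apply: bmB|apply: bmD]; exact: bmM.
Qed.

Lemma bm_cos_mul (x : R) : bm (fun th : R => cos (th * x)).
Proof. by apply: bm_cos; exact: measurable_funM. Qed.

Lemma bm_sin_mul (x : R) : bm (fun th : R => sin (th * x)).
Proof. by apply: bm_sin; exact: measurable_funM. Qed.

Lemma bm_cos_mul' (x : R) : bm (fun y : R => cos (x * y)).
Proof. by apply: bm_cos; exact: measurable_funM. Qed.

Lemma bm_sin_mul' (x : R) : bm (fun y : R => sin (x * y)).
Proof. by apply: bm_sin; exact: measurable_funM. Qed.

(** Band-limited test functions: cosine transforms of a weight on [0, T]. On them the n-step
    operator becomes an integral over [0, T] of the n-th power of the transform ([iter_bl]), so only
    frequencies up to T have to be controlled. *)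
Definition bl (T : R) w (y : R) : R := LI 0 T (fun th => w th * cos (th * y)).

Lemma iter_bl mu p T w n x : bm p -> bm w ->
  iter n (Op mu p) (bl T w) x =
  LI 0 T (fun th => w th * ((powtr mu p n th).1 * cos (th * x) +
                            (powtr mu p n th).2 * sin (th * x))).
Proof.
move=> bp bw; elim: n x => [|n IH] x.
  by apply: LI_eq => th _ /=; rewrite mul1r mul0r addr0.
have [ba bb] := bm_powtr mu n bp.
have -> : iter n.+1 (Op mu p) (bl T w) x = J mu (fun y => p y *
    LI 0 T (fun th => w th * ((powtr mu p n th).1 * cos (th * (x - y)) +
                            (powtr mu p n th).2 * sin (th * (x - y))))).
  by rewrite /= /Op; congr J; apply/funext => y; rewrite IH.
pose G (z : R * R) : R := p z.2 * (w z.1 * ((powtr mu p n z.1).1 * cos (z.1 * (x - z.2)) +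
                            (powtr mu p n z.1).2 * sin (z.1 * (x - z.2)))).
have m1 : measurable_fun [set: R * R] (fun z : R * R => z.1 * (x - z.2)).
  apply: measurable_funM; first exact: measurable_fst.
  by apply: measurable_funB => //; exact: measurable_snd.
have bG : bm G.
  apply: bmM; first by apply: bm_comp bp; exact: measurable_snd.
  apply: bmM; first by apply: bm_comp bw; exact: measurable_fst.
  apply: bmD; apply: bmM.
  - by apply: (bm_comp (u := fun z : R * R => z.1) _ ba); exact: measurable_fst.
  - exact: bm_cos.
  - by apply: (bm_comp (u := fun z : R * R => z.1) _ bb); exact: measurable_fst.
  - exact: bm_sin.
have bin y : bm (fun th => w th * ((powtr mu p n th).1 * cos (th * (x - y)) +
                            (powtr mu p n th).2 * sin (th * (x - y)))).
  by apply: bmM => //; apply: bmD; apply: bmM => //; [exact: bm_cos_mul|exact: bm_sin_mul].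
have -> : (fun y => p y *
    LI 0 T (fun th => w th * ((powtr mu p n th).1 * cos (th * (x - y)) +
                            (powtr mu p n th).2 * sin (th * (x - y))))) =
   (fun y => J (leb 0 T) (fun th => G (th, y))).
  apply/funext => y; rewrite -LIZ//= LI_J//.
  exact: bmZ.
rewrite -(J_fubini (leb 0 T) mu bG).
have bq : bm (fun th : R => J mu (fun y => G (th, y))) by exact: (@bm_J _ _ _ _ _ mu G bG).
rewrite -LI_J//; apply: LI_eq => th _.
rewrite /G /=.
have -> : (fun y => p y * (w th * ((powtr mu p n th).1 * cos (th * (x - y)) +
       (powtr mu p n th).2 * sin (th * (x - y))))) =
  (fun y => w th * ((powtr mu p n th).1 * cos (th * x) + (powtr mu p n th).2 * sin (th * x)) *
     (p y * cos (th * y)) +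
     w th * ((powtr mu p n th).1 * sin (th * x) - (powtr mu p n th).2 * cos (th * x)) *
     (p y * sin (th * y))).
  by apply/funext => y; rewrite mulrBr cosB sinB; ring.
have bpc : bm (fun y => p y * cos (th * y)) by apply: bmM => //; exact: bm_cos_mul'.
have bps : bm (fun y => p y * sin (th * y)) by apply: bmM => //; exact: bm_sin_mul'.
rewrite JD; [|exact: bmZ..].
rewrite !JZ// -/(ctr mu p th) -/(str mu p th).
by case: (powtr mu p n th) => a b /=; ring.
Qed.

Lemma iter_bl_bound mu p T w W (r : R -> R) n x : bm p -> bm w -> bm r -> 0 <= W ->
  (forall th, 0 <= r th) -> (forall th, `|w th| <= W) ->
  (forall th, 0 <= th <= T -> ctr mu p th ^+ 2 + str mu p th ^+ 2 <= r th ^+ 2) ->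
  `|iter n (Op mu p) (bl T w) x| <= W * LI 0 T (fun th => r th ^+ n).
Proof.
move=> bp bw br W0 r0 wW rr; have [ba bb] := bm_powtr mu n bp.
have b1 : bm (fun th => w th * ((powtr mu p n th).1 * cos (th * x) +
                            (powtr mu p n th).2 * sin (th * x))).
  by apply: bmM => //; apply: bmD; apply: bmM => //; [exact: bm_cos_mul|exact: bm_sin_mul].
rewrite iter_bl//; apply: le_trans (LI_norm _ _ b1) _; rewrite -LIZ; last exact: bmX.
apply: LI_le; first exact: bm_norm.
  by apply: bmZ; exact: bmX.
move=> th thT; rewrite normrM; apply: ler_pM => //.
apply: norm_lincomb; first exact: exprn_ge0.
  rewrite powtr_norm -exprM mulnC exprM lerXn2r ?nnegrE ?sqr_ge0//; last exact: rr.
  by rewrite addr_ge0 ?sqr_ge0.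
exact: cos2Dsin2.
Qed.

(** Differencing in x brings a factor [th] under the integral. The Lipschitz bound is applied to the
    cosine and the sine separately, whence the factor 2. *)
Lemma iter_bl_diff mu p T w W (r : R -> R) n x x' : bm p -> bm w -> bm r -> 0 <= T -> 0 <= W ->
  (forall th, 0 <= r th) -> (forall th, `|w th| <= W) ->
  (forall th, 0 <= th <= T -> ctr mu p th ^+ 2 + str mu p th ^+ 2 <= r th ^+ 2) ->
  `|iter n (Op mu p) (bl T w) x - iter n (Op mu p) (bl T w) x'| <=
  2 * W * `|x - x'| * LI 0 T (fun th => clamp T th * r th ^+ n).
Proof.
move=> bp bw br T0 W0 r0 wW rr; have [ba bb] := bm_powtr mu n bp.
have b1 y : bm (fun th => w th * ((powtr mu p n th).1 * cos (th * y) +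
                            (powtr mu p n th).2 * sin (th * y))).
  by apply: bmM => //; apply: bmD; apply: bmM => //; [exact: bm_cos_mul|exact: bm_sin_mul].
have bc : bm (fun th => clamp T th * r th ^+ n).
  by apply: bmM; [exact: bm_clamp|exact: bmX].
rewrite !iter_bl// -LIB//; apply: le_trans (LI_norm _ _ (bmB (b1 _) (b1 _))) _.
rewrite -LIZ//; apply: LI_le; first by apply: bm_norm; exact: bmB.
  exact: bmZ.
move=> th thT; rewrite (clampE thT) -mulrBr normrM.
have th0 : 0 <= th by case/andP: thT.
set a := (powtr mu p n th).1; set b := (powtr mu p n th).2.
have ab : a ^+ 2 + b ^+ 2 <= (r th ^+ n) ^+ 2.
  rewrite powtr_norm -exprM mulnC exprM lerXn2r ?nnegrE ?sqr_ge0//; last exact: rr.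
  by rewrite addr_ge0 ?sqr_ge0.
have rn : 0 <= r th ^+ n by exact: exprn_ge0.
have ar : `|a| <= r th ^+ n.
  have := @norm_lincomb R a b 1 0 _ rn ab; rewrite mulr1 mulr0 addr0; apply.
  by rewrite expr1n expr0n addr0.
have br' : `|b| <= r th ^+ n.
  have := @norm_lincomb R a b 0 1 _ rn ab; rewrite mulr1 mulr0 add0r; apply.
  by rewrite expr1n expr0n add0r.
have xx : `|th * x - th * x'| = th * `|x - x'| by rewrite -mulrBr normrM ger0_norm.
have h1 : `|a * (cos (th * x) - cos (th * x'))| <= r th ^+ n * (th * `|x - x'|).
  by rewrite normrM; apply: ler_pM => //; rewrite -xx; exact: cos_lip.
have h2 : `|b * (sin (th * x) - sin (th * x'))| <= r th ^+ n * (th * `|x - x'|).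
  by rewrite normrM; apply: ler_pM => //; rewrite -xx; exact: sin_lip.
have -> : 2 * W * `|x - x'| * (th * r th ^+ n) =
  W * (r th ^+ n * (th * `|x - x'|) + r th ^+ n * (th * `|x - x'|)) by ring.
apply: ler_pM => //.
have -> : a * cos (th * x) + b * sin (th * x) - (a * cos (th * x') + b * sin (th * x')) =
  a * (cos (th * x) - cos (th * x')) + b * (sin (th * x) - sin (th * x')) by ring.
by apply: le_trans (ler_normD _ _) _; exact: lerD.
Qed.

End fourier.

Section boolean_functions.
Context {R : realType}.
Implicit Types x y a b : R.

Lemma normb (b : bool) : `|b%:R : R| <= 1.
Proof. by case: b; rewrite ?normr1 ?normr0. Qed.

Lemma bm_gt a : bm (fun y : R => (a < y)%R%:R : R).
Proof.
apply: (@bm_nondecreasing _ _ 1) => [x y xy|x]; last exact: normb.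
by case: (ltP a x) => [ax|_]; rewrite ?(lt_le_trans ax xy) ?ler0n.
Qed.

Lemma bm_ge a : bm (fun y : R => (a <= y)%R%:R : R).
Proof.
apply: (@bm_nondecreasing _ _ 1) => [x y xy|x]; last exact: normb.
by case: (leP a x) => [ax|_]; rewrite ?(le_trans ax xy) ?ler0n.
Qed.

Lemma bm_lt a : bm (fun y : R => (y < a)%R%:R : R).
Proof.
apply: (@bm_nonincreasing _ _ 1) => [x y xy|x]; last exact: normb.
by case: (ltP x a) => [xa|_]; rewrite ?(le_lt_trans xy xa) ?ler0n.
Qed.

Lemma bm_le a : bm (fun y : R => (y <= a)%R%:R : R).
Proof.
apply: (@bm_nonincreasing _ _ 1) => [x y xy|x]; last exact: normb.
by case: (leP x a) => [xa|_]; rewrite ?(le_trans xy xa) ?ler0n.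
Qed.

Definition chi (h y : R) : R := (0 <= y < h)%R%:R.

Lemma bm_chi h : bm (chi h).
Proof.
rewrite (_ : chi h = fun y => (0 <= y)%R%:R * (y < h)%R%:R).
  by apply: bmM; [exact: bm_ge|exact: bm_lt].
by apply/funext => y; rewrite /chi -natrM mulnb.
Qed.

Lemma chi_ge0 h y : 0 <= chi h y.
Proof. exact: ler0n. Qed.

Lemma chi_le1 h y : chi h y <= 1.
Proof. by rewrite /chi; case: (_ && _). Qed.

Lemma chi_neg h y : y < 0 -> chi h y = 0.
Proof. by rewrite /chi leNgt => ->. Qed.

End boolean_functions.

(** * Tail of the lazy law and the deficit of its characteristic function *)

Section tails.
Context {R : realType}.
Implicit Types (F : probability (measurableTypeR R) R) (A : R -> R).

Definition tl F (x : R) : R := J (lazyF F) (fun y : R => (x < y)%R%:R).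

(* tl is the tail of the lazy law, half that of F on [0, +oo[: whence the limit 1/2. *)
Record half_tail F A : Prop := {
  ht_rv : rv_half A ;
  ht_neg : F `]-oo, 0[%classic = 0%E ;
  ht_tail : forall e : R, 0 < e -> exists2 x1 : R, 1 <= x1 & forall x : R, x1 <= x ->
    2^-1 - e <= tl F x * A x <= 2^-1 + e }.

Lemma lazy_neg F : F `]-oo, 0[%classic = 0%E -> lazyF F `]-oo, (0:R)[%classic = 0%E.
Proof.
move=> F0; rewrite lazyFE; have -> : @dirac _ (measurableTypeR R) 0 R `]-oo, (0:R)[%classic = 0%E.
  by rewrite diracE memNset//= in_itv/= ltxx.
by rewrite F0 !mule0 adde0.
Qed.

Lemma J_prob1 F : J F (fun=> 1) = 1 :> R.
Proof.
rewrite /J Rintegral_cst// mul1r; transitivity (fine (1%:E : \bar R)) => //.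
by congr fine; exact: probability_setT.
Qed.

Lemma J_lazy1 F : J (lazyF F) (fun=> 1) = 1 :> R.
Proof. by rewrite J_lazy ?J_prob1; [lra|exact: bm_cst]. Qed.

Lemma tl_ge0 F x : 0 <= tl F x.
Proof. by apply: J_ge0 => y; exact: ler0n. Qed.

Lemma tl_le1 F x : tl F x <= 1.
Proof.
rewrite -(J_lazy1 F); apply: J_le; [exact: bm_gt|exact: bm_cst|].
by move=> y; case: (_ < _).
Qed.

Lemma tl_mono F x y : x <= y -> tl F y <= tl F x.
Proof.
move=> xy; apply: J_le; [exact: bm_gt|exact: bm_gt|].
by move=> z; case: (ltP y z) => [yz|_]; rewrite ?(le_lt_trans xy yz) ?ler0n.
Qed.

Lemma tl_bound F A : half_tail F A ->
  exists2 C : R, 0 < C & forall x : R, 0 <= x -> tl F x <= C / A x.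
Proof.
move=> [rA F0 tA]; have [x1 x11 H] := tA (2^-1) (ltac:(lra)).
have x10 : 0 <= x1 by lra.
have Ax1 := A_gt0 rA x10.
exists (1 + A x1) => [|x x0]; first by lra.
have Ax := A_gt0 rA x0.
rewrite ler_pdivlMr//; have [xx1|x1x] := leP x x1.
  have := A_le rA x0 xx1; have := tl_le1 F x; have := tl_ge0 F x => h1 h2 h3.
  apply: (@le_trans _ _ (1 * A x1)); last by clear; lra.
  by apply: ler_pM => //; exact: ltW.
by have /andP[_ h] := H x (ltW x1x); move: h; clear -Ax1; lra.
Qed.

Lemma tl_small F A : half_tail F A -> forall e : R, 0 < e ->
  exists2 x1 : R, 1 <= x1 & forall x : R, x1 <= x -> tl F x <= e.
Proof.
move=> FA e e0; have [C C0 tC] := tl_bound FA; have [rA _ _] := FA.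
have [x1 x11 H] := A_large rA (C / e); exists x1 => // x xx1.
have [h _ _] := H x xx1; have x0 : 0 <= x by lra.
apply: le_trans (tC x x0) _; rewrite ler_pdivrMr ?(A_gt0 rA)// mulrC.
by rewrite -ler_pdivrMr.
Qed.

(* 1 - Re phi(th), phi the characteristic function of the lazy law. *)
Definition dec F (th : R) : R := J (lazyF F) (fun y => 1 - cos (th * y)).

Lemma bm_1cos (th : R) : bm (fun y : R => 1 - cos (th * y)).
Proof. by apply: bmB; [exact: bm_cst|exact: bm_cos_mul']. Qed.

Lemma cos1_lt1 : cos 1 < 1 :> R.
Proof.
have p2 := pi_ge2 R; rewrite -[X in _ < X]cos0 ltr_cos ?ltr01// in_itv/=.
all: by apply/andP; split; lra.
Qed.

(** The deficit at [z^-1] is at least [1 - cos 1] times the mass of ]z, 2z], where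
    [1 <= y / z <= 2 <= pi]. That mass is comparable with [1 / A z], because the ratio of [A] at 2z
    and z tends to sqrt 2. *)
Lemma dec_near0 F A : half_tail F A -> exists c0 z0 : R, [/\ 0 < c0, 1 <= z0 &
  forall z : R, z0 <= z -> c0 / A z <= dec F z^-1].
Proof.
move=> FA; have [rA F0 tA] := FA.
have [x1 x11 H] := tA (1/25) (ltac:(lra)).
have [x2 x21 H2] := @ell_unif R A rA 2^-1 (1/10) (ltac:(lra)) (ltac:(lra)) (ltac:(lra)).
have c1 := cos1_lt1.
exists ((1 - cos 1) * (1/25)), (Num.max x1 x2); split.
- by rewrite mulr_gt0//; lra.
- by rewrite le_max x11.
move=> z; rewrite ge_max => /andP[x1z x2z].
have z0 : 0 < z by clear -x21 x2z; lra.
have Az := A_gt0 rA (ltW z0).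
have A2z : 0 < A (2 * z) by apply: (A_gt0 rA); clear -z0; lra.
have /andP[h1 _] := H z x1z.
have /andP[_ h2] := H (2 * z) (ltac:(clear -x11 x1z; lra)).
have /andP[_ h3] := H2 (2 * z) z (ltac:(clear -x21 x2z; lra)) (ltac:(clear -x21 x2z; lra)) (ltac:(clear -x21 x2z; lra)).
(* 13/10 is below sqrt 2. With the tail error 1/25 it leaves a mass of at least
   [(23/50 - 27/50 * 10/13) / A z], which exceeds [(1/25) / A z]. *)
have A13 : 13/10 * A z <= A (2 * z).
  have c130 : 0 <= 13/10 :> R by clear; lra.
  rewrite -(@ler_pXn2r _ 2)// ?nnegrE ?mulr_ge0 ?(ltW Az) ?(ltW A2z)//.
  have : A z ^+ 2 <= (1 + 1 / 10) * (A (2 * z) ^+ 2 / (2 * z)) * z by rewrite -ler_pdivrMr.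
  have -> : (1 + 1 / 10) * (A (2 * z) ^+ 2 / (2 * z)) * z = 11/20 * A (2 * z) ^+ 2 by field; exact: lt0r_neq0.
  by move: (A (2 * z) ^+ 2) => X; rewrite exprMn; move: (A z ^+ 2) (sqr_ge0 (A z)) => Y; clear; lra.
have t1 : (2^-1 - 1/25) / A z <= tl F z by rewrite ler_pdivrMr.
have t2 : tl F (2 * z) <= (2^-1 + 1/25) * (10/13) / A z.
  apply: (@le_trans _ _ ((2^-1 + 1/25) / A (2 * z))); first by rewrite ler_pdivlMr.
  rewrite -mulrA ler_pM2l; last by clear; lra.
  by rewrite ler_pdivlMr// mulrC ler_pdivrMr//; move: A13; clear; lra.
have key : (1 - cos 1) * (tl F z - tl F (2 * z)) <= dec F z^-1.
  have b2 : bm (fun y : R => (z < y)%R%:R - (2 * z < y)%R%:R : R) by apply: bmB; exact: bm_gt.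
  rewrite /tl -JB; [|exact: bm_gt..].
  rewrite -JZ//; apply: J_le; [exact: bmZ|exact: bm_1cos|].
  move=> y; have h0 : 0 <= 1 - cos (z^-1 * y) by rewrite subr_ge0 cos_le1.
  have [zy|yz] := ltP z y; last first.
    have -> : (2 * z < y) = false by apply/negbTE; rewrite -leNgt; clear -z0 yz; lra.
    by rewrite subrr mulr0.
  have [zy2|yz2] := ltP (2 * z) y; first by rewrite subrr mulr0.
  rewrite subr0 mulr1 lerB//.
  have u1 : 1 <= z^-1 * y by rewrite mulrC ler_pdivlMr// mul1r ltW.
  have u2 : z^-1 * y <= 2 by rewrite mulrC ler_pdivrMr.
  have p2 := pi_ge2 R.
  by rewrite leNgt ltr_cos -?leNgt// in_itv/=; apply/andP; split; clear -u1 u2 p2; lra.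
apply: le_trans key; rewrite -mulrA ler_pM2l ?subr_gt0//.
move: t1 t2; rewrite -(mulrA _ (10/13)).
have : 0 < (A z)^-1 by rewrite invr_gt0.
by move: ((A z)^-1) (tl F z) (tl F _) => a b c; clear; lra.
Qed.

(** Jumps up to [K] contribute a Lipschitz term, the others at most twice their mass. Letting [K]
    grow gives continuity of the characteristic function although the mean is infinite. *)
Lemma dec_lip F A : half_tail F A -> forall (K a b : R), 0 <= K ->
  `|dec F a - dec F b| <= `|a - b| * K + 2 * tl F K.
Proof.
move=> [rA F0 tA] K a b K0; rewrite -JB; [|exact: bm_1cos..].
have bd : bm (fun y : R => 1 - cos (a * y) - (1 - cos (b * y))) by apply: bmB; exact: bm_1cos.
apply: le_trans (@J_norm _ _ (measurableTypeR R) (lazyF F) _ bd) _.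
have -> : `|a - b| * K + 2 * tl F K = J (lazyF F) (fun y => `|a - b| * K + 2 * (K < y)%R%:R).
  rewrite JD; [|exact: bm_cst|by apply: bmZ; exact: bm_gt].
  have -> : J (lazyF F) (fun=> `|a - b| * K) = `|a - b| * K by rewrite J_cst J_lazy1 mulr1.
  by rewrite JZ//; exact: bm_gt.
apply: (J_le0 (lazy_neg F0)).
- exact: bm_norm.
- by apply: bmD; [exact: bm_cst|apply: bmZ; exact: bm_gt].
move=> y y0.
have -> : 1 - cos (a * y) - (1 - cos (b * y)) = cos (b * y) - cos (a * y) by ring.
have [Ky|yK] := ltP K y.
  rewrite mulr1; apply: le_trans (ler_normB _ _) _.
  have := cos_max (a * y); have := cos_max (b * y).
  have : 0 <= `|a - b| * K by rewrite mulr_ge0.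
  move: (`|a - b| * K) (`|cos _|) (`|cos _|) => u v w; clear; lra.
rewrite mulr0 addr0; apply: le_trans (cos_lip _ _) _.
by rewrite -mulrBl normrM distrC [X in _ * X]ger0_norm// ler_wpM2l.
Qed.

(** Near 0 this is [dec_near0]. On the compact remainder the continuous function [dec F] has a
    positive minimum, and [A th^-1] is bounded below by [A 0]. *)
Lemma dec_lower F A (T : R) : half_tail F A -> 0 < T ->
  (forall th : R, 0 < th <= T -> 0 < dec F th) ->
  exists2 c0 : R, 0 < c0 & forall th : R, 0 < th <= T -> c0 / A th^-1 <= dec F th.
Proof.
move=> FA T0 nl; have [rA F0 tA] := FA.
have [c0 [z0 [c00 z01 H]]] := dec_near0 FA.
have z00 : 0 < z0 by lra.
have A0 := A_gt0 rA (lexx 0).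
have near th : 0 < th -> th <= z0^-1 -> c0 / A th^-1 <= dec F th.
  move=> th0 thz; rewrite -{2}(invrK th); apply: H.
  by rewrite -(invrK z0) lef_pV2 ?posrE ?invr_gt0.
have [zT|Tz] := leP z0^-1 T; last first.
  exists c0 => // th /andP[th0 thT]; apply: near => //.
  by rewrite (le_trans thT)// ltW.
have cd : {within `[z0^-1, T], continuous (dec F)}.
  apply: continuous_subspaceT => x; apply/cvgrPdist_le => e e0.
  have [K K1 HK] := tl_small FA (ltac:(clear -e0; lra) : 0 < e / 4).
  have K0 : 0 < K by clear -K1; lra.
  have d0 : 0 < e / 2 / K by rewrite !divr_gt0//; lra.
  near=> t; apply: le_trans (dec_lip FA _ _ (ltW K0)) _.
  have h1 : `|x - t| * K <= e / 2.
    rewrite -ler_pdivlMr//; near: t; apply: nbhs_le_dist_ball => //.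
  by have := HK K (lexx _); move: h1; clear; lra.
have [m mzT mm] := EVT_min zT cd.
have m0 : 0 < m by move: mzT; rewrite in_itv/= => /andP[h _]; apply: lt_le_trans h; rewrite invr_gt0.
have dm : 0 < dec F m by apply: nl; rewrite m0; move: mzT; rewrite in_itv/= => /andP[].
exists (Num.min c0 (dec F m * A 0)); first by rewrite lt_min c00 mulr_gt0.
move=> th /andP[th0 thT].
have At : 0 < A th^-1 by apply: (A_gt0 rA); rewrite invr_ge0 ltW.
have [thz|zth] := leP th z0^-1.
  apply: le_trans (near th th0 thz); rewrite ler_pM2r ?invr_gt0//.
  by rewrite ge_min lexx.
apply: (@le_trans _ _ (dec F m)); last by apply: mm; rewrite in_itv/= thT ltW.
rewrite ler_pdivrMr//; apply: (@le_trans _ _ (dec F m * A 0)).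
  by rewrite ge_min lexx orbT.
by rewrite ler_pM2l//; apply: (A_le rA) => //; rewrite invr_ge0 ltW.
Unshelve. all: by end_near. Qed.

End tails.

(** * Local bounds by Fourier inversion *)

Section transform_bounds.
Context {R : realType}.
Implicit Types (F : probability (measurableTypeR R) R) (A p : R -> R).

(** The triangle inequality for a complex integral: project on the direction of its own value, where
    [norm_lincomb] bounds the integrand by [w * p]. *)
Lemma J_cos_sin_le F p (th : R) : bm p -> (forall y, 0 <= p y) ->
  ctr F p th ^+ 2 + str F p th ^+ 2 <= J F p ^+ 2.
Proof.
move=> bp p0; set u := ctr F p th; set v := str F p th.
have S0 : 0 <= J F p by exact: J_ge0.
have uv0 : 0 <= u ^+ 2 + v ^+ 2 by rewrite addr_ge0 ?sqr_ge0.
pose w := Num.sqrt (u ^+ 2 + v ^+ 2).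
have w0 : 0 <= w by exact: sqrtr_ge0.
have w2 : w ^+ 2 = u ^+ 2 + v ^+ 2 by rewrite sqr_sqrtr.
have bc : bm (fun y => p y * cos (th * y)) by apply: bmM => //; exact: bm_cos_mul'.
have bs : bm (fun y => p y * sin (th * y)) by apply: bmM => //; exact: bm_sin_mul'.
have h : u ^+ 2 + v ^+ 2 <= w * J F p.
  have -> : u ^+ 2 + v ^+ 2 = J F (fun y => u * (p y * cos (th * y)) + v * (p y * sin (th * y))).
    by rewrite JD; [rewrite !JZ// -/(ctr F p th) -/(str F p th)|exact: bmZ..].
  rewrite -JZ//; apply: J_le; [by apply: bmD; exact: bmZ|exact: bmZ|].
  move=> y; have -> : u * (p y * cos (th * y)) + v * (p y * sin (th * y)) =
    p y * (u * cos (th * y) + v * sin (th * y)) by ring.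
  rewrite [w * _]mulrC ler_wpM2l//; apply: le_trans (ler_norm _) _.
  by apply: norm_lincomb => //; [rewrite w2|exact: cos2Dsin2].
rewrite -w2; rewrite lerXn2r ?nnegrE//.
move: h; rewrite -w2 expr2; move: w0; rewrite le_eqVlt => /predU1P[<-//|w0].
by rewrite ler_pM2l.
Qed.

(* The atom of the lazy law at 0 makes [1 - |phi|^2] comparable with [1 - Re phi]. *)
Lemma lazy_transform_bound F p (th : R) : bm p -> (forall y, 0 <= p y) -> p 0 = 1 ->
  ctr (lazyF F) p th ^+ 2 + str (lazyF F) p th ^+ 2 <=
  J (lazyF F) p ^+ 2 - J (lazyF F) (fun y => p y * (1 - cos (th * y))).
Proof.
move=> bp p0 p1.
have bc : bm (fun y => p y * cos (th * y)) by apply: bmM => //; exact: bm_cos_mul'.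
have bs : bm (fun y => p y * sin (th * y)) by apply: bmM => //; exact: bm_sin_mul'.
have bd : bm (fun y => p y * (1 - cos (th * y))) by apply: bmM => //; exact: bm_1cos.
rewrite /ctr /str !J_lazy// mulr0 cos0 sin0 p1 subrr !mulr0 !mulr1 !add0r.
have -> : J F (fun y => p y * (1 - cos (th * y))) = J F p - J F (fun y => p y * cos (th * y)).
  by rewrite -JB//; congr J; apply/funext => y; ring.
have := J_cos_sin_le F th bp p0; rewrite /ctr /str.
set S := J F p; set u := J F (fun y => p y * cos (th * y)); set v := J F (fun y => p y * sin (th * y)).
move: S u v => S u v; rewrite !expr2 => h.
have -> : (2^-1 + 2^-1 * S) * (2^-1 + 2^-1 * S) - 2^-1 * (S - u) =
  4^-1 * (1 + 2 * u + S * S) by field.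
have -> : (2^-1 + 2^-1 * u) * (2^-1 + 2^-1 * u) + 2^-1 * v * (2^-1 * v) =
  4^-1 * (1 + 2 * u + (u * u + v * v)) by field.
by clear -h; lra.
Qed.

(** The tilting weights are controlled from below on [0, b] only. Discarding the jumps beyond [b]
    costs at most [2 * tl F b], as 1 - cos is at most 2. *)
Lemma dec_weight F p (c b th : R) : F `]-oo, 0[%classic = 0%E ->
  bm p -> (forall y, 0 <= p y) -> 0 <= c ->
  (forall y, 0 <= y <= b -> c <= p y) ->
  c * (dec F th - 2 * tl F b) <= J (lazyF F) (fun y => p y * (1 - cos (th * y))).
Proof.
move=> F0 bp p0 c0 cp; rewrite /dec /tl -JZ; last exact: bm_gt.
rewrite -JB; [|exact: bm_1cos|by apply: bmZ; exact: bm_gt].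
have b1 : bm (fun y : R => 1 - cos (th * y) - 2 * (b < y)%R%:R).
  by apply: bmB; [exact: bm_1cos|apply: bmZ; exact: bm_gt].
rewrite -JZ//; apply: (J_le0 (lazy_neg F0)); first exact: bmZ.
  by apply: bmM => //; exact: bm_1cos.
move=> y y0; have h0 : 0 <= 1 - cos (th * y) by rewrite subr_ge0 cos_le1.
have h1 := cos_geN1 (th * y).
have [b_y|yb] := ltP b y.
  apply: (@le_trans _ _ 0); last by rewrite mulr_ge0.
  by rewrite mulr1 mulr_ge0_le0//; clear -h1; lra.
by rewrite mulr0 subr0 ler_wpM2r// cp// y0.
Qed.

End transform_bounds.

(** * The Fejer kernel as a nonnegative band-limited majorant *)

Section fejer.
Context {R : realType}.
Implicit Types (T y th : R).

Definition fw T th : R := Num.min 1 (Num.max 0 (1 - th / T)).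

Lemma fw_bounds T th : 0 <= fw T th <= 1.
Proof. by rewrite /fw le_min ler01 le_max lexx /= ge_min lexx. Qed.

Lemma fw_norm T th : `|fw T th| <= 1.
Proof. by rewrite ger0_norm; case/andP: (fw_bounds T th). Qed.

Lemma bm_fw T : 0 < T -> bm (fw T).
Proof.
move=> T0; apply: (@bm_nonincreasing _ _ 1) => [x y xy|x]; last exact: fw_norm.
apply: le_min2 => //; apply: le_max2 => //; rewrite lerD2l lerN2.
by rewrite ler_pM2r ?invr_gt0.
Qed.

Lemma fwE T th : 0 < T -> 0 <= th <= T -> fw T th = 1 - th / T.
Proof.
move=> T0 /andP[th0 thT].
have h1 : 0 <= th / T by rewrite divr_ge0// ltW.
have h2 : th / T <= 1 by rewrite ler_pdivrMr// mul1r.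
by rewrite /fw max_r ?min_r//; lra.
Qed.

(* The Fejer kernel (1 - cos(T y))/(T y^2), see fejE. *)
Definition fej T y : R := bl T (fw T) y.

Lemma fejE T y : 0 < T -> y != 0 -> fej T y = (1 - cos (T * y)) / (T * y ^+ 2).
Proof.
move=> T0 y0.
have bf : bm (fun th => fw T th * cos (th * y)).
  by apply: bmM; [exact: bm_fw|exact: bm_cos_mul].
pose P th := (1 - th / T) * (sin (th * y) / y) - cos (th * y) / (T * y ^+ 2).
have dlin (c th : R) : is_derive th 1 (fun t => t * c) c.
  have := is_deriveM (is_derive_id th (1 : R)) (is_derive_cst c th (1 : R)).
  have -> : ((fun x : R => x) * cst c) = (fun t => t * c) by apply/funext.
  move=> h; apply: is_derive_eq.
  by rewrite /GRing.scale /= mulr0 add0r mulr1.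
have dP th : is_derive th 1 P ((1 - th / T) * cos (th * y)).
  have d1 : is_derive th 1 (fun t => sin (t * y)) (cos (th * y) * y).
    have := @is_derive1_comp R (@sin R) (fun t => t * y) th (cos (th * y)) y.
    by apply.
  have d2 : is_derive th 1 (fun t => cos (t * y)) (- sin (th * y) * y).
    have := @is_derive1_comp R (@cos R) (fun t => t * y) th (- sin (th * y)) y.
    by apply.
  have d3 : is_derive th 1 (fun t => 1 - t / T) (- T^-1).
    have := is_deriveB (is_derive_cst (1:R) th (1:R)) (dlin T^-1 th).
    by rewrite sub0r.
  have d4 : is_derive th 1 (fun t => sin (t * y) / y) (cos (th * y)).
    have := is_deriveM d1 (is_derive_cst y^-1 th (1 : R)).
    move=> h; apply: is_derive_eq.
    by rewrite /GRing.scale /=; field.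
  have d5 : is_derive th 1 (fun t => cos (t * y) / (T * y ^+ 2)) (- sin (th * y) / (T * y)).
    have := is_deriveM d2 (is_derive_cst (T * y ^+ 2)^-1 th (1 : R)).
    move=> h; apply: is_derive_eq.
    by rewrite /GRing.scale /=; field; rewrite y0 lt0r_neq0.
  have := is_deriveB (is_deriveM d3 d4) d5.
  move=> h; apply: is_derive_eq.
  by rewrite /GRing.scale /=; field; rewrite y0 lt0r_neq0.
have cP : {within `[0, T], continuous P}.
  apply: derivable_within_continuous => x _.
  by have h := dP x; exact: ex_derive.
have cf t : 0 < t < T -> {for t, continuous (fun th => fw T th * cos (th * y))}.
  move=> tT; apply: (@near_eq_continuous _ _ (fun th => (1 - th / T) * cos (th * y)) 0 T) => //.
    by move=> x /andP[x0 xT]; rewrite fwE// !ltW.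
  apply: cvgM.
    apply: cvgB; first exact: cvg_cst.
    by apply: cvgMl; exact: cvg_id.
  apply: (@continuous_comp _ _ _ (fun t : R => t * y) (@cos R)); last exact: continuous_cos.
  by apply: cvgMl; exact: cvg_id.
have e : P T - P 0 = (1 - cos (T * y)) / (T * y ^+ 2).
  rewrite /P !mul0r sin0 cos0 divff ?lt0r_neq0//; field.
  by rewrite y0 lt0r_neq0.
rewrite -e; apply: le_anti; apply/andP; split.
  apply: (LI_le_primitive (dP := fun th => (1 - th / T) * cos (th * y))) => //; first exact: ltW.
  by move=> x /andP[x0 xT]; rewrite fwE// !ltW.
apply: (LI_ge_primitive (dP := fun th => (1 - th / T) * cos (th * y))) => //; first exact: ltW.
by move=> x /andP[x0 xT]; rewrite fwE// !ltW.
Qed.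

Lemma bm_bl T (w : R -> R) : bm w -> bm (bl T w).
Proof.
move=> bw.
have bz : bm (fun z : R * R => w z.2 * cos (z.2 * z.1)).
  apply: bmM; first by apply: bm_comp bw; exact: measurable_snd.
  by apply: bm_cos; apply: measurable_funM; [exact: measurable_snd|exact: measurable_fst].
rewrite (_ : bl T w = fun y => J (leb 0 T) (fun th => w th * cos (th * y))).
  exact: (@bm_J _ _ _ _ _ (leb 0 T) _ bz).
apply/funext => y; rewrite /bl LI_J//.
by apply: bmM => //; exact: bm_cos_mul.
Qed.

Lemma bm_fej T : 0 < T -> bm (fej T).
Proof. by move=> T0; apply: bm_bl; exact: bm_fw. Qed.

(** For [th <= T / 2] the weight is at least 1/2, and for [|y| <= 1 / (2 T)] the cosine is at least
    cos(1/2). Integrating over [0, T/2] gives [cF * T] in [fej_ge]. *)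
Definition cF : R := cos (2^-1) / 4.

Lemma cos_half_gt0 : 0 < cos (2^-1 : R).
Proof. by apply: cos_gt0_pihalf; have := pihalf_ge1 R; move=> h; apply/andP; split; lra. Qed.

Lemma cF_gt0 : 0 < cF.
Proof. by rewrite divr_gt0 ?cos_half_gt0. Qed.

Lemma fej_ge T y : 0 < T -> `|y| <= (2 * T)^-1 -> cF * T <= fej T y.
Proof.
move=> T0 yT.
have bf : bm (fun th => fw T th * cos (th * y)).
  by apply: bmM; [exact: bm_fw|exact: bm_cos_mul].
have c0 := cos_half_gt0.
have cy th : 0 <= th <= T -> cos 2^-1 <= cos (th * y).
  move=> /andP[th0 thT]; rewrite -(cos_norm (th * y)) normrM (ger0_norm th0).
  have h1 : th * `|y| <= 2^-1.
    apply: (@le_trans _ _ (T * (2 * T)^-1)); first exact: ler_pM.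
    by rewrite invfM mulrCA divff ?mulr1// lt0r_neq0.
  have h0 : 0 <= th * `|y| by rewrite mulr_ge0.
  have p2 := pi_ge2 R.
  by rewrite leNgt ltr_cos -?leNgt// in_itv/=; apply/andP; split; clear -h1 h0 p2; lra.
have T20 : 0 <= T / 2 by lra.
have T2T : T / 2 <= T by lra.
rewrite /fej /bl (LI_split bf T20 T2T).
have h1 : cF * T <= LI 0 (T / 2) (fun th => fw T th * cos (th * y)).
  have -> : cF * T = LI 0 (T / 2) (fun=> 2^-1 * cos 2^-1) by rewrite LI_cst// /cF; field.
  apply: LI_le => //; first exact: bm_cst.
  move=> th /andP[th0 thT]; rewrite fwE//; last by apply/andP; split; lra.
  apply: ler_pM; rewrite ?(ltW c0)//.
    have : th / T <= 2^-1 by rewrite ler_pdivrMr//; clear -thT; lra.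
    by clear; lra.
  by apply: cy; apply/andP; split; clear -th0 thT; lra.
have h2 : 0 <= LI (T / 2) T (fun th => fw T th * cos (th * y)).
  apply: LI_ge0 => th /andP[th0 thT]; rewrite mulr_ge0//; first by case/andP: (fw_bounds T th).
  by apply: le_trans (ltW c0) _; apply: cy; apply/andP; split; clear -th0 thT; lra.
by lra.
Qed.

Lemma fej_ge0 T y : 0 < T -> 0 <= fej T y.
Proof.
move=> T0; have [->|y0] := eqVneq y 0.
  apply: le_trans (fej_ge T0 _); first by rewrite mulr_ge0 ?ltW ?cF_gt0.
  by rewrite normr0 invr_ge0 mulr_ge0// ltW.
rewrite fejE// divr_ge0 ?subr_ge0 ?cos_le1// mulr_ge0 ?sqr_ge0//; exact: ltW.
Qed.

Lemma fej_decay T y : 0 < T -> y != 0 -> fej T y <= 2 / (T * y ^+ 2).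
Proof.
move=> T0 y0; rewrite fejE// ler_wpM2r//.
  by rewrite invr_ge0 mulr_ge0 ?sqr_ge0//; exact: ltW.
by have := cos_geN1 (T * y); lra.
Qed.

Lemma chi_le_fej T h y : 0 < T -> 0 < h -> T * h <= 2^-1 ->
  chi h y <= (cF * T)^-1 * fej T y.
Proof.
move=> T0 h0 Th; have cT : 0 < cF * T by rewrite mulr_gt0 ?cF_gt0.
rewrite /chi; case: (boolP (0 <= y < h)) => [/andP[y0 yh]|_]; last first.
  by rewrite mulr_ge0 ?fej_ge0// invr_ge0 ltW.
rewrite mulrC ler_pdivlMr// mul1r; apply: fej_ge => //.
rewrite ger0_norm// (le_trans (ltW yh))// -div1r ler_pdivlMr ?mulr_gt0//.
by lra.
Qed.

End fejer.

Section concentration.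
Context {R : realType}.
Implicit Types (F : probability (measurableTypeR R) R) (A p : R -> R).

Lemma bm_expR (u : R -> R) : bm u -> bm (fun x => expR (u x)).
Proof.
move=> [mu [M uM]]; split; first exact: measurableT_comp (@measurable_expR R) mu.
exists (expR M) => x; rewrite ger0_norm ?expR_ge0// ler_expR.
exact: le_trans (ler_norm _) (uM x).
Qed.

Lemma bm_ainvV A (rA : rv_half A) (d : R) : 0 < d -> bm (fun th => (ainv A d th)^-1).
Proof.
move=> d0; have A0 := A_gt0 rA (lexx 0).
apply: (@bm_nondecreasing _ _ (A 0)^-1) => [x y xy|x].
  rewrite lef_pV2 ?posrE ?(ainv_gt0 rA)//.
  have m0 : 0 < Num.max x d by rewrite lt_max d0 orbT.
  have m0' : 0 < Num.max y d by rewrite lt_max d0 orbT.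
  apply: (A_le rA); first by rewrite invr_ge0 ltW.
  by rewrite lef_pV2 ?posrE// ge_max !le_max xy lexx orbT.
rewrite ger0_norm ?invr_ge0 ?(ltW (ainv_gt0 rA _ d0))// lef_pV2 ?posrE ?(ainv_gt0 rA)//.
by case/andP: (ainv_bounds rA x d0).
Qed.

(* [qint] is the Fourier bound for the local probabilities of the n-th step. *)
Definition qint A (c d T : R) (n : nat) : R :=
  LI d T (fun th => expR (- (c * n%:R * (ainv A d th)^-1))).

Lemma bm_qexp A (rA : rv_half A) (c d : R) n : 0 < d ->
  bm (fun th => expR (- (c * n%:R * (ainv A d th)^-1))).
Proof. by move=> d0; apply: bm_expR; apply: bmN; apply: bmZ; exact: bm_ainvV. Qed.

Lemma qint_ge0 A c d T n : 0 <= qint A c d T n.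
Proof. by apply: LI_ge0 => th _; exact: expR_ge0. Qed.

(** The window lies below a multiple of a Fejer kernel, whose n-step value is bounded by the
    integral of the n-th power of the modulus of the transform. For [th >= K / x] the weight,
    bounded below up to [g * x], keeps a fixed share of the deficit [c0 / A th^-1]; for [th < K / x]
    the modulus is bounded by the mass alone. The estimate is uniform in the weight, which may
    therefore depend on x and n: this is what makes tilting possible. *)
Lemma concentration F A (T h c0 g cp : R) : half_tail F A -> 0 < h -> 0 < T -> T * h <= 2^-1 ->
  0 < c0 -> (forall th : R, 0 < th <= T -> c0 / A th^-1 <= dec F th) ->
  0 < g -> 0 < cp ->
  exists C c K0 : R, [/\ 0 < C, 0 < c, 0 < K0 & forall K : R, K0 <= K -> 
    exists2 x1 : R, 1 <= x1 & forall x : R, x1 <= x ->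
    forall p, bm p -> (forall y, 0 <= p y) -> p 0 = 1 ->
      (forall y, 0 <= y <= g * x -> cp <= p y) -> J (lazyF F) p <= 2 ->
      forall n z, iter n (Op (lazyF F) p) (chi h) z <=
        C * J (lazyF F) p ^+ n * (K / x + qint A c (K / x) T n)].
Proof.
move=> FA h0 T0 Th c00 dl g0 cp0; have [rA F0 tA] := FA.
have [Ct Ct0 tC] := tl_bound FA.
have cT : 0 < cF * T :> R by rewrite mulr_gt0 ?cF_gt0.
(* Half of the deficit is given up to the tail beyond [g * x]. The rest must dominate the loss in
   [m ^+ 2 * (1 - 2 * w)], where [m <= 2] allows a loss of up to [8 * w]: together a factor 16. *)
pose c := cp * c0 / 16; have cc : 0 < c by rewrite /c !(mulr_gt0, divr_gt0).
(* Large [K] makes [A (x / K)] small against [A (g * x)], so that for [th >= K / x] twice the tail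
   beyond [g * x] is at most half of [c0 / A th^-1]. *)
pose K0 := Num.max (2 / g) (32 * Ct ^+ 2 / (g * c0 ^+ 2)).
have K00 : 0 < K0 by rewrite lt_max divr_gt0.
exists (cF * T)^-1, c, K0; split => //; first by rewrite invr_gt0.
move=> K; rewrite ge_max => /andP[K1 K2].
have K0' : 0 < K by apply: lt_le_trans K1; rewrite divr_gt0.
have gK : 2 <= g * K by rewrite mulrC -ler_pdivrMr.
have d1 : 0 < (g * K)^-1 by rewrite invr_gt0 mulr_gt0.
have d2 : (g * K)^-1 < 1 by rewrite invf_lt1 ?mulr_gt0//; clear -gK; lra.
have [x1 x11 H] := ell_unif rA d1 d2 ltr01.
exists (Num.max (Num.max 1 (x1 / g)) (K / T)) => [|x]; first by rewrite !le_max lexx.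
rewrite !ge_max -andbA => /and3P[x_1 xg xK] p bp p0 p1 cpp m2 n z.
have x0 : 0 < x by clear -x_1; lra.
set d := K / x; have dp : 0 < d by rewrite divr_gt0.
have dT : d <= T by rewrite /d ler_pdivrMr// mulrC -ler_pdivrMr.
set m := J (lazyF F) p; have m0 : 0 <= m by exact: J_ge0.
have gx : x1 <= g * x by rewrite mulrC -ler_pdivrMr.
have gx0 : 0 < g * x by rewrite mulr_gt0.
have AK : A (x / K) * (4 * Ct) <= c0 * A (g * x).
  have xK0 : 0 < x / K by rewrite divr_gt0.
  have AxK := A_gt0 rA (ltW xK0); have Agx := A_gt0 rA (ltW gx0).
  have hz1 : (g * K)^-1 * (g * x) <= x / K.
    by rewrite invfM mulrACA mulVf ?mul1r ?lt0r_neq0// mulrC.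
  have hz2 : x / K <= g * x.
    rewrite ler_pdivrMr// mulrAC ler_peMl//; first exact: ltW.
    by clear -gK; lra.
  have /andP[_] := H (g * x) (x / K) gx hz1 hz2.
  rewrite ler_pdivrMr// => h1.
  have h2 : A (x / K) ^+ 2 <= 2 * A (g * x) ^+ 2 / (g * K).
    apply: le_trans h1 _; rewrite le_eqVlt; apply/orP; left; apply/eqP.
    by field; rewrite !lt0r_neq0.
  rewrite -(@ler_pXn2r _ 2)// ?nnegrE ?mulr_ge0 ?(ltW AxK) ?(ltW Agx) ?(ltW c00) ?(ltW Ct0)//.
  rewrite !exprMn.
  have h3 : 32 * Ct ^+ 2 <= K * (g * c0 ^+ 2) by rewrite -ler_pdivrMr// mulr_gt0 ?exprn_gt0.
  apply: (@le_trans _ _ (2 * A (g * x) ^+ 2 / (g * K) * (4 ^+ 2 * Ct ^+ 2))).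
    by rewrite ler_wpM2r// mulr_ge0 ?sqr_ge0.
  have -> : 2 * A (g * x) ^+ 2 / (g * K) * (4 ^+ 2 * Ct ^+ 2) =
     A (g * x) ^+ 2 / (g * K) * (32 * Ct ^+ 2) by ring.
  apply: (@le_trans _ _ (A (g * x) ^+ 2 / (g * K) * (K * (g * c0 ^+ 2)))).
    by rewrite ler_wpM2l// divr_ge0 ?sqr_ge0// ltW// mulr_gt0.
  rewrite le_eqVlt; apply/orP; left; apply/eqP.
  by field; rewrite !lt0r_neq0.
pose r (th : R) := m * expR (- (c * (d <= th)%R%:R * (ainv A d th)^-1)).
have br : bm r.
  apply: bmZ; apply: bm_expR; apply: bmN; apply: bmM; last exact: bm_ainvV.
  by apply: bmZ; exact: bm_ge.
have r0 th : 0 <= r th by rewrite mulr_ge0// expR_ge0.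
have rr th : 0 <= th <= T -> ctr (lazyF F) p th ^+ 2 + str (lazyF F) p th ^+ 2 <= r th ^+ 2.
  move=> /andP[th0 thT]; apply: le_trans (lazy_transform_bound F th bp p0 p1) _.
  rewrite -/m; have Dp0 : 0 <= J (lazyF F) (fun y => p y * (1 - cos (th * y))).
    by apply: J_ge0 => y; rewrite mulr_ge0// subr_ge0 cos_le1.
  rewrite /r; have [dth|thd] := leP d th; last first.
    by rewrite mulr0 mul0r oppr0 expR0 mulr1 gerBl.
  have th0' : 0 < th by clear -dp dth; lra.
  have Dw := dec_weight th F0 bp p0 (ltW cp0) cpp.
  have dlt := dl th (introT andP (conj th0' thT)).
  have At0 : 0 < A th^-1 by apply: (A_gt0 rA); rewrite invr_ge0 ltW.
  have Agx := A_gt0 rA (ltW gx0).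
  have AtK : A th^-1 <= A (x / K).
    apply: (A_le rA); first by rewrite invr_ge0 ltW.
    by rewrite -invf_div lef_pV2 ?posrE.
  have tlb : 4 * tl F (g * x) <= c0 / A th^-1.
    apply: (@le_trans _ _ (4 * (Ct / A (g * x)))); first by rewrite ler_pM2l// tC// ltW.
    rewrite ler_pdivlMr//.
    have -> : 4 * (Ct / A (g * x)) * A th^-1 = A th^-1 * (4 * Ct) / A (g * x) by ring.
    rewrite ler_pdivrMr//; apply: le_trans AK; apply: ler_wpM2r => //.
    by rewrite mulr_ge0 ?(ltW Ct0).
  have Dlow : 8 * (c / A th^-1) <= J (lazyF F) (fun y => p y * (1 - cos (th * y))).
    apply: le_trans Dw; rewrite /c.
    have -> : 8 * (cp * c0 / 16 / A th^-1) = cp * (2^-1 * (c0 / A th^-1)) by field; exact: lt0r_neq0.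
    by rewrite ler_pM2l//; move: tlb dlt; clear; lra.
  rewrite mulr1 (ainvE A dth) exprMn -expRM_natl.
  set w := c / A th^-1.
  have w0 : 0 <= w by rewrite divr_ge0 ?(ltW cc) ?(ltW At0).
  have e1 : 1 - 2 * w <= expR (2%:R * - w) by have := expR_ge1Dx (2%:R * - w); clear; lra.
  apply: (@le_trans _ _ (m ^+ 2 * (1 - 2 * w))); last by rewrite ler_wpM2l ?sqr_ge0.
  have : m ^+ 2 * (2 * w) <= 8 * w.
    have -> : 8 * w = 2 ^+ 2 * (2 * w) by ring.
    apply: ler_wpM2r; first by rewrite mulr_ge0.
    by rewrite lerXn2r ?nnegrE.
  by move: Dlow; rewrite -/w; move: (J _ _) => D; clear; rewrite mulrBr mulr1; lra.
have h1 : iter n (Op (lazyF F) p) (chi h) z <=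
    (cF * T)^-1 * iter n (Op (lazyF F) p) (fej T) z.
  have bf := bm_fej T0; rewrite -[leRHS]/((fun z => (cF * T)^-1 * iter n (Op (lazyF F) p) (fej T) z) z).
  rewrite -iterZ//; apply: iter_le => //; [exact: bm_chi|exact: bmZ|].
  by move=> y; exact: chi_le_fej.
apply: le_trans h1 _; rewrite -mulrA ler_wpM2l ?invr_ge0 ?(ltW cT)//.
have h2 := iter_bl_bound n z bp (bm_fw T0) br ler01 r0 (@fw_norm _ T) rr.
apply: le_trans (ler_norm _) _; apply: le_trans h2 _; rewrite mul1r.
have brn : bm (fun th => r th ^+ n) by exact: bmX.
rewrite (LI_split brn (ltW dp) dT) mulrDr lerD//.
  apply: (@le_trans _ _ (LI 0 d (fun=> m ^+ n))).
    apply: LI_le => //; first exact: bm_cst.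
    move=> th _; rewrite lerXn2r ?nnegrE// /r ler_piMr// expR_le1 oppr_le0.
    apply: mulr_ge0; first by apply: mulr_ge0; [exact: ltW|exact: ler0n].
    by rewrite invr_ge0; exact: ltW (ainv_gt0 rA _ dp).
  by rewrite LI_cst ?subr0// ltW.
rewrite /qint -LIZ; last exact: bm_qexp.
rewrite le_eqVlt; apply/orP; left; apply/eqP; apply: LI_eq => th /andP[dth _].
rewrite /r dth mulr1 exprMn -expRM_natl; congr (_ * expR _).
by ring.
Qed.

End concentration.

Section geometric_sums.
Context {R : realType}.
Implicit Types (u v t a c : R).

Lemma geo_sum v N : 0 < v -> \sum_(n < N) expR (- (v * n%:R)) <= 1 + v^-1.
Proof.
move=> v0; pose q := expR (- v).
have q0 : 0 <= q by exact: expR_ge0.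
have hq : q * (1 + v) <= 1.
  have e1 : q * expR v = 1 by rewrite /q -expRD addNr expR0.
  by have := ler_wpM2l q0 (expR_ge1Dx v); rewrite e1.
have q1 : q < 1.
  rewrite ltNge; apply/negP => q1; have : 1 * (1 + v) <= q * (1 + v) by apply: ler_wpM2r => //; lra.
  by lra.
have e n : expR (- (v * n%:R)) = q ^+ n.
  by rewrite /q -expRM_natl mulrN mulrC.
rewrite (eq_bigr (fun n : 'I_N => q ^+ n)); last by move=> n _; rewrite e.
have h : (1 - q) * \sum_(n < N) q ^+ n = 1 - q ^+ N.
  elim: N => [|N IH]; first by rewrite big_ord0 mulr0 expr0 subrr.
  by rewrite big_ord_recr /= mulrDr IH exprS; ring.
have h2 : (1 - q) * \sum_(n < N) q ^+ n <= (1 - q) * (1 + v^-1).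
  rewrite h; apply: (@le_trans _ _ 1); first by rewrite gerBl exprn_ge0.
  rewrite -(ler_pM2r v0).
  have -> : (1 - q) * (1 + v^-1) * v = (1 - q) * (1 + v) by field; exact: lt0r_neq0.
  by lra.
by move: h2; rewrite ler_pM2l// subr_gt0.
Qed.

Lemma pow_exp k t : 0 <= t -> t ^+ k * expR (- t) <= k`!%:R.
Proof.
move=> t0; case: k => [|k]; first by rewrite expr0 mul1r fact0 expR_le1 oppr_le0.
rewrite expRN ler_pdivrMr ?expR_gt0// mulrC -ler_pdivrMr ?ltr0n ?fact_gt0//.
by have := expR_ge1Dxn k t0; lra.
Qed.

(** Half of the exponent absorbs the power of n through [pow_exp]; the other half is summed as a
    geometric series. *)
Lemma poly_geo k (a0 c : R) : 0 < a0 -> 0 < c -> exists2 C : R, 0 < C &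
  forall a N, a0 <= a ->
    \sum_(n < N) n%:R ^+ k * expR (- (c * n%:R * a^-1)) <= C * a ^+ k.+1.
Proof.
move=> a00 c0; exists (k`!%:R * (2 / c) ^+ k * (a0^-1 + 2 / c)) => [|a N a0a].
  by rewrite !mulr_gt0 ?exprn_gt0 ?addr_gt0 ?invr_gt0 ?divr_gt0 ?ltr0n ?fact_gt0//.
have ap : 0 < a by lra.
pose v := c / (2 * a); have v0 : 0 < v by rewrite divr_gt0// mulr_gt0.
have tb n : n%:R ^+ k * expR (- (c * n%:R * a^-1)) <=
  k`!%:R * (2 * a / c) ^+ k * expR (- (v * n%:R)).
  have -> : - (c * n%:R * a^-1) = - (v * n%:R) + - (v * n%:R) by rewrite /v; field; exact: lt0r_neq0.
  rewrite expRD mulrA ler_wpM2r ?expR_ge0//.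
  have -> : n%:R ^+ k = (2 * a / c) ^+ k * (v * n%:R) ^+ k :> R.
    by rewrite -exprMn; congr (_ ^+ _); rewrite /v; field; rewrite !lt0r_neq0.
  rewrite -mulrA [k`!%:R * _]mulrC; apply: ler_wpM2l.
    by rewrite exprn_ge0// divr_ge0 ?mulr_ge0 ?ltW.
  by apply: pow_exp; rewrite mulr_ge0 ?ler0n// ltW.
apply: (@le_trans _ _ (\sum_(n < N) (k`!%:R * (2 * a / c) ^+ k * expR (- (v * n%:R))))).
  by apply: ler_sum => n _; exact: tb.
rewrite -mulr_sumr.
apply: (@le_trans _ _ (k`!%:R * (2 * a / c) ^+ k * (1 + v^-1))).
  by rewrite ler_wpM2l ?geo_sum// mulr_ge0 ?ler0n// exprn_ge0// divr_ge0 ?mulr_ge0 ?ltW.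
have -> : 2 * a / c = 2 / c * a by ring.
rewrite exprMn exprS.
have -> : k`!%:R * (2 / c) ^+ k * (a0^-1 + 2 / c) * (a * a ^+ k) =
  k`!%:R * ((2 / c) ^+ k * a ^+ k) * (a * a0^-1 + a * (2 / c)) by ring.
apply: ler_wpM2l.
  by rewrite mulr_ge0 ?ler0n// mulr_ge0// exprn_ge0// ?divr_ge0// ltW.
apply: lerD; first by rewrite ler_pdivlMr// mul1r.
by have -> : v^-1 = a * (2 / c) by rewrite /v; field; rewrite !lt0r_neq0.
Qed.

End geometric_sums.

Section fourier_sums.
Context {R : realType}.
Implicit Types (A : R -> R).

Lemma LI_mono_r (a b b' : R) (f : R -> R) : bm f -> b <= b' ->
  (forall x, 0 <= f x) -> LI a b f <= LI a b' f.
Proof.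
move=> bf bb f0; have [ab|ba] := leP a b.
  by rewrite (LI_split bf ab bb) lerDl; apply: LI_ge0 => x _.
rewrite {1}/LI set_itv_ge ?Rintegral_set0; last by rewrite bnd_simp -ltNge.
by apply: LI_ge0 => x _.
Qed.

(** Summing under the integral turns the weight [n ^+ k] into [A th^-1 ^+ k.+1], to which [J_high]
    applies at [j = 1] once [k >= 2]. The weight n falls on the critical exponent; sums carrying it
    first trade a power of [A x] for another n. *)
Lemma qint_sum_le A (rA : rv_half A) (c T : R) k : 0 < c -> (20 < 9 * k.+1)%N ->
  exists C w1 : R, [/\ 0 < C, 1 <= w1 & forall w N, w1 <= w ->
    \sum_(n < N) n%:R ^+ k * qint A c w^-1 T n <= C * (A w ^+ k.+1 / w)].
Proof.
move=> c0 k3; have A0 := A_gt0 rA (lexx 0).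
have [C C0 HC] := poly_geo k A0 c0.
pose T' := Num.max T 1; have T'1 : 1 <= T' by rewrite le_max lexx orbT.
have [D [w1 [D0 w11 HD]]] := @J_high R A rA T' 1 k.+1 isT k3 T'1.
exists (C * D), w1; split => //; first by rewrite mulr_gt0.
move=> w N w1w; have w0 : 0 < w by lra.
have w0' : 0 < w^-1 by rewrite invr_gt0.
have := HD w w^-1 w1w w0' (lexx _).
have bs n : bm (fun th => n%:R ^+ k * expR (- (c * n%:R * (ainv A w^-1 th)^-1))).
  by apply: bmZ; exact: bm_qexp.
have -> : \sum_(n < N) n%:R ^+ k * qint A c w^-1 T n =
   LI w^-1 T (fun th => \sum_(n < N) n%:R ^+ k * expR (- (c * n%:R * (ainv A w^-1 th)^-1))).
  rewrite LI_sum; last by move=> n; exact: bs.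
  by apply: eq_bigr => n _; rewrite LIZ//; exact: bm_qexp.
have ba : bm (fun th => clamp T' th ^+ 0 * ainv A w^-1 th ^+ k.+1).
  by apply: bm_clamp_ainv => //; clear -T'1; lra.
move=> h; apply: (@le_trans _ _ (C * LI w^-1 T' (fun th => clamp T' th ^+ 0 * ainv A w^-1 th ^+ k.+1))); last first.
  by rewrite -mulrA ler_wpM2l ?(ltW C0)//; rewrite expr1 in h.
rewrite -LIZ//; apply: (@le_trans _ _ (LI w^-1 T (fun th => C * (clamp T' th ^+ 0 * ainv A w^-1 th ^+ k.+1)))).
  apply: LI_le; [by apply: bm_sum => n; exact: bs|exact: bmZ|].
  move=> th _; rewrite expr0 mul1r; apply: HC.
  by case/andP: (ainv_bounds rA th w0').
apply: LI_mono_r; first exact: bmZ.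
  by rewrite le_max lexx.
move=> th; rewrite expr0 mul1r mulr_ge0 ?(ltW C0)// exprn_ge0// ltW//.
exact: (ainv_gt0 rA).
Qed.

(** The two parts make opposite demands. Frequencies above K/x contribute a multiple of
    [A x ^+ 3 / x] of order K^(-1/2), small for large K; those below contribute at most
    [N ^ 3 * K / x], small once [eta] is chosen after K. *)
Lemma S2_small A (rA : rv_half A) (c T K0 e : R) : 0 < c -> 0 < e ->
  exists K eta x1 : R, [/\ K0 <= K, 0 < K, 0 < eta <= 1, 1 <= x1 & forall x (N : nat), x1 <= x ->
    N%:R <= eta * A x ->
    \sum_(n < N) n%:R ^+ 2 * (K / x + qint A c (K / x) T n) <= e * (A x ^+ 3 / x)].
Proof.
move=> c0 e0.
have [C [w1 [C0 w11 HC]]] := @qint_sum_le A rA c T 2 c0 isT.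
pose k := Num.max (Num.max 2 K0) (4 * C / e).
have k2 : 2 <= k by rewrite !le_max lexx.
have kK0 : K0 <= k by rewrite !le_max lexx orbT.
have kC : 4 * C <= k * e by rewrite -ler_pdivrMr// le_max lexx orbT.
(* Slow variation with error 1 then gives [k * A (x / K) <= A x]. *)
pose K := 2 * k ^+ 2.
have kp : 0 < k by lra.
have K0p : 0 < K by rewrite /K mulr_gt0// exprn_gt0.
have kK : k <= K by rewrite /K expr2; have : 1 * k <= 2 * k * k by [rewrite ler_pM2r//; (clear -k2; lra)]; clear -k2; lra.
have Ki : K^-1 < 1 by rewrite invf_lt1//; clear -k2 kK; lra.
have [x1 x11 H] := ell_unif rA (ltac:(by rewrite invr_gt0) : 0 < K^-1) Ki ltr01.
pose eta := Num.min 1 (e / (2 * K)).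
have eta0 : 0 < eta by rewrite lt_min ltr01 divr_gt0// mulr_gt0.
have eta1 : eta <= 1 by rewrite ge_min lexx.
have etaK : eta * K <= e / 2.
  have : eta <= e / (2 * K) by rewrite ge_min lexx orbT.
  move=> h; apply: (@le_trans _ _ (e / (2 * K) * K)); first by rewrite ler_pM2r.
  rewrite le_eqVlt; apply/orP; left; apply/eqP; field; exact: lt0r_neq0.
exists K, eta, (Num.max x1 (w1 * K)); split => //.
- exact: le_trans kK.
- by rewrite eta0.
- by rewrite le_max x11.
move=> x N; rewrite ge_max => /andP[x1x wx] NA.
have x0 : 0 < x by clear -x11 x1x; lra.
have Ax := A_gt0 rA (ltW x0).
have xK : w1 <= x / K by rewrite ler_pdivlMr.
have xKe : K / x = (x / K)^-1 by rewrite invf_div.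
have AKk : k * A (x / K) <= A x.
  have xK0 : 0 < x / K by rewrite divr_gt0.
  have /andP[_] := H x (x / K) x1x (ltac:(by rewrite mulrC)) (ltac:(by rewrite ler_piMr// ltW)).
  rewrite ler_pdivrMr// => h.
  rewrite -(@ler_pXn2r _ 2)// ?nnegrE ?mulr_ge0 ?(ltW Ax) ?(ltW kp) ?(ltW (A_gt0 rA (ltW xK0)))//.
  rewrite exprMn; apply: (@le_trans _ _ (k ^+ 2 * ((1 + 1) * (A x ^+ 2 / x) * (x / K)))).
    by rewrite ler_wpM2l// sqr_ge0.
  rewrite le_eqVlt; apply/orP; left; apply/eqP; rewrite /K; field.
  by rewrite !lt0r_neq0.
have s1 : \sum_(n < N) n%:R ^+ 2 * (K / x) <= e / 2 * (A x ^+ 3 / x).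
  apply: (@le_trans _ _ (\sum_(n < N) (eta * A x) ^+ 2 * (K / x))).
    apply: ler_sum => n _; apply: ler_wpM2r; first by rewrite divr_ge0 ?ltW.
    rewrite lerXn2r ?nnegrE ?ler0n ?mulr_ge0 ?(ltW eta0) ?(ltW Ax)//.
    by apply: le_trans NA; rewrite ler_nat ltnW.
  rewrite sumr_const card_ord -[leLHS]mulr_natr.
  apply: (@le_trans _ _ ((eta * A x) ^+ 2 * (K / x) * (eta * A x))).
    by rewrite ler_wpM2l// mulr_ge0 ?sqr_ge0// divr_ge0 ?ltW.
  have -> : (eta * A x) ^+ 2 * (K / x) * (eta * A x) = eta ^+ 2 * (eta * K) * (A x ^+ 3 / x) by ring.
  rewrite ler_pM2r; last by rewrite divr_gt0// exprn_gt0.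
  apply: (@le_trans _ _ (1 * (eta * K))); last by rewrite mul1r.
  by rewrite ler_pM2r ?mulr_gt0// expr_le1// ltW.
have s2 : \sum_(n < N) n%:R ^+ 2 * qint A c (K / x) T n <= e / 2 * (A x ^+ 3 / x).
  rewrite xKe; apply: le_trans (HC (x / K) N xK) _.
  have AK0 : 0 < A (x / K) by apply: (A_gt0 rA); rewrite ltW// divr_gt0.
  have -> : C * (A (x / K) ^+ 3 / (x / K)) = C * K / k ^+ 3 * ((k * A (x / K)) ^+ 3 / x).
    by field; rewrite !lt0r_neq0.
  apply: ler_pM.
  - by rewrite divr_ge0 ?mulr_ge0 ?exprn_ge0 ?(ltW C0) ?(ltW K0p) ?(ltW kp).
  - by rewrite divr_ge0 ?exprn_ge0 ?mulr_ge0 ?(ltW kp) ?(ltW x0) ?(ltW AK0).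
  - have -> : C * K / k ^+ 3 = 2 * C / k by rewrite /K; field; exact: lt0r_neq0.
    by rewrite ler_pdivrMr//; move: kC; clear; lra.
  - rewrite ler_pM2r ?invr_gt0//.
    by rewrite lerXn2r ?nnegrE ?mulr_ge0 ?(ltW kp) ?(ltW AK0) ?(ltW Ax).
rewrite (eq_bigr (fun n : 'I_N => n%:R ^+ 2 * (K / x) + n%:R ^+ 2 * qint A c (K / x) T n)); last first.
  by move=> n _; rewrite mulrDr.
rewrite big_split /=; have -> : e * (A x ^+ 3 / x) = e / 2 * (A x ^+ 3 / x) + e / 2 * (A x ^+ 3 / x) by field; exact: lt0r_neq0.
exact: lerD.
Qed.

End fourier_sums.

(** * The integrated tail *)

Section integrated_tail.
Context {R : realType}.
Implicit Types (F : probability (measurableTypeR R) R) (A : R -> R).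

(* 1/A, continued to the left of 0 by a constant. *)
Definition iA A (s : R) : R := (A (Num.max s 0))^-1.

Lemma bm_iA A (rA : rv_half A) : bm (iA A).
Proof.
have A0 := A_gt0 rA (lexx 0).
have m0 (s : R) : 0 <= Num.max s 0 by rewrite le_max lexx orbT.
apply: (@bm_nonincreasing _ _ (A 0)^-1) => [x y xy|x].
  rewrite /iA lef_pV2 ?posrE ?(A_gt0 rA)//; apply: (A_le rA) => //.
  by rewrite ge_max !le_max xy lexx orbT.
rewrite /iA ger0_norm ?invr_ge0 ?(ltW (A_gt0 rA _))//.
by rewrite lef_pV2 ?posrE ?(A_gt0 rA)//; exact: (A_le rA).
Qed.

Lemma iA_ge0 A (rA : rv_half A) s : 0 <= iA A s.
Proof. by rewrite /iA invr_ge0 ltW// (A_gt0 rA)// le_max lexx orbT. Qed.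

Lemma iAE A s : 0 <= s -> iA A s = (A s)^-1.
Proof. by rewrite /iA => /max_idPl ->. Qed.

(** Karamata's theorem for 1/A: the derivative of [s / A s] is about half of [1 / A s], whence the
    constant 2. *)
Lemma LI_iA A (rA : rv_half A) (e : R) : 0 < e -> e <= 1 -> exists2 x1 : R, 1 <= x1 &
  forall x : R, x1 <= x -> (2 - e) * (x / A x) <= LI 0 x (iA A) <= (2 + e) * (x / A x).
Proof.
move=> e0 e1; pose e' := e / 10.
have e'0 : 0 < e' by rewrite /e' divr_gt0.
have e'1 : e' <= 1/10 by rewrite /e'; lra.
have [s0 s01 H] := A_der rA e'0.
have s00 : 0 < s0 by lra.
have A0 := A_gt0 rA (lexx 0).
have As0 := A_gt0 rA (ltW s00).
pose M := s0 / A 0 + s0 / A s0.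
have [x1 x11 HL] := A_large rA (M / e').
exists (Num.max s0 x1) => [|x]; first by rewrite le_max s01.
rewrite ge_max => /andP[sx x1x].
have x0 : 0 < x by clear -x11 x1x; lra.
have Ax := A_gt0 rA (ltW x0).
have [_ hM _] := HL x x1x.
have hM' : M <= e' * (x / A x) by rewrite mulrC -ler_pdivrMr.
have bi := bm_iA rA.
have dA s : s0 <= s -> is_derive s 1 A (derive1 A s).
  by move=> /H[d _]; rewrite derive1E; exact/derivableP.
pose P s := s / A s.
pose dP s := (A s)^-1 - s * (A s)^-2 * derive1 A s.
have dPP s : s0 <= s -> is_derive s 1 P (dP s).
  move=> ss; have h1 := dA s ss; have As : A s != 0 by rewrite gt_eqF// (A_gt0 rA)//; clear -s00 ss; lra.
  have h2 := is_deriveV As h1.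
  have := is_deriveM (is_derive_id s (1 : R)) h2.
  move=> h; apply: is_derive_eq.
  by rewrite /GRing.scale /= /dP; ring.
have key s : s0 <= s -> (2^-1 - e') * (A s)^-1 <= dP s <= (2^-1 + e') * (A s)^-1.
  move=> ss; have [_ /andP[h1 h2]] := H s ss.
  have s'0 : 0 < s by clear -s00 ss; lra.
  have As := A_gt0 rA (ltW s'0).
  have w0 : 0 < s * (A s)^-2 by rewrite mulr_gt0// invr_gt0 exprn_gt0.
  have e2 c : s * (A s)^-2 * (c * (A s / s)) = c * (A s)^-1 by field; rewrite !lt0r_neq0.
  have := ler_wpM2l (ltW w0) h1; have := ler_wpM2l (ltW w0) h2; rewrite !e2 /dP.
  move: (s * _ * _) ((A s)^-1) => u v; clear; rewrite !mulrBl !mulrDl => h1 h2.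
  by apply/andP; split; lra.
have cP : {within `[s0, x], continuous P}.
  apply: derivable_within_continuous => s; rewrite in_itv/= => /andP[ss _].
  by have h := dPP s ss; exact: ex_derive.
have ci t : s0 < t < x -> {for t, continuous (iA A)}.
  move=> stx; apply: (@near_eq_continuous _ _ (fun s => (A s)^-1) s0 x) => //.
    by move=> y /andP[sy _]; rewrite iAE//; lra.
  have /andP[st _] := stx; have h := dA t (ltW st).
  apply: cvgV; first by rewrite gt_eqF// (A_gt0 rA)//; clear -s00 st; lra.
  by apply/differentiable_continuous/derivable1_diffP; exact: ex_derive.
have up : (2^-1 - e') * LI s0 x (iA A) <= P x - P s0.
  rewrite -LIZ//; apply: (LI_le_primitive (dP := dP)) => //.
  - exact: bmZ.
  - by move=> t tt; apply: cvgM; [exact: cvg_cst|exact: ci].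
  - by move=> t /andP[st _]; apply: dPP; exact: ltW.
  - by move=> t /andP[st _]; rewrite iAE; [case/andP: (key t (ltW st))|lra].
have lo : P x - P s0 <= (2^-1 + e') * LI s0 x (iA A).
  rewrite -LIZ//; apply: (LI_ge_primitive (dP := dP)) => //.
  - exact: bmZ.
  - by move=> t tt; apply: cvgM; [exact: cvg_cst|exact: ci].
  - by move=> t /andP[st _]; apply: dPP; exact: ltW.
  - by move=> t /andP[st _]; rewrite iAE; [case/andP: (key t (ltW st))|lra].
have i0 : 0 <= LI 0 s0 (iA A) by apply: LI_ge0 => t _; exact: iA_ge0.
have i1 : LI 0 s0 (iA A) <= s0 / A 0.
  apply: (@le_trans _ _ (LI 0 s0 (fun=> (A 0)^-1))).
    apply: LI_le => //; first exact: bm_cst.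
    move=> t /andP[t0 _]; rewrite iAE// lef_pV2 ?posrE ?(A_gt0 rA)//; exact: (A_le rA).
  by rewrite LI_cst ?subr0 ?[_ * s0]mulrC// ltW.
have Is : LI 0 x (iA A) = LI 0 s0 (iA A) + LI s0 x (iA A).
  by apply: LI_split => //; exact: ltW.
have Ps : 0 < P s0 by rewrite /P divr_gt0.
have Px : 0 < P x by rewrite /P divr_gt0.
have M1 : s0 / A 0 + P s0 <= e' * P x by exact: hM'.
have i2 : 0 <= LI s0 x (iA A) by apply: LI_ge0 => t _; exact: iA_ge0.
rewrite Is -/(P x).
have -> : e = 10 * e' by rewrite /e'; field.
move: (LI 0 s0 _) (LI s0 x _) (P x) (P s0) (s0 / A 0) up lo i0 i1 Ps Px M1 i2 => I0 I1 u u0 m up lo i0 i1 Ps Px M1 i2.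
have p1 : 0 <= e' * u by rewrite mulr_ge0// ltW.
have p2 : 0 <= e' * e' by rewrite mulr_ge0// ltW.
clear -e'0 e'1 up lo i0 i1 Ps Px M1 i2 p1; apply/andP; split.
  rewrite -(ler_pM2l (ltac:(clear -e'0; lra) : 0 < 2^-1 + e')); nra.
rewrite -(ler_pM2l (ltac:(clear -e'1; lra) : 0 < 2^-1 - e')); nra.
Qed.

Lemma bm_tl F : bm (tl F).
Proof.
apply: (@bm_nonincreasing _ _ 1) => [x y xy|x]; first exact: tl_mono.
by rewrite ger0_norm ?tl_ge0// tl_le1.
Qed.

(** The constant is 1 because the tail of the lazy law is half of 1/A and the integral of 1/A is
    twice x/A. *)
Lemma tau_asymp F A (e : R) : half_tail F A -> 0 < e -> e <= 1 -> exists2 x1 : R, 1 <= x1 &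
  forall x : R, x1 <= x -> (1 - e) * (x / A x) <= LI 0 x (tl F) <= (1 + e) * (x / A x).
Proof.
move=> [rA F0 tA] e0 e1; pose e' := e / 10.
have e'0 : 0 < e' by rewrite /e' divr_gt0.
have e'1 : e' <= 1/10 by rewrite /e'; lra.
have [x1 x11 H1] := LI_iA rA e'0 (ltac:(lra)).
have [x2 x21 H2] := tA e' e'0.
have A0 := A_gt0 rA (lexx 0).
have [x3 x31 H3] := A_large rA ((x2 + x2 / A 0) / e').
exists (Num.max (Num.max x1 x2) x3) => [|x]; first by rewrite !le_max x11.
rewrite !ge_max -andbA => /and3P[x1x x2x x3x].
have [_ hM _] := H3 x x3x; rewrite ler_pdivrMr// in hM.
have /andP[h1 h2] := H1 x x1x.
have bi := bm_iA rA; have bt := bm_tl F.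
have x20 : 0 <= x2 by clear -x21; lra.
have x0 : 0 < x by clear -x31 x3x; lra.
have x2A : 0 <= x2 / A 0 by rewrite divr_ge0// ltW.
have tS : LI 0 x (tl F) = LI 0 x2 (tl F) + LI x2 x (tl F) by exact: LI_split.
have aS : LI 0 x (iA A) = LI 0 x2 (iA A) + LI x2 x (iA A) by exact: LI_split.
have t0 : 0 <= LI 0 x2 (tl F) by apply: LI_ge0 => s _; exact: tl_ge0.
have t1 : LI 0 x2 (tl F) <= x2.
  apply: (@le_trans _ _ (LI 0 x2 (fun=> 1))); last by rewrite LI_cst ?subr0 ?mul1r.
  by apply: LI_le => //; [exact: bm_cst|move=> s _; exact: tl_le1].
have a0 : 0 <= LI 0 x2 (iA A) by apply: LI_ge0 => s _; exact: iA_ge0.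
have a1 : LI 0 x2 (iA A) <= x2 / A 0.
  have <- : LI 0 x2 (fun=> (A 0)^-1) = x2 / A 0 by rewrite LI_cst ?subr0 // mulrC.
  apply: LI_le => //; first exact: bm_cst.
  move=> s /andP[s0 _]; rewrite iAE// lef_pV2 ?posrE ?(A_gt0 rA)//; exact: (A_le rA).
have up' : LI x2 x (tl F) <= (2^-1 + e') * LI x2 x (iA A).
  rewrite -LIZ//; apply: LI_le => //; first exact: bmZ.
  move=> s /andP[xs _]; have s0 : 0 <= s by clear -xs x20; lra.
  by rewrite iAE// ler_pdivlMr ?(A_gt0 rA)//; case/andP: (H2 s xs).
have lo' : (2^-1 - e') * LI x2 x (iA A) <= LI x2 x (tl F).
  rewrite -LIZ//; apply: LI_le => //; first exact: bmZ.
  move=> s /andP[xs _]; have s0 : 0 <= s by clear -xs x20; lra.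
  by rewrite iAE// ler_pdivrMr ?(A_gt0 rA)//; case/andP: (H2 s xs).
have up : LI 0 x (tl F) <= (2^-1 + e') * LI 0 x (iA A) + x2.
  rewrite tS aS; move: (LI 0 x2 (iA A)) (LI x2 x (iA A)) a0 up' => a b a0 up'.
  have := mulr_ge0 (ltW e'0) a0; clear -t1 a0 up'; lra.
have lo : (2^-1 - e') * LI 0 x (iA A) - x2 / A 0 <= LI 0 x (tl F).
  rewrite tS aS; move: (LI 0 x2 (iA A)) (LI x2 x (iA A)) (x2 / A 0) a0 a1 lo' => a b m a0 a1 lo'.
  have := mulr_ge0 (ltW e'0) a0; clear -t0 a0 a1 lo'; lra.
have u0 : 0 < x / A x by rewrite divr_gt0// (A_gt0 rA)// ltW.
have -> : e = 10 * e' by rewrite /e'; field.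
have p1 : 0 <= e' * (x / A x) by rewrite mulr_ge0// ltW.
have p2 : e' * e' * (x / A x) <= 1/10 * (e' * (x / A x)) by rewrite -mulrA ler_wpM2r.
move: (x / A x) (LI 0 x (tl F)) (LI 0 x _) (x2 / A 0) h1 h2 hM up lo u0 p1 p2 x20 x2A => u t I m h1 h2 hM up lo u0 p1 p2 x20 m0.
have k1 := ler_wpM2l (ltac:(clear -e'1; lra) : 0 <= 2^-1 - e') h1.
have k2 := ler_wpM2l (ltac:(clear -e'0; lra) : 0 <= 2^-1 + e') h2.
by clear -k1 k2 h1 h2 hM up lo u0 p1 p2 x20 m0; apply/andP; split; nra.
Qed.

End integrated_tail.

(** * Walks without big jumps *)

Section layer_cake.
Context {R : realType}.
Implicit Types (F : probability (measurableTypeR R) R) (A p : R -> R).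

Lemma clamp_le_LI (b y : R) : 0 <= b -> clamp b y <= LI 0 b (fun s : R => (s < y)%R%:R).
Proof.
move=> b0; suff key z : z < clamp b y -> z <= LI 0 b (fun s : R => (s < y)%R%:R).
  rewrite leNgt; apply/negP => l; have [m1 m2] := midf_lt l.
  by have := key _ m2; rewrite leNgt m1.
move=> zc; have bi : bm (fun s : R => (s < y)%R%:R : R) by exact: bm_lt.
have [z0|z0] := leP z 0; first by apply: le_trans z0 _; exact: LI_ge0.
have [zb zy] : z < b /\ z < y.
  move: zc; rewrite /clamp lt_min lt_max => /andP[/orP[zy|z0'] zb] //.
  by have := lt_trans z0 z0'; rewrite ltxx.
apply: (@le_trans _ _ (LI 0 z (fun s : R => (s < y)%R%:R))); last first.
  by apply: LI_mono_r => //; exact: ltW.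
have <- : LI 0 z (fun=> 1) = z by rewrite LI_cst ?subr0 ?mul1r// ltW.
rewrite LI_cst ?subr0 ?mul1r ?(ltW z0)//.
apply: (@le_trans _ _ (LI 0 z (fun=> 1))); first by rewrite LI_cst ?subr0 ?mul1r// ltW.
apply: LI_le => //; first exact: bm_cst.
by move=> s /andP[_ sz]; rewrite (le_lt_trans sz zy).
Qed.

Lemma layer_cake F (b : R) : 0 <= b -> J (lazyF F) (clamp b) <= LI 0 b (tl F).
Proof.
move=> b0; rewrite LI_J; last exact: bm_tl.
have bp : bm (fun z : R * R => (z.2 < z.1)%R%:R : R).
  split; last by exists 1 => z; exact: normb.
  have h : measurable_fun [set: R * R] (fun z : R * R => (0 < z.1 - z.2)%R%:R : R).
    have [m _] := bm_gt (0 : R).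
    apply: (measurableT_comp m); exact: measurable_funB.
  by apply: eq_measurable_fun h => z _ /=; rewrite subr_gt0.
have <- := @J_fubini _ _ _ (measurableTypeR R) (measurableTypeR R) (lazyF F) (leb 0 b) _ bp.
apply: J_le => /=; [exact: bm_clamp| exact: (@bm_J _ _ _ (measurableTypeR R) (measurableTypeR R) (leb 0 b) _ bp) |].
move=> y; rewrite -LI_J; last exact: bm_lt.
exact: clamp_le_LI.
Qed.

End layer_cake.

Section tilting.
Context {R : realType} (mu : {finite_measure set (measurableTypeR R) -> \bar R}).
Implicit Types (f g p q : R -> R).

(** Exponential change of measure: [expR (lam * x)] splits over the steps and the remaining
    distance. As the steps are nonnegative, [pt] has to be the exponential weight on [0, +oo[ only,
    which leaves room for a bounded function. *)
Lemma iter_tilt (p pt f ft : R -> R) (lam : R) n (x : R) : mu `]-oo, (0:R)[%classic = 0%E ->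
  bm p -> bm pt -> bm f -> bm ft ->
  (forall y, 0 <= y -> pt y = expR (lam * y) * p y) ->
  (forall v, ft v = expR (lam * v) * f v) ->
  iter n (Op mu pt) ft x = expR (lam * x) * iter n (Op mu p) f x.
Proof.
move=> mu0 bp bpt bf bft Hp Hf; elim: n x => [|n IH] x; first by rewrite /= Hf.
rewrite !iterS {1}/Op /Op -JZ; last by apply: bm_Op_body => //; exact: bm_iter.
apply: (J_eq0 mu0).
- by apply: bm_Op_body => //; exact: bm_iter.
- by apply: bmZ; apply: bm_Op_body => //; exact: bm_iter.
move=> y y0; rewrite IH (Hp _ y0) mulrBr expRD expRN.
by have := expR_gt0 (lam * y); move: (expR (lam * y)) => u u0; field; rewrite gt_eqF.
Qed.

(** Either no step exceeds [b], or some step does: a union bound over its position, the operators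
    commuting so that it can be put first. *)
Lemma iter_union (b : R) f n x : bm f -> (forall y, 0 <= f y) ->
  iter n (Op mu (fun=> 1)) f x <= iter n (Op mu (fun y => (y <= b)%R%:R)) f x +
   n%:R * Op mu (fun y => (b < y)%R%:R) (iter n.-1 (Op mu (fun=> 1)) f) x.
Proof.
move=> bf f0.
pose q := fun _ : R => (1 : R); pose q1 := fun y : R => (y <= b)%R%:R : R.
pose q2 := fun y : R => (b < y)%R%:R : R.
rewrite -/q -/q1 -/q2.
have bq : bm q by exact: bm_cst.
have b1 : bm q1 by exact: bm_le.
have b2 : bm q2 by exact: bm_gt.
have p1 y : 0 <= q1 y by [].
have p2 y : 0 <= q2 y by [].
have p0 y : 0 <= q y by rewrite /q.
have qE g y : bm g -> Op mu q g y = Op mu q1 g y + Op mu q2 g y.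
  move=> bg; have /(congr1 (fun k => k y)) <- := OpDp mu b1 b2 bg.
  congr (Op mu _ g y); apply/funext => z; rewrite /q /q1 /q2 ltNge.
  by case: (z <= b); rewrite /= ?addr0 ?add0r.
elim: n x => [|n IH] x; first by rewrite /= mul0r addr0.
have bi k : bm (iter k (Op mu q) f) by exact: bm_iter.
have bh k : bm (Op mu q2 (iter k (Op mu q) f)) by exact: bm_Op.
rewrite iterS qE//.
have h1 : Op mu q1 (iter n (Op mu q) f) x <= iter n.+1 (Op mu q1) f x +
    n%:R * Op mu q1 (Op mu q2 (iter n.-1 (Op mu q) f)) x.
  apply: (@le_trans _ _ (Op mu q1 (fun x => iter n (Op mu q1) f x +
     n%:R * Op mu q2 (iter n.-1 (Op mu q) f) x) x)).
    by apply: Op_le => //; apply: bmD; [exact: bm_iter|exact: bmZ].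
  by rewrite OpD//; [rewrite OpZ|exact: bm_iter|exact: bmZ].
apply: le_trans (lerD h1 (lexx _)) _; rewrite -addrA lerD2l.
case: n {IH h1} => [|n]; first by rewrite mul0r add0r mul1r.
rewrite [n.+1.-1]/= [n.+2.-1]/= -[in leRHS](natr1 n.+1) mulrDl mul1r lerD2r.
apply: ler_wpM2l; first exact: ler0n.
rewrite (Op_comm mu mu b1 b2 (bi n)); apply: Op_le => //; first exact: bm_Op.
move=> y; rewrite iterS qE// lerDl; apply: Op_ge0 => // z; exact: iter_ge0.
Qed.

End tilting.

Section no_big_jump.
Context {R : realType}.
Implicit Types (F : probability (measurableTypeR R) R) (A p : R -> R).

Lemma dec_lower_near F A (h : R) : half_tail F A -> 0 < h ->
  exists T c0 : R, [/\ 0 < T, T * h <= 2^-1, 0 < c0 &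
    forall th : R, 0 < th <= T -> c0 / A th^-1 <= dec F th].
Proof.
move=> hF h0; have [c0 [z0 [c00 z01 H]]] := dec_near0 hF.
have z00 : 0 < z0 by lra.
exists (Num.min z0^-1 (2^-1 / h)), c0; split => //.
- by rewrite lt_min invr_gt0 z00 divr_gt0.
- by rewrite -ler_pdivlMr// ge_min lexx orbT.
move=> th /andP[th0]; rewrite le_min => /andP[h1 _].
rewrite -[X in dec F X]invrK; apply: H.
by rewrite -[leLHS]invrK lef_pV2 ?posrE ?invr_gt0.
Qed.

(** From e^u <= 1 + u e^u, which is [1 - u <= expR (- u)] multiplied by e^u, and from the bound of
    the truncated mean by the integrated tail. *)
Lemma exp_tilt_mass F (b lam : R) : F `]-oo, 0[%classic = 0%E -> 0 <= b -> 0 <= lam ->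
  J (lazyF F) (fun y => expR (lam * clamp b y) * (y <= b)%R%:R) <=
  1 + lam * expR (lam * b) * LI 0 b (tl F).
Proof.
move=> F0 b0 l0; have lc := layer_cake F b0.
apply: (@le_trans _ _ (J (lazyF F) (fun y => 1 + lam * expR (lam * b) * clamp b y))).
  apply: J_le => /=.
  - by apply: bmM; [apply: bm_expR; apply: bmZ; exact: bm_clamp|exact: bm_le].
  - by apply: bmD; [exact: bm_cst|apply: bmZ; exact: bm_clamp].
  move=> y; have /andP[c0 cb] := clamp_bounds y b0.
  set u := clamp b y in c0 cb *.
  apply: (@le_trans _ _ (expR (lam * u))).
    by rewrite ler_piMr ?expR_ge0//; case: (y <= b).
  have e1 : expR (lam * u) <= 1 + lam * u * expR (lam * u).
    have := expR_ge1Dx (- (lam * u)); rewrite expRN => e1.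
    have := ler_wpM2r (expR_ge0 (lam * u)) e1; rewrite mulVf ?gt_eqF ?expR_gt0//.
    lra.
  apply: le_trans e1 _; rewrite lerD2l mulrAC; apply: ler_wpM2r => //.
  by apply: ler_wpM2l => //; rewrite ler_expR ler_wpM2l.
rewrite JD ?JZ ?J_lazy1; [|exact: bm_clamp|exact: bm_cst|by apply: bmZ; exact: bm_clamp].
by rewrite lerD2l ler_wpM2l// mulr_ge0// expR_ge0.
Qed.


Lemma one_le_expR (x : R) : (1 <= expR x) = (0 <= x).
Proof. by rewrite -expR0 ler_expR. Qed.

(** A jump beyond x has probability at least [(1/4) / A x], and there the weight is at most 1/e. *)
Lemma exp_decay_weight F A : half_tail F A -> exists a x1 : R, [/\ 0 < a, 1 <= x1 &
  forall x : R, x1 <= x -> J (lazyF F) (fun y => expR (- (x^-1 * Num.max y 0))) <= 1 - a / A x].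
Proof.
move=> hF; have [x1 x11 H] := ht_tail hF (ltac:(lra) : 0 < 1/4 :> R).
have [k [k0 kE]] : exists k : R, 0 < k /\ k = 1 - expR (-1).
  by exists (1 - expR (-1)); split => //; rewrite subr_gt0 expR_lt1 ltrN10.
exists (k / 4), x1; split => //; first by rewrite divr_gt0.
move=> x xx; have x0 : 0 < x by lra.
have bq : bm (fun y : R => k * (x < y)%R%:R) by apply: bmZ; exact: bm_gt.
apply: (@le_trans _ _ (J (lazyF F) (fun y => 1 - k * (x < y)%R%:R))).
  apply: J_le.
  - apply: (@bm_nonincreasing _ _ 1) => [y z yz|y].
      rewrite ler_expR lerN2 ler_wpM2l ?invr_ge0 ?(ltW x0)//.
      by rewrite ge_max !le_max yz lexx orbT.
    by rewrite ger0_norm ?expR_ge0// expR_le1 oppr_le0 mulr_ge0 ?invr_ge0 ?(ltW x0)// le_max lexx orbT.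
  - by apply: bmB => //; exact: bm_cst.
  move=> y; have [xy|xy] := ltP x y; last first.
    by rewrite mulr0 subr0 expR_le1 oppr_le0 mulr_ge0 ?invr_ge0 ?(ltW x0)// le_max lexx orbT.
  rewrite mulr1 kE opprB addrC subrK ler_expR lerN2 mulrC ler_pdivlMr// mul1r.
  by rewrite le_max (ltW xy).
rewrite JB ?J_lazy1; [|exact: bm_cst|by []].
rewrite JZ; last exact: bm_gt.
rewrite lerD2l lerN2 -/(tl F x).
have Ax := A_gt0 (ht_rv hF) (ltW x0).
have /andP[h1 _] := H x xx.
rewrite -mulrA; apply: ler_wpM2l; first exact: ltW.
by rewrite ler_pdivrMr//; lra.
Qed.

Lemma bm_exp_weight (x : R) : 0 < x -> bm (fun y : R => expR (- (x^-1 * Num.max y 0))).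
Proof.
move=> x0; apply: (@bm_nonincreasing _ _ 1) => [y z yz|y].
  rewrite ler_expR lerN2 ler_wpM2l ?invr_ge0 ?(ltW x0)//.
  by rewrite ge_max !le_max yz lexx orbT.
by rewrite ger0_norm ?expR_ge0// expR_le1 oppr_le0 mulr_ge0 ?invr_ge0 ?(ltW x0)// le_max lexx orbT.
Qed.

Lemma tilted_chi (lam h v : R) : 0 < h ->
  expR (lam * clamp h v) * chi h v = expR (lam * v) * chi h v.
Proof.
move=> h0; rewrite /chi; case: (boolP (0 <= v < h)) => [/andP[v0 vh]|]; last by rewrite !mulr0.
by rewrite clampE// v0 ltW.
Qed.

(** Three uses of [concentration]. The weight 1 gives the first bound. For steps up to x/4 the
    weight is [expR (lam * y)] with [lam = 4 s / x] and [expR (2 s) = A x / n]: it gains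
    [expR (lam * x) = (A x / n) ^ 2], while its mass stays below [1 + 1/n], whose n-th power is at
    most e. The weight [expR (- y / x)] has mass at most [1 - a / A x], which produces the
    exponential decay for large n. *)
Lemma local_bounds F A (h : R) : half_tail F A -> 0 < h ->
  exists T C c K0 a d : R, [/\ [/\ 0 < T, 0 < C & 0 < c], [/\ 0 < K0, 0 < a & 0 < d] &
  forall K : R, K0 <= K -> exists2 x1 : R, 1 <= x1 & forall x : R, x1 <= x -> forall n : nat,
    let B := K / x + qint A c (K / x) T n in
    [/\ forall z, iter n (Op (lazyF F) (fun=> 1)) (chi h) z <= C * B,
        n%:R <= d * A x ->
          iter n (Op (lazyF F) (fun y => (y <= x / 4)%R%:R)) (chi h) x <= C * (n%:R / A x) ^+ 2 * B &
        forall z, z <= x -> iter n (Op (lazyF F) (fun=> 1)) (chi h) z <=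
          C * expR (- (a * n%:R * (A x)^-1)) * B]].
Proof.
move=> hF h0; have [rA F0 tA] := hF.
have mu0 := lazy_neg F0.
have [T [c0 [T0 Th c00 Hc]]] := dec_lower_near hF h0.
have [C [c [K0 [C0 c1 K00 conc]]]] := concentration hF h0 T0 Th c00 Hc
  (ltac:(clear; lra) : 0 < 4^-1 :> R) (expR_gt0 (-1)).
have [a [xa [a0 xa1 Ha]]] := exp_decay_weight hF.
have [xt xt1 Ht] := tau_asymp hF (ltac:(clear; lra) : 0 < 1 :> R) (lexx _).
have [xl xl1 Hl] := A_large rA (2 * h).
have e21 : 1 <= expR 2 :> R by rewrite one_le_expR; clear; lra.
(* [expR 2] covers two factors e in the second bound, one from the n-th power of the mass, one from
   the tilt inside the window of length h. The range [n <= expR (-32) * A x] ensures [s >= 16]. *)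
exists T, (C * expR 2), c, K0, a, (expR (-32)); split.
- by split => //; rewrite mulr_gt0// expR_gt0.
- by split => //; exact: expR_gt0.
move=> K KK; have [x1 x11 H] := conc K KK.
exists (Num.max (Num.max (Num.max x1 h) xa) (Num.max xt xl)); first by rewrite !le_max x11.
move=> x; rewrite !ge_max => /andP[/andP[/andP[x1x hx] xax] /andP[xtx xlx]] n.
have x0 : 0 < x by clear -x11 x1x; lra.
have Ax := A_gt0 rA (ltW x0).
have Kx : 0 <= K / x by rewrite divr_ge0//; clear -K00 KK x11 x1x; lra.
move=> B; have B0 : 0 <= B by rewrite addr_ge0// qint_ge0.
have {}H := H x x1x.
have bc := bm_chi h.
have b1 : bm (fun _ : R => 1 : R) by exact: bm_cst.
have e11 : expR (-1) <= 1 :> R by rewrite expR_le1; clear; lra.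
split.
- move=> z; have := H (fun=> 1) b1 (fun=> ler01) erefl (fun _ _ => e11).
  rewrite J_lazy1 => /(_ ltac:(clear; lra) n z); rewrite expr1n mulr1 => /le_trans; apply.
  by rewrite ler_wpM2r// ler_peMr// ltW.
- move=> nA; case: n @B B0 nA => [|n] B B0 nA.
    rewrite /= /chi [x < h]ltNge hx andbF; apply: mulr_ge0 => //; apply: mulr_ge0; last exact: sqr_ge0.
    by rewrite mulr_ge0 ?expR_ge0// ltW.
  set N : R := n.+1%:R; have N0 : 0 < N by rewrite ltr0n.
  (* The excess mass is at most [N^-1 * 8 * s * expR (- s)], and this is at most [N^-1], because
     [s ^ 2 * expR (- s) <= 2] and [s >= 16]. *)
  pose s := 2^-1 * ln (A x / N).
  have AN : 0 < A x / N by rewrite divr_gt0.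
  have es k : expR (k * s) = expR (k / 2 * ln (A x / N)) by rewrite /s mulrA.
  have e2s : expR (2 * s) = A x / N by rewrite es divff ?pnatr_eq0// mul1r lnK ?posrE.
  have s16 : 16 <= s.
    have : expR 32 <= expR (2 * s).
      rewrite e2s ler_pdivlMr// mulrC -ler_pdivlMr ?expR_gt0// -expRN mulrC.
      exact: nA.
    by rewrite ler_expR; clear; lra.
  have s0 : 0 <= s by clear -s16; lra.
  pose lam := 4 * s / x; pose b := x / 4.
  have l0 : 0 <= lam by apply: divr_ge0; [exact: mulr_ge0|exact: ltW].
  have b0 : 0 <= b by apply: divr_ge0 => //; exact: ltW.
  have lb : lam * b = s by rewrite /lam /b; field; rewrite gt_eqF.
  pose pt := fun y : R => expR (lam * clamp b y) * (y <= b)%R%:R.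
  have bpt : bm pt.
    by apply: bmM; [apply: bm_expR; apply: bmZ; exact: bm_clamp|exact: bm_le].
  have pt0 y : 0 <= pt y by rewrite mulr_ge0// expR_ge0.
  have m1 : J (lazyF F) pt <= 1 + N^-1.
    apply: le_trans (exp_tilt_mass F0 b0 l0) _; rewrite lerD2l lb.
    have /andP[_ ht] := Ht x xtx.
    have ht' : LI 0 b (tl F) <= 2 * (x / A x).
      apply: (@le_trans _ _ (LI 0 x (tl F))); last by clear -ht; lra.
      apply: LI_mono_r; [exact: bm_tl|by rewrite /b; (clear -x0; lra)|exact: tl_ge0].
    apply: le_trans (ler_wpM2l (mulr_ge0 l0 (expR_ge0 s)) ht') _.
    have -> : lam * expR s * (2 * (x / A x)) = 8 * s * expR s * (A x)^-1.
      by rewrite /lam; field; rewrite !gt_eqF.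
    have AE : (A x)^-1 = N^-1 * expR (- s) * expR (- s).
      rewrite -mulrA -expRD; have -> : - s - s = - (2 * s) by ring.
      by rewrite expRN e2s; field; rewrite !gt_eqF.
    rewrite AE; have -> : 8 * s * expR s * (N^-1 * expR (- s) * expR (- s)) =
       N^-1 * (8 * (s * expR (- s))).
      by rewrite expRN; have := expR_gt0 s; move: (expR s) => u u0; field; rewrite !gt_eqF.
    rewrite ler_piMr ?invr_ge0 ?(ltW N0)//.
    have := @pow_exp _ 2 s s0; rewrite (_ : 2`!%:R = 2)// => pe.
    have := ler_wpM2r (mulr_ge0 s0 (expR_ge0 (- s))) s16.
    have pe' : s * (s * expR (- s)) <= 2 by rewrite mulrA.
    move: (s * expR (- s)) pe' => v; clear; move: (s * v) => u; lra.
  have N1 : N^-1 <= 1 by rewrite invf_le1// ler1n.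
  have m0 : 0 <= J (lazyF F) pt by exact: J_ge0.
  have pt1 y : 0 <= y <= 4^-1 * x -> expR (-1) <= pt y.
    move=> /andP[y0]; rewrite [4^-1 * x]mulrC -/b => yb; rewrite /pt yb mulr1.
    apply: le_trans e11 _; rewrite one_le_expR mulr_ge0//.
    by case/andP: (clamp_bounds y b0).
  have pt00 : pt 0 = 1.
    by rewrite /pt clampE ?lexx ?b0// mulr0 expR0 mul1r.
  have m2 : J (lazyF F) pt <= 2 by apply: le_trans m1 _; rewrite (_ : 2 = 1 + 1 :> R)// lerD2l.
  have hc := H pt bpt pt0 pt00 pt1 m2 n.+1 x.
  have mn : J (lazyF F) pt ^+ n.+1 <= expR 1.
    apply: (@le_trans _ _ ((expR N^-1) ^+ n.+1)).
      rewrite lerXn2r ?nnegrE ?expR_ge0//; apply: le_trans m1 _; exact: expR_ge1Dx.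
    by rewrite -expRM_natr -/N mulVf ?gt_eqF.
  pose ft := fun v : R => expR (lam * clamp h v) * chi h v.
  have bft : bm ft.
    by apply: bmM => //; apply: bm_expR; apply: bmZ; apply: bm_clamp; exact: ltW.
  have := @iter_tilt _ (lazyF F) (fun y => (y <= b)%R%:R) pt (chi h) ft lam n.+1 x mu0
    (bm_le b) bpt bc bft.
  have hp y : 0 <= y -> pt y = expR (lam * y) * (y <= b)%R%:R.
    move=> y0; rewrite /pt; case: (boolP (y <= b)) => yb; last by rewrite !mulr0.
    by rewrite clampE// y0.
  move=> /(_ hp (fun v => tilted_chi lam v h0)) tE.
  have s2A : 2 * s <= A x.
    have := expR_ge1Dx (2 * s); rewrite e2s.
    have : A x / N <= A x by rewrite ler_pdivrMr// ler_peMr ?ler1n// ltW.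
    by move=> h1 h2; apply: le_trans h1; apply: le_trans h2; rewrite lerDr.
  have lh : lam * h <= 1.
    have [_ hl _] := Hl x xlx.
    rewrite /lam mulrAC ler_pdivrMr// mul1r.
    move: hl; rewrite ler_pdivlMr// => hl; apply: le_trans hl.
    have -> : 4 * s * h = 2 * h * (2 * s) by ring.
    by apply: ler_wpM2l => //; rewrite mulr_ge0// ltW.
  have up : iter n.+1 (Op (lazyF F) pt) ft x <= expR 1 * iter n.+1 (Op (lazyF F) pt) (chi h) x.
    have /(congr1 (fun k => k x)) <- := iterZ (lazyF F) (expR 1) n.+1 bpt bc.
    apply: iter_le => //; first exact: bmZ.
    move=> y; rewrite /ft ler_wpM2r ?chi_ge0// ler_expR; apply: le_trans lh.
    by apply: ler_wpM2l => //; case/andP: (clamp_bounds y (ltW h0)).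
  have e4 : expR (lam * x) = (A x / N) ^+ 2.
    have -> : lam * x = 2 * s + 2 * s by rewrite /lam; field; rewrite gt_eqF.
    by rewrite expRD e2s expr2.
  rewrite tE e4 in up.
  have -> : C * expR 2 * (N / A x) ^+ 2 * B = (A x / N) ^- 2 * (expR 1 * (C * expR 1 * B)).
    have -> : expR 2 = expR 1 * expR 1 :> R by rewrite -expRD.
    by field; rewrite !gt_eqF.
  rewrite -ler_pdivrMl ?invr_gt0 ?exprn_gt0// invrK.
  apply: le_trans up _; rewrite ler_wpM2l ?expR_ge0//.
  apply: le_trans hc _; apply: (ler_wpM2r B0).
  by rewrite ler_wpM2l// ltW.
- move=> z zx.
  pose pt := fun y : R => expR (- (x^-1 * Num.max y 0)).
  have bpt : bm pt by exact: bm_exp_weight.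
  have pt0 y : 0 <= pt y by rewrite expR_ge0.
  have xv : 0 < x^-1 by rewrite invr_gt0.
  have pt00 : pt 0 = 1 by rewrite /pt maxxx mulr0 oppr0 expR0.
  have pt1 y : 0 <= y <= 4^-1 * x -> expR (-1) <= pt y.
    move=> /andP[y0 yb]; rewrite ler_expR lerN2 mulrC ler_pdivrMr// mul1r ge_max (ltW x0) andbT; clear -x0 yb; lra.
  have mJ := Ha x xax.
  have aA : 0 < a / A x by rewrite divr_gt0.
  have m2 : J (lazyF F) pt <= 2 by apply: le_trans mJ _; clear -aA; lra.
  have hc := H pt bpt pt0 pt00 pt1 m2 n z.
  pose ft := fun v : R => expR (- x^-1 * clamp h v) * chi h v.
  have bft : bm ft.
    by apply: bmM => //; apply: bm_expR; apply: bmZ; apply: bm_clamp; exact: ltW.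
  have := @iter_tilt _ (lazyF F) (fun=> 1) pt (chi h) ft (- x^-1) n z mu0 b1 bpt bc bft.
  have hp y : 0 <= y -> pt y = expR (- x^-1 * y) * 1.
    by move=> y0; rewrite /pt mulr1 mulNr (max_idPl _).
  move=> /(_ hp (fun v => tilted_chi (- x^-1) v h0)) tE.
  have up : iter n (Op (lazyF F) pt) ft z <= iter n (Op (lazyF F) pt) (chi h) z.
    apply: iter_le => // y; rewrite /ft ler_piMl ?chi_ge0// expR_le1 mulNr oppr_le0.
    by rewrite mulr_ge0 ?(ltW xv)//; case/andP: (clamp_bounds y (ltW h0)).
  rewrite tE in up.
  have mn : J (lazyF F) pt ^+ n <= expR (- (a * n%:R * (A x)^-1)).
    have -> : - (a * n%:R * (A x)^-1) = (- (a / A x)) * n%:R by ring.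
    rewrite expRM_natr lerXn2r ?nnegrE ?expR_ge0//; first exact: J_ge0.
    by apply: le_trans mJ _; exact: expR_ge1Dx.
  have ez : expR (-1) <= expR (- x^-1 * z).
    by rewrite ler_expR mulNr lerN2 mulrC ler_pdivrMr// mul1r.
  have q0 : 0 <= iter n (Op (lazyF F) (fun=> 1)) (chi h) z.
    by apply: iter_ge0 => // y; exact: chi_ge0.
  have h1 : expR (-1) * iter n (Op (lazyF F) (fun=> 1)) (chi h) z <=
     C * expR (- (a * n%:R * (A x)^-1)) * B.
    apply: le_trans (ler_wpM2r q0 ez) _; apply: le_trans up _; apply: le_trans hc _.
    by rewrite ler_wpM2r// ler_wpM2l// ltW.
  have e1E : expR (-1) = (expR 1)^-1 :> R by rewrite expRN.
  move: h1; rewrite e1E ler_pdivrMl ?expR_gt0// => /le_trans; apply.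
  have -> : C * expR 2 * expR (- (a * n%:R * (A x)^-1)) * B =
            expR 2 * (C * expR (- (a * n%:R * (A x)^-1)) * B) by ring.
  apply: ler_wpM2r; first by rewrite !mulr_ge0 ?expR_ge0// ltW.
  by rewrite ler_expR ler1n.
Qed.

End no_big_jump.

(** * Small and large numbers of steps *)

Section step_counts.
Context {R : realType}.
Implicit Types (F : probability (measurableTypeR R) R) (A p f : R -> R).

Lemma A_scale A (rA : rv_half A) (d : R) : 0 < d -> d < 1 -> exists2 x1 : R, 1 <= x1 &
  forall x z : R, x1 <= x -> d * x <= z -> z <= x -> d / 2 * A x <= A z.
Proof.
move=> d0 d1; have [x1 x11 H] := ell_unif rA d0 d1 (ltac:(lra) : 0 < 2^-1 :> R).
exists x1 => // x z xx dz zx; have x0 : 0 < x by lra.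
have z0 : 0 < z by apply: lt_le_trans dz; exact: mulr_gt0.
have /andP[h _] := H x z xx dz zx.
have Ax := A_gt0 rA (ltW x0); have Az := A_gt0 rA (ltW z0).
rewrite -(ler_pXn2r (ltn0Sn 1)) ?nnegrE ?(ltW Az) ?mulr_ge0 ?divr_ge0 ?(ltW d0) ?(ltW Ax)//.
have h1 : d / 2 * A x ^+ 2 <= A z ^+ 2.
  have e2 : 1 - 2^-1 = 2^-1 :> R by field.
  have w0 : 0 <= 2^-1 * (A x ^+ 2 / x) by rewrite mulr_ge0 ?divr_ge0 ?sqr_ge0// ltW.
  rewrite e2 in h; have := le_trans (ler_wpM2r w0 dz) (ler_wpM2l (ltW z0) h).
  have -> : d * x * (2^-1 * (A x ^+ 2 / x)) = d / 2 * A x ^+ 2 by field; rewrite gt_eqF.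
  by have -> : z * (A z ^+ 2 / z) = A z ^+ 2 by field; rewrite gt_eqF.
apply: le_trans h1; rewrite exprMn ler_wpM2r ?sqr_ge0// expr2 ler_piMl//; lra.
Qed.

Lemma tl_scale F A (d : R) : half_tail F A -> 0 < d -> d < 1 -> exists C x1 : R,
  [/\ 0 < C, 1 <= x1 & forall x : R, x1 <= x -> tl F (d * x) <= C / A x].
Proof.
move=> hF d0 d1; have rA := ht_rv hF.
have [x1 x11 H] := A_scale rA d0 d1; have [C C0 HC] := tl_bound hF.
exists (C * (2 / d)), x1; split => //; first by rewrite mulr_gt0// divr_gt0.
move=> x xx; have x0 : 0 < x by lra.
have dx0 : 0 <= d * x by rewrite mulr_ge0// ltW.
apply: le_trans (HC _ dx0) _; rewrite -mulrA ler_wpM2l ?(ltW C0)//.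
have Ax := A_gt0 rA (ltW x0); have Az := A_gt0 rA dx0.
rewrite -[leRHS]invrK lef_pV2 ?posrE ?invr_gt0 ?divr_gt0//.
have -> : (2 / d / A x)^-1 = d / 2 * A x by field; rewrite !gt_eqF.
by apply: H => //; rewrite ler_piMl// ltW.
Qed.

(** A window of relative length k has tail increment O(k / A x): slow variation gives
    [(1 - k) * A x <= A z] at its left end, and the tail constants at both ends agree up to k. *)
Lemma tl_window F A (k : R) : half_tail F A -> 0 < k -> k <= 1/2 -> exists2 x1 : R, 1 <= x1 &
  forall x : R, x1 <= x -> tl F ((1 - k) * x) - tl F x <= 4 * k / A x.
Proof.
move=> hF k0 k1; have rA := ht_rv hF.
have [x1 x11 H] := ell_unif rA (ltac:(lra) : 0 < 1 - k) (ltac:(lra) : 1 - k < 1) k0.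
have [x2 x21 H2] := ht_tail hF k0.
exists (Num.max x1 (2 * x2)) => [|x]; first by rewrite le_max x11.
rewrite ge_max => /andP[xx1 xx2].
have x0 : 0 < x by lra.
set z := (1 - k) * x.
have zx : z <= x by rewrite /z ler_piMl//; lra.
have zx2 : x2 <= z.
  have : 2^-1 * x <= z by rewrite /z ler_wpM2r//; clear -k1 x0; lra.
  lra.
have z0 : 0 < z by lra.
have Ax := A_gt0 rA (ltW x0); have Az := A_gt0 rA (ltW z0).
have /andP[h _] := H x z xx1 (lexx _) zx.
have hA : (1 - k) * A x <= A z.
  rewrite -(ler_pXn2r (ltn0Sn 1)) ?nnegrE ?(ltW Az) ?mulr_ge0 ?(ltW Ax)//; last (clear -k1; lra).
  have := ler_wpM2r (ltW z0) h; rewrite mulfVK ?gt_eqF// /z => /(le_trans _); apply.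
  by rewrite le_eqVlt; apply/orP; left; apply/eqP; field; rewrite gt_eqF.
have /andP[_ hz] := H2 z zx2.
have /andP[hx _] := H2 x (ltac:(clear -xx2 x0; lra)).
have k1' : 0 < 1 - k by clear -k1; lra.
have hz1 : tl F z * ((1 - k) * A x) <= 2^-1 + k.
  by apply: le_trans hz; rewrite ler_wpM2l ?tl_ge0.
rewrite ler_pdivlMr// mulrBl -(ler_pM2l k1').
have -> : (1 - k) * (tl F z * A x - tl F x * A x) =
  tl F z * ((1 - k) * A x) - (1 - k) * (tl F x * A x) by ring.
have := ler_wpM2l (ltW k1') hx.
move: (tl F z * _) (tl F x * _) hz1 => u v hu hv.
have kk : k * k <= k * 2^-1 by rewrite ler_wpM2l//; clear -k0 k1; lra.
(clear -hu hv kk; lra).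
Qed.

Lemma Op_le_cst mu p f (M x : R) : bm p -> bm f -> (forall y, 0 <= p y) ->
  (forall y, f y <= M) -> Op mu p f x <= M * J mu p.
Proof.
move=> bp bf p0 fM; rewrite -JZ//; apply: J_le; [exact: bm_Op_body|exact: bmZ|].
by move=> y; rewrite mulrC ler_wpM2r.
Qed.

Definition Qn F (h : R) n x : R := iter n (Op (lazyF F) (fun=> 1)) (chi h) x.

Lemma Qn_ge0 F h n x : 0 <= Qn F h n x.
Proof. by apply: iter_ge0 => // y; exact: chi_ge0. Qed.

Lemma bm_Qn F h n : bm (Qn F h n).
Proof. by apply: bm_iter; [exact: bm_cst|exact: bm_chi]. Qed.

(** Both sums reduce to [S2_small]. Without a jump beyond x/4, the factor [(n / A x) ^+ 2] of
    [local_bounds] supplies the weight. With one, whose probability is O(1 / A x), the rest of the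
    walk is bounded uniformly in its position. *)
Lemma no_big_jump_sum F A (h e : R) : half_tail F A -> 0 < h -> 0 < e ->
  exists eta x1 : R, [/\ 0 < eta <= 1, 1 <= x1 & forall (x : R) (N : nat), x1 <= x ->
    N%:R <= eta * A x ->
    \sum_(n < N) iter n (Op (lazyF F) (fun y => (y <= x / 4)%R%:R)) (chi h) x <= e * (A x / x) /\
    \sum_(n < N) n%:R ^+ 2 * Op (lazyF F) (fun y => (x / 4 < y)%R%:R) (Qn F h n.-1) x <=
      e * (A x ^+ 2 / x)].
Proof.
move=> hF h0 e0; have rA := ht_rv hF.
have [T [C [c [K0 [a [d [[T0 C0 c0] [K00 a0 d0] H]]]]]]] := local_bounds hF h0.
have [C1 [x1 [C10 x11 H1]]] := tl_scale hF (ltac:(clear; lra) : 0 < 4^-1 :> R) (ltac:(clear; lra) : 4^-1 < 1 :> R).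
pose D := C + C1 * (4 * C); have D0 : 0 < D by rewrite addr_gt0// !mulr_gt0.
pose e' := e / (2 * D); have e'0 : 0 < e' by rewrite divr_gt0// mulr_gt0.
have [K [eta [x2 [K0K Kg /andP[eta0 eta1] x21 H2]]]] := S2_small rA T K0 c0 e'0.
have [x3 x31 H3] := H K K0K.
have [x4 x41 H4] := A_large rA (C1 / (e / 2)).
exists (Num.min eta d), (Num.max (Num.max x1 x2) (Num.max x3 x4)); split.
- by rewrite lt_min eta0 d0/= ge_min eta1.
- by rewrite !le_max x11.
move=> x N; rewrite !ge_max => /andP[/andP[xx1 xx2] /andP[xx3 xx4]] NA.
have x0 : 0 < x by clear -x41 xx4; lra.
have Ax := A_gt0 rA (ltW x0).
have N1 : N%:R <= eta * A x by apply: le_trans NA _; rewrite ler_wpM2r ?(ltW Ax)// ge_min lexx.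
have N2 : N%:R <= d * A x by apply: le_trans NA _; rewrite ler_wpM2r ?(ltW Ax)// ge_min lexx orbT.
pose B n := K / x + qint A c (K / x) T n.
have B0 n : 0 <= B n by rewrite addr_ge0 ?qint_ge0// divr_ge0// ltW.
have S := H2 x N xx2 N1; rewrite -/(B _) in S.
have S0 : 0 <= \sum_(n < N) n%:R ^+ 2 * B n by apply: sumr_ge0 => i _; rewrite mulr_ge0 ?sqr_ge0.
have De : D * e' = e / 2 by rewrite /e'; field; rewrite gt_eqF.
split.
  apply: (@le_trans _ _ (\sum_(n < N) C / A x ^+ 2 * (n%:R ^+ 2 * B n))).
    apply: ler_sum => n _; have [_ hn _] := H3 x xx3 n.
    apply: le_trans (hn _) _.
      by apply: le_trans N2; rewrite ler_nat ltnW.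
    by rewrite le_eqVlt; apply/orP; left; apply/eqP; rewrite -/(B n); field; rewrite gt_eqF.
  rewrite -mulr_sumr.
  have w0 : 0 <= C / A x ^+ 2 by rewrite divr_ge0 ?sqr_ge0// ltW.
  apply: le_trans (ler_wpM2l w0 S) _.
  have -> : C / A x ^+ 2 * (e' * (A x ^+ 3 / x)) = C * e' * (A x / x) by field; rewrite !gt_eqF.
  apply: ler_wpM2r; first by rewrite divr_ge0// ltW.
  apply: (@le_trans _ _ (D * e')); last by rewrite De; clear -e0; lra.
  by rewrite ler_wpM2r ?(ltW e'0)// lerDl !mulr_ge0// ltW.
have [_ _ hA] := H4 x xx4.
(* The index 1 is kept apart: there the walk after the jump is [chi h] itself, which [0 ^+ 2 * B 0]
   does not control. From 2 on, n is at most [2 * n.-1]. *)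
have Q1 (n : nat) z : n%:R ^+ 2 * Qn F h n.-1 z <= (n == 1)%N%:R + 4 * C * (n.-1%:R ^+ 2 * B n.-1).
  case: n => [|[|n]].
  - by rewrite expr0n/= !mul0r add0r mulr0.
  - by rewrite expr1n mul1r expr0n/= mul0r mulr0 addr0 chi_le1.
  rewrite [n.+2 == 1%N]/= add0r [n.+2.-1]/=.
  have [hn _ _] := H3 x xx3 n.+1.
  have -> : 4 * C * (n.+1%:R ^+ 2 * B n.+1) = (2 * n.+1%:R) ^+ 2 * (C * B n.+1) by ring.
  apply: ler_pM; rewrite ?sqr_ge0 ?Qn_ge0//; last exact: hn.
  rewrite lerXn2r ?nnegrE ?mulr_ge0 ?ler0n// -natrM ler_nat mul2n -addnn.
  by rewrite addSn ltnS leq_addl.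
have bQ n : bm (Qn F h n) by exact: bm_Qn.
have bg := bm_gt (x / 4).
apply: (@le_trans _ _ (\sum_(n < N) tl F (x / 4) * ((nat_of_ord n == 1)%N%:R + 4 * C * (n.-1%:R ^+ 2 * B n.-1)))).
  apply: ler_sum => n _.
  have /(congr1 (fun k => k x)) <- := OpZ (lazyF F) (n%:R ^+ 2) bg (bQ n.-1).
  rewrite [leRHS]mulrC; apply: Op_le_cst => //; exact: bmZ.
rewrite -mulr_sumr big_split/= -mulr_sumr.
have s1 : \sum_(n < N) (nat_of_ord n == 1)%N%:R <= 1 :> R.
  suff -> : \sum_(n < N) (nat_of_ord n == 1)%N%:R = (1 < N)%N%:R :> R by case: (1 < N)%N.
  elim: N {NA N1 N2 S S0} => [|N IH]; first by rewrite big_ord0.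
  by rewrite big_ord_recr/= IH; case: N {IH} => [|[|N]] /=; rewrite ?addr0 ?add0r.
have s2 : \sum_(n < N) n.-1%:R ^+ 2 * B n.-1 <= \sum_(n < N) n%:R ^+ 2 * B n.
  case: N {NA N1 N2 S S0 s1} => [|N]; first by rewrite !big_ord0.
  rewrite big_ord_recl big_ord_recr/= expr0n/= mul0r add0r lerDl.
  by rewrite mulr_ge0 ?sqr_ge0.
have t1 : tl F (x / 4) <= C1 / A x by rewrite mulrC; exact: H1.
apply: (@le_trans _ _ (C1 / A x * (1 + 4 * C * (e' * (A x ^+ 3 / x))))).
  apply: ler_pM => //; first exact: tl_ge0.
    by rewrite addr_ge0 ?sumr_ge0// mulr_ge0 ?sumr_ge0 ?mulr_ge0// ?(ltW C0)// => i _; rewrite mulr_ge0 ?sqr_ge0.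
  apply: lerD; first exact: s1.
  by apply: ler_wpM2l; [rewrite mulr_ge0// ltW|exact: le_trans S].
rewrite mulrDr mulr1.
have -> : C1 / A x * (4 * C * (e' * (A x ^+ 3 / x))) = C1 * (4 * C) * e' * (A x ^+ 2 / x).
  by field; rewrite !gt_eqF.
have u0 : 0 < A x ^+ 2 / x by rewrite divr_gt0// exprn_gt0.
have r1 : C1 / A x <= e / 2 * (A x ^+ 2 / x).
  rewrite ler_pdivrMr//; move: hA; rewrite ler_pdivrMr ?divr_gt0// => /le_trans; apply.
  by rewrite le_eqVlt; apply/orP; left; apply/eqP; field; rewrite gt_eqF.
have r2 : C1 * (4 * C) * e' <= e / 2.
  by rewrite -De ler_wpM2r ?(ltW e'0)// lerDr ltW.
have := ler_wpM2r (ltW u0) r2; move: r1; move: (A x ^+ 2 / x) (C1 / A x) (C1 * _ * _).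
by move=> u v w h1 h2; have := lerD h1 h2; rewrite -mulrDl -splitr.
Qed.

(** What a big jump leaves behind, summed over n: the factor n counts the possible positions of the
    jump among the steps. *)
Definition Vn F (h : R) (N : nat) x : R := \sum_(n < N) n%:R * Qn F h n x.

(** As [n <= A x], the part without a big jump costs [A x] times the first sum of [no_big_jump_sum].
    In the other part the union bound brings one more n, whence the weight [n ^+ 2] of the second
    sum. *)
Lemma V_small F A (h e : R) : half_tail F A -> 0 < h -> 0 < e ->
  exists eta x1 : R, [/\ 0 < eta <= 1, 1 <= x1 & forall (x : R) (N : nat), x1 <= x ->
    N%:R <= eta * A x -> Vn F h N x <= e * (A x ^+ 2 / x)].
Proof.
move=> hF h0 e0; have rA := ht_rv hF.
have [eta [x1 [/andP[eta0 eta1] x11 H]]] := no_big_jump_sum hF h0 (ltac:(lra) : 0 < e / 2).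
exists eta, x1; split; [by rewrite eta0| by []|].
move=> x N xx NA; have [h1 h2] := H x N xx NA.
have x0 : 0 < x by clear -x11 xx; lra.
have Ax := A_gt0 rA (ltW x0).
have bc := bm_chi h.
apply: (@le_trans _ _ (A x * \sum_(n < N) iter n (Op (lazyF F) (fun y => (y <= x / 4)%R%:R)) (chi h) x +
  \sum_(n < N) n%:R ^+ 2 * Op (lazyF F) (fun y => (x / 4 < y)%R%:R) (Qn F h n.-1) x)).
  rewrite mulr_sumr -big_split/=; apply: ler_sum => n _.
  have nA : n%:R <= A x.
    apply: (@le_trans _ _ N%:R); first by rewrite ler_nat ltnW.
    by apply: le_trans NA _; rewrite ler_piMl// ltW.
  have := @iter_union _ (lazyF F) (x / 4) (chi h) n x bc (chi_ge0 h).
  move=> /(ler_wpM2l (ler0n _ n)) /le_trans; apply.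
  rewrite mulrDr mulrA -expr2 lerD2r ler_wpM2r//.
  by apply: iter_ge0 => // y; exact: chi_ge0.
have := ler_wpM2l (ltW Ax) h1.
have -> : A x * (e / 2 * (A x / x)) = e / 2 * (A x ^+ 2 / x) by rewrite expr2; ring.
lra.
Qed.

Lemma sum_cut (f g : nat -> R) (N0 N : nat) : (forall n, 0 <= f n) -> (forall n, 0 <= g n) ->
  (forall n, (N0 <= n)%N -> f n <= g n) ->
  \sum_(n < N) f n <= \sum_(n < N0) f n + \sum_(n < N) g n.
Proof.
move=> f0 g0 fg; elim: N => [|N IH]; first by rewrite !big_ord0 addr0 sumr_ge0.
rewrite [X in _ <= _ + X]big_ord_recr/= addrA.
have [h|h] := leqP N0 N; first by rewrite big_ord_recr/= lerD// fg.
apply: (@le_trans _ _ (\sum_(n < N0) f n)).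
  by rewrite -(subnK h) addnC big_split_ord/= lerDl sumr_ge0.
by rewrite -addrA lerDl addr_ge0// sumr_ge0.
Qed.

(** Up to [eta * A x] this is [V_small]. Above, the third bound of [local_bounds] is summed: its K/x
    part by exponential decay, its [qint] part after a change of weight. *)
Lemma V_full F A (h : R) : half_tail F A -> 0 < h ->
  exists C x1 : R, [/\ 0 < C, 1 <= x1 & forall (x : R) (N : nat), x1 <= x ->
    Vn F h N x <= C * (A x ^+ 2 / x)].
Proof.
move=> hF h0; have rA := ht_rv hF.
have [T [C [c [K0 [a [d [[T0 C0 c0] [K00 a0 d0] H]]]]]]] := local_bounds hF h0.
pose K := Num.max K0 1.
have K1 : 1 <= K by rewrite le_max lexx orbT.
have K0' : 0 < K by clear -K1; lra.
have [x1 x11 H1] := H K (ltac:(by rewrite le_max lexx)).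
have [eta [x2 [/andP[eta0 eta1] x21 H2]]] := V_small hF h0 ltr01.
have [C3 [w3 [C30 w31 H3]]] := @qint_sum_le _ A rA c T 2 c0 isT.
have A0 := A_gt0 rA (lexx 0).
have [C4 C40 H4] := poly_geo 1 A0 a0.
exists (1 + C * K * C4 + C * (2 / eta) * (C3 * K)), (Num.max (Num.max x1 x2) (K * w3)); split.
- by rewrite !addr_gt0 ?mulr_gt0 ?invr_gt0.
- by rewrite !le_max x11.
move=> x N; rewrite !ge_max => /andP[/andP[xx1 xx2] xx3].
have x0 : 0 < x by clear -x21 xx2; lra.
have Ax := A_gt0 rA (ltW x0).
have u0 : 0 <= A x ^+ 2 / x by rewrite divr_ge0 ?sqr_ge0// ltW.
have eA : 0 <= eta * A x by rewrite mulr_ge0// ltW.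
have /andP[N1 N2] := truncn_itv eA.
set N0 := Num.truncn _ in N1 N2.
(* Beyond [eta * A x] one has [n <= 2 / (eta * A x) * n ^+ 2], which replaces the critical weight n
   by [n ^+ 2]. *)
pose g (n : nat) : R := C * K / x * (n%:R ^+ 1 * expR (- (a * n%:R * (A x)^-1))) +
  C * (2 / (eta * A x)) * (n%:R ^+ 2 * qint A c (K / x) T n).
have g0 n : 0 <= g n.
  rewrite addr_ge0// mulr_ge0// ?mulr_ge0 ?expR_ge0 ?qint_ge0 ?divr_ge0 ?mulr_ge0 ?sqr_ge0 ?invr_ge0 ?(ltW C0) ?(ltW K0') ?(ltW x0) ?exprn_ge0//.
apply: (@le_trans _ _ (\sum_(n < N0) n%:R * Qn F h n x + \sum_(n < N) g n)).
  apply: (sum_cut (f := fun n => n%:R * Qn F h n x)) => // [n|n N0n].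
    by rewrite mulr_ge0// Qn_ge0.
  have [_ _ /(_ x (lexx x)) h1] := H1 x xx1 n.
  apply: le_trans (ler_wpM2l (ler0n _ n) h1) _.
  have -> : n%:R * (C * expR (- (a * n%:R / A x)) * (K / x + qint A c (K / x) T n)) =
    C * K / x * (n%:R ^+ 1 * expR (- (a * n%:R / A x))) +
    C * (expR (- (a * n%:R / A x)) * n%:R * qint A c (K / x) T n) by rewrite expr1; ring.
  rewrite lerD2l -[leRHS]mulrA; apply: ler_wpM2l; first exact: ltW.
  rewrite [leRHS]mulrA; apply: ler_wpM2r; first exact: qint_ge0.
  apply: (@le_trans _ _ n%:R).
    rewrite ler_piMl// expR_le1 oppr_le0 divr_ge0 ?mulr_ge0// ltW//.
  case: n N0n {h1} => [|n] N0n; first by rewrite expr0n/= mulr0.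
  rewrite -[leLHS]mul1r expr2 mulrA ler_wpM2r// mulrAC ler_pdivlMr ?mulr_gt0// mul1r.
  have : eta * A x <= n.+2%:R by apply: le_trans (ltW N2) _; rewrite ler_nat.
  move=> /le_trans; apply; rewrite -natrM ler_nat mul2n -addnn addSn.
  by rewrite ltnS leq_addl.
rewrite !mulrDl mul1r -addrA; apply: lerD; first by rewrite -[leRHS]mul1r; exact: H2.
rewrite big_split/= -!mulr_sumr; apply: lerD.
  have hA : A 0 <= A x by apply: (A_le rA) => //; exact: ltW.
  have w0 : 0 <= C * K / x by rewrite divr_ge0 ?mulr_ge0// ltW.
  apply: le_trans (ler_wpM2l w0 (H4 (A x) N hA)) _.
  by rewrite le_eqVlt; apply/orP; left; apply/eqP; field; rewrite gt_eqF.
have Kx : K / x = (x / K)^-1 by field; rewrite !gt_eqF.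
have xK : w3 <= x / K by rewrite ler_pdivlMr// mulrC.
have := H3 (x / K) N xK; rewrite -Kx => h3.
have w0 : 0 <= C * (2 / (eta * A x)) by rewrite mulr_ge0 ?divr_ge0// ltW.
apply: le_trans (ler_wpM2l w0 h3) _.
have hA : A (x / K) ^+ 3 <= A x ^+ 3.
  have xK0 : 0 <= x / K by rewrite divr_ge0// ltW.
  rewrite lerXn2r ?nnegrE ?(ltW Ax) ?(ltW (A_gt0 rA xK0))//.
  by apply: (A_le rA) => //; rewrite ler_pdivrMr// ler_peMr// ltW.
apply: (@le_trans _ _ (C * (2 / (eta * A x)) * (C3 * (A x ^+ 3 * (K / x))))).
  apply: ler_wpM2l => //; apply: ler_wpM2l; first exact: ltW.
  by rewrite ler_wpM2r// divr_ge0// ltW.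
by rewrite le_eqVlt; apply/orP; left; apply/eqP; field; rewrite !gt_eqF.
Qed.

Lemma V_bounded F A (h X : R) : half_tail F A -> 0 < h ->
  exists2 M : R, 0 < M & forall (z : R) (N : nat), z <= X -> Vn F h N z <= M.
Proof.
move=> hF h0; have rA := ht_rv hF.
have [T [C [c [K0 [a [d [[T0 C0 c0] [K00 a0 d0] H]]]]]]] := local_bounds hF h0.
have [x1 x11 H1] := H K0 (lexx _).
have A0 := A_gt0 rA (lexx 0).
have [C4 C40 H4] := poly_geo 1 A0 a0.
pose x := Num.max (Num.max x1 X) (K0 / T).
have xx1 : x1 <= x by rewrite !le_max lexx.
have xX : X <= x by rewrite !le_max lexx orbT.
have xK : K0 / T <= x by rewrite !le_max lexx orbT.
have x0 : 0 < x by clear -x11 xx1; lra.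
have Ax := A_gt0 rA (ltW x0).
have KT : K0 / x <= T by rewrite ler_pdivrMr// mulrC -ler_pdivrMr.
have hA : A 0 <= A x by apply: (A_le rA) => //; exact: ltW.
exists (C * (K0 / x + T) * (C4 * A x ^+ 2)).
  by rewrite !mulr_gt0 ?addr_gt0 ?divr_gt0 ?exprn_gt0.
move=> z N zX.
have w0 : 0 <= C * (K0 / x + T) by rewrite mulr_ge0 ?addr_ge0 ?divr_ge0// ltW.
apply: le_trans (ler_wpM2l w0 (H4 (A x) N hA)).
rewrite mulr_sumr; apply: ler_sum => n _.
have [_ _ /(_ z (le_trans zX xX)) h1] := H1 x xx1 n.
apply: le_trans (ler_wpM2l (ler0n _ n) h1) _.
have q1 : qint A c (K0 / x) T n <= T.
  apply: (@le_trans _ _ (LI (K0 / x) T (fun=> 1))); last first.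
    by rewrite LI_cst// mul1r gerDl oppr_le0 divr_ge0// ltW.
  apply: LI_le; [by apply: bm_qexp => //; rewrite divr_gt0|exact: bm_cst|].
  move=> th _; rewrite expR_le1 oppr_le0 !mulr_ge0// ?(ltW c0)// invr_ge0 ltW//.
  by apply: ainv_gt0 => //; rewrite divr_gt0.
have -> : C * (K0 / x + T) * (n%:R ^+ 1 * expR (- (a * n%:R / A x))) =
  n%:R * (C * expR (- (a * n%:R / A x)) * (K0 / x + T)) by rewrite expr1; ring.
by rewrite ler_wpM2l// ler_wpM2l ?lerD2l// mulr_ge0 ?expR_ge0// ltW.
Qed.


(* L^* = O(L), in the form used: L(z)^2 is dominated by L(x)^2 for x2 <= z <= x. *)
Definition L_dominated A : Prop := exists CL x2 : R, [/\ 0 < CL, 1 <= x2 &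
  forall x z : R, x2 <= z -> z <= x -> A z ^+ 2 / z <= CL * (A x ^+ 2 / x)].

Lemma V_dominated F A (h : R) : half_tail F A -> L_dominated A -> 0 < h ->
  exists C x3 : R, [/\ 0 < C, 1 <= x3 & forall (x z : R) (N : nat), x3 <= x -> z <= x ->
    chi h z + 2 * Vn F h N z <= C * (A x ^+ 2 / x)].
Proof.
move=> hF [CL [x2 [CL0 x21 HL]]] h0; have rA := ht_rv hF.
have [C [x1 [C0 x11 H]]] := V_full hF h0.
pose X := Num.max x1 x2; have X2 : x2 <= X by rewrite le_max lexx orbT.
have X1 : x1 <= X by rewrite le_max lexx.
have [M M0 HM] := V_bounded X hF h0.
have X0 : 0 < X by lra.
have AX := A_gt0 rA (ltW X0).
have lX : 0 < A X ^+ 2 / X by rewrite divr_gt0// exprn_gt0.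
pose D := (1 + 2 * M) / (A X ^+ 2 / X) + (A X ^+ 2 / X)^-1 + 2 * C.
have D0 : 0 < D.
  apply: addr_gt0; last exact: mulr_gt0.
  by apply: addr_gt0; [rewrite divr_gt0// addr_gt0// mulr_gt0|rewrite invr_gt0].
exists (D * CL), X; split; first exact: mulr_gt0.
  (clear -x21 X2; lra).
move=> x z N xX zx.
have x0 : 0 < x by clear -X0 xX; lra.
have l0 y : X <= y -> y <= x -> A y ^+ 2 / y <= CL * (A x ^+ 2 / x).
  by move=> Xy yx; apply: HL => //; exact: le_trans Xy.
have lx := l0 X (lexx _) xX.
have base : 1 + 2 * M <= (1 + 2 * M) / (A X ^+ 2 / X) * (CL * (A x ^+ 2 / x)).
  by rewrite mulrAC ler_pdivlMr// ler_wpM2l// addr_ge0// mulr_ge0// ltW.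
have base1 : 1 <= (A X ^+ 2 / X)^-1 * (CL * (A x ^+ 2 / x)).
  by rewrite mulrC ler_pdivlMr// mul1r.
have c1 := chi_le1 h z.
rewrite -mulrA.
have -> : D * (CL * (A x ^+ 2 / x)) = (1 + 2 * M) / (A X ^+ 2 / X) * (CL * (A x ^+ 2 / x)) +
  (A X ^+ 2 / X)^-1 * (CL * (A x ^+ 2 / x)) + 2 * C * (CL * (A x ^+ 2 / x)) by rewrite /D; ring.
have w0 : 0 <= CL * (A x ^+ 2 / x) by apply: le_trans lx; exact: ltW.
have [zX|Xz] := leP z X.
  have hm := HM z N zX.
  have p1 : 0 <= 2 * C * (CL * (A x ^+ 2 / x)) by rewrite mulr_ge0// mulr_ge0// ltW.
  move: base base1 p1; move: ((1 + 2 * M) / _ * _) (_^-1 * _) (2 * C * _) => a b c k1 k2 k3.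
  by move: (chi h z) (Vn F h N z) hm c1 => u v hm c1; clear -hm c1 k1 k2 k3; lra.
have hv := H z N (ltW (le_lt_trans X1 Xz)).
have p1 : 0 <= (1 + 2 * M) / (A X ^+ 2 / X) * (CL * (A x ^+ 2 / x)).
  by rewrite mulr_ge0// divr_ge0 ?(ltW lX)// addr_ge0// mulr_ge0// ltW.
have p2 : 2 * Vn F h N z <= 2 * C * (CL * (A x ^+ 2 / x)).
  rewrite -[leRHS]mulrA ler_wpM2l//; apply: le_trans hv _; rewrite ler_wpM2l ?(ltW C0)//.
  by apply: l0 => //; exact: ltW.
move: base1 p1 p2; move: ((1 + 2 * M) / _ * _) (_^-1 * _) (2 * C * _) (2 * Vn F h N z) => a b c v k1 k2 k3.
by move: (chi h z) c1 => u c1; clear -c1 k1 k2 k3; lra.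
Qed.

(** After a jump y beyond x/4 the walk has x - y left. If [k * x <= x - y], [V_small] makes the
    remaining sum small. If x - y is smaller, [V_dominated] gives only O(L(x)^2), but then y lies in
    a window of mass O(k / A x), and k is small. *)
Lemma U_small F A (h e : R) : half_tail F A -> L_dominated A -> 0 < h -> 0 < e ->
  exists eta x1 : R, [/\ 0 < eta <= 1, 1 <= x1 & forall (x : R) (N : nat), x1 <= x ->
    N%:R <= eta * A x -> \sum_(n < N) Qn F h n x <= e * (A x / x)].
Proof.
move=> hF HL h0 e0; have rA := ht_rv hF.
have [C3 [x3 [C30 x31 H3]]] := V_dominated hF HL h0.
have [C1 [x1 [C10 x11 H1]]] := tl_scale hF (ltac:(clear; lra) : 0 < 4^-1 :> R) (ltac:(clear; lra) : 4^-1 < 1 :> R).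
pose k := Num.min 4^-1 (e / (16 * C3)).
have k0 : 0 < k by rewrite lt_min invr_gt0 ltr0n divr_gt0// mulr_gt0.
have k14 : k <= 4^-1 by rewrite ge_min lexx.
have kC : 4 * k * C3 <= e / 4.
  have : k <= e / (16 * C3) by rewrite ge_min lexx orbT.
  by rewrite ler_pdivlMr ?mulr_gt0//; move=> ?; lra.
have k1 : k < 1 by lra.
have [x4 x41 H4] := tl_window hF k0 (ltac:(clear -k14; lra)).
pose e5 := e / (32 * C1); have e50 : 0 < e5 by rewrite divr_gt0// mulr_gt0.
have [eta5 [x5 [/andP[eta50 eta51] x51 H5]]] := V_small hF h0 e50.
have [eta6 [x6 [/andP[eta60 eta61] x61 H6]]] := no_big_jump_sum hF h0 (ltac:(clear -e0; lra) : 0 < e / 4).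
have [x7 x71 H7] := A_scale rA k0 k1.
have [x8 x81 H8] := ell_unif rA k0 k1 (ltac:(clear; lra) : 0 < 1 :> R).
exists (Num.min eta6 (eta5 * (k / 2))),
  (Num.max (Num.max (Num.max x1 x3) (Num.max x4 x6)) (Num.max (Num.max x7 x8) (Num.max (x5 / k) (h / k)))).
split.
- by rewrite lt_min eta60/= mulr_gt0 ?divr_gt0//= ge_min eta61.
- by rewrite !le_max x11.
move=> x N; rewrite !ge_max => /andP[/andP[/andP[xx1 xx3] /andP[xx4 xx6]] /andP[/andP[xx7 xx8] /andP[xx5 xxh]]] NA.
have x0 : 0 < x by clear -x81 xx8; lra.
have Ax := A_gt0 rA (ltW x0).
have N6 : N%:R <= eta6 * A x by apply: le_trans NA _; rewrite ler_wpM2r ?(ltW Ax)// ge_min lexx.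
have N5 : N%:R <= eta5 * (k / 2) * A x by apply: le_trans NA _; rewrite ler_wpM2r ?(ltW Ax)// ge_min lexx orbT.
rewrite ler_pdivrMr// in xx5; rewrite ler_pdivrMr// in xxh.
have [h6 _] := H6 x N xx6 N6.
have bc := bm_chi h.
have bg := bm_gt (x / 4).
have bQ n : bm (Qn F h n) by exact: bm_Qn.
(* Majorant of the sum of [n Q^(n-1)] over n: the index 1 gives [chi h], and beyond it n is at most
   2 (n - 1). *)
pose W z := chi h z + 2 * Vn F h N z.
have bV : bm (Vn F h N) by apply: bm_sum => i; exact: bmZ.
have bW : bm W by apply: bmD => //; exact: bmZ.
have W0 z : 0 <= W z.
  by rewrite addr_ge0 ?chi_ge0// mulr_ge0// sumr_ge0// => i _; rewrite mulr_ge0// Qn_ge0.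
have WE z : \sum_(n < N) n%:R * Qn F h n.-1 z <= W z.
  rewrite /W /Vn mulr_sumr; case: N {NA N6 N5 h6 W bV bW W0} => [|N].
    by rewrite !big_ord0 addr0 chi_ge0.
  rewrite big_ord_recl/= mul0r add0r; apply: (@le_trans _ _ (\sum_(n < N) ((nat_of_ord n == 0)%N%:R * chi h z + 2 * (n%:R * Qn F h n z)))).
    apply: ler_sum => n _; rewrite /bump/= add1n; case: (nat_of_ord n) => [|m].
      by rewrite !mul1r mul0r mulr0 addr0.
    rewrite [(m.+1 == 0)%N]/= mul0r add0r mulrA ler_wpM2r ?Qn_ge0// -natrM ler_nat mul2n -addnn.
    by rewrite addSn ltnS addnS ltnS leq_addl.
  rewrite big_split/= -mulr_suml; apply: lerD.
    rewrite ler_piMl ?chi_ge0//; case: N => [|N]; first by rewrite big_ord0.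
    by rewrite big_ord_recl/= big1 ?addr0.
  by rewrite [leRHS]big_ord_recr/= lerDl !mulr_ge0// Qn_ge0.
have u0 : 0 < A x / x by rewrite divr_gt0.
have l0 : 0 < A x ^+ 2 / x by rewrite divr_gt0// exprn_gt0.
pose M1 := 4 * e5 * (A x ^+ 2 / x); pose M2 := C3 * (A x ^+ 2 / x).
have M10 : 0 <= M1 by rewrite mulr_ge0 ?(ltW l0)// mulr_ge0// ltW.
have M20 : 0 <= M2 by rewrite mulr_ge0 ?(ltW l0)// ltW.
have Wz z : k * x <= z -> z <= x -> W z <= M1.
  move=> kz zx; have hz : h <= z by apply: le_trans xxh _; rewrite mulrC.
  rewrite /W /chi [z < h]ltNge hz andbF add0r.
  have z5 : x5 <= z by apply: le_trans kz; rewrite mulrC.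
  have NZ : N%:R <= eta5 * A z.
    apply: le_trans N5 _; rewrite -mulrA ler_wpM2l ?(ltW eta50)//; exact: H7.
  have /andP[_ l2] := H8 x z xx8 kz zx.
  apply: (@le_trans _ _ (2 * (e5 * (2 * (A x ^+ 2 / x))))).
    rewrite ler_wpM2l//; apply: le_trans (H5 z N z5 NZ) _.
    by apply: ler_wpM2l; [exact: ltW|exact: l2].
  by rewrite /M1; clear; lra.
have T1 : \sum_(n < N) n%:R * Op (lazyF F) (fun y => (x / 4 < y)%R%:R) (Qn F h n.-1) x <=
    M1 * tl F (x / 4) + M2 * (tl F ((1 - k) * x) - tl F x).
  apply: (@le_trans _ _ (Op (lazyF F) (fun y => (x / 4 < y)%R%:R) W x)).
    have -> : \sum_(n < N) n%:R * Op (lazyF F) (fun y => (x / 4 < y)%R%:R) (Qn F h n.-1) x =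
      Op (lazyF F) (fun y => (x / 4 < y)%R%:R) (fun z => \sum_(n < N) n%:R * Qn F h n.-1 z) x.
      rewrite (Op_sum (lazyF F) _ _ bg); last by move=> i; exact: bmZ.
      by apply: eq_bigr => i _; rewrite OpZ.
    by apply: Op_le => //; apply: bm_sum => i; exact: bmZ.
  have bk := bm_gt ((1 - k) * x); have bx := bm_gt x.
  rewrite /tl -JB// -!JZ//; last by apply: bmB.
  rewrite -JD; [|exact: bmZ|by apply: bmZ; apply: bmB].
  apply: J_le => /=; [exact: bm_Op_body|by apply: bmD; apply: bmZ => //; apply: bmB|].
  move=> y; have [yx|yx] := ltP (x / 4) y; last first.
    rewrite mul0r mulr0 add0r mulr_ge0// subr_ge0.
    by have [xy|] := ltP x y => //; rewrite (lt_le_trans _ (ltW xy)) ?(le_lt_trans _ xy)// ?ler_piMl//; clear -x51 xx5; lra.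
  rewrite mul1r mulr1.
  have [ky|ky] := leP y ((1 - k) * x).
    have -> : (x < y) = false.
      by apply/negbTE; rewrite -leNgt; apply: le_trans ky _; rewrite ler_piMl ?(ltW x0)//; clear -k0; lra.
    by rewrite subrr mulr0 addr0; apply: Wz; clear -x0 yx ky; lra.
  have [xy|xy] := ltP x y; last by rewrite subr0 mulr1 ler_wpDl//; apply: H3 => //; clear -x0 yx; lra.
  rewrite subrr mulr0 addr0 /W.
  have z0 : x - y < 0 by rewrite subr_lt0.
  rewrite chi_neg// add0r /Vn big1 ?mulr0// => i _.
  rewrite /Qn (iter_neg (lazy_neg (ht_neg hF)))// ?mulr0//; first exact: bm_cst.
  by move=> v; exact: chi_neg.
apply: (@le_trans _ _ (\sum_(n < N) iter n (Op (lazyF F) (fun y => (y <= x / 4)%R%:R)) (chi h) x +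
  \sum_(n < N) n%:R * Op (lazyF F) (fun y => (x / 4 < y)%R%:R) (Qn F h n.-1) x)).
  by rewrite -big_split/=; apply: ler_sum => n _; apply: iter_union => // y; exact: chi_ge0.
have t1 : tl F (x / 4) <= C1 / A x by rewrite mulrC; exact: H1.
have t2 := H4 x xx4.
have r1 : M1 * tl F (x / 4) <= e / 8 * (A x / x).
  apply: le_trans (ler_wpM2l M10 t1) _; rewrite /M1 /e5.
  by rewrite le_eqVlt; apply/orP; left; apply/eqP; field; rewrite !gt_eqF.
have r2 : M2 * (tl F ((1 - k) * x) - tl F x) <= e / 4 * (A x / x).
  apply: le_trans (ler_wpM2l M20 t2) _; rewrite /M2.
  have -> : C3 * (A x ^+ 2 / x) * (4 * k / A x) = 4 * k * C3 * (A x / x) by field; rewrite !gt_eqF.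
  by rewrite ler_wpM2r// ltW.
move: h6 T1 r1 r2 u0; move: (A x / x) (M1 * _) (M2 * _) (\sum_(_ < _) _) (\sum_(_ < _) _) => u a b c d.
by move=> h1 h2 h3 h4 h5; clear -h1 h2 h3 h4 h5 e0; nra.
Qed.

End step_counts.

(** * Flatness of the middle range *)

Section flatness.
Context {R : realType}.
Implicit Types (F : probability (measurableTypeR R) R) (A p f w : R -> R).

Definition late (N n : nat) : R := (N <= n)%N%:R.

(** In the second bound, [expR (- c N / a)] is traded for [(a / N) ^+ 4]. After multiplication by
    [th], [J_high] is used with [j = 2] and needs [40 < 9 * k]: 5 is the least power of [a] that
    serves. *)
Lemma exp_late_sum (a0 c : R) : 0 < a0 -> 0 < c -> exists2 C : R, 0 < C &
  forall (a : R) (N M : nat), a0 <= a ->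
    \sum_(n < M) late N n * expR (- (c * n%:R * a^-1)) <= C * a /\
    ((0 < N)%N -> \sum_(n < M) late N n * expR (- (c * n%:R * a^-1)) <= C * (a ^+ 5 / N%:R ^+ 4)).
Proof.
move=> a00 c0; pose C1 := a0^-1 + 2 / c.
have C10 : 0 < C1 by rewrite addr_gt0 ?divr_gt0 ?invr_gt0.
have [k k0 kE] : exists2 k : R, 0 < k & k = 24 * 16 / c ^+ 4.
  by exists (24 * 16 / c ^+ 4) => //; apply: divr_gt0; [exact: mulr_gt0|exact: exprn_gt0].
exists (C1 + C1 * (k)); first by rewrite addr_gt0// mulr_gt0.
move=> a N M aa; have a1 : 0 < a by exact: lt_le_trans aa.
pose v := c / (2 * a); have v0 : 0 < v by rewrite divr_gt0// mulr_gt0.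
have vE n : c * n%:R * a^-1 = v * n%:R + v * n%:R by rewrite /v; field; rewrite gt_eqF.
have S1 : \sum_(n < M) expR (- (v * n%:R)) <= C1 * a.
  apply: le_trans (geo_sum M v0) _; rewrite /C1 mulrDl; apply: lerD.
    by rewrite mulrC ler_pdivlMr// mul1r.
  by rewrite /v le_eqVlt; apply/orP; left; apply/eqP; field; rewrite !gt_eqF.
have vn0 (n : nat) : 0 <= v * n%:R by rewrite mulr_ge0// ltW.
have S2 : \sum_(n < M) late N n * expR (- (c * n%:R * a^-1)) <= expR (- (v * N%:R)) * (C1 * a).
  apply: (@le_trans _ _ (expR (- (v * N%:R)) * \sum_(n < M) expR (- (v * n%:R)))); last first.
    by rewrite ler_wpM2l// expR_ge0.
  rewrite mulr_sumr; apply: ler_sum => n _; rewrite /late.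
  case: (leqP N n) => Nn; last by rewrite mul0r mulr_ge0// expR_ge0.
  rewrite mul1r vE opprD expRD ler_wpM2r ?expR_ge0// ler_expR lerN2.
  by rewrite ler_wpM2l ?(ltW v0)// ler_nat.
split.
  apply: le_trans S2 _; apply: (@le_trans _ _ (C1 * a)).
    by rewrite ler_piMl ?mulr_ge0 ?(ltW C10) ?(ltW a1)// expR_le1 oppr_le0.
  by rewrite ler_wpM2r ?(ltW a1)// lerDl mulr_ge0// ltW.
move=> N0; apply: le_trans S2 _.
have N0' : 0 < N%:R :> R by rewrite ltr0n.
have h := pow_exp 4 (vn0 N).
have h4 : expR (- (v * N%:R)) <= k * (a ^+ 4 / N%:R ^+ 4).
  have p0 : 0 < (v * N%:R) ^+ 4 by rewrite exprn_gt0// mulr_gt0.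
  rewrite -(ler_pM2l p0); apply: le_trans h _.
  by rewrite kE /v le_eqVlt; apply/orP; left; apply/eqP; rewrite (_ : 4`! = 24)%N//; field; rewrite !gt_eqF.
apply: (@le_trans _ _ (k * (a ^+ 4 / N%:R ^+ 4) * (C1 * a))).
  by rewrite ler_wpM2r// mulr_ge0// ltW.
have -> : k * (a ^+ 4 / N%:R ^+ 4) * (C1 * a) = C1 * (k) * (a ^+ 5 / N%:R ^+ 4).
  by field; rewrite !gt_eqF.
rewrite ler_wpM2r ?divr_ge0 ?exprn_ge0 ?(ltW a1)// lerDr ltW//.
Qed.

Lemma clamp_mono (T T' th : R) : T <= T' -> clamp T th <= clamp T' th.
Proof. by move=> TT; rewrite /clamp le_min ge_min lexx/= ge_min TT orbT. Qed.

(** For [th <= x^-1] the sum over n of the powers of the modulus is O(A(1/th)); for [th >= x^-1] the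
    restriction to [n >= N] leaves O(A(1/th)^5 / N^4). With the factor [th] from the difference,
    [J_low] and [J_high] give [A x / x ^+ 2] for both when N is at least [eta * A x]. *)
Lemma flatness F A (T c0 W eta : R) w : half_tail F A -> 0 < T -> 0 < c0 ->
  (forall th : R, 0 < th <= T -> c0 / A th^-1 <= dec F th) ->
  bm w -> 0 <= W -> (forall th, `|w th| <= W) -> 0 < eta ->
  exists C x1 : R, [/\ 0 < C, 1 <= x1 & forall (x y : R) (N M : nat), x1 <= x ->
    eta * A x <= N%:R ->
    `|\sum_(n < M) late N n * (iter n (Op (lazyF F) (fun=> 1)) (bl T w) x -
                    iter n (Op (lazyF F) (fun=> 1)) (bl T w) y)| <=
    C * `|x - y| * (A x / x ^+ 2)].
Proof.
move=> hF T0 c00 Hc bw W0 wW eta0; have [rA F0 tA] := hF.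
have A0 := A_gt0 rA (lexx 0).
pose c := c0 / 2; have c1 : 0 < c by rewrite divr_gt0.
have [C5 C50 H5] := exp_late_sum A0 c1.
pose T' := Num.max T 1; have T'1 : 1 <= T' by rewrite le_max lexx orbT.
have TT' : T <= T' by rewrite le_max lexx.
have T'0 : 0 <= T' by clear -T'1; lra.
have [D [w1 [D0 w11 HD]]] := @J_high R A rA T' 2 5 isT isT T'1.
have [w2 w21 HL] := J_low rA.
pose C := 2 * W * (1 + C5 + C5 * D / eta ^+ 4) + 1.
exists C, (Num.max (Num.max w1 w2) T^-1); split.
- have : 0 <= 2 * W * (1 + C5 + C5 * D / eta ^+ 4).
    apply: mulr_ge0; first by rewrite mulr_ge0.
    by rewrite !addr_ge0 ?(ltW C50)// divr_ge0 ?mulr_ge0 ?exprn_ge0// ltW.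
  by rewrite /C => ?; rewrite ltr_wpDl.
- by rewrite !le_max w11.
move=> x y N M; rewrite !ge_max -andbA => /and3P[xw1 xw2 xT] NA.
have x0 : 0 < x by clear -w21 xw2; lra.
have Ax := A_gt0 rA (ltW x0).
have xv0 : 0 < x^-1 by rewrite invr_gt0.
have xvT : x^-1 <= T by rewrite -[T]invrK lef_pV2 ?posrE ?invr_gt0.
pose u := A x / x ^+ 2; have u0 : 0 < u by rewrite divr_gt0// exprn_gt0.
have M1 : 0 < M%:R + 1 :> R by rewrite ltr_wpDl.
(* The cutoff keeps [ainv] bounded. It depends on [M], so that the M contributions of frequencies
   below [d] add up to at most [u]; [M] does not enter the final constant. *)
pose d := Num.min x^-1 (u / (M%:R + 1)).
have d0 : 0 < d by rewrite lt_min xv0 divr_gt0.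
have dx : d <= x^-1 by rewrite ge_min lexx.
have du : M%:R * d <= u.
  apply: (@le_trans _ _ ((M%:R + 1) * d)); first by rewrite ler_wpM2r ?(ltW d0)// lerDl.
  by rewrite mulrC -ler_pdivlMr// ge_min lexx orbT.
have dT : d <= T := le_trans dx xvT.
have d1 : d <= 1 by apply: le_trans dx _; rewrite invf_le1//; clear -w11 xw1; lra.
have ai0 th := ainv_gt0 rA th d0.
pose r (th : R) := expR (- (c * (d <= th)%R%:R * (ainv A d th)^-1)).
have br : bm r.
  apply: bm_expR; apply: bmN; apply: bmM; last exact: bm_ainvV.
  by apply: bmZ; exact: bm_ge.
have r0 th : 0 <= r th by rewrite expR_ge0.
have b1 : bm (fun _ : R => 1 : R) by exact: bm_cst.
have rr th : 0 <= th <= T -> ctr (lazyF F) (fun=> 1) th ^+ 2 + str (lazyF F) (fun=> 1) th ^+ 2 <= r th ^+ 2.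
  move=> /andP[th0 thT].
  apply: le_trans (lazy_transform_bound F th b1 (fun=> ler01) erefl) _.
  have -> : (fun y : R => 1 * (1 - cos (th * y))) = (fun y : R => 1 - cos (th * y)).
    by apply/funext => z; rewrite mul1r.
  rewrite J_lazy1 expr1n -/(dec F th) /r.
  have D0' : 0 <= dec F th by apply: J_ge0 => z; rewrite subr_ge0 cos_le1.
  have [dth|thd] := leP d th; last by rewrite mulr0 mul0r oppr0 expR0 expr1n gerBl.
  have th0' : 0 < th by clear -d0 dth; lra.
  have h := Hc th (introT andP (conj th0' thT)).
  rewrite mulr1 (ainvE A dth) -expRM_natl.
  have e1 := expR_ge1Dx (2%:R * - (c / A th^-1)); apply: le_trans e1.
  have -> : 2 * - (c / A th^-1) = - (c0 / A th^-1) by rewrite /c; field; rewrite gt_eqF// (A_gt0 rA)// invr_ge0.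
  by rewrite lerD2l lerN2.
have bcl : bm (clamp T) by apply: bm_clamp; exact: ltW.
have bcr n : bm (fun th => clamp T th * r th ^+ n) by apply: bmM => //; exact: bmX.
have cl0 th : 0 <= clamp T th by case/andP: (clamp_bounds th (ltW T0)).
have step (n : nat) : `|iter n (Op (lazyF F) (fun=> 1)) (bl T w) x - iter n (Op (lazyF F) (fun=> 1)) (bl T w) y| <=
    2 * W * `|x - y| * (LI 0 d (fun th => clamp T th * r th ^+ n) + LI d T (fun th => clamp T th * r th ^+ n)).
  rewrite -(LI_split (bcr n) (ltW d0) dT).
  exact: (iter_bl_diff n x y b1 bw br (ltW T0) W0 r0 wW rr).
have low n : LI 0 d (fun th => clamp T th * r th ^+ n) <= d.
  apply: (@le_trans _ _ (LI 0 d (fun=> 1))); last by rewrite LI_cst ?subr0 ?mul1r// ltW.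
  apply: LI_le; [exact: bcr|exact: bm_cst|].
  move=> th /andP[th0 thd]; rewrite clampE; last by rewrite th0 (le_trans thd).
  apply: mulr_ile1 => //; [exact: exprn_ge0|(clear -d1 thd; lra)|].
  rewrite exprn_ile1 ?r0// /r expR_le1 oppr_le0; apply: mulr_ge0; last by rewrite invr_ge0 ltW.
  by apply: mulr_ge0; [exact: ltW|exact: ler0n].
pose E th := \sum_(n < M) late N n * expR (- (c * n%:R * (ainv A d th)^-1)).
have bE : bm E by apply: bm_sum => n; apply: bmZ; exact: bm_qexp.
have E0 th : 0 <= E th by apply: sumr_ge0 => n _; rewrite mulr_ge0// expR_ge0.
have bcE : bm (fun th => clamp T th * E th) by exact: bmM.
have S1 : \sum_(n < M) late N n * LI d T (fun th => clamp T th * r th ^+ n) =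
    LI d T (fun th => clamp T th * E th).
  rewrite /E.
  transitivity (LI d T (fun th => \sum_(n < M) late N n * (clamp T th * r th ^+ n))).
    rewrite LI_sum; last by move=> n; exact: bmZ.
    by apply: eq_bigr => n _; rewrite LIZ.
  apply: LI_eq => th /andP[dth _]; rewrite mulr_sumr; apply: eq_bigr => n _.
  rewrite mulrCA; congr (_ * (_ * _)); rewrite /r dth mulr1 -expRM_natl; congr expR.
  by ring.
have S2 : LI d T (fun th => clamp T th * E th) <= (C5 + C5 * D / eta ^+ 4) * u.
  rewrite (LI_split bcE dx xvT) mulrDl; apply: lerD.
    have bc1 : bm (fun th => clamp x^-1 th * ainv A d th).
      by apply: bmM; [apply: bm_clamp; exact: ltW|exact: bm_ainv].
    apply: (@le_trans _ _ (LI d x^-1 (fun th => C5 * (clamp x^-1 th * ainv A d th)))); last first.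
      by rewrite LIZ// ler_wpM2l ?(ltW C50)//; apply: HL.
    apply: LI_le => //; first exact: bmZ.
    move=> th /andP[dth thx]; have th0 : 0 <= th by clear -d0 dth; lra.
    rewrite !clampE ?th0//=; last exact: le_trans xvT.
    rewrite mulrCA ler_wpM2l//.
    by have [] := H5 (ainv A d th) N M (proj1 (andP (ainv_bounds rA th d0))).
  have bc2 : bm (fun th => clamp T' th ^+ 1 * ainv A d th ^+ 5) by apply: bm_clamp_ainv.
  have N0 : (0 < N)%N.
    by rewrite -(ltr0n R); apply: lt_le_trans NA; rewrite mulr_gt0.
  have N0' : 0 < N%:R :> R by rewrite ltr0n.
  apply: (@le_trans _ _ (LI x^-1 T' (fun th => C5 / N%:R ^+ 4 * (clamp T' th ^+ 1 * ainv A d th ^+ 5)))).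
    apply: (@le_trans _ _ (LI x^-1 T (fun th => C5 / N%:R ^+ 4 * (clamp T' th ^+ 1 * ainv A d th ^+ 5)))).
      apply: LI_le => //; first exact: bmZ.
      move=> th /andP[xth thT].
      have [_ /(_ N0) h] := H5 (ainv A d th) N M (proj1 (andP (ainv_bounds rA th d0))).
      have -> : C5 / N%:R ^+ 4 * (clamp T' th ^+ 1 * ainv A d th ^+ 5) =
         clamp T' th * (C5 * (ainv A d th ^+ 5 / N%:R ^+ 4)) by rewrite expr1; ring.
      by apply: ler_pM => //; exact: clamp_mono.
    apply: LI_mono_r => //; first exact: bmZ.
    move=> th; rewrite mulr_ge0 ?divr_ge0 ?(ltW C50) ?exprn_ge0//.
    rewrite mulr_ge0 ?exprn_ge0 ?(ltW (ai0 _))//.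
    by case/andP: (clamp_bounds th T'0).
  rewrite LIZ//; apply: (@le_trans _ _ (C5 / N%:R ^+ 4 * (D * (A x ^+ 5 / x ^+ 2)))).
    by rewrite ler_wpM2l ?divr_ge0 ?(ltW C50)//; apply: HD.
  have -> : C5 * D / eta ^+ 4 * u = C5 / (eta * A x) ^+ 4 * (D * (A x ^+ 5 / x ^+ 2)).
    by rewrite /u; field; rewrite !gt_eqF.
  apply: ler_wpM2r; first by rewrite mulr_ge0 ?(ltW D0)// divr_ge0 ?exprn_ge0// ltW.
  have eA : 0 < eta * A x by rewrite mulr_gt0.
  rewrite ler_wpM2l ?(ltW C50)// lef_pV2 ?posrE ?exprn_gt0//.
  by rewrite lerXn2r ?nnegrE// ltW.
apply: le_trans (ler_norm_sum _ _ _) _.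
apply: (@le_trans _ _ (\sum_(n < M) (2 * W * `|x - y| * (d + late N n * LI d T (fun th => clamp T th * r th ^+ n))))).
  apply: ler_sum => n _; rewrite normrM /late; case: (N <= n)%N; last first.
    by rewrite normr0 !mul0r addr0 !mulr_ge0// ltW.
  rewrite normr1 !mul1r; apply: le_trans (step n) _.
  by rewrite ler_wpM2l ?mulr_ge0// lerD2r.
rewrite -mulr_sumr big_split/= sumr_const card_ord S1 -[d *+ M]mulr_natl.
apply: (@le_trans _ _ (2 * W * `|x - y| * (u + (C5 + C5 * D / eta ^+ 4) * u))).
  by rewrite ler_wpM2l ?mulr_ge0// lerD.
rewrite -/u /C.
have -> : 2 * W * `|x - y| * (u + (C5 + C5 * D / eta ^+ 4) * u) =
  (2 * W * (1 + C5 + C5 * D / eta ^+ 4)) * `|x - y| * u by ring.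
by rewrite ler_wpM2r ?(ltW u0)// ler_wpM2r// lerDl.
Qed.

End flatness.

Ltac slra := repeat match goal with
  | H : forall _, _ |- _ => clear H
  | H : bm _ |- _ => clear H
  end; lra.

(** * Growth of the renewal function *)

Section arcsine_convolution.
Context {R : realType}.
Implicit Types (F : probability (measurableTypeR R) R) (A p f w : R -> R).

(** For [k = 2 / z] the derivative is 1/sqrt(s (z - s)): this is the primitive of the arcsine
    density. *)
Lemma is_derive_acos_affine (k s : R) : -1 < 1 - k * s < 1 ->
  is_derive s 1 (fun t => acos (1 - k * t)) (k * (Num.sqrt (1 - (1 - k * s) ^+ 2))^-1).
Proof.
move=> h; have d1 := is_derive1_acos h.
have d2 : is_derive s 1 (fun t : R => 1 - k * t) (- k).
  have d0 := is_deriveM (is_derive_cst k s (1 : R)) (is_derive_id s (1 : R)).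
  have := is_deriveB (is_derive_cst (1 : R) s 1) d0.
  move=> d3; apply: is_derive_eq; rewrite /GRing.scale /=; ring.
have := is_derive1_comp (f := @acos R) (g := fun t : R => 1 - k * t) d1 d2.
move=> d3; apply: is_derive_eq; ring.
Qed.

(** The margin [d] is such that the endpoints [d * z] and [(1 - d) * z] have angles exactly [eps]
    and [pi - eps], so the arcsine integral between them is [pi - 2 * eps]. *)
Lemma arcsine_middle A (rA : rv_half A) (e eps : R) : 0 < e -> e <= 1 -> 0 < eps -> eps < 1 ->
  let d := (1 - cos eps) / 2 in
  exists2 x1 : R, 1 <= x1 & forall z : R, x1 <= z ->
   (1 - e) * (pi - 2 * eps) * (z / A z ^+ 2) <=
   LI (d * z) ((1 - d) * z) (fun s => iA A s * iA A (z - s)) <=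
   (1 + e) * (pi - 2 * eps) * (z / A z ^+ 2).
Proof.
move=> e0 e1 eps0 eps1 d.
have pi2 := pi_ge2 R.
have ce1 : cos eps < 1.
  by rewrite -cos0 ltr_cos// in_itv/=; apply/andP; split; slra.
have ce0 : 0 < cos eps by apply: cos_gt0_pihalf; apply/andP; split; clear -eps0 eps1 pi2; lra.
have gE (K l z q : R) : K / l * (2 / z * q^-1) = K / (l * z * q / 2).
  by rewrite !invfM invrK; ring.
have d0 : 0 < d by rewrite /d; slra.
have d12 : d < 1/2 by rewrite /d; slra.
have d1 : d < 1 by slra.
pose e' := e / 4; have e'0 : 0 < e' by rewrite /e' divr_gt0.
have e'1 : e' <= 1/4 by rewrite /e'; clear -e1; lra.
have [x1 x11 H] := ell_unif rA d0 d1 e'0.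
have [s0 s01 Hd] := A_der rA e'0.
have s00 : 0 < s0 by clear -s01; lra.
exists (Num.max x1 (s0 / d)); first by rewrite le_max x11.
move=> z; rewrite ge_max => /andP[zx1 zs0]; rewrite ler_pdivrMr// mulrC in zs0.
have z0 : 0 < z by clear -x11 zx1; lra.
have Az := A_gt0 rA (ltW z0).
pose l := A z ^+ 2 / z; have l0 : 0 < l by rewrite divr_gt0// exprn_gt0.
have lE : z / A z ^+ 2 = l^-1 by rewrite /l invf_div.
set a := d * z; set b := (1 - d) * z.
have a0 : 0 < a by rewrite mulr_gt0.
have ab : a <= b by rewrite /a /b ler_pM2r//; clear -d12; lra.
have as0 : s0 <= a := zs0.
have bz : b = z - a by rewrite /b /a; ring.
have ac s : s0 <= s -> {for s, continuous A}.
  by move=> /Hd[dv _]; apply/differentiable_continuous/derivable1_diffP.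
(* [q s] is 2 sqrt(s (z - s)) / z, so [l * z * q s / 2] is L(z)^2 sqrt(s (z - s)), the expected size
   of [A s * A (z - s)]. *)
pose q s : R := Num.sqrt (1 - (1 - 2 / z * s) ^+ 2).
have rng s : a <= s <= b -> -1 < 1 - 2 / z * s < 1.
  move=> /andP[as_ sb]; have : 0 < 2 / z * s < 2.
    rewrite mulrAC divr_gt0 ?mulr_gt0//; last by clear -a0 as_; lra.
    by rewrite ltr_pdivrMr//=; clear -a0 bz sb; lra.
  by move=> /andP[? ?]; slra.
have qE s : a <= s <= b -> 0 < q s /\ q s ^+ 2 = 4 * (s * (z - s)) / z ^+ 2.
  move=> sab; have h := rng s sab.
  have p0 : 0 < 1 - (1 - 2 / z * s) ^+ 2 by move: h; move: (2 / z * s) => u /andP[h1 h2]; clear -h1 h2; nra.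
  split; first by rewrite sqrtr_gt0.
  by rewrite sqr_sqrtr ?ltW//; field; rewrite gt_eqF.
have bnd s : a <= s <= b -> (1 - e') * (l * z * q s / 2) <= A s * A (z - s) <= (1 + e') * (l * z * q s / 2).
  move=> sab; have [q0 q2] := qE s sab; move: (sab) => /andP[as_ sb].
  have sz : s <= z by clear -a0 bz sab; lra.
  have zsz : z - s <= z by clear -a0 as_; lra.
  have azs : a <= z - s by clear -bz sab; lra.
  have s0' : 0 < s by clear -a0 as_; lra.
  have zs0' : 0 < z - s by clear -a0 bz sab; lra.
  have /andP[h1 h2] := H z s zx1 as_ sz.
  have /andP[h3 h4] := H z (z - s) zx1 azs zsz.
  have As := A_gt0 rA (ltW s0'); have Azs := A_gt0 rA (ltW zs0').
  have w0 : 0 <= l * z * q s / 2 by apply: divr_ge0 => //; apply: mulr_ge0; [apply: mulr_ge0|]; exact: ltW.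
  have lw0 : 0 <= (1 - e') * (A z ^+ 2 / z) by rewrite mulr_ge0 ?(ltW l0)//; clear -e'1; lra.
  have sq c : (c * (l * z * q s / 2)) ^+ 2 = (c * l * s) * (c * l * (z - s)).
    transitivity (c ^+ 2 * l ^+ 2 * z ^+ 2 / 4 * q s ^+ 2); first by field.
    by rewrite q2; field; rewrite gt_eqF.
  have m1 : (1 - e') * l * s <= A s ^+ 2 by rewrite -ler_pdivlMr.
  have m2 : A s ^+ 2 <= (1 + e') * l * s by rewrite -ler_pdivrMr.
  have m3 : (1 - e') * l * (z - s) <= A (z - s) ^+ 2 by rewrite -ler_pdivlMr.
  have m4 : A (z - s) ^+ 2 <= (1 + e') * l * (z - s) by rewrite -ler_pdivrMr.
  apply/andP; split; rewrite -(ler_pXn2r (ltn0Sn 1)) ?nnegrE.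
  - by rewrite sq exprMn; apply: ler_pM => //; rewrite mulr_ge0// ltW.
  - by apply: mulr_ge0 w0; clear -e'1; lra.
  - by rewrite mulr_ge0// ltW.
  - by rewrite sq exprMn; apply: ler_pM => //; exact: sqr_ge0.
  - by rewrite mulr_ge0// ltW.
  - by apply: mulr_ge0 w0; clear -e'0; lra.
pose P K s := K / l * acos (1 - 2 / z * s).
pose dP K s := K / l * (2 / z * (q s)^-1).
have dPP K s : a <= s <= b -> is_derive s 1 (P K) (dP K s).
  move=> sab; have h := is_derive_acos_affine (rng s sab).
  have := is_deriveM (is_derive_cst (K / l) s (1 : R)) h.
  by move=> h2; apply: is_derive_eq; rewrite /GRing.scale /= /dP; ring.
have cP K : {within `[a, b], continuous (P K)}.
  apply: derivable_within_continuous => s; rewrite in_itv/= => sab.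
  by have h := dPP K s sab; exact: ex_derive.
have bi := bm_iA rA.
have bg : bm (fun s => iA A s * iA A (z - s)) by apply: bmM => //; exact: bm_shift.
have cg t : a < t < b -> {for t, continuous (fun s => iA A s * iA A (z - s))}.
  move=> tab; apply: (@near_eq_continuous _ _ (fun s => (A s)^-1 * (A (z - s))^-1) a b t) => //.
    by move=> y /andP[ay yb]; rewrite !iAE//; clear -ay yb a0 bz; lra.
  have /andP[at_ tb] := tab.
  have At : A t != 0 by rewrite gt_eqF// (A_gt0 rA)//; clear -a0 at_; lra.
  have Azt : A (z - t) != 0 by rewrite gt_eqF// (A_gt0 rA)//; clear -a0 bz tab; lra.
  apply: cvgM.
    by apply: cvgV => //; apply: ac; clear -as0 at_; lra.
  apply: cvgV => //; apply: (@continuous_comp _ _ _ (fun s : R => z - s) A); last by apply: ac; clear -as0 bz tab; lra.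
  by apply: cvgB; [exact: cvg_cst|exact: cvg_id].
have PE K : P K b - P K a = K / l * (pi - 2 * eps).
  rewrite /P -mulrBr; congr (_ * _).
  have -> : 1 - 2 / z * b = - cos eps by rewrite /b /d; field; rewrite gt_eqF.
  have -> : 1 - 2 / z * a = cos eps by rewrite /a /d; field; rewrite gt_eqF.
  have cb : -1 <= cos eps <= 1 by rewrite cos_geN1 cos_le1.
  have ep : eps \in `[0, pi] by rewrite in_itv/=; apply/andP; split; clear -eps0 eps1 pi2; lra.
  by rewrite acosN// cosK//; ring.
have dPE K s : dP K s = K / (l * z * q s / 2).
  exact: gE.
have w0 s : a < s < b -> 0 < l * z * q s / 2.
  move=> /andP[as_ sb]; have [q0 _] := qE s (introT andP (conj (ltW as_) (ltW sb))).
  by apply: divr_gt0 => //; apply: mulr_gt0 => //; exact: mulr_gt0.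
have pe : 0 <= pi - 2 * eps :> R by clear -eps1 pi2; lra.
rewrite lE; apply/andP; split.
  apply: (@le_trans _ _ ((1 + e')^-1 / l * (pi - 2 * eps))).
    rewrite mulrAC ler_wpM2r// ler_wpM2r ?invr_ge0 ?(ltW l0)//.
    rewrite -[leRHS]mul1r ler_pdivlMr; last (clear -e'0; lra).
    have ee : 0 <= e * e by rewrite mulr_ge0// ltW.
    by rewrite /e'; clear -e0 ee; lra.
  rewrite -PE; apply: (@LI_ge_primitive _ _ _ _ (P (1 + e')^-1) (dP (1 + e')^-1) ab bg cg _ (cP _)).
    by move=> s /andP[h1 h2]; apply: dPP; rewrite (ltW h1) (ltW h2).
  move=> s sab; have /andP[as_ sb] := sab.
  have /andP[h1 h2] := bnd s (introT andP (conj (ltW as_) (ltW sb))).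
  have W0 := w0 s sab.
  have k0 : 0 < 1 + e' by clear -e'0; lra.
  have AA : 0 < A s * A (z - s) by apply: mulr_gt0; apply: (A_gt0 rA); clear -a0 bz as_ sb; lra.
  rewrite !iAE; [|(clear -a0 bz sab; lra)|(clear -a0 bz sab; lra)]; rewrite dPE -invfM -[leRHS]invfM lef_pV2 ?posrE//.
  exact: mulr_gt0.
apply: (@le_trans _ _ ((1 - e')^-1 / l * (pi - 2 * eps))); last first.
  rewrite [leRHS]mulrAC ler_wpM2r// ler_wpM2r ?invr_ge0 ?(ltW l0)//.
  rewrite -[leLHS]mul1r ler_pdivrMr; last (clear -e'1; lra).
  have ee : e * e <= e by rewrite ler_piMr// ltW.
  by rewrite /e'; clear -e0 ee; lra.
rewrite -PE; apply: (@LI_le_primitive _ _ _ _ (P (1 - e')^-1) (dP (1 - e')^-1) ab bg cg _ (cP _)).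
  by move=> s /andP[h1 h2]; apply: dPP; rewrite (ltW h1) (ltW h2).
move=> s sab; have /andP[as_ sb] := sab.
have /andP[h1 h2] := bnd s (introT andP (conj (ltW as_) (ltW sb))).
have W0 := w0 s sab.
have k0 : 0 < 1 - e' by clear -e'1; lra.
have AA : 0 < A s * A (z - s) by apply: mulr_gt0; apply: (A_gt0 rA); clear -a0 bz as_ sb; lra.
rewrite !iAE; [|(clear -a0 bz sab; lra)|(clear -a0 bz sab; lra)]; rewrite dPE -invfM -[leRHS]invfM lef_pV2 ?posrE//.
exact: mulr_gt0.
Qed.

End arcsine_convolution.

(** * The convolution square of the tail, its potential and the renewal function *)

Section tail_convolution.
Context {R : realType}.
Implicit Types (F : probability (measurableTypeR R) R) (A p f w : R -> R).

(** The primitive [s / A s] again, reflected: its derivative is at least a quarter of 1/A, which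
    gives 4, and the part near the singular end adds 1. *)
Lemma LI_iA_reflect A (rA : rv_half A) : exists2 x1 : R, 1 <= x1 & forall u z : R, x1 <= u ->
  LI (z - u) z (fun s => iA A (z - s)) <= 5 * (u / A u).
Proof.
have [s0 s01 H] := A_der rA (ltac:(lra) : 0 < 4^-1 :> R).
have s00 : 0 < s0 by lra.
have A0 := A_gt0 rA (lexx 0).
have [x1 x11 HL] := A_large rA (s0 / A 0).
exists (Num.max s0 x1) => [|u z]; first by rewrite le_max s01.
rewrite ge_max => /andP[su x1u].
have u0 : 0 < u by clear -x11 x1u; lra.
have [_ hM _] := HL u x1u.
have bi : bm (fun s : R => iA A (z - s)) by apply: bm_shift; exact: bm_iA.
have uz : z - u <= z - s0 by rewrite lerD2l lerN2.
have sz : z - s0 <= z by rewrite gerBl ltW.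
have dA s : s0 <= s -> is_derive s 1 A (derive1 A s).
  by move=> /H[d _]; rewrite derive1E; exact/derivableP.
pose dP s := (A s)^-1 - s * (A s)^-2 * derive1 A s.
have dPP s : s0 <= s -> is_derive s 1 (fun s => s / A s) (dP s).
  move=> ss; have h1 := dA s ss; have As : A s != 0 by rewrite gt_eqF// (A_gt0 rA)//; clear -sz ss; lra.
  have h2 := is_deriveV As h1.
  have := is_deriveM (is_derive_id s (1 : R)) h2.
  move=> h; apply: is_derive_eq.
  by rewrite /GRing.scale /= /dP; ring.
have key s : s0 <= s -> (A s)^-1 <= 4 * dP s.
  move=> ss; have [_ /andP[_ h2]] := H s ss.
  have s'0 : 0 < s by clear -s00 ss; lra.
  have As := A_gt0 rA (ltW s'0).
  have w0 : 0 < s * (A s)^-2 by rewrite mulr_gt0// invr_gt0 exprn_gt0.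
  have e2 c : s * (A s)^-2 * (c * (A s / s)) = c * (A s)^-1 by field; rewrite !lt0r_neq0.
  have := ler_wpM2l (ltW w0) h2; rewrite e2 /dP.
  by move: (s * _ * _) ((A s)^-1) => v w; clear => h; lra.
pose P s := - 4 * ((z - s) / A (z - s)).
pose dQ s := 4 * dP (z - s).
have dQP s : s0 <= z - s -> is_derive s 1 P (dQ s).
  move=> ss; have h1 := dPP (z - s) ss.
  have h2 := is_deriveB (is_derive_cst z s (1 : R)) (is_derive_id s (1 : R)).
  have h3 := is_derive1_comp (f := fun s => s / A s) (g := fun s => z - s) h1 h2.
  have := is_deriveM (is_derive_cst (- 4 : R) s (1 : R)) h3.
  by move=> h; apply: is_derive_eq; rewrite /GRing.scale /= /dQ; ring.
rewrite (LI_split bi uz sz).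
have l1 : LI (z - u) (z - s0) (fun s => iA A (z - s)) <= P (z - s0) - P (z - u).
  apply: (@LI_le_primitive _ _ _ _ P dQ uz bi).
  - move=> t /andP[t1 t2].
    apply: (@near_eq_continuous _ _ (fun s => (A (z - s))^-1) (z - u) (z - s0) t); first by rewrite t1.
      by move=> y /andP[ay yb]; rewrite iAE//; lra.
    have Azt : A (z - t) != 0 by rewrite gt_eqF// (A_gt0 rA)//; clear -sz t2; lra.
    apply: cvgV => //; apply: (@continuous_comp _ _ _ (fun s : R => z - s) A).
      by apply: cvgB; [exact: cvg_cst|exact: cvg_id].
    have [dv _] := H (z - t) (ltac:(clear -t2; lra)).
    by apply/differentiable_continuous/derivable1_diffP.
  - by move=> t /andP[t1 t2]; apply: dQP; lra.
  - apply: derivable_within_continuous => s; rewrite in_itv/= => /andP[s1 s2].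
    by have h := dQP s (ltac:(clear -s2; lra)); exact: ex_derive.
  - by move=> t /andP[t1 t2]; rewrite iAE; [apply: key|]; lra.
have l2 : LI (z - s0) z (fun s => iA A (z - s)) <= s0 / A 0.
  apply: (@le_trans _ _ (LI (z - s0) z (fun=> (A 0)^-1))).
    apply: LI_le => //; first exact: bm_cst.
    move=> s /andP[_ sz']; have zs : 0 <= z - s by rewrite subr_ge0.
    by rewrite iAE// lef_pV2 ?posrE ?(A_gt0 rA)//; exact: (A_le rA).
  by rewrite LI_cst// (_ : z - (z - s0) = s0) 1?mulrC//; ring.
have p0 : 0 <= s0 / A s0 by rewrite divr_ge0// ltW// (A_gt0 rA)// ltW.
move: l1; rewrite /P (_ : z - (z - s0) = s0); last by ring.
rewrite (_ : z - (z - u) = u); last by ring.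
move: (LI _ _ _) (LI _ _ _) (u / A u) (s0 / A 0) (s0 / A s0) l2 hM p0 => a b c d e h1 h2 h3 h4.
by clear -h1 h2 h3 h4; lra.
Qed.

Definition pos1 (x : R) : R := (0 <= x)%R%:R.
(** Cut off on the negative side, the tail becomes exactly [pos1] minus its image under one step
    ([Op_pos1]). *)
Definition tlp F (x : R) : R := pos1 x * tl F x.

Lemma bm_pos1 : bm pos1. Proof. exact: bm_ge. Qed.
Lemma bm_tlp F : bm (tlp F). Proof. by apply: bmM; [exact: bm_pos1|exact: bm_tl]. Qed.
Lemma tlp_ge0 F x : 0 <= tlp F x. Proof. by rewrite mulr_ge0// tl_ge0. Qed.
Lemma tlpE F x : 0 <= x -> tlp F x = tl F x.
Proof. by rewrite /tlp /pos1 => ->; rewrite mul1r. Qed.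
Lemma tlp_neg F x : x < 0 -> tlp F x = 0.
Proof. by rewrite /tlp /pos1 ltNge => /negbTE ->; rewrite mul0r. Qed.

(* The convolution square of the tail, for 0 <= z <= X. *)
Definition g2 F (X z : R) : R := Op (leb 0 X) (tl F) (tlp F) z.

Lemma g2E F X z : g2 F X z = LI 0 X (fun s => tl F s * tlp F (z - s)).
Proof. by rewrite LI_J//; apply: bm_Op_body; [exact: bm_tl|exact: bm_tlp]. Qed.

Lemma LI_pos_part (X z : R) f : bm f -> 0 <= z -> z <= X -> (forall s, z < s -> f s = 0) ->
  LI 0 X f = LI 0 z f.
Proof.
move=> bf z0 zX fz; rewrite (LI_split bf z0 zX) -[RHS]addr0; congr (_ + _).
(* [f] may be nonzero at the single point [z]. On [z, X] it equals [f z] times the indicator of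
   [s <= z], whose integral is below every positive number. *)
pose M := (f z); pose g s := M * (s <= z)%R%:R.
have bg : bm g by apply: bmZ; exact: bm_le.
have fg s : z <= s -> f s = g s.
  rewrite le_eqVlt => /orP[/eqP <-|zs]; first by rewrite /g lexx mulr1.
  by rewrite fz// /g leNgt zs mulr0.
transitivity (LI z X g); first by apply: LI_eq => s /andP[zs _]; exact: fg.
rewrite /g LIZ; last exact: bm_le.
have le1 : LI z X (fun s : R => (s <= z)%R%:R) <= 0.
  apply/ler_addgt0Pr => e e0; rewrite add0r.
  have [Xe|eX] := leP X (z + e).
    apply: (@le_trans _ _ (LI z X (fun=> 1))).
      by apply: LI_le; [exact: bm_le|exact: bm_cst|move=> s _; case: (s <= z)].
    by rewrite LI_cst// mul1r lerBlDl.
  rewrite (@LI_split _ _ _ (z + e)); [|exact: bm_le|by rewrite lerDl ltW|exact: ltW].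
  rewrite -[leRHS]addr0; apply: lerD.
    apply: (@le_trans _ _ (LI z (z + e) (fun=> 1))).
      by apply: LI_le; [exact: bm_le|exact: bm_cst|move=> s _; case: (s <= z)].
    by rewrite LI_cst ?lerDl ?(ltW e0)// mul1r addrAC subrr add0r.
  apply: (@le_trans _ _ (LI (z + e) X (fun=> 0))); last by rewrite LI_cst ?mul0r// ltW.
  apply: LI_le; [exact: bm_le|exact: bm_cst|move=> s /andP[zs _]].
  have sz : z < s by apply: lt_le_trans zs; rewrite ltrDl.
  by have -> : (s <= z) = false by apply/negbTE; rewrite -ltNge.
have ge1 : 0 <= LI z X (fun s : R => (s <= z)%R%:R) by apply: LI_ge0.
by rewrite (le_anti (introT andP (conj le1 ge1))) mulr0.
Qed.

Lemma g2_local F X z : 0 <= z -> z <= X -> g2 F X z = LI 0 z (fun s => tl F s * tl F (z - s)).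
Proof.
move=> z0 zX; rewrite g2E.
have b1 : bm (fun s => tl F s * tlp F (z - s)) by apply: bm_Op_body; [exact: bm_tl|exact: bm_tlp].
rewrite (LI_pos_part b1 z0 zX); last first.
  by move=> s zs; rewrite tlp_neg ?mulr0// subr_lt0.
by apply: LI_eq => s /andP[_ sz]; rewrite tlpE// subr_ge0.
Qed.

Lemma one_sub_cos (eps : R) : 0 <= eps -> 1 - cos eps <= eps ^+ 2 / 2.
Proof.
move=> e0; have -> : cos eps = 1 - 2 * sin (eps / 2) ^+ 2.
  have h2 := cos2Dsin2 (eps / 2); have := cosD (eps / 2) (eps / 2); rewrite -splitr => ->.
  by move: h2; rewrite !expr2; move: (cos _ * _) (sin _ * _) => u v h; lra.
have h := sin_lip (eps / 2) 0; rewrite sin0 !subr0 in h.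
have h2 : sin (eps / 2) ^+ 2 <= (eps / 2) ^+ 2.
  by rewrite -[leLHS]real_normK ?num_real// -[leRHS]real_normK ?num_real// lerXn2r ?nnegrE.
by move: h2; move: (sin _ ^+ 2) => s; rewrite exprMn => h2; rewrite opprB addrC subrK; lra.
Qed.

Lemma scale_window A (rA : rv_half A) (eps d : R) : 0 < eps -> 0 < d -> d < 1 -> d <= eps ^+ 2 / 4 ->
  exists2 x1 : R, 1 <= x1 & forall z : R, x1 <= z -> (d * z) / A (d * z) <= eps * (z / A z).
Proof.
move=> e0 d0 d1 de; have [x1 x11 H] := ell_unif rA d0 d1 (ltac:(lra) : 0 < 2^-1 :> R).
exists x1 => // z zx; have z0 : 0 < z by lra.
have dz : d * z <= z by rewrite ler_piMl// ltW.
have dz0 : 0 < d * z by rewrite mulr_gt0.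
have Az := A_gt0 rA (ltW z0); have Ad := A_gt0 rA (ltW dz0).
have /andP[h _] := H z (d * z) zx (lexx _) dz.
rewrite ler_pdivlMr// in h.
rewrite ler_pdivrMr//.
have -> : eps * (z / A z) * A (d * z) = eps * z * A (d * z) / A z by ring.
rewrite ler_pdivlMr// -(ler_pXn2r (ltn0Sn 1)) ?nnegrE; first last.
- by rewrite !mulr_ge0// ltW.
- by rewrite !mulr_ge0// ltW.
rewrite !exprMn.
have p0 : 0 <= eps ^+ 2 * z ^+ 2 by rewrite mulr_ge0 ?sqr_ge0.
apply: le_trans (ler_wpM2l p0 h).
have -> : eps ^+ 2 * z ^+ 2 * ((1 - 2^-1) * (A z ^+ 2 / z) * (d * z)) =
   A z ^+ 2 * (d * z ^+ 2) * (eps ^+ 2 / 2) by field; rewrite gt_eqF.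
have -> : d ^+ 2 * z ^+ 2 * A z ^+ 2 = A z ^+ 2 * (d * z ^+ 2) * d by ring.
apply: ler_wpM2l; first by rewrite mulr_ge0 ?sqr_ge0// mulr_ge0 ?sqr_ge0// ltW.
by apply: le_trans de _; have := sqr_ge0 eps => q; lra.
Qed.

(** Arithmetic of errors, with [p] for pi: errors of size [t] in the tail constant 1/2, in the
    arcsine integral and in its angles cost at most [40 * t] in all. *)
Lemma arcsine_const_low (p t eps : R) : 2 <= p -> 0 < t -> t <= 1/40 -> 0 < eps -> eps <= t ->
  (1 - 40 * t) * (p / 4) <= (2^-1 - t) ^+ 2 * ((1 - t) * (p - 2 * eps)).
Proof.
move=> p2 t0 t1 e0 et.
have q1 : 4^-1 - t <= (2^-1 - t) ^+ 2 by have := sqr_ge0 t; rewrite sqrrB => h; lra.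
have q2 : 4^-1 - 2 * t <= (2^-1 - t) ^+ 2 * (1 - t).
  have h0 : 0 <= 1 - t by lra.
  have h1 := ler_wpM2r h0 q1.
  by have := sqr_ge0 t; rewrite expr2 => h2; apply: le_trans h1; lra.
have h0 : 0 <= p - 2 * eps by lra.
rewrite [leRHS]mulrA; apply: le_trans (ler_wpM2r h0 q2).
have h1 : 0 <= t * eps by rewrite mulr_ge0// ltW.
have h2 : t * 2 <= t * p by rewrite ler_wpM2l// ltW.
by clear -e0 et h1 h2; lra.
Qed.

Lemma arcsine_const_up (p t eps u : R) : 2 <= p -> 0 < t -> t <= 1/40 -> 0 < eps -> eps <= t ->
  u <= 10 * t ->
  (2^-1 + t) ^+ 2 * ((1 + t) * (p - 2 * eps)) + u <= (1 + 40 * t) * (p / 4).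
Proof.
move=> p2 t0 t1 e0 et ut.
have h : t * t <= t by rewrite ler_piMr// ?ltW//; lra.
have q1 : (2^-1 + t) ^+ 2 <= 4^-1 + 2 * t by rewrite sqrrD expr2; lra.
have q2 : (2^-1 + t) ^+ 2 * (1 + t) <= 4^-1 + 5 * t.
  have h0 : 0 <= 1 + t by lra.
  by apply: le_trans (ler_wpM2r h0 q1) _; clear -e0 et q1; lra.
have h0 : 0 <= p - 2 * eps by clear -p2 t1 et; lra.
apply: (@le_trans _ _ ((4^-1 + 5 * t) * (p - 2 * eps) + 10 * t)).
  by apply: lerD => //; rewrite mulrA; exact: ler_wpM2r.
have h1 : 0 <= t * eps by rewrite mulr_ge0// ltW.
have h2 : t * 2 <= t * p by rewrite ler_wpM2l// ltW.
by clear -e0 h1 h2; lra.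
Qed.

(** Away from the ends each tail is about 1/(2A), so the arcsine integral pi comes with the factor
    1/4. On an end piece of length [d * z] one factor is O(1 / A z), while the other integrates to
    O(eps z / A z) by the choice of [d]. *)
Lemma g2_asymp F A (e : R) : half_tail F A -> 0 < e -> e <= 1 -> exists2 x1 : R, 1 <= x1 &
  forall z X : R, x1 <= z -> z <= X ->
   (1 - e) * (pi / 4) * (z / A z ^+ 2) <= g2 F X z <= (1 + e) * (pi / 4) * (z / A z ^+ 2).
Proof.
move=> hF e0 e1; have rA := ht_rv hF.
have [C C0 HC] := tl_bound hF.
have [C1 [y1 [C10 y11 H1]]] := tl_scale hF (ltac:(lra) : 0 < 2^-1 :> R) (ltac:(lra) : 2^-1 < 1 :> R).
pose D := 2 * C1 + 5 * C * C1.
have D0 : 0 < D by rewrite addr_gt0// mulr_gt0// mulr_gt0.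
pose e2 := e / 40; pose eps := Num.min e2 (e / (4 * D)).
have e20 : 0 < e2 by rewrite divr_gt0.
have eps0 : 0 < eps by rewrite lt_min e20 divr_gt0// mulr_gt0.
have epse : eps <= e2 by rewrite ge_min lexx.
have epsD : D * eps <= e / 4.
  have : eps <= e / (4 * D) by rewrite ge_min lexx orbT.
  by rewrite ler_pdivlMr ?mulr_gt0// => h; clear -h; lra.
have e2s : e2 <= 1/40 by rewrite /e2; clear -e1; lra.
have eE : e = 40 * e2 by rewrite /e2; field.
clearbody eps e2.
have eps1 : eps < 1 by clear -epse e2s; lra.
have pi2 := pi_ge2 R.
have e21 : e2 <= 1 by clear -e2s; lra.
have [y2 y21 H2] := arcsine_middle rA e20 e21 eps0 eps1.
set d := (1 - cos eps) / 2 in H2.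
have d0 : 0 < d.
  by rewrite divr_gt0// subr_gt0 -cos0 ltr_cos// in_itv/=; apply/andP; split; clear -eps0 eps1 pi2; lra.
have de : d <= eps ^+ 2 / 4 by have := one_sub_cos (ltW eps0); rewrite /d => h; clear -h; lra.
have d12 : d <= 2^-1.
  apply: le_trans de _; have h : eps ^+ 2 <= 1 by rewrite expr_le1// ltW.
  by clear -h; lra.
have d1 : d < 1 by clear -d12; lra.
clearbody d.
have [y3 y31 H3] := scale_window rA eps0 d0 d1 de.
have [y4 y41 H4] := ht_tail hF e20.
have [y5 y51 H5] := tau_asymp hF ltr01 (lexx _).
have [y6 y61 H6] := LI_iA_reflect rA.
exists (Num.max (Num.max y1 y2) (Num.max y3 (Num.max y4 (Num.max y5 y6) / d))).
  by rewrite !le_max y11.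
move=> z X; rewrite !ge_max => /andP[/andP[z1 z2] /andP[z3]].
rewrite ler_pdivrMr// mulrC => z4 zX.
have z0 : 0 < z by clear -y31 z3; lra.
rewrite g2_local ?(ltW z0)//.
set a := d * z in z4; pose b := (1 - d) * z.
move: z4; rewrite !ge_max => /and3P[a4 a5 a6].
have a0 : 0 < a by rewrite mulr_gt0.
have az : a <= z / 2 by rewrite /a mulrC ler_wpM2l// ltW.
have ba : b = z - a by rewrite /b /a; ring.
have ab : a <= b by clear -az ba; lra.
have bz : b <= z by clear -a0 ba; lra.
have m0 := H2 z z2; rewrite -/a -/b in m0.
have sw := H3 z z3; rewrite -/a in sw.
clearbody a b.
have Az := A_gt0 rA (ltW z0).
have bt := bm_tl F.
have btz : bm (fun s : R => tl F (z - s)) by exact: bm_shift.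
pose f s := tl F s * tl F (z - s).
have bf : bm f by exact: bmM.
have f0 s : 0 <= f s by rewrite mulr_ge0// tl_ge0.
pose w := z / A z ^+ 2; have w0 : 0 < w by rewrite divr_gt0// exprn_gt0.
rewrite -/w -/f (LI_split bf (ltW a0) (le_trans ab bz)) (LI_split bf ab bz).
have I1 : 0 <= LI 0 a f by apply: LI_ge0 => s _.
have I3 : 0 <= LI b z f by apply: LI_ge0 => s _.
have th : tl F (z / 2) <= C1 / A z by rewrite mulrC; exact: H1.
have th0 := tl_ge0 F (z / 2).
have I1' : LI 0 a f <= 2 * C1 * eps * w.
  apply: (@le_trans _ _ (tl F (z / 2) * LI 0 a (tl F))).
    rewrite -(LIZ 0 a (tl F (z / 2)) bt); apply: LI_le; [exact: bf|exact: (bmZ (tl F (z / 2)) bt)|].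
    move=> s /andP[s0 sa]; rewrite /f mulrC; apply: ler_wpM2r; [exact: tl_ge0|apply: tl_mono; clear -sa az; lra].
  have /andP[_ t1] := H5 a a5.
  have t0 : 0 <= LI 0 a (tl F) by apply: LI_ge0 => s _; exact: tl_ge0.
  apply: (@le_trans _ _ (C1 / A z * (2 * (eps * (z / A z))))).
    apply: ler_pM => //; apply: le_trans t1 _; exact: ler_wpM2l.
  by rewrite /w le_eqVlt; apply/orP; left; apply/eqP; field; rewrite gt_eqF.
have I3' : LI b z f <= 5 * C * C1 * eps * w.
  have bi : bm (fun s : R => iA A (z - s)) by apply: bm_shift; exact: bm_iA.
  apply: (@le_trans _ _ (tl F (z / 2) * C * LI b z (fun s => iA A (z - s)))).
    rewrite -LIZ//; apply: LI_le; [exact: bf|exact: bmZ|].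
    move=> s /andP[bs sz]; rewrite /f -mulrA; apply: ler_pM; rewrite ?tl_ge0//.
      by apply: tl_mono; clear -bs ba az; lra.
    have zs : 0 <= z - s by rewrite subr_ge0.
    by rewrite iAE//; exact: HC.
  have := H6 a z a6; rewrite -ba => t1.
  have t0 : 0 <= LI b z (fun s => iA A (z - s)) by apply: LI_ge0 => s _; exact: iA_ge0.
  apply: (@le_trans _ _ (C1 / A z * C * (5 * (eps * (z / A z))))).
    apply: ler_pM => //; first by rewrite mulr_ge0// ltW.
      by rewrite ler_wpM2r// ltW.
    apply: le_trans t1 _; exact: ler_wpM2l.
  by rewrite /w le_eqVlt; apply/orP; left; apply/eqP; field; rewrite gt_eqF.
have bg : bm (fun s => iA A s * iA A (z - s)).
  by apply: bmM; [|apply: bm_shift]; exact: bm_iA.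
move: m0; rewrite -/w => /andP[m1 m2].
have pt s : a <= s <= b -> (2^-1 - e2) ^+ 2 * (iA A s * iA A (z - s)) <= f s <=
    (2^-1 + e2) ^+ 2 * (iA A s * iA A (z - s)).
  move=> /andP[sa sb].
  have s0 : 0 < s by exact: lt_le_trans sa.
  have azs : a <= z - s by clear -sb ba; lra.
  have zs0 : 0 < z - s by exact: lt_le_trans azs.
  have As := A_gt0 rA (ltW s0); have Azs := A_gt0 rA (ltW zs0).
  have /andP[h1 h2] := H4 s (le_trans a4 sa).
  have /andP[h3 h4] := H4 (z - s) (le_trans a4 azs).
  rewrite !iAE ?(ltW s0) ?(ltW zs0)// -invfM.
  have AA : 0 < A s * A (z - s) by exact: mulr_gt0.
  have fE : f s * (A s * A (z - s)) = (tl F s * A s) * (tl F (z - s) * A (z - s)) by rewrite /f; ring.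
  have p0 : 0 <= 2^-1 - e2 by clear -e2s; lra.
  by rewrite ler_pdivrMr// ler_pdivlMr// fE !expr2; apply/andP; split; apply: ler_pM => //;
    rewrite mulr_ge0 ?tl_ge0// ltW.
have I2l : (2^-1 - e2) ^+ 2 * ((1 - e2) * (pi - 2 * eps) * w) <= LI a b f.
  apply: (@le_trans _ _ ((2^-1 - e2) ^+ 2 * LI a b (fun s => iA A s * iA A (z - s)))).
    by rewrite ler_wpM2l// sqr_ge0.
  rewrite -LIZ//; apply: LI_le; [exact: bmZ|exact: bf|].
  by move=> s /pt/andP[].
have I2u : LI a b f <= (2^-1 + e2) ^+ 2 * ((1 + e2) * (pi - 2 * eps) * w).
  apply: (@le_trans _ _ ((2^-1 + e2) ^+ 2 * LI a b (fun s => iA A s * iA A (z - s)))).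
    rewrite -LIZ//; apply: LI_le; [exact: bf|exact: bmZ|].
    by move=> s /pt/andP[].
  by rewrite ler_wpM2l// sqr_ge0.
have L1 := arcsine_const_low pi2 e20 e2s eps0 epse; rewrite -eE in L1.
have eD : D * eps <= 10 * e2 by apply: le_trans epsD _; clear -eE; lra.
have L2 := arcsine_const_up pi2 e20 e2s eps0 epse eD; rewrite -eE in L2.
apply/andP; split.
  apply: (@le_trans _ _ (LI a b f)); last by rewrite addrCA lerDl addr_ge0.
  by apply: le_trans I2l; rewrite [leRHS]mulrA; apply: ler_wpM2r; [exact: ltW|exact: L1].
apply: (@le_trans _ _ (((2^-1 + e2) ^+ 2 * ((1 + e2) * (pi - 2 * eps)) + D * eps) * w)); last first.
  by apply: ler_wpM2r => //; exact: ltW.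
move: I1' I3' I2u; rewrite /D; move: (LI 0 a f) (LI a b f) (LI b z f) => i1 i2 i3 h1 h3 h2.
have := lerD (lerD h1 h3) h2.
have -> : i1 + (i2 + i3) = i1 + i3 + i2 by ring.
by move=> /le_trans; apply; rewrite le_eqVlt; apply/orP; left; apply/eqP; ring.
Qed.


Definition GN F (N : nat) (x : R) : R := \sum_(n < N) iter n (Op (lazyF F) (fun=> 1)) pos1 x.

(** The source of the telescoping: the tail is the image of the half-line indicator under identity
    minus one step. *)
Lemma Op_pos1 F x : F `]-oo, 0[%classic = 0%E -> Op (lazyF F) (fun=> 1) pos1 x = pos1 x - tlp F x.
Proof.
move=> F0; have mu0 := lazy_neg F0.
have b1 : bm (fun _ : R => 1 : R) by exact: bm_cst.
have bb : bm (fun y : R => 1 * pos1 (x - y)) by apply: bm_Op_body => //; exact: bm_pos1.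
have [x0|x0] := leP 0 x.
  have -> : pos1 x = J (lazyF F) (fun=> 1) by rewrite J_lazy1 /pos1 x0.
  rewrite tlpE// /tl -JB; [|exact: b1|exact: bm_gt].
  congr (J _ _); apply/funext => y; rewrite mul1r /pos1 subr_ge0 leNgt.
  by case: (x < y); rewrite /= ?subrr ?subr0.
rewrite tlp_neg// subr0 /pos1 leNgt x0/=.
have -> : 0%:R = J (lazyF F) (fun=> 0) :> R by rewrite J_cst mul0r.
apply: (J_eq0 mu0) => //; first exact: bm_cst.
by move=> y y0; rewrite mul1r /pos1 leNgt (_ : x - y < 0)//; lra.
Qed.

Lemma sum_tlp F N x : F `]-oo, 0[%classic = 0%E ->
  \sum_(n < N) iter n (Op (lazyF F) (fun=> 1)) (tlp F) x =
  pos1 x - iter N (Op (lazyF F) (fun=> 1)) pos1 x.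
Proof.
move=> F0; have b1 : bm (fun _ : R => 1 : R) by exact: bm_cst.
elim: N => [|N IH]; first by rewrite big_ord0 /= subrr.
rewrite big_ord_recr/= IH.
have E : tlp F = fun x => pos1 x - Op (lazyF F) (fun=> 1) pos1 x.
  by apply/funext => y; rewrite Op_pos1// opprB addrC subrK.
rewrite [in X in _ + X]E iterB//; [|exact: bm_pos1|apply: bm_Op => //; exact: bm_pos1].
by rewrite -iterSr iterS; ring.
Qed.

(** Convolution with the tail commutes with the steps, so it applies to the telescoped sum of
    [sum_tlp]. Up to the remainder [Q^N pos1], the potential is the integrated tail. *)
Lemma sum_g2 F X N x : F `]-oo, 0[%classic = 0%E ->
  \sum_(n < N) iter n (Op (lazyF F) (fun=> 1)) (g2 F X) x =
  LI 0 X (fun s => tl F s * (pos1 (x - s) - iter N (Op (lazyF F) (fun=> 1)) pos1 (x - s))).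
Proof.
move=> F0; have b1 : bm (fun _ : R => 1 : R) by exact: bm_cst.
have bt := bm_tl F; have btp := bm_tlp F.
transitivity (\sum_(n < N) Op (leb 0 X) (tl F) (iter n (Op (lazyF F) (fun=> 1)) (tlp F)) x).
  by apply: eq_bigr => n _; rewrite /g2 iter_comm.
have bi n : bm (iter n (Op (lazyF F) (fun=> 1)) (tlp F)) by exact: bm_iter.
transitivity (Op (leb 0 X) (tl F) (fun z => \sum_(n < N) iter n (Op (lazyF F) (fun=> 1)) (tlp F) z) x).
  by rewrite (Op_sum (leb 0 X) _ _ bt).
rewrite LI_J; last first.
  apply: (@bm_Op_body _ _ (fun z => pos1 z - iter N (Op (lazyF F) (fun=> 1)) pos1 z)) => //.
  by apply: bmB; [exact: bm_pos1|apply: bm_iter => //; exact: bm_pos1].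
by congr (J _ _); apply/funext => s; rewrite sum_tlp.
Qed.

Lemma bm_pos1_shift (c : R) : bm (fun z : R => pos1 (z + c)).
Proof.
have -> : (fun z : R => pos1 (z + c)) = (fun z => (- c <= z)%R%:R).
  by apply/funext => z; rewrite /pos1 -lerBlDr sub0r.
exact: bm_ge.
Qed.

Lemma iter_pos1_mono F n x y : x <= y ->
  iter n (Op (lazyF F) (fun=> 1)) pos1 x <= iter n (Op (lazyF F) (fun=> 1)) pos1 y.
Proof.
move=> xy; have -> : y = x + (y - x) by ring.
have /(congr1 (fun k => k x)) <- := @iter_shift _ (lazyF F) (fun=> 1) pos1 (y - x) n.
apply: iter_le; [exact: bm_cst|exact: bm_pos1|exact: bm_pos1_shift|by []|].
move=> z; rewrite /pos1; case: (leP 0 z) => // z0; have -> // : 0 <= z + (y - x).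
by rewrite addr_ge0// subr_ge0.
Qed.

Lemma GN_mono F N x y : x <= y -> GN F N x <= GN F N y.
Proof. by move=> xy; apply: ler_sum => n _; exact: iter_pos1_mono. Qed.

Lemma iter_pos1_dec F n x : F `]-oo, 0[%classic = 0%E ->
  iter n.+1 (Op (lazyF F) (fun=> 1)) pos1 x <= iter n (Op (lazyF F) (fun=> 1)) pos1 x.
Proof.
move=> F0; have b1 : bm (fun _ : R => 1 : R) by exact: bm_cst.
rewrite iterSr; apply: iter_le => //; [|exact: bm_pos1|].
  by apply: bm_Op => //; exact: bm_pos1.
by move=> y; rewrite Op_pos1// gerBl tlp_ge0.
Qed.

(** The terms decrease in n, so N times the last is at most the sum. A bound on [GN] uniform in N
    will thus force the remainder of the telescoping to vanish. *)
Lemma iter_pos1_small F N x : F `]-oo, 0[%classic = 0%E ->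
  N%:R * iter N (Op (lazyF F) (fun=> 1)) pos1 x <= GN F N x.
Proof.
move=> F0; elim: N => [|N IH]; first by rewrite mul0r /GN big_ord0.
rewrite -natr1 mulrDl mul1r /GN big_ord_recr/=; apply: lerD; last exact: iter_pos1_dec.
apply: le_trans IH; apply: ler_wpM2l => //; exact: iter_pos1_dec.
Qed.

(* Strong Markov property at the entrance of the window where f lives. *)
Lemma potential_bound F f (b M : R) : bm f -> 0 <= M ->
  (forall z, b <= z -> f z = 0) ->
  (forall N z, z < b -> \sum_(n < N) iter n (Op (lazyF F) (fun=> 1)) f z <= M) ->
  forall N x, \sum_(n < N) iter n (Op (lazyF F) (fun=> 1)) f x <= M.
Proof.
move=> bf M0 fb H N; have b1 : bm (fun _ : R => 1 : R) by exact: bm_cst.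
elim: N => [|N IH] x; first by rewrite big_ord0.
have [xb|bx] := ltP x b; first exact: H.
rewrite big_ord_recl/= fb// add0r.
have bi n : bm (iter n (Op (lazyF F) (fun=> 1)) f) by exact: bm_iter.
have -> : \sum_(i < N) iter (bump 0 i) (Op (lazyF F) (fun=> 1)) f x =
   Op (lazyF F) (fun=> 1) (fun y => \sum_(i < N) iter i (Op (lazyF F) (fun=> 1)) f y) x.
  by rewrite (Op_sum (lazyF F) _ _ b1).
rewrite [leRHS](_ : M = M * J (lazyF F) (fun=> 1)); last by rewrite J_lazy1 mulr1.
apply: Op_le_cst => //.
by apply: bm_sum => i; exact: bi.
Qed.

Lemma sum_g2_le F X N b z : F `]-oo, 0[%classic = 0%E -> 0 <= b -> b <= X -> z <= b ->
  \sum_(n < N) iter n (Op (lazyF F) (fun=> 1)) (g2 F X) z <= LI 0 b (tl F).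
Proof.
move=> F0 b0 bX zb; rewrite sum_g2//.
have b1 : bm (fun _ : R => 1 : R) by exact: bm_cst.
have bt := bm_tl F.
have bi : bm (iter N (Op (lazyF F) (fun=> 1)) pos1) by apply: bm_iter => //; exact: bm_pos1.
have bL : bm (fun s => tl F s * (pos1 (z - s) - iter N (Op (lazyF F) (fun=> 1)) pos1 (z - s))).
  apply: (@bm_Op_body _ _ (fun y => pos1 y - iter N (Op (lazyF F) (fun=> 1)) pos1 y)) => //.
  by apply: bmB => //; exact: bm_pos1.
pose k s := tl F s * (s <= b)%R%:R.
have bk : bm k by apply: bmM => //; exact: bm_le.
apply: (@le_trans _ _ (LI 0 X k)).
  apply: LI_le; [exact: bL|exact: bk|] => s _; rewrite /k ler_wpM2l ?tl_ge0//.
  have i0 : 0 <= iter N (Op (lazyF F) (fun=> 1)) pos1 (z - s) by apply: iter_ge0.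
  apply: (@le_trans _ _ (pos1 (z - s))); first by rewrite gerBl.
  rewrite /pos1; have [zs|//] := leP 0 (z - s).
  by have -> : s <= b by rewrite subr_ge0 in zs; exact: le_trans zs zb.
rewrite (LI_pos_part bk b0 bX); last first.
  by move=> s bs; rewrite /k leNgt bs mulr0.
by apply: LI_le; [exact: bk|exact: bt|move=> s /andP[_ sb]; rewrite /k sb mulr1].
Qed.

Lemma sum_g2_ge F X N t : F `]-oo, 0[%classic = 0%E -> 0 <= X ->
  iter N (Op (lazyF F) (fun=> 1)) pos1 X <= t ->
  (1 - t) * LI 0 X (tl F) <= \sum_(n < N) iter n (Op (lazyF F) (fun=> 1)) (g2 F X) X.
Proof.
move=> F0 X0 it; rewrite sum_g2//.
have b1 : bm (fun _ : R => 1 : R) by exact: bm_cst.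
have bt := bm_tl F.
have bi : bm (iter N (Op (lazyF F) (fun=> 1)) pos1) by apply: bm_iter => //; exact: bm_pos1.
have bL : bm (fun s => tl F s * (pos1 (X - s) - iter N (Op (lazyF F) (fun=> 1)) pos1 (X - s))).
  apply: (@bm_Op_body _ _ (fun y => pos1 y - iter N (Op (lazyF F) (fun=> 1)) pos1 y)) => //.
  by apply: bmB => //; exact: bm_pos1.
rewrite -LIZ//; apply: LI_le; [exact: bmZ|exact: bL|] => s /andP[s0 sX].
rewrite mulrC; apply: ler_wpM2l; first exact: tl_ge0.
rewrite /pos1 subr_ge0 sX lerD2l lerN2; apply: le_trans it.
by apply: iter_pos1_mono; rewrite gerBl.
Qed.

(** On [d X, X] the convolution square is within a factor 1 +- e of the constant [k], so its
    potential there is about [k * GN F N (X - d * X)]. The part of it living below [d * X] has, by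
    [potential_bound], a potential at most the integrated tail up to [d * X], which is small. The
    two together make up the integrated tail, up to the remainder bounded by [t]. *)
Lemma G_window F A (e : R) : half_tail F A -> 0 < e -> e <= 1/2 ->
  exists d x1 : R, [/\ 0 < d <= e, 1 <= x1 & forall X : R, x1 <= X ->
   let k := pi / 4 * (X / A X ^+ 2) in forall N : nat,
     (1 - e) * k * GN F N (X - d * X) <= (1 + e) * (X / A X) /\
     forall t, iter N (Op (lazyF F) (fun=> 1)) pos1 X <= t -> t <= 1 ->
       (1 - t) * (1 - e) * (X / A X) <= e * (X / A X) + (1 + e) * k * GN F N X].
Proof.
move=> hF e0 e1; have [rA F0 _] := hF.
pose e' := e / 4; have e'0 : 0 < e' by rewrite divr_gt0.
have e'1 : e' <= 1/8 by rewrite /e'; lra.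
pose d := e' ^+ 2 / 4.
have d0 : 0 < d by rewrite divr_gt0// exprn_gt0.
have e'2 : e' ^+ 2 <= e' by rewrite expr2 ler_piMr// ?ltW//; clear -e'1; lra.
have de : d <= e by rewrite /d; rewrite /e' in e'2 *; clear -e0 e'2; lra.
have d1 : d < 1 by lra.
have e'le1 : e' <= 1 by clear -e'1; lra.
move: (pi_gt0 R) (g2_asymp hF e'0 e'le1); generalize (@pi R) => p p_gt0 [x1 x11 H1].
have [x2 x21 H2] := ell_unif rA d0 d1 e'0.
have [x3 x31 H3] := tau_asymp hF e'0 (ltac:(clear -e'le1; lra)).
have [x4 x41 H4] := scale_window rA e'0 d0 d1 (lexx _).
exists d, (Num.max (Num.max x1 x3 / d) (Num.max (Num.max x2 x3) x4)); split.
- by rewrite d0.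
- by rewrite !le_max x21 !orbT.
move=> X; rewrite !ge_max => /andP[X1 /andP[/andP[X2 X3] X4]].
rewrite ler_pdivrMr// mulrC ge_max in X1; move: X1 => /andP[dX1 dX3].
move=> k N.
have X0 : 0 < X by clear -x41 X4; lra.
set b := d * X in dX1 dX3 *.
have b0 : 0 < b by rewrite mulr_gt0.
have bX : b <= X by rewrite /b ler_piMl// ltW.
have AX := A_gt0 rA (ltW X0).
have u0 : 0 < X / A X by rewrite divr_gt0.
have k0 : 0 < k by rewrite mulr_gt0 ?divr_gt0 ?exprn_gt0 ?p_gt0.
have b1 : bm (fun _ : R => 1 : R) by exact: bm_cst.
have bg : bm (g2 F X) by apply: bm_Op; [exact: bm_tl|exact: bm_tlp].
pose f1 z := g2 F X z * (z < b)%R%:R; pose f2 z := g2 F X z * (b <= z)%R%:R.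
have bf1 : bm f1 by apply: bmM => //; exact: bm_lt.
have bf2 : bm f2 by apply: bmM => //; exact: bm_ge.
have g0 z : 0 <= g2 F X z by apply: Op_ge0; [exact: tl_ge0|exact: tlp_ge0].
have gE z : g2 F X z = f1 z + f2 z.
  by rewrite /f1 /f2 leNgt; case: (z < b); rewrite /= ?mulr1 ?mulr0 ?addr0 ?add0r.
pose S f := \sum_(n < N) iter n (Op (lazyF F) (fun=> 1)) f X.
have S12 : S (g2 F X) = S f1 + S f2.
  rewrite /S -big_split/=; apply: eq_bigr => n _.
  have -> : g2 F X = fun z => f1 z + f2 z by apply/funext.
  by rewrite iter_opD.
have S1 : S f1 <= LI 0 b (tl F).
  apply: (@potential_bound F f1 b) => //.
  - by apply: LI_ge0 => s _; exact: tl_ge0.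
  - by move=> z bz; rewrite /f1 ltNge bz mulr0.
  move=> N' z zb; apply: le_trans (sum_g2_le N' F0 (ltW b0) bX (ltW zb)).
  apply: ler_sum => n _; apply: iter_le => // y; rewrite gE lerDl /f2.
  by rewrite mulr_ge0.
have S10 : 0 <= S f1 by apply: sumr_ge0 => n _; apply: iter_ge0 => // y; rewrite /f1 mulr_ge0.
have gb z : b <= z -> z <= X -> (1 - e) * k <= g2 F X z <= (1 + e) * k.
  move=> bz zX; have /andP[h1 h2] := H1 z X (le_trans dX1 bz) zX.
  have /andP[l1 l2] := H2 X z X2 bz zX.
  have z0 : 0 < z by clear -b0 bz; lra.
  have Az := A_gt0 rA (ltW z0).
  have lz : 0 < A z ^+ 2 / z by rewrite divr_gt0// exprn_gt0.
  have lX : 0 < A X ^+ 2 / X by rewrite divr_gt0// exprn_gt0.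
  have zE : z / A z ^+ 2 = (A z ^+ 2 / z)^-1 by rewrite invf_div.
  have XE : X / A X ^+ 2 = (A X ^+ 2 / X)^-1 by rewrite invf_div.
  have p4 : 0 < p / 4 :> R by rewrite divr_gt0// p_gt0.
  have i1 : (1 + e')^-1 * (X / A X ^+ 2) <= z / A z ^+ 2.
    rewrite zE XE -invfM lef_pV2 ?posrE// mulr_gt0//; clear -e'0; lra.
  have i2 : z / A z ^+ 2 <= (1 - e')^-1 * (X / A X ^+ 2).
    rewrite zE XE -invfM lef_pV2 ?posrE// mulr_gt0//; clear -e'1; lra.
  have i3 : (1 - 2 * e') <= (1 - e') * (1 + e')^-1.
    rewrite ler_pdivlMr; last (clear -e'0; lra).
    have : 0 <= e' * e' by rewrite mulr_ge0// ltW.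
    by clear -e'0 => h; lra.
  have i4 : (1 + e') * (1 - e')^-1 <= 1 + 4 * e'.
    rewrite ler_pdivrMr; last (clear -e'1; lra).
    by move: e'2; rewrite expr2 => e'2; have : e' * e' <= 1/8 * e' by [rewrite ler_wpM2r// ltW]; clear -e'0 => h; lra.
  have eE : e = 4 * e' by rewrite /e'; field.
  apply/andP; split.
    apply: le_trans h1; rewrite /k.
    apply: (@le_trans _ _ ((1 - e') * (p / 4) * ((1 + e')^-1 * (X / A X ^+ 2)))); last first.
      by rewrite ler_wpM2l// mulr_ge0// ?ltW//; clear -e'1; lra.
    have -> : (1 - e') * (p / 4) * ((1 + e')^-1 * (X / A X ^+ 2)) = (1 - e') * (1 + e')^-1 * k by rewrite /k; ring.
    rewrite -/k; apply: ler_wpM2r; first exact: ltW.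
    by apply: le_trans i3; clear -eE e'0; lra.
  apply: le_trans h2 _; rewrite /k.
  apply: (@le_trans _ _ ((1 + e') * (p / 4) * ((1 - e')^-1 * (X / A X ^+ 2)))).
    by rewrite ler_wpM2l// mulr_ge0// ?ltW//; clear -e'0; lra.
  have -> : (1 + e') * (p / 4) * ((1 - e')^-1 * (X / A X ^+ 2)) = (1 + e') * (1 - e')^-1 * k by rewrite /k; ring.
  rewrite -/k; apply: ler_wpM2r; first exact: ltW.
  by apply: le_trans i4 _; clear -eE; lra.
have shE c n : iter n (Op (lazyF F) (fun=> 1)) (fun z => c * pos1 (z + - b)) X =
    c * iter n (Op (lazyF F) (fun=> 1)) pos1 (X - b).
  by rewrite iterZ//; [rewrite iter_shift|exact: bm_pos1_shift].
have bsh c : bm (fun z : R => c * pos1 (z + - b)) by apply: bmZ; exact: bm_pos1_shift.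
have bzE z : (b <= z) = (0 <= z + - b) by rewrite subr_ge0.
have S2l : (1 - e) * k * GN F N (X - b) <= S f2.
  rewrite /GN mulr_sumr; apply: ler_sum => n _; rewrite -shE.
  apply: (iter_le_loc (lazy_neg F0)) => // z zX; rewrite /f2 /pos1 -bzE.
  case: (boolP (b <= z)) => bz; last by rewrite !mulr0.
  by rewrite !mulr1; case/andP: (gb z bz zX).
have S2u : S f2 <= (1 + e) * k * GN F N (X - b).
  rewrite /GN mulr_sumr; apply: ler_sum => n _; rewrite -shE.
  apply: (iter_le_loc (lazy_neg F0)) => // z zX; rewrite /f2 /pos1 -bzE.
  case: (boolP (b <= z)) => bz; last by rewrite !mulr0.
  by rewrite !mulr1; case/andP: (gb z bz zX).
have /andP[t1 t2] := H3 X X3.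
have e'e : e' <= e by rewrite /e'; clear -d0 de; lra.
split.
  apply: le_trans S2l _; apply: (@le_trans _ _ (S (g2 F X))); first by rewrite S12 lerDr.
  apply: le_trans (sum_g2_le N F0 (ltW X0) (lexx X) (lexx X)) _.
  by apply: le_trans t2 _; rewrite ler_wpM2r ?(ltW u0)// lerD2l.
move=> t it tle1.
have h1 := sum_g2_ge F0 (ltW X0) it; rewrite -/(S _) S12 in h1.
have t0 : 0 <= 1 - t by rewrite subr_ge0.
have /andP[_ t3] := H3 b dX3.
have sw := H4 X X4; rewrite -/b in sw.
have h2 : LI 0 b (tl F) <= e * (X / A X).
  apply: le_trans t3 _; apply: (@le_trans _ _ (2 * (b / A b))).
    rewrite ler_wpM2r ?divr_ge0 ?(ltW b0) ?(ltW (A_gt0 rA (ltW b0)))//; clear -e'le1; lra.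
  apply: (@le_trans _ _ (2 * (e' * (X / A X)))); first by rewrite ler_wpM2l.
  by rewrite mulrA ler_wpM2r ?(ltW u0)// /e'; clear -d0 de; lra.
have h3 : GN F N (X - b) <= GN F N X by apply: GN_mono; rewrite gerBl ltW.
have h4 : (1 + e) * k * GN F N (X - b) <= (1 + e) * k * GN F N X.
  by rewrite ler_wpM2l// mulr_ge0// ?ltW//; clear -e0; lra.
have h5 : (1 - t) * (1 - e) * (X / A X) <= (1 - t) * LI 0 X (tl F).
  rewrite -mulrA ler_wpM2l//; apply: le_trans t1; rewrite ler_wpM2r ?(ltW u0)//; clear -e'e; lra.
apply: le_trans h5 _; apply: le_trans h1 _; apply: lerD; first exact: le_trans S1 h2.
exact: le_trans S2u h4.
Qed.

(** The quotient of X / A(X) by pi/4 X / A(X)^2. The upper bound, valid for all N, is proved first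
    because it provides the smallness of the remainder needed in the lower one. *)
Lemma G_asymp F A (e : R) : half_tail F A -> 0 < e -> e <= 1 -> exists2 x1 : R, 1 <= x1 &
  forall x : R, x1 <= x ->
    (forall N, GN F N x <= (1 + e) * (4 / pi * A x)) /\
    exists N0 : nat, forall N, (N0 <= N)%N -> (1 - e) * (4 / pi * A x) <= GN F N x.
Proof.
move=> hF e0 e1; have [rA F0 _] := hF.
pose e' := e / 16; have e'0 : 0 < e' by rewrite divr_gt0.
have e'1 : e' <= 1/16 by rewrite /e'; lra.
have eE : e = 16 * e' by rewrite /e'; field.
have e'2 : e' <= 1/2 by lra.
move: (pi_gt0 R) (G_window hF e'0 e'2); generalize (@pi R) => p p0 [d [x1 [/andP[d0 de] x11 H]]].
clearbody e'.
have d1 : 0 < 1 - d by clear -e'2 de; lra.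
have d2 : 1 - d < 1 by clear -d0; lra.
have [x2 x21 H2] := ell_unif rA d1 d2 e'0.
have up x : Num.max x1 x2 <= x -> forall N, GN F N x <= (1 + e) * (4 / p * A x).
  rewrite ge_max => /andP[xx1 xx2] N; have x0 : 0 < x by lra.
  (* Then [x = X - d * X], the point at which [G_window] bounds [GN] from above. *)
  pose X : R := x / (1 - d).
  have xX : x = (1 - d) * X by rewrite /X mulrC divfK// gt_eqF.
  have xleX : x <= X by rewrite /X ler_pdivlMr// ler_piMr// ltW.
  have X0 : 0 < X by clear -x0 xleX; lra.
  clearbody X.
  have [h _] := H X (le_trans xx1 xleX) N.
  have -> : x = X - d * X by rewrite xX; ring.
  rewrite (_ : X - d * X = x) in h *; last by rewrite xX; ring.
  have AX := A_gt0 rA (ltW X0); have Ax := A_gt0 rA (ltW x0).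
  have xX' : (1 - d) * X <= x by rewrite -xX.
  have /andP[l _] := H2 X x (le_trans xx2 xleX) xX' xleX.
  have AA : (1 - e') * A X <= A x.
    rewrite -(ler_pXn2r (ltn0Sn 1)) ?nnegrE ?(ltW Ax) ?mulr_ge0 ?(ltW AX)//; last (clear -e'2; lra).
    have l' : (1 - e') * (A X ^+ 2 / X) * x <= A x ^+ 2 by rewrite -ler_pdivlMr.
    apply: le_trans l'; rewrite exprMn xX.
    have -> : (1 - e') * (A X ^+ 2 / X) * ((1 - d) * X) = (1 - e') * (1 - d) * A X ^+ 2 by field; rewrite gt_eqF.
    rewrite ler_wpM2r ?sqr_ge0// expr2 ler_wpM2l//; clear -e'2 de; lra.
  have e1' : 0 < 1 - e' by clear -e'2; lra.
  have kE : (1 - e') * (p / 4 * (X / A X ^+ 2)) = (1 - e') * (X / A X) * (p / 4) / A X by field; rewrite gt_eqF.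
  have w0 : 0 < (1 - e') * (X / A X) * (p / 4) / A X by rewrite !mulr_gt0 ?invr_gt0.
  rewrite kE mulrC -ler_pdivlMr// in h; apply: le_trans h _.
  have -> : (1 + e') * (X / A X) / ((1 - e') * (X / A X) * (p / 4) / A X) =
    (1 + e') / (1 - e') * (4 / p) * A X.
    field; by rewrite !gt_eqF.
  apply: (@le_trans _ _ ((1 + e') / (1 - e') * (4 / p) * (A x / (1 - e')))).
    apply: ler_wpM2l; last by rewrite ler_pdivlMr// mulrC.
    by rewrite !mulr_ge0 ?invr_ge0// ?ltW//; clear -d0 de; lra.
  have -> : (1 + e') / (1 - e') * (4 / p) * (A x / (1 - e')) = (1 + e') / (1 - e') ^+ 2 * (4 / p * A x) by field; rewrite !gt_eqF.
  apply: ler_wpM2r; first by rewrite mulr_ge0 ?divr_ge0// ltW.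
  rewrite ler_pdivrMr ?exprn_gt0// eE expr2.
  have ee : e' * e' <= 1/16 * e' by rewrite ler_wpM2r// ltW.
  have ee0 : 0 <= e' * e' * e' by rewrite !mulr_ge0// ltW.
  clear -e'0 ee ee0 e'1; nra.
exists (Num.max x1 x2); first by rewrite le_max x11.
move=> x xx; split; first exact: up.
move: (xx); rewrite ge_max => /andP[xx1 xx2].
have x0 : 0 < x by clear -x21 xx2; lra.
have Ax := A_gt0 rA (ltW x0).
pose U := (1 + e) * (4 / p * A x).
have U0 : 0 < U by apply: mulr_gt0; [(clear -eE d0 de; lra)|rewrite mulr_gt0// divr_gt0].
have Ue : 0 <= U / e' by rewrite divr_ge0// ltW.
exists (Num.truncn (U / e')).+1 => N N0.
have /andP[_ tr] := truncn_itv Ue.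
have NU : U / e' <= N%:R by apply: le_trans (ltW tr) _; rewrite ler_nat.
have N00 : 0 < N%:R :> R by rewrite ltr0n (leq_trans _ N0).
(* N times the remainder is at most [U], by the upper bound just proved, and N exceeds [U / e']. *)
have it : iter N (Op (lazyF F) (fun=> 1)) pos1 x <= e'.
  rewrite -(ler_pM2l N00); apply: le_trans (iter_pos1_small N x F0) _.
  by apply: le_trans (up x xx N) _; rewrite -/U -ler_pdivrMr.
have [_ /(_ _ it) h] := H x xx1 N.
have {}h := h (ltac:(clear -e'2; lra)).
have w0 : 0 < x / A x by rewrite divr_gt0.
have kE : (1 + e') * (p / 4 * (x / A x ^+ 2)) * GN F N x =
  (1 + e') * (GN F N x / (4 / p * A x)) * (x / A x).
  field; by rewrite !gt_eqF.
rewrite kE -mulrDl ler_pM2r// in h.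
have c0 : 0 < 4 / p * A x by rewrite mulr_gt0 ?divr_gt0.
rewrite -ler_pdivlMr// eE.
move: (GN F N x / _) h => g h.
have ee : e' * e' <= 1/16 * e' by rewrite ler_wpM2r// ltW.
have ee0 : 0 <= e' * e' by rewrite mulr_ge0// ltW.
rewrite -(ler_pM2l (ltac:(clear -ee ee0; lra) : 0 < 1 + e')).
clear -h ee ee0 e'0; lra.
Qed.

End tail_convolution.

(** * Renewal mass of long windows *)

Section window.
Context {R : realType}.
Implicit Types (F : probability (measurableTypeR R) R) (A p f w : R -> R).

(** Small indices are [U_small]. For large ones, [late M n <= n / M] bounds the sum by [Vn / M],
    hence by a multiple of [A x ^+ 2 / (M * x)]. *)
Lemma ends_small F A (h e : R) : half_tail F A -> L_dominated A -> 0 < h -> 0 < e ->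
  exists eta x1 : R, [/\ 0 < eta <= 1, 1 <= x1 & forall (x : R) (N M M' : nat), x1 <= x ->
    N%:R <= eta * A x -> A x <= eta * M%:R ->
    \sum_(n < N) Qn F h n x <= e * (A x / x) /\
    \sum_(n < M') late M n * Qn F h n x <= e * (A x / x)].
Proof.
move=> hF HL h0 e0; have rA := ht_rv hF.
have [eta [x1 [/andP[eta0 eta1] x11 H]]] := U_small hF HL h0 e0.
have [C [x2 [C0 x21 H2]]] := V_full hF h0.
pose k := Num.min eta (e / C).
have k0 : 0 < k by rewrite lt_min eta0 divr_gt0.
exists k, (Num.max x1 x2); split.
- by rewrite k0 ge_min eta1.
- by rewrite le_max x11.
move=> x N M M'; rewrite ge_max => /andP[xx1 xx2] NA MA.
have x0 : 0 < x by clear -x21 xx2; lra.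
have Ax := A_gt0 rA (ltW x0).
split.
  apply: H => //; apply: le_trans NA _; rewrite ler_wpM2r ?(ltW Ax)//.
  by rewrite ge_min lexx.
have M0 : 0 < M%:R :> R by rewrite -(pmulr_rgt0 _ k0); exact: lt_le_trans MA.
apply: (@le_trans _ _ (M%:R^-1 * Vn F h M' x)).
  rewrite /Vn mulr_sumr; apply: ler_sum => n _; rewrite mulrA ler_wpM2r ?Qn_ge0//.
  rewrite /late; case: (leqP M n) => Mn; last by rewrite mulr_ge0// invr_ge0 ltW.
  by rewrite mulrC ler_pdivlMr// mul1r ler_nat.
have M0' : 0 <= M%:R^-1 :> R by rewrite invr_ge0 ltW.
apply: le_trans (ler_wpM2l M0' (H2 x M' xx2)) _.
have u0 : 0 < A x / x by rewrite divr_gt0.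
have -> : M%:R^-1 * (C * (A x ^+ 2 / x)) = C * A x / M%:R * (A x / x) by ring.
rewrite ler_wpM2r ?(ltW u0)// ler_pdivrMr//.
apply: (@le_trans _ _ (C * (k * M%:R))); first by rewrite ler_wpM2l// ltW.
rewrite mulrA ler_wpM2r// mulrC -ler_pdivlMr//.
by rewrite ge_min lexx orbT.
Qed.

Lemma pos1_diff F h n x : 0 < h ->
  iter n (Op (lazyF F) (fun=> 1)) pos1 x - iter n (Op (lazyF F) (fun=> 1)) pos1 (x - h) = Qn F h n x.
Proof.
move=> h0; have /(congr1 (fun k => k x)) <- := @iter_shift _ (lazyF F) (fun=> 1) pos1 (- h) n.
have b1 : bm (fun _ : R => 1 : R) by exact: bm_cst.
have /(congr1 (fun k => k x)) <- := iterB (lazyF F) n b1 bm_pos1 (bm_pos1_shift (- h)).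
rewrite /Qn; congr (iter n _ _ x); apply/funext => z.
rewrite /pos1 /chi subr_ge0 ltNge; case: (leP 0 z) => z0 /=.
  by case: (h <= z); rewrite /= ?subrr ?subr0.
by rewrite leNgt (lt_trans z0 h0) subr0.
Qed.

Lemma pos1_blocks F h n J x : 0 < h ->
  iter n (Op (lazyF F) (fun=> 1)) pos1 x - iter n (Op (lazyF F) (fun=> 1)) pos1 (x - J%:R * h) =
  \sum_(j < J) Qn F h n (x - j%:R * h).
Proof.
move=> h0; elim: J => [|J IH]; first by rewrite big_ord0 mul0r subr0 subrr.
rewrite big_ord_recr/= -IH -pos1_diff// -natr1 mulrDl mul1r opprD addrA; ring.
Qed.

Lemma pos1_window_le F (h x l : R) : 0 < h -> 0 <= l -> exists2 J : nat, J%:R * h <= l + h &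
  (forall j, (j < J)%N -> j%:R * h <= l) /\
  forall n, iter n (Op (lazyF F) (fun=> 1)) pos1 x - iter n (Op (lazyF F) (fun=> 1)) pos1 (x - l) <=
  \sum_(j < J) Qn F h n (x - j%:R * h).
Proof.
move=> h0 l0; have lh : 0 <= l / h by rewrite divr_ge0// ltW.
have /andP[t1 t2] := truncn_itv lh.
exists (Num.truncn (l / h)).+1.
  rewrite -natr1 mulrDl mul1r lerD2r -ler_pdivlMr//.
split=> [j jJ|m].
  by rewrite -ler_pdivlMr//; apply: le_trans t1; rewrite ler_nat.
rewrite -pos1_blocks// lerD2l lerN2; apply: iter_pos1_mono.
by rewrite lerD2l lerN2 -ler_pdivrMr// ltW.
Qed.

(** Unit windows cover ]x - l, x]. At their right ends z >= x/2, so [A z] lies between [A x / 4] and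
    [A x], whence [eta / 4]. *)
Lemma ends_window F A (e : R) : half_tail F A -> L_dominated A -> 0 < e ->
  exists eta x1 : R, [/\ 0 < eta <= 1, 1 <= x1 & forall (x l : R) (N M M' : nat), x1 <= x ->
    0 <= l -> l <= x / 2 -> N%:R <= eta * A x -> A x <= eta * M%:R ->
    \sum_(n < N) (iter n (Op (lazyF F) (fun=> 1)) pos1 x -
                  iter n (Op (lazyF F) (fun=> 1)) pos1 (x - l)) <= e * ((l + 1) * (A x / x)) /\
    \sum_(n < M') late M n * (iter n (Op (lazyF F) (fun=> 1)) pos1 x -
                  iter n (Op (lazyF F) (fun=> 1)) pos1 (x - l)) <= e * ((l + 1) * (A x / x))].
Proof.
move=> hF HL e0; have rA := ht_rv hF.
have e2 : 0 < e / 2 by rewrite divr_gt0.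
have [eta [x1 [/andP[eta0 eta1] x11 H]]] := ends_small hF HL ltr01 e2.
have d0 : 0 < 2^-1 :> R by rewrite invr_gt0.
have d1 : 2^-1 < 1 :> R by clear; lra.
have [x2 x21 H2] := A_scale rA d0 d1.
exists (eta / 4), (Num.max (2 * x1) x2); split.
- by rewrite divr_gt0//=; lra.
- by rewrite le_max x21 orbT.
move=> x l N M M'; rewrite ge_max => /andP[xx1 xx2] l0 lx NA MA.
have x0 : 0 < x by clear -x21 xx2; lra.
have Ax := A_gt0 rA (ltW x0).
have [J Jh [jJ HJ]] := @pos1_window_le F 1 x l ltr01 l0.
rewrite mulr1 in Jh.
have u0 : 0 < A x / x by rewrite divr_gt0.
have pt j : (j < J)%N -> \sum_(n < N) Qn F 1 n (x - j%:R * 1) <= e * (A x / x) /\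
    \sum_(n < M') late M n * Qn F 1 n (x - j%:R * 1) <= e * (A x / x).
  move=> /jJ; set z := x - _ => jl.
  have zx2 : 2^-1 * x <= z by rewrite /z; clear -jl lx; lra.
  have zx : z <= x by rewrite /z mulr1 gerBl.
  have z0 : 0 < z by apply: lt_le_trans zx2; rewrite mulr_gt0.
  have zx1 : x1 <= z by apply: le_trans zx2; clear -xx1; lra.
  have Az := A_gt0 rA (ltW z0).
  have hA := H2 x z xx2 zx2 zx.
  have hA' : A z <= A x by apply: (A_le rA) => //; exact: ltW.
  have NA' : N%:R <= eta * A z.
    apply: le_trans NA _; rewrite -mulrA ler_wpM2l ?(ltW eta0)//.
    by apply: le_trans hA; clear; lra.
  have MA' : A z <= eta * M%:R.
    apply: le_trans hA' _; apply: le_trans MA _.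
    by rewrite ler_wpM2r// ler_piMr// ?ltW//; clear; lra.
  have [h1 h2] := H z N M M' zx1 NA' MA'.
  have up : e / 2 * (A z / z) <= e * (A x / x).
    have -> : e * (A x / x) = e / 2 * (2 * (A x / x)) by field; rewrite gt_eqF.
    rewrite ler_wpM2l ?(ltW e2)// ler_pdivrMr//.
    have -> : 2 * (A x / x) * z = A x * (2 * z / x) by ring.
    apply: le_trans hA' _; rewrite ler_peMr ?(ltW Ax)// ler_pdivlMr// mul1r.
    by clear -zx2; lra.
  by split; [apply: le_trans h1 _|apply: le_trans h2 _].
have fin s : s <= J%:R * (e * (A x / x)) -> s <= e * ((l + 1) * (A x / x)).
  move=> /le_trans; apply; rewrite mulrCA ler_wpM2l ?(ltW e0)// ler_wpM2r// ltW//.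
have exch (P : nat -> R) (K : nat) : (forall n, 0 <= P n) ->
   (forall j, (j < J)%N -> \sum_(n < K) P n * Qn F 1 n (x - j%:R * 1) <= e * (A x / x)) ->
   \sum_(n < K) P n * (iter n (Op (lazyF F) (fun=> 1)) pos1 x -
                  iter n (Op (lazyF F) (fun=> 1)) pos1 (x - l)) <= e * ((l + 1) * (A x / x)).
  move=> P0 hP; apply: fin.
  apply: (@le_trans _ _ (\sum_(n < K) \sum_(j < J) P n * Qn F 1 n (x - j%:R * 1))).
    by apply: ler_sum => n _; rewrite -mulr_sumr ler_wpM2l.
  rewrite exchange_big/=; apply: (@le_trans _ _ (\sum_(j < J) (e * (A x / x)))).
    by apply: ler_sum => j _; exact: hP.
  by rewrite sumr_const card_ord -[leLHS]mulr_natl lexx.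
split.
  rewrite (eq_bigr (fun n : 'I_N => 1 * (iter n (Op (lazyF F) (fun=> 1)) pos1 x -
    iter n (Op (lazyF F) (fun=> 1)) pos1 (x - l)))); last by move=> n _; rewrite mul1r.
  apply: (exch (fun=> 1)) => // j /pt[h1 _].
  by rewrite (eq_bigr (fun n : 'I_N => Qn F 1 n (x - j%:R * 1)))// => n _; rewrite mul1r.
by apply: exch => // j /pt[].
Qed.

(** The order of the quantifiers matters: [eta] depends on [e1] alone. The flatness constant, which
    depends on [eta], can thus determine the relative length of the window before [e2] is taken
    small against that length. *)
Lemma window_sum F A (e1 : R) : half_tail F A -> L_dominated A -> 0 < e1 ->
  exists2 eta : R, 0 < eta <= 1 & forall e2 : R, 0 < e2 -> exists2 x1 : R, 1 <= x1 &
  forall (x l : R) (N M : nat), x1 <= x ->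
    0 <= l -> l <= x / 2 -> N%:R <= eta * A x -> A x <= eta * M%:R ->
    `|\sum_(n < M) late N n * (iter n (Op (lazyF F) (fun=> 1)) pos1 x -
                  iter n (Op (lazyF F) (fun=> 1)) pos1 (x - l)) - 4 / pi * (A x - A (x - l))| <=
    (e1 * (l / x) + e2) * A x.
Proof.
move=> hF HL e10; have rA := ht_rv hF.
have e12 : 0 < e1 / 2 by rewrite divr_gt0.
have [eta [x1 [eta01 x11 H]]] := ends_window hF HL e12.
exists eta => // e2 e20.
pose e3 := Num.min 1 (e2 / 8).
have e30 : 0 < e3 by rewrite lt_min ltr01 divr_gt0.
have e31 : e3 <= 1 by rewrite ge_min lexx.
have e32 : e3 <= e2 / 8 by rewrite ge_min lexx orbT.
have [x2 x21 H2] := G_asymp hF e30 e31.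
exists (Num.max x1 (Num.max (2 * x2) (2 * e1 / e2))); first by rewrite le_max x11.
move=> x l N M; rewrite !ge_max => /andP[xx1 /andP[xx2 xx3]] l0 lx NA MA.
have x0 : 0 < x by clear -x21 xx2; lra.
have Ax := A_gt0 rA (ltW x0).
pose D n := iter n (Op (lazyF F) (fun=> 1)) pos1 x - iter n (Op (lazyF F) (fun=> 1)) pos1 (x - l).
have D0 n : 0 <= D n by rewrite subr_ge0 iter_pos1_mono// gerBl.
set z := x - l in D D0 *.
have zx : z <= x by rewrite gerBl.
have zx2 : x2 <= z by rewrite /z; clear -xx2 lx; lra.
have [u1 [N1 l1]] := H2 x (ltac:(clear -xx2 x21; lra)).
have [u2 [N2 l2]] := H2 z zx2.
pose M' := maxn M (maxn N1 N2).
have MM' : (M <= M')%N by rewrite leq_maxl.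
have l1' := l1 M' (ltac:(by rewrite !leq_max leqnn orbT)).
have l2' := l2 M' (ltac:(by rewrite !leq_max leqnn !orbT)).
have [h1 h2] := H x l N M M' xx1 l0 lx NA MA.
have Az : A z <= A x by apply: (A_le rA) => //; clear -zx2 x21; lra.
have Az0 : 0 < A z by apply: (A_gt0 rA); clear -zx2 x21; lra.
have E1 : \sum_(n < M') D n = GN F M' x - GN F M' z by rewrite /GN -sumrB.
have E2 : \sum_(n < M') D n <= \sum_(n < N) D n + \sum_(n < M) late N n * D n + \sum_(n < M') late M n * D n.
  have step1 : \sum_(n < M') D n <= \sum_(n < M) D n + \sum_(n < M') late M n * D n.
    apply: (sum_cut (f := D) (g := fun n => late M n * D n)) => // [n|n Mn].
      by rewrite mulr_ge0.
    by rewrite /late Mn mul1r.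
  apply: le_trans step1 _; rewrite lerD2r.
  apply: (sum_cut (f := D) (g := fun n => late N n * D n)) => // [n|n Mn].
    by rewrite mulr_ge0.
  by rewrite /late Mn mul1r.
have E3 : \sum_(n < M) late N n * D n <= \sum_(n < M') D n.
  apply: (@le_trans _ _ (\sum_(n < M) D n)).
    by apply: ler_sum => n _; rewrite ler_piMl// /late; case: (N <= n)%N.
  by rewrite -(subnK MM') addnC big_split_ord/= lerDl sumr_ge0.
have p4 : 0 < 4 / pi :> R by rewrite divr_gt0// pi_gt0.
have p42 : 4 / pi <= 2 :> R.
  by rewrite ler_pdivrMr ?pi_gt0//; have := pi_ge2 R; move: (pi : R) => p hp; clear -p hp; lra.
have b1 : e3 * (4 / pi * A x) <= e2 / 4 * A x.
  have -> : e2 / 4 * A x = e2 / 8 * (2 * A x) by field.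
  apply: ler_pM; [exact: ltW|by rewrite mulr_ge0// ltW|exact: e32|by rewrite ler_wpM2r// ltW].
have b2 : e3 * (4 / pi * A z) <= e2 / 4 * A x.
  by apply: le_trans b1; rewrite ler_wpM2l ?(ltW e30)// ler_wpM2l// ltW.
have b3 : e1 / 2 * ((l + 1) * (A x / x)) <= e1 / 2 * (l / x) * A x + e2 / 4 * A x.
  have -> : e1 / 2 * ((l + 1) * (A x / x)) = e1 / 2 * (l / x) * A x + e1 / 2 / x * A x by ring.
  rewrite lerD2l ler_wpM2r ?(ltW Ax)// ler_pdivrMr//.
  by move: xx3; rewrite ler_pdivrMr// => xx3; clear -xx3; lra.
have v1 := u1 M'; have v2 := u2 M'.
have g1 : \sum_(n < N) D n <= e1 / 2 * (l / x) * A x + e2 / 4 * A x by exact: le_trans h1 b3.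
have g2' : \sum_(n < M') late M n * D n <= e1 / 2 * (l / x) * A x + e2 / 4 * A x by exact: le_trans h2 b3.
rewrite mulrBr; have -> : (e1 * (l / x) + e2) * A x = 2 * (e1 / 2 * (l / x) * A x + e2 / 4 * A x) + 2 * (e2 / 4 * A x).
  by field; rewrite gt_eqF.
have w0 : 0 <= e1 / 2 * (l / x) * A x.
  by rewrite mulr_ge0 ?(ltW Ax)// mulr_ge0 ?(ltW e12)// divr_ge0// ltW.
have w1 : 0 <= e2 / 4 * A x by rewrite mulr_ge0 ?(ltW Ax)// divr_ge0// ltW.
rewrite mulrDl mul1r in v1; rewrite mulrDl mul1r in v2.
rewrite mulrBl mul1r in l1'; rewrite mulrBl mul1r in l2'.
rewrite -/(D _); move: E1 E2 E3 v1 v2 l1' l2' g1 g2' w0 w1 b1 b2.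
move: (\sum_(_ < N) _) (\sum_(_ < M) _) (\sum_(_ < M') D _) (\sum_(_ < M') _ * _) => s1 s2 s3 s4.
move: (GN F M' x) (GN F M' z) (e3 * (4 / pi * A x)) (e3 * (4 / pi * A z)) (4 / pi * A x) (4 / pi * A z).
move: (e1 / 2 * (l / x) * A x) (e2 / 4 * A x) => a b g g' c c' d d' E1 E2 E3 v1 v2 l1' l2' g1 g2' w0 w1 b1 b2.
by rewrite ler_norml; clear -E1 E2 E3 v1 v2 l1' l2' g1 g2' w0 w1 b1 b2; apply/andP; split; lra.
Qed.

Lemma A_increment A (rA : rv_half A) (e : R) : 0 < e -> e <= 1/4 -> exists2 x1 : R, 1 <= x1 &
  forall x l : R, x1 <= x -> 0 <= l -> l <= e * x ->
  (1 - 8 * e) * (l / 2 * (A x / x)) <= A x - A (x - l) <= (1 + 8 * e) * (l / 2 * (A x / x)).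
Proof.
move=> e0 e1; have [x1 x11 H] := A_der rA e0.
have d0 : 0 < 1 - e by lra.
have d1 : 1 - e < 1 by lra.
have [x2 x21 H2] := ell_unif rA d0 d1 e0.
exists (Num.max (2 * x1) x2) => [|x l]; first by rewrite le_max x21 orbT.
rewrite ge_max => /andP[xx1 xx2] l0 lx.
have x0 : 0 < x by clear -x21 xx2; lra.
have Ax := A_gt0 rA (ltW x0).
have exx : e * x <= 1/4 * x by rewrite ler_wpM2r// ltW.
have [->|ln0] := eqVneq l 0; first by rewrite subr0 subrr !mul0r !mulr0 lexx.
have lp : 0 < l by rewrite lt_neqAle eq_sym ln0.
have zx : x - l < x by rewrite gtrBl.
have dA s : x - l < s < x -> is_derive s 1 A (derive1 A s).
  move=> /andP[sz _]; have [dv _] := H s (ltac:(clear -sz xx1 exx lx x11; lra)).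
  by rewrite derive1E; exact/derivableP.
have cA : {within `[x - l, x], continuous A}.
  apply: derivable_within_continuous => s; rewrite in_itv/= => /andP[sz _].
  by have [dv _] := H s (ltac:(clear -sz xx1 exx lx x11; lra)).
have [c cI ->] := MVT zx (fun s si => dA s (ltac:(by move: si; rewrite in_itv/=))) cA.
move: cI; rewrite in_itv/= => /andP[c1 c2].
have -> : x - (x - l) = l by ring.
have [_ /andP[h1 h2]] := H c (ltac:(clear -c1 xx1 exx lx x11; lra)).
have cx : (1 - e) * x <= c by clear -c1 lx; lra.
have /andP[m1 m2] := H2 x c xx2 cx (ltW c2).
have c0 : 0 < c by apply: lt_le_trans cx; rewrite mulr_gt0.
have Ac := A_gt0 rA (ltW c0).
have AcAx : A c <= A x by apply: (A_le rA); exact: ltW.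
have low : (1 - e) * A x <= A c.
  rewrite -(ler_pXn2r (ltn0Sn 1)) ?nnegrE ?(ltW Ac) ?mulr_ge0 ?(ltW d0) ?(ltW Ax)//.
  have m1' : (1 - e) * (A x ^+ 2 / x) * c <= A c ^+ 2 by rewrite -ler_pdivlMr.
  apply: le_trans m1'.
  apply: (@le_trans _ _ ((1 - e) * (A x ^+ 2 / x) * ((1 - e) * x))).
    by rewrite le_eqVlt; apply/orP; left; apply/eqP; field; rewrite gt_eqF.
  by rewrite ler_wpM2l// mulr_ge0 ?(ltW d0)// divr_ge0 ?sqr_ge0// ltW.
have u0 : 0 <= A x / x by rewrite divr_ge0// ltW.
have r1 : (1 - e) * (A x / x) <= A c / c.
  rewrite mulrA; apply: ler_pM => //; [by rewrite mulr_ge0// ltW|by rewrite invr_ge0 ltW|].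
  by rewrite lef_pV2 ?posrE// ltW.
have r2 : A c / c <= (1 + 2 * e) * (A x / x).
  apply: (@le_trans _ _ (A x / ((1 - e) * x))).
    apply: ler_pM => //; [exact: ltW|by rewrite invr_ge0 ltW|].
    by rewrite lef_pV2 ?posrE// mulr_gt0.
  rewrite ler_pdivrMr ?mulr_gt0//.
  have -> : (1 + 2 * e) * (A x / x) * ((1 - e) * x) = (1 + 2 * e) * (1 - e) * A x by field; rewrite gt_eqF.
  rewrite ler_peMl ?(ltW Ax)//.
  have ee : e * e <= 1/4 * e by rewrite ler_wpM2r// ltW.
  by clear -ee e0; lra.
have ee : e * e <= 1/4 * e by rewrite ler_wpM2r// ltW.
have ee0 : 0 <= e * e by rewrite mulr_ge0// ltW.
have he : 0 <= 2^-1 - e by clear -e1; lra.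
have he' : 0 <= 2^-1 + e by clear -e0; lra.
have lu : 0 <= l * (A x / x) by rewrite mulr_ge0.
apply/andP; split.
  have := ler_wpM2r l0 (le_trans (ler_wpM2l he r1) h1) => /(le_trans _); apply.
  have -> : (1 - 8 * e) * (l / 2 * (A x / x)) = (1 - 8 * e) / 2 * (l * (A x / x)) by ring.
  have -> : (2^-1 - e) * ((1 - e) * (A x / x)) * l = (2^-1 - e) * (1 - e) * (l * (A x / x)) by ring.
  by rewrite ler_wpM2r//; clear -ee0 e0; lra.
apply: le_trans (ler_wpM2r l0 (le_trans h2 (ler_wpM2l he' r2))) _.
have -> : (1 + 8 * e) * (l / 2 * (A x / x)) = (1 + 8 * e) / 2 * (l * (A x / x)) by ring.
have -> : (2^-1 + e) * ((1 + 2 * e) * (A x / x)) * l = (2^-1 + e) * (1 + 2 * e) * (l * (A x / x)) by ring.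
by rewrite ler_wpM2r//; clear -ee e0; lra.
Qed.

End window.

(** * Arithmetic laws *)

Section lattices.
Context {R : realType}.
Implicit Types (F : probability (measurableTypeR R) R) (A p f w : R -> R).

Lemma cos_eq1 (x : R) : cos x = 1 -> exists k : int, x = k%:~R * (2 * pi).
Proof.
move=> cx; pose T : R := 2 * pi.
have p0 := pi_gt0 R.
have T0 : 0 < T by rewrite mulr_gt0.
exists (Num.floor (x / T)); set k := Num.floor _.
have /andP[k1 k2] := floor_itv (x / T).
rewrite -/k in k1 k2.
pose r := x - k%:~R * T.
have r0 : 0 <= r by rewrite subr_ge0 -ler_pdivlMr.
have rT : r < T.
  by move: k2; rewrite ltr_pdivrMr// intrD mulrDl mul1r /r ltrBlDl.
have cr : cos r = 1.
  rewrite -cx /r; have pT : T = pi *+ 2 by rewrite mulr2n /T mulrDl mul1r.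
  case: (k) => n.
    rewrite -[LHS](periodicn (@cosD2pi R) n) -pT -mulr_natl; congr cos.
    exact: subrK.
  rewrite NegzE mulrNz mulNr opprK.
  have -> : n.+1%:~R * T = (pi *+ 2) *+ n.+1 by rewrite -pT -mulr_natl pmulrn.
  by rewrite (periodicn (@cosD2pi R)).
suff : r = 0 by move=> /eqP; rewrite subr_eq0 => /eqP.
have [rp|rp] := leP r pi.
  by rewrite -[r](cosK (_ : r \in `[0, pi])) ?in_itv/= ?r0// cr acos1.
have c2 : cos (T - r) = 1.
  have -> : T - r = - (r - T) by ring.
  rewrite cosN -[RHS]cr; have -> : r = (r - T) + pi *+ 2 by rewrite mulr2n /T; ring.
  by rewrite cosD2pi mulr2n /T; congr cos; ring.
have h : T - r \in `[0, pi].
  by rewrite in_itv/= subr_ge0 (ltW rT)/= lerBlDr /T mulrDl mul1r lerD2l ltW.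
have : T - r = 0 by rewrite -[LHS](cosK h) c2 acos1.
by move=> e; move: rT; rewrite -subr_gt0 e ltxx.
Qed.

Lemma measurable_lattice (h : R) : measurable (lattice h : set (measurableTypeR R)).
Proof.
apply: countable_measurable; first exact: measurable_set1.
rewrite /lattice; apply: (card_le_trans (card_image_le _ _)); exact: countableP.
Qed.

Lemma F_compl F (B : set (measurableTypeR R)) : measurable B -> F B = 1%E -> F (~` B) = 0%E.
Proof. by move=> mB FB; rewrite probability_setC// FB subee. Qed.

(** The atom of the lazy law contributes nothing, so 1 - cos(th y), which is nonnegative, has
    integral 0 under F and vanishes almost everywhere. *)
Lemma dec_eq0_lattice F (th : R) : 0 < th -> dec F th <= 0 ->
  F (lattice (2 * pi / th)) = 1%E.
Proof.
move=> th0 d0.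
have bg := bm_1cos th.
have g0 (y : R) : 0 <= 1 - cos (th * y) by rewrite subr_ge0 cos_le1.
have J0 : J F (fun y => 1 - cos (th * y)) = 0.
  apply/eqP; rewrite eq_le J_ge0// andbT.
  move: d0; rewrite /dec J_lazy// mulr0 cos0 subrr mulr0 add0r.
  by rewrite pmulr_rle0// invr_gt0.
pose G : measurableTypeR R -> R := fun y => 1 - cos (th * y).
have mg : measurable_fun [set: measurableTypeR R] (EFin \o G).
  by apply/measurable_EFinP; case: bg.
have I0 : (\int[F]_(x in [set: measurableTypeR R]) `|(EFin \o G) x| = 0)%E.
  transitivity (\int[F]_(x in [set: measurableTypeR R]) (G x)%:E)%E.
    by apply: eq_integral => x _ /=; rewrite ger0_norm// g0.
  by rewrite -(@EFin_J _ _ _ F G)// J0.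
have aez := (ae_eq_integral_abs F measurableT mg).1 I0.
have mL := measurable_lattice (2 * pi / th).
have FC : F (~` lattice (2 * pi / th)) = 0%E.
  apply: (measure_negligible (measurableC mL)).
  apply: negligibleS aez => y nL /= h; apply: nL; have /= := h I.
  move=> [] /eqP; rewrite subr_eq0 => /eqP e.
  have [k ke] := cos_eq1 (esym e); exists k => //.
  by rewrite mulrA -ke mulrAC divff ?mul1r// gt_eqF.
have := probability_setC F mL; rewrite FC => h.
have h2 : (F (lattice (2 * pi / th)) <= 1)%E by exact: probability_le1.
have h3 : F (lattice (2 * pi / th)) \is a fin_num by rewrite fin_num_measure.
rewrite -(fineK h3) in h *; congr (_%:E).
by move: h => /esym/eqP; rewrite -EFinB eqe subr_eq0 eq_sym => /eqP.
Qed.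

Lemma J_lattice F h f g : F (lattice h) = 1%E -> bm f -> bm g ->
  (forall v, lattice h v -> f v = g v) -> J (lazyF F) f = J (lazyF F) g.
Proof.
move=> FL bf bg fg; have mL := measurable_lattice h.
apply: (@J_eq_ae _ _ (~` lattice h)) => //; first exact: measurableC.
  have FC := F_compl mL FL; have e := lazyFE F (~` lattice h).
  rewrite FC in e.
  have n0 : ~ (~` lattice h) (0 : R) by move=> nL; apply: nL; exists 0 => //; rewrite mul0r.
  by rewrite mule0 adde0 diracE memNset// mule0 in e.
by move=> y /contrapT; exact: fg.
Qed.

Lemma lattice_sub (h x y : R) : lattice h x -> lattice h y -> lattice h (x - y).
Proof.
by move=> [k _ <-] [l _ <-]; exists (k - l) => //; rewrite intrB mulrBl.
Qed.

Lemma iter_lattice F h f g n x : F (lattice h) = 1%E -> bm f -> bm g ->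
  (forall v, lattice h v -> f v = g v) -> lattice h x ->
  iter n (Op (lazyF F) (fun=> 1)) f x = iter n (Op (lazyF F) (fun=> 1)) g x.
Proof.
move=> FL bf bg fg; have b1 : bm (fun _ : R => 1 : R) by exact: bm_cst.
elim: n x => [|n IH] x Lx /=; first exact: fg.
apply: (J_lattice FL).
- by apply: bm_Op_body => //; exact: bm_iter.
- by apply: bm_Op_body => //; exact: bm_iter.
by move=> y Ly; rewrite IH//; exact: lattice_sub.
Qed.

Lemma chi_lattice (h r v : R) : 0 < h -> 0 <= r -> r < h -> lattice h v ->
  chi h (v + r) = (v == 0)%:R.
Proof.
move=> h0 r0 rh [k _ <-]; rewrite /chi mulf_eq0 (gt_eqF h0) orbF intr_eq0.
case: (ltrgtP k 0) => [k0|k0|->].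
- have : k%:~R * h + r < 0.
    have : k%:~R * h <= - 1 * h.
      rewrite ler_wpM2r ?(ltW h0)// -[- 1]/((-1)%:~R) ler_int.
      by rewrite -ltzD1 addNr.
    by rewrite mulN1r => kh; lra.
  by rewrite ltNge => /negbTE ->.
- have : h <= k%:~R * h + r.
    have : 1 * h <= k%:~R * h by rewrite ler_wpM2r ?(ltW h0)// -[1]/(1%:~R) ler_int -gtz0_ge1.
    by rewrite mul1r => kh; lra.
  by rewrite leNgt => /negbTE ->; rewrite andbF.
- by rewrite mul0r add0r r0 rh.
Qed.

Lemma sin_int_pi (k : int) : sin (k%:~R * pi) = 0 :> R.
Proof.
have hn (n : nat) : sin (n%:R * pi) = 0 :> R.
  elim: n => [|n IH]; first by rewrite mul0r sin0.
  by rewrite -natr1 mulrDl mul1r sinDpi IH oppr0.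
case: k => n; first exact: hn.
by rewrite NegzE mulrNz mulNr sinN hn oppr0.
Qed.

(* (h/pi) int_0^{pi/h} cos(th y) dth vanishes on h Z except at 0. *)
Lemma bl_lattice (h v : R) : 0 < h -> lattice h v ->
  bl (pi / h) (fun=> h / pi) v = (v == 0)%:R.
Proof.
move=> h0 [k _ <-]; have p0 := pi_gt0 R.
have ph : 0 <= pi / h by rewrite divr_ge0// ltW.
rewrite /bl mulf_eq0 (gt_eqF h0) orbF intr_eq0.
case: (eqVneq k 0) => [->|k0].
  rewrite (@LI_eq _ _ _ _ (fun=> h / pi)); last by move=> t _; rewrite mul0r mulr0 cos0 mulr1.
  rewrite LI_cst// subr0 mulrA divfK ?divff//; exact/lt0r_neq0.
set u := k%:~R * h; have u0 : u != 0 by rewrite mulf_neq0 ?intr_eq0// gt_eqF.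
have bc : bm (fun t : R => h / pi * cos (t * u)) by apply: bmZ; exact: bm_cos_mul.
pose P t := h / pi * (sin (t * u) / u).
have dP (t : R) : is_derive t 1 P (h / pi * cos (t * u)).
  have d1 : is_derive t 1 (fun t => sin (t * u)) (cos (t * u) * u).
    have dl : is_derive t 1 (fun t => t * u) u.
      have := is_deriveM (is_derive_id t (1 : R)) (is_derive_cst u t (1 : R)).
      have -> : ((fun x : R => x) * cst u) = (fun t => t * u) by apply/funext.
      move=> hh; apply: is_derive_eq.
      by rewrite /GRing.scale /= mulr0 add0r mulr1.
    have := @is_derive1_comp R (@sin R) (fun t => t * u) t (cos (t * u)) u.
    by apply.
  have d4 := is_deriveM d1 (is_derive_cst u^-1 t (1 : R)).
  have := is_deriveM (is_derive_cst (h / pi) t (1 : R)) d4.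
  move=> hh; apply: is_derive_eq.
  by rewrite /GRing.scale /=; move: (h / pi) => c; field.
have cP : {within `[0, pi / h], continuous P}.
  apply: derivable_within_continuous => x _.
  by have hh := dP x; exact: ex_derive.
have cf (t : R) : 0 < t < pi / h -> {for t, continuous (fun t : R => h / pi * cos (t * u))}.
  move=> _; apply: cvgM; first exact: cvg_cst.
  apply: (@continuous_comp _ _ _ (fun t : R => t * u) (@cos R)); last exact: continuous_cos.
  by apply: cvgMl; exact: cvg_id.
have e : P (pi / h) - P 0 = 0.
  rewrite /P mul0r sin0 mul0r mulr0 subr0.
  have -> : pi / h * u = k%:~R * pi by rewrite /u mulrCA divfK// gt_eqF.
  by rewrite sin_int_pi mul0r mulr0.
rewrite -[RHS]e; apply: le_anti; apply/andP; split.
  by apply: (@LI_le_primitive _ _ _ _ P (fun t => h / pi * cos (t * u)) ph bc cf _ cP).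
by apply: (@LI_ge_primitive _ _ _ _ P (fun t => h / pi * cos (t * u)) ph bc cf _ cP).
Qed.

End lattices.

Section lattice_case.
Context {R : realType}.
Implicit Types (F : probability (measurableTypeR R) R) (A p f w : R -> R).

(* The constant is twice that of the theorem, the renewal measure of the lazy law
   being twice that of F. *)
Definition lazy_srt F A (h : R) : Prop := forall e : R, 0 < e -> exists2 x1 : R, 1 <= x1 &
  forall x : R, x1 <= x -> exists N0 : nat, forall N, (N0 <= N)%N ->
    `|\sum_(n < N) Qn F h n x - 2 / pi * h * (A x / x)| <= e * (A x / x).

(* Only the indices eta A(x) <= n <= A(x) / eta matter. *)
Lemma lazy_srt_middle F A (h : R) : half_tail F A -> L_dominated A -> 0 < h ->
  (forall e : R, 0 < e -> exists2 eta0 : R, 0 < eta0 & forall eta : R, 0 < eta <= eta0 ->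
   exists2 x1 : R, 1 <= x1 & forall (x : R) (N M : nat), x1 <= x -> 
    N%:R <= eta * A x -> eta * A x <= 2 * N%:R -> A x <= eta * M%:R -> eta * M%:R <= 2 * A x ->
    `|\sum_(n < M) late N n * Qn F h n x - 2 / pi * h * (A x / x)| <= e * (A x / x)) ->
  lazy_srt F A h.
Proof.
move=> hF HL h0 H e e0; have rA := ht_rv hF.
have e3 : 0 < e / 3 by rewrite divr_gt0.
have [eta1 eta10 H1] := H _ e3.
have [eta2 [x2 [/andP[eta20 eta21] x21 H2]]] := ends_small hF HL h0 e3.
pose eta := Num.min eta1 eta2.
have eta0 : 0 < eta by rewrite lt_min eta10.
have etal1 : eta <= eta1 by rewrite ge_min lexx.
have etal2 : eta <= eta2 by rewrite ge_min lexx orbT.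
have [x1 x11 {}H1] := H1 eta (introT andP (conj eta0 etal1)).
have [x3 x31 H3] := A_large rA (2 / eta).
exists (Num.max (Num.max x1 x2) x3) => [|x]; first by rewrite !le_max x11.
rewrite !ge_max => /andP[/andP[xx1 xx2] xx3].
have x0 : 0 < x by clear -x31 xx3; lra.
have Ax := A_gt0 rA (ltW x0).
have [hA _ _] := H3 x xx3.
have eA2 : 2 <= eta * A x by rewrite mulrC -ler_pdivrMr.
have eA : 0 <= eta * A x by rewrite mulr_ge0// ltW.
have Ae : 0 <= A x / eta by rewrite divr_ge0// ltW.
have /andP[N1 N2] := truncn_itv eA.
have /andP[M1 M2] := truncn_itv Ae.
set N := Num.truncn (eta * A x) in N1 N2.
pose M := (Num.truncn (A x / eta)).+1.
have Nt : eta * A x <= 2 * N%:R.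
  by move: N2; rewrite -natr1 => N2; clear -N2 eA2 N1; lra.
have MA : A x <= eta * M%:R by rewrite mulrC -ler_pdivrMr// ltW.
have MA2 : eta * M%:R <= 2 * A x.
  have eta1' : eta <= 1 by exact: le_trans eta21.
  have h1 : eta <= A x.
    have : eta * A x <= A x by rewrite ler_piMl// ltW.
    by clear -eA2 eta1'; move=> ?; lra.
  rewrite /M -natr1 mulrDr mulr1 mulrC.
  have h2 : (Num.truncn (A x / eta))%:R * eta <= A x by rewrite -ler_pdivlMr.
  by rewrite [leRHS]mulrDl !mul1r lerD.
clearbody M.
have hm := H1 x N M xx1 N1 Nt MA MA2.
have u0 : 0 < A x / x by rewrite divr_gt0.
exists M => M' MM'.
have NA2 : N%:R <= eta2 * A x by apply: le_trans N1 _; rewrite ler_wpM2r// ltW.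
have MA' : A x <= eta2 * M%:R by apply: le_trans MA _; rewrite ler_wpM2r.
have [s1 s2] := H2 x N M M' xx2 NA2 MA'.
have Q0 n : 0 <= Qn F h n x by exact: Qn_ge0.
have E2 : \sum_(n < M') Qn F h n x <= \sum_(n < N) Qn F h n x + \sum_(n < M) late N n * Qn F h n x +
    \sum_(n < M') late M n * Qn F h n x.
  have step1 : \sum_(n < M') Qn F h n x <= \sum_(n < M) Qn F h n x + \sum_(n < M') late M n * Qn F h n x.
    apply: (sum_cut (f := fun n => Qn F h n x) (g := fun n => late M n * Qn F h n x)) => // [n|n Mn].
      by rewrite mulr_ge0.
    by rewrite /late Mn mul1r.
  apply: le_trans step1 _; rewrite lerD2r.
  apply: (sum_cut (f := fun n => Qn F h n x) (g := fun n => late N n * Qn F h n x)) => // [n|n Mn].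
    by rewrite mulr_ge0.
  by rewrite /late Mn mul1r.
have E3 : \sum_(n < M) late N n * Qn F h n x <= \sum_(n < M') Qn F h n x.
  apply: (@le_trans _ _ (\sum_(n < M) Qn F h n x)).
    by apply: ler_sum => n _; rewrite ler_piMl// /late; case: (N <= n)%N.
  by rewrite -(subnK MM') addnC big_split_ord/= lerDl sumr_ge0.
move: hm s1 s2 E2 E3; rewrite !ler_norml.
move: (\sum_(_ < N) _) (\sum_(_ < M) _) (\sum_(_ < M') Qn _ _ _ _) (\sum_(_ < M') _ * _) => a b c d.
move: (2 / pi * h * (A x / x)) (A x / x) u0 => p u u0 /andP[h1 h2] s1 s2 E2 E3.
have eu : 0 <= e * u by rewrite mulr_ge0// ltW.
by clear -u0 h1 h2 s1 s2 E2 E3 eu; apply/andP; split; lra.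
Qed.

(** On the lattice the window indicator coincides with a band-limited function of band [0, pi/h]
    ([bl_lattice]), so Fourier inversion is exact once x is rounded down to a lattice point. *)
Lemma Qn_floor F (h x : R) : 0 < h -> F (lattice h) = 1%E -> exists X : R,
  [/\ lattice h X, X <= x, x < X + h & forall n j : nat, Qn F h n (x - j%:R * h) =
    iter n (Op (lazyF F) (fun=> 1)) (bl (pi / h) (fun=> h / pi)) (X - j%:R * h)].
Proof.
move=> h0 FL; have /andP[k1 k2] := floor_itv (x / h).
set k := Num.floor _ in k1 k2.
pose X := k%:~R * h.
have LX : lattice h X by exists k.
have r0 : 0 <= x - X by rewrite subr_ge0 -ler_pdivlMr.
have rh : x < X + h by move: k2; rewrite ltr_pdivrMr// intrD mulrDl mul1r.
exists X; split => //; first by rewrite -subr_ge0.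
move=> n j; have -> : x - j%:R * h = (X - j%:R * h) + (x - X) by ring.
have Lj : lattice h (X - j%:R * h) by apply: lattice_sub => //; exists j%:Z.
have /(congr1 (fun g => g (X - j%:R * h))) := @iter_shift _ (lazyF F) (fun=> 1) (chi h) (x - X) n.
rewrite /Qn => <-.
apply: (iter_lattice n FL) => //.
- have -> : (fun v : R => chi h (v + (x - X))) = (fun v : R => (X - x <= v)%R%:R - (X - x + h <= v)%R%:R).
    apply/funext => v; rewrite /chi -lerBlDr sub0r opprB.
    have -> : (v + (x - X) < h) = ~~ (X - x + h <= v).
      by rewrite -ltNge -ltrBrDr; congr (_ < _); ring.
    case: (leP (X - x + h) v) => hv /=; last by rewrite andbT subr0.
    rewrite andbF; have -> : X - x <= v by apply: le_trans hv; rewrite lerDl ltW.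
    by rewrite subrr.
  by apply: bmB; exact: bm_ge.
- by apply: bm_bl; exact: bm_cst.
move=> v Lv; rewrite bl_lattice// (chi_lattice h0 r0)//.
by rewrite ltrBlDl.
Qed.

(** J consecutive lattice windows fill a length [l] close to [eps * x]. Flatness equates J times the
    middle sum at x with their total, which [window_sum] and [A_increment] evaluate as 4/pi * (l/2)
    * A(x)/x, up to errors of at most e/4, e/2 and e/4. *)
Lemma arithmetic_srt F A (h : R) : half_tail F A -> L_dominated A -> 0 < h ->
  F (lattice h) = 1%E -> (forall h' : R, 0 < h' -> F (lattice h') = 1%E -> h' <= h) ->
  lazy_srt F A h.
Proof.
move=> hF HL h0 FL maxh; have rA := ht_rv hF.
have p0 := pi_gt0 R.
pose T := pi / h; have T0 : 0 < T by rewrite divr_gt0.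
(* A zero of the deficit at [th <= pi / h] would put F on a lattice of step [2 * pi / th >= 2 * h],
   against the maximality of [h]. *)
have decp (th : R) : 0 < th <= T -> 0 < dec F th.
  move=> /andP[th0 thT]; rewrite ltNge; apply/negP => /(dec_eq0_lattice th0) FL'.
  have q0 : 0 < 2 * pi / th by rewrite divr_gt0// mulr_gt0.
  have := maxh _ q0 FL'; apply/negP; rewrite -ltNge ltr_pdivlMr//.
  have : h * th <= pi by rewrite mulrC -ler_pdivlMr.
  by move: (pi : R) p0 => p p0 hp; clear -p0 hp; lra.
have [c0 c00 Hc] := dec_lower hF T0 decp.
apply: lazy_srt_middle => // e e0.
pose e1 := e / (4 * h); have e10 : 0 < e1 by rewrite divr_gt0// mulr_gt0.
have [eta0 /andP[eta00 _] HW] := window_sum hF HL e10.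
exists eta0 => // eta /andP[etap etal].
pose W := h / pi; have W0 : 0 <= W by rewrite divr_ge0// ltW.
have eta2 : 0 < eta / 2 by rewrite divr_gt0.
have bw : bm (fun _ : R => W) by exact: bm_cst.
have wW (th : R) : `|W| <= W by rewrite ger0_norm.
have [C [xf [C0 xf1 HF]]] := flatness hF T0 c00 Hc bw W0 wW eta2.
(* Bounds the flatness error by [4 * C * eps] and the error in the increment of [A] by
   [8 * h * eps], each at most e/4 per window. [e2] is then taken proportional to [eps]. *)
pose eps := Num.min (1/4) (Num.min (e / (16 * C)) (e / (32 * h))).
have eps0 : 0 < eps.
  by rewrite !lt_min; apply/and3P; split; rewrite ?divr_gt0 ?mulr_gt0.
have epsl : eps <= 1/4 by rewrite ge_min lexx.
have epsC : 4 * C * eps <= e / 4.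
  have : eps <= e / (16 * C) by rewrite !ge_min lexx orbT.
  by rewrite ler_pdivlMr ?mulr_gt0// => hh; clear -hh; lra.
have epsh : 8 * h * eps <= e / 4.
  have : eps <= e / (32 * h) by rewrite !ge_min lexx !orbT.
  by rewrite ler_pdivlMr ?mulr_gt0// => hh; clear -hh; lra.
clearbody eps.
pose e2 := e * eps / (8 * h); have e20 : 0 < e2 by rewrite divr_gt0 ?mulr_gt0.
have [xw xw1 {}HW] := HW e2 e20.
have [xi xi1 HI] := A_increment rA eps0 epsl.
exists (Num.max (Num.max (2 * xf) xw) (Num.max (Num.max xi (2 * h / eps)) (2 * h))).
  by rewrite !le_max xw1 !orbT.
move=> x N M; rewrite !ge_max => /andP[/andP[xxf xxw] /andP[/andP[xxi xxe] xxh]] N1 N2 M1 M2.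
have x0 : 0 < x by clear -xxw xw1; lra.
have Ax := A_gt0 rA (ltW x0).
have xeps : 2 * h <= eps * x by rewrite [leRHS]mulrC -ler_pdivrMr.
have xh0 : 0 <= eps * x / h by rewrite divr_ge0 ?mulr_ge0// ltW.
have /andP[J1 J2] := truncn_itv xh0.
set J := Num.truncn _ in J1 J2.
pose l := J%:R * h.
have lx : l <= eps * x by rewrite -ler_pdivlMr.
have lx2 : eps * x <= 2 * l.
  by move: J2; rewrite ltr_pdivrMr// -natr1 mulrDl mul1r -/l => J2; clear -J2 xeps; lra.
have l0 : 0 < l by clear -lx2 xeps h0; lra.
have J0 : 0 < J%:R :> R by rewrite -(pmulr_lgt0 _ h0).
have lx4 : eps * x <= 1/4 * x by rewrite ler_wpM2r// ltW.
have lx' : l <= x / 2 by clear -lx lx4 x0; lra.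
have N1' : N%:R <= eta0 * A x by apply: le_trans N1 _; rewrite ler_wpM2r// ltW.
have M1' : A x <= eta0 * M%:R by apply: le_trans M1 _; rewrite ler_wpM2r.
have hw := HW x l N M xxw (ltW l0) lx' N1' M1'.
have /andP[i1 i2] := HI x l xxi (ltW l0) lx.
pose D y := \sum_(n < M) late N n * Qn F h n y.
have SD : \sum_(n < M) late N n * (iter n (Op (lazyF F) (fun=> 1)) pos1 x -
   iter n (Op (lazyF F) (fun=> 1)) pos1 (x - l)) = \sum_(j < J) D (x - j%:R * h).
  rewrite exchange_big/=; apply: eq_bigr => n _.
  by rewrite -mulr_sumr pos1_blocks.
have fl j : (j < J)%N -> `|D x - D (x - j%:R * h)| <= 4 * C * l * (A x / x ^+ 2).
  move=> jJ; have [X [LX Xx xX XE]] := Qn_floor x h0 FL.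
  have Xx2 : x / 2 <= X by clear -xX xxh; lra.
  have X0 : 0 < X by clear -Xx2 x0; lra.
  have AX := A_gt0 rA (ltW X0).
  have AXx : A X <= A x by apply: (A_le rA) => //; exact: ltW.
  have NX : eta / 2 * A X <= N%:R.
    apply: (@le_trans _ _ (eta / 2 * A x)).
      by rewrite ler_wpM2l// ltW.
    by move: N2; clear; move=> ?; lra.
  have Xf : xf <= X by clear -Xx2 xxf; lra.
  have := HF X (X - j%:R * h) N M Xf NX.
  have -> : X - (X - j%:R * h) = j%:R * h by ring.
  have -> : \sum_(n < M) late N n * (iter n (Op (lazyF F) (fun=> 1)) (bl T (fun=> W)) X -
     iter n (Op (lazyF F) (fun=> 1)) (bl T (fun=> W)) (X - j%:R * h)) = D x - D (x - j%:R * h).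
    rewrite /D -sumrB; apply: eq_bigr => n _; rewrite XE -mulrBr; congr (_ * (_ - _)).
    by have := XE n 0%N; rewrite !mul0r !subr0 => ->.
  move=> /le_trans; apply.
  have jl : `|j%:R * h| <= l.
    by rewrite ger0_norm ?mulr_ge0 ?(ltW h0)// ler_wpM2r ?(ltW h0)// ler_nat ltnW.
  have Ax2 : A X / X ^+ 2 <= 4 * (A x / x ^+ 2).
    rewrite ler_pdivrMr ?exprn_gt0//.
    have -> : 4 * (A x / x ^+ 2) * X ^+ 2 = A x * ((2 * X) ^+ 2 / x ^+ 2) by ring.
    apply: le_trans AXx _; rewrite ler_peMr ?(ltW Ax)// ler_pdivlMr ?exprn_gt0// mul1r.
    by rewrite lerXn2r ?nnegrE ?mulr_ge0 ?(ltW x0) ?(ltW X0)//; clear -Xx2; lra.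
  apply: (@le_trans _ _ (C * l * (4 * (A x / x ^+ 2)))); last first.
    by rewrite le_eqVlt; apply/orP; left; apply/eqP; ring.
  apply: ler_pM; [by rewrite mulr_ge0// ltW|by rewrite divr_ge0 ?sqr_ge0// ltW|
    by rewrite ler_wpM2l// ltW|exact: Ax2].
have flS : `|J%:R * D x - \sum_(j < J) D (x - j%:R * h)| <= J%:R * (4 * C * l * (A x / x ^+ 2)).
  have -> : J%:R * D x - \sum_(j < J) D (x - j%:R * h) = \sum_(j < J) (D x - D (x - j%:R * h)).
    by rewrite sumrB sumr_const card_ord mulr_natl.
  apply: le_trans (ler_norm_sum _ _ _) _.
  apply: (@le_trans _ _ (\sum_(j < J) (4 * C * l * (A x / x ^+ 2)))).
    by apply: ler_sum => j _; exact: fl.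
  by rewrite sumr_const card_ord -[leLHS]mulr_natl lexx.
rewrite SD in hw.
rewrite -/(D x) -(ler_pM2l J0) -[X in X * `|_|]ger0_norm ?(ltW J0)// -normrM mulrBr.
have u0 : 0 < A x / x by rewrite divr_gt0.
have p42 : 4 / pi <= 2 :> R.
  by rewrite ler_pdivrMr//; have := pi_ge2 R; move: (pi : R) => p hp; clear -hp; lra.
have p40 : 0 < 4 / pi :> R by rewrite divr_gt0.
have cE : J%:R * (2 / pi * h * (A x / x)) = 4 / pi * (l / 2 * (A x / x)).
  by rewrite /l; move: (pi : R) p0 => p p0; field; rewrite !gt_eqF.
rewrite cE.
have B1 : `|4 / pi * (A x - A (x - l)) - 4 / pi * (l / 2 * (A x / x))| <= 2 * (8 * eps * (l / 2 * (A x / x))).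
  rewrite -mulrBr normrM gtr0_norm//; apply: ler_pM => //; first exact: ltW.
  by rewrite ler_norml; apply/andP; split;
    [move: i1; rewrite mulrBl mul1r|move: i2; rewrite mulrDl mul1r]; move: (A x) (A (x - l)) (l / 2 * _) => q q' v hh; clear -hh; lra.
have R1 : J%:R * (4 * C * l * (A x / x ^+ 2)) <= e / 4 * (J%:R * (A x / x)).
  have -> : J%:R * (4 * C * l * (A x / x ^+ 2)) = (4 * C * (l / x)) * (J%:R * (A x / x)) by field; rewrite gt_eqF.
  apply: ler_wpM2r; first by rewrite mulr_ge0// ltW.
  apply: le_trans epsC.
  by rewrite ler_wpM2l ?mulr_ge0 ?(ltW C0)// ler_pdivrMr.
have R2 : 2 * (8 * eps * (l / 2 * (A x / x))) <= e / 4 * (J%:R * (A x / x)).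
  have -> : 2 * (8 * eps * (l / 2 * (A x / x))) = (8 * h * eps) * (J%:R * (A x / x)) by rewrite /l; field; rewrite gt_eqF.
  by rewrite ler_wpM2r// mulr_ge0// ltW.
have R3 : (e1 * (l / x) + e2) * A x <= e / 2 * (J%:R * (A x / x)).
  have -> : (e1 * (l / x) + e2) * A x = (e1 * l + e2 * x) * (A x / x) by field; rewrite gt_eqF.
  rewrite [leRHS]mulrA; apply: ler_wpM2r; first exact: ltW.
  have -> : e1 * l = e / 4 * J%:R by rewrite /e1 /l; field; rewrite gt_eqF.
  have : e2 * x <= e / 4 * J%:R.
    have -> : e2 * x = e / (8 * h) * (eps * x) by rewrite /e2; ring.
    have -> : e / 4 * J%:R = e / (8 * h) * (2 * l) by rewrite /l; field; rewrite gt_eqF.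
    by rewrite ler_wpM2l// divr_ge0 ?mulr_ge0 ?(ltW e0)// ltW.
  by move=> hh; clear -hh; lra.
move: flS hw B1 R1 R2 R3.
move: (J%:R * (4 * _ * _ * _)) (2 * (8 * _ * _)) ((e1 * _ + _) * _) => b1 b2 b3.
move: (J%:R * D x) (\sum_(_ < _) _) (4 / pi * (A x - _)) (4 / pi * (l / 2 * _)) => a1 a2 a3 a4.
have -> : J%:R * (e * (A x / x)) = e / 4 * (J%:R * (A x / x)) + (e / 4 * (J%:R * (A x / x)) + e / 2 * (J%:R * (A x / x))).
  by field; rewrite gt_eqF.
move: (e / 4 * _) (e / 2 * _) => b4 b5 h1 h2 h3 h4 h5 h6.
have := lerD (lerD h1 h2) h3 => hh.
have tri : `|a1 - a4| <= `|a1 - a2| + `|a2 - a3| + `|a3 - a4|.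
  have -> : a1 - a4 = (a1 - a2) + (a2 - a3) + (a3 - a4) by ring.
  by apply: le_trans (ler_normD _ _) _; rewrite lerD2r ler_normD.
apply: le_trans tri _; apply: le_trans hh _; clear -h4 h5 h6; lra.
Qed.

End lattice_case.

(** * Non-arithmetic laws *)

Section reflection.
Context {R : realType}.

Definition refl_at (z s : measurableTypeR R) : measurableTypeR R := z - s.

Lemma measurable_refl (z : R) : measurable_fun [set: measurableTypeR R] (refl_at z).
Proof.
have := @measurable_funB _ _ R [set: measurableTypeR R] (cst z) id.
by apply; [exact: measurable_cst|exact: measurable_id].
Qed.

(** The reflection maps half-open intervals to half-open intervals of the same length, so uniqueness
    of Lebesgue measure identifies the image measure. *)
Lemma LI_reflect (f : R -> R) (a b z : R) : bm f ->
  LI a b (fun s => f (z - s)) = LI (z - b) (z - a) f.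
Proof.
move=> bf; have mz := measurable_refl z.
have mf : measurable_fun [set: measurableTypeR R] (EFin \o f).
  by apply/measurable_EFinP; case: bf.
pose D : set (measurableTypeR R) := `[z - b, z - a]%classic.
have mD : measurable D by exact: (@measurable_itv R).
have pD : refl_at z @^-1` D = `[a, b]%classic.
  apply/seteqP; split => s; rewrite /D /refl_at /= !in_itv/= => /andP[h1 h2]; apply/andP; split; lra.
have bfz : bm (fun s : R => f (z - s)) by exact: bm_shift.
have fi : (@lebesgue_measure R).-integrable (refl_at z @^-1` D) ((EFin \o f) \o refl_at z).
  by rewrite pD; exact: (bm_integrable_itv a b bfz).
have e := integral_pushforward mz mf fi mD.
rewrite /LI /Rintegral; congr fine.
rewrite pD in e; rewrite -[LHS]e.
apply: eq_measure_integral => B mB _.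
apply/esym/lebesgue_measure_unique => //= _ [[c d]] _ <-.
rewrite /pushforward.
have -> : refl_at z @^-1` `]c, d]%classic = `[z - d, z - c[%classic.
  apply/seteqP; split => s; rewrite /refl_at /= !in_itv/= => /andP[h1 h2]; apply/andP; split; lra.
rewrite !lebesgue_measure_itv/= !lte_fin ltrD2l ltrN2.
by congr (if _ then _ else _); rewrite -EFinB -EFinB; congr EFin; ring.
Qed.

End reflection.

Section fejer_mass.
Context {R : realType}.
Implicit Types (T D E p q rho : R).

Lemma LI_sub (f : R -> R) (a a' b b' : R) : bm f -> (forall s, 0 <= f s) ->
  a' <= a -> a <= b -> b <= b' -> LI a b f <= LI a' b' f.
Proof.
move=> bf f0 aa ab bb; rewrite (LI_split bf aa (le_trans ab bb)) (LI_split bf ab bb).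
have h1 : 0 <= LI a' a f by exact: LI_ge0.
have h2 : 0 <= LI b b' f by exact: LI_ge0.
by rewrite addrCA lerDl addr_ge0.
Qed.

Lemma fej_even T (y : R) : fej T (- y) = fej T y.
Proof. by apply: LI_eq => t _; rewrite mulrN cosN. Qed.

Lemma fej_tail T D E : 0 < T -> 0 < D -> D <= E -> LI D E (fej T) <= 2 / (T * D).
Proof.
move=> T0 D0 DE.
pose P (s : R) : R := - (2 / T) * s^-1.
pose dP (s : R) : R := 2 / (T * s ^+ 2).
have dPP (s : R) : D <= s -> is_derive s 1 P (dP s).
  move=> Ds; have s0 : s != 0 by rewrite gt_eqF// (lt_le_trans D0).
  have h2 := is_deriveV s0 (is_derive_id s (1 : R)).
  have := is_deriveM (is_derive_cst (- (2 / T)) s (1 : R)) h2.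
  move=> h; apply: is_derive_eq; rewrite /GRing.scale /= /dP; field.
  by rewrite s0 gt_eqF.
have bf := @bm_fej R T T0.
have cP : {within `[D, E], continuous P}.
  apply: derivable_within_continuous => s; rewrite in_itv/= => /andP[Ds _].
  by have h := dPP s Ds; exact: ex_derive.
have cf (t : R) : D < t < E -> {for t, continuous (fej T)}.
  move=> tDE; apply: (@near_eq_continuous _ _ (fun y => (1 - cos (T * y)) / (T * y ^+ 2)) D E t) => //.
    by move=> y /andP[Dy _]; rewrite fejE// gt_eqF// (lt_trans D0).
  have t0 : 0 < t by case/andP: tDE => Dt _; exact: lt_trans Dt.
  apply: cvgM.
    apply: cvgB; first exact: cvg_cst.
    apply: (@continuous_comp _ _ _ (fun t : R => T * t) (@cos R)); last exact: continuous_cos.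
    by apply: cvgMr; exact: cvg_id.
  apply: cvgV; first by rewrite gt_eqF// mulr_gt0// exprn_gt0.
  by apply: cvgMr; apply: cvgM; exact: cvg_id.
have h : LI D E (fej T) <= P E - P D.
  apply: (@LI_le_primitive _ _ _ _ P dP DE bf cf _ cP).
    by move=> t /andP[Dt _]; apply: dPP; exact: ltW.
  by move=> t /andP[Dt _]; apply: fej_decay => //; rewrite gt_eqF// (lt_trans D0).
apply: le_trans h _; rewrite /P.
have E0 : 0 < E by exact: lt_le_trans DE.
have -> : - (2 / T) * E^-1 - - (2 / T) * D^-1 = 2 / (T * D) - 2 / T * E^-1.
  by field; rewrite !gt_eqF.
by rewrite gerBl mulr_ge0 ?divr_ge0 ?invr_ge0// ltW.
Qed.

Lemma fej_far T D p q : 0 < T -> 0 < D -> p <= q -> D <= p \/ q <= - D ->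
  LI p q (fej T) <= 2 / (T * D).
Proof.
move=> T0 D0 pq; have key a b : D <= a -> a <= b -> LI a b (fej T) <= 2 / (T * D).
  move=> Da ab; have a0 : 0 < a by exact: lt_le_trans Da.
  apply: le_trans (fej_tail T0 a0 ab) _.
  by rewrite ler_wpM2l// lef_pV2 ?posrE ?mulr_gt0// ler_wpM2l// ltW.
case=> [Dp|qD]; first exact: key.
have -> : LI p q (fej T) = LI (0 - q) (0 - p) (fej T).
  rewrite -LI_reflect; last exact: bm_fej.
  by apply: LI_eq => s _; rewrite sub0r fej_even.
by apply: key; rewrite !sub0r ?lerN2// lerNr.
Qed.

(** The kernel's mass near 0; up to [4 / (T * rho)] it bounds the mass of any segment
    ([mass_upper]). Its value cancels between [kernel_asymp], where the kernel is averaged over a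
    long window, and [nonarithmetic_srt], where it smooths a short one. *)
Definition mass T rho : R := LI (- rho) rho (fej T).

Lemma mass_ge T rho : 0 < T -> (2 * T)^-1 <= rho -> cF <= mass T rho.
Proof.
move=> T0 Tr; have bf := @bm_fej R T T0.
have T2 : 0 < (2 * T)^-1 by rewrite invr_gt0 mulr_gt0.
apply: (@le_trans _ _ (LI (- (2 * T)^-1) (2 * T)^-1 (fej T))); last first.
  apply: (LI_sub bf (fun s => fej_ge0 _ T0)); [by rewrite lerN2| |exact: Tr].
  by apply: (@le_trans _ _ 0); rewrite ?oppr_le0 ltW.
apply: (@le_trans _ _ (LI (- (2 * T)^-1) (2 * T)^-1 (fun=> cF * T))).
  rewrite LI_cst; last by apply: (@le_trans _ _ 0); rewrite ?oppr_le0 ltW.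
  by rewrite le_eqVlt; apply/orP; left; apply/eqP; field; rewrite gt_eqF.
apply: LI_le => //; first exact: bm_cst.
by move=> y hy; apply: fej_ge => //; rewrite ler_norml.
Qed.

Lemma mass_upper T rho p q : 0 < T -> 0 < rho -> p <= q ->
  LI p q (fej T) <= mass T rho + 4 / (T * rho).
Proof.
move=> T0 r0 pq; have bf := @bm_fej R T T0.
pose E : R := Num.max (Num.max `|p| `|q|) rho.
have Er : rho <= E by rewrite le_max lexx orbT.
have pE : - E <= p.
  by rewrite lerNl; apply: (@le_trans _ _ `|p|); [rewrite -normrN ler_norm|rewrite !le_max lexx].
have qE : q <= E by apply: le_trans (ler_norm q) _; rewrite !le_max lexx orbT.
apply: (@le_trans _ _ (LI (- E) E (fej T))).
  exact: (LI_sub bf (fun s => fej_ge0 _ T0) pE pq qE).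
have rr : - rho <= rho by apply: (@le_trans _ _ 0); rewrite ?oppr_le0 ltW.
have Nr : - E <= - rho by rewrite lerN2.
rewrite (LI_split bf Nr (le_trans rr Er)) (LI_split bf rr Er) -/(mass T rho).
have h1 := fej_far T0 r0 Nr (or_intror (lexx _)).
have h2 := fej_far T0 r0 Er (or_introl (lexx _)).
have -> : 4 / (T * rho) = 2 / (T * rho) + 2 / (T * rho) by field; rewrite !gt_eqF.
by move: (mass T rho) h1 h2 => m; move: (LI _ _ _) (LI _ _ _) (2 / _) => a b c h1 h2; clear -h1 h2 m a b c; lra.
Qed.

Lemma mass_lower T rho p q : 0 < T -> 0 < rho -> p <= - rho -> rho <= q ->
  mass T rho <= LI p q (fej T).
Proof.
move=> T0 r0 pr rq; have bf := @bm_fej R T T0.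
apply: (LI_sub bf (fun s => fej_ge0 _ T0) pr _ rq).
by apply: (@le_trans _ _ 0); rewrite ?oppr_le0 ltW.
Qed.

End fejer_mass.

Section late_sums.
Context {R : realType} (F : probability (measurableTypeR R) R).
Implicit Types (f g : R -> R).

Definition Dl (N M : nat) f (x : R) : R :=
  \sum_(n < M) late N n * iter n (Op (lazyF F) (fun=> 1)) f x.

Let b1 : bm (fun _ : R => 1 : R). Proof. exact: bm_cst. Qed.

Lemma bm_Dl N M f : bm f -> bm (Dl N M f).
Proof. by move=> bf; apply: bm_sum => n; apply: bmZ; exact: bm_iter. Qed.

Lemma Dl_le N M f g x : bm f -> bm g -> (forall y, f y <= g y) -> Dl N M f x <= Dl N M g x.
Proof.
by move=> bf bg fg; apply: ler_sum => n _; rewrite ler_wpM2l//; exact: iter_le.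
Qed.

Lemma DlD N M f g x : bm f -> bm g ->
  Dl N M (fun y => f y + g y) x = Dl N M f x + Dl N M g x.
Proof.
move=> bf bg; rewrite /Dl -big_split/=; apply: eq_bigr => n _.
by rewrite iter_opD// mulrDr.
Qed.

Lemma DlZ N M c f x : bm f -> Dl N M (fun y => c * f y) x = c * Dl N M f x.
Proof.
by move=> bf; rewrite /Dl mulr_sumr; apply: eq_bigr => n _; rewrite iterZ// mulrCA.
Qed.

Lemma Dl_shift N M f a x : Dl N M (fun y => f (y + a)) x = Dl N M f (x + a).
Proof. by apply: eq_bigr => n _; rewrite iter_shift. Qed.

Lemma iter_cst n (c x : R) : iter n (Op (lazyF F) (fun=> 1)) (fun=> c) x = c.
Proof.
elim: n x => //= n IH x.
have -> : iter n (Op (lazyF F) (fun=> 1)) (fun=> c) = fun=> c by apply/funext.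
by rewrite /Op J_cst J_lazy1 mulr1 mul1r.
Qed.

Lemma Dl_cst_le N M (c x : R) : 0 <= c -> Dl N M (fun=> c) x <= M%:R * c.
Proof.
move=> c0; apply: (@le_trans _ _ (\sum_(n < M) c)).
  apply: ler_sum => n _; rewrite iter_cst ler_piMl// /late; by case: (N <= n)%N.
by rewrite sumr_const card_ord -[leLHS]mulr_natl lexx.
Qed.

Lemma Op_leb a b f x : bm f -> Op (leb a b) (fun=> 1) f x = LI a b (fun s => f (x - s)).
Proof.
move=> bf; rewrite LI_J; last exact: bm_shift.
by congr (J _ _); apply/funext => s; rewrite mul1r.
Qed.

Lemma Dl_LI N M a b f x : bm f ->
  Dl N M (fun z => LI a b (fun s => f (z - s))) x = LI a b (fun s => Dl N M f (x - s)).
Proof.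
move=> bf; have bi n : bm (iter n (Op (lazyF F) (fun=> 1)) f) by exact: bm_iter.
rewrite -(Op_leb a b); last exact: bm_Dl.
rewrite /Dl (Op_sum (leb a b) _ _ b1); last by move=> n; exact: bmZ.
apply: eq_bigr => n _; rewrite OpZ//; congr (_ * _).
have -> : (fun z => LI a b (fun s => f (z - s))) = Op (leb a b) (fun=> 1) f.
  by apply/funext => z; rewrite Op_leb.
by rewrite iter_comm.
Qed.

Lemma bm_LI_shift a b f : bm f -> bm (fun z : R => LI a b (fun s => f (z - s))).
Proof.
move=> bf; have -> : (fun z => LI a b (fun s => f (z - s))) = Op (leb a b) (fun=> 1) f.
  by apply/funext => z; rewrite Op_leb.
exact: bm_Op.
Qed.

Lemma LI_near (g : R -> R) (a b x E : R) : bm g -> a <= b ->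
  (forall s, a <= s <= b -> `|g x - g (x - s)| <= E) ->
  (b - a) * (g x - E) <= LI a b (fun s => g (x - s)) <= (b - a) * (g x + E).
Proof.
move=> bg ab H; have bs : bm (fun s : R => g (x - s)) by exact: bm_shift.
apply/andP; split; rewrite mulrC -LI_cst//; apply: LI_le => //; try exact: bm_cst.
  by move=> s /H; rewrite ler_norml => /andP[h1 h2]; lra.
by move=> s /H; rewrite ler_norml => /andP[h1 h2]; lra.
Qed.

End late_sums.

Section nonlattice_case.
Context {R : realType}.
Implicit Types (F : probability (measurableTypeR R) R) (A f g : R -> R).

Definition middle_range A (eta x : R) (N M : nat) : Prop :=
  [/\ N%:R <= eta * A x, eta * A x <= 2 * N%:R, A x <= eta * M%:R & eta * M%:R <= 2 * A x].

Let lower_arith (eps C m p t e d : R) : 0 <= eps -> eps <= 1/4 -> 0 <= C -> 0 <= m -> p <= 1 -> 0 <= e ->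
  m * t + (m + 4 * C) * eps < e ->
  m * (p - t) <= (1 + eps) * (d + 2 * C * eps) -> p * m - e <= d.
Proof.
move=> h1 h2 h3 h4 h6 he h7 h8; rewrite leNgt; apply/negP => h9.
have a1 : 0 <= (1 + eps) * (p * m - e - d) by rewrite mulr_ge0//; clear -h1 h9; lra.
have a2 : eps * (p * m) <= eps * m by rewrite ler_wpM2l// ler_piMl.
have a3 : eps * (C * eps) <= 1/4 * (C * eps) by rewrite ler_wpM2r// mulr_ge0.
have a4 : 0 <= eps * e by rewrite mulr_ge0.
have a5 : 0 <= C * eps by rewrite mulr_ge0.
(clear -h7 h8 a1 a2 a3 a4 a5; lra).
Qed.

Let upper_arith (eps C mu p t e d : R) : 0 <= eps -> eps <= 1/4 -> 0 <= C -> 0 <= mu -> p <= 1 -> 0 <= e ->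
  mu * t + (mu + 4 * C + 1) * eps + e / 4 < e ->
  (1 - eps / 2) * (d - 2 * C * eps) <= mu * (p + t) + eps -> d <= p * mu + e.
Proof.
move=> h1 h2 h3 h4 h6 he h7 h8; rewrite leNgt; apply/negP => h9.
have a1 : 0 <= (1 - eps / 2) * (d - (p * mu + e)) by rewrite mulr_ge0//; clear -h1 h2 h9; lra.
have a2 : eps * (p * mu) <= eps * mu by rewrite ler_wpM2l// ler_piMl.
have a3 : eps * e <= 1/4 * e by rewrite ler_wpM2r.
have a5 : 0 <= C * eps * eps by rewrite !mulr_ge0.
have a6 : 0 <= C * eps by rewrite mulr_ge0.
have a7 : 0 <= eps * mu by rewrite mulr_ge0.
(clear -he h7 h8 a1 a2 a3 a5 a6 a7; lra).
Qed.

(* Averaging the potential of the kernel over a window of length eps x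
   identifies it up to its flatness. *)
Lemma kernel_asymp F A (T rho e : R) : half_tail F A -> L_dominated A ->
  (forall th : R, 0 < th -> 0 < dec F th) -> 0 < T -> 0 < rho -> 0 < e -> e <= 1 ->
  exists2 eta0 : R, 0 < eta0 & forall eta : R, 0 < eta <= eta0 -> exists C x1 : R,
   [/\ 0 < C, 1 <= x1 & forall x N M, x1 <= x -> middle_range A eta x N M ->
     [/\ (2 / pi * mass T rho - e) * (A x / x) <= Dl F N M (fej T) x,
         Dl F N M (fej T) x <= (2 / pi * (mass T rho + 4 / (T * rho)) + e) * (A x / x) &
         forall y, `|Dl F N M (fej T) x - Dl F N M (fej T) y| <= C * `|x - y| * (A x / x ^+ 2)]].
Proof.
move=> hF HL decp T0 r0 e0 e1; have rA := ht_rv hF.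
set m := mass T rho; pose mu := m + 4 / (T * rho).
have m0 : 0 <= m by apply: LI_ge0 => s _; exact: fej_ge0.
have mu0 : 0 < mu by rewrite ltr_wpDl// divr_gt0// mulr_gt0.
have mmu : m <= mu by rewrite lerDl divr_ge0// ?mulr_ge0// ltW.
have [c0 c00 Hc] := dec_lower hF T0 (fun th h => decp th (proj1 (andP h))).
pose e1' := e / (4 * (mu + 1)).
have mu1 : 0 < mu + 1 by rewrite addr_gt0.
have e10 : 0 < e1' by rewrite divr_gt0// mulr_gt0.
have e1m : (mu + 1) * e1' <= e / 4 by rewrite /e1' le_eqVlt; apply/orP; left; apply/eqP; field; rewrite gt_eqF.
clearbody e1'.
have [eta0 /andP[eta00 eta01] HW] := window_sum hF HL e10.
exists eta0 => // eta /andP[etap etal].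
have eta2 : 0 < eta / 2 by rewrite divr_gt0.
have [C [xf [C0 xf1 HF]]] := flatness hF T0 c00 Hc (bm_fw T0) ler01 (@fw_norm _ T) eta2.
exists C; pose K := 4 * C + 12 * (mu + 1) + 4; have K0 : 0 < K by rewrite !addr_gt0 ?mulr_gt0.
pose eps := Num.min (1/4) (e / (4 * K)).
have eps0 : 0 < eps by rewrite lt_min divr_gt0//= divr_gt0// mulr_gt0.
have epsl : eps <= 1/4 by rewrite ge_min lexx.
have epsK : K * eps <= e / 4.
  have : eps <= e / (4 * K) by rewrite !ge_min lexx orbT.
  by rewrite ler_pdivlMr ?mulr_gt0// => hh; clear -hh; lra.
clearbody eps.
have e20 : 0 < eps ^+ 2 by rewrite exprn_gt0.
have [xw xw1 {}HW] := HW _ e20.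
have [xi xi1 HI] := A_increment rA eps0 epsl.
pose X4 := 32 / (eta * T * eps ^+ 4).
exists (Num.max (Num.max xf xw) (Num.max (Num.max xi X4) (2 * rho / eps ^+ 2))).
split => //; first by rewrite !le_max xf1.
move=> x N M; rewrite !ge_max => /andP[/andP[xxf xxw] /andP[/andP[xxi xx4] xxr]] [N1 N2 M1 M2].
have x0 : 0 < x by clear -xxw xw1; lra.
have Ax := A_gt0 rA (ltW x0).
pose q := A x / x; have q0 : 0 < q by rewrite divr_gt0.
have bk := @bm_fej R T T0.
pose D := Dl F N M (fej T); have bD : bm D by exact: bm_Dl.
have NX : eta / 2 * A x <= N%:R by move: N2; clear => ?; lra.
have flat y : `|D x - D y| <= C * `|x - y| * (A x / x ^+ 2).
  have := HF x y N M xxf NX; rewrite /D /Dl -sumrB.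
  by under eq_bigr do rewrite mulrBr.
pose L := eps * x; have L0 : 0 < L by rewrite mulr_gt0.
have Lx : L <= 1/4 * x by rewrite ler_wpM2r// ltW.
have flatL (s : R) : - L <= s <= 2 * L -> `|D x - D (x - s)| <= 2 * C * eps * q.
  move=> /andP[s1 s2]; apply: le_trans (flat _) _.
  have -> : x - (x - s) = s by ring.
  have sL : `|s| <= 2 * L by rewrite ler_norml; apply/andP; split; clear -s1 s2 L0; lra.
  have -> : 2 * C * eps * q = C * (2 * L) * (A x / x ^+ 2) by rewrite /q /L; field; rewrite gt_eqF.
  by rewrite ler_wpM2r ?divr_ge0 ?sqr_ge0 ?(ltW Ax)// ler_wpM2l// ltW.
pose W := Dl F N M (fun z => pos1 z - pos1 (z + - L)) x.
have bsh : bm (fun z : R => pos1 (z + - L)) by exact: bm_pos1_shift.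
have bw : bm (fun z : R => pos1 z - pos1 (z + - L)) by apply: bmB => //; exact: bm_pos1.
have WE : W = \sum_(n < M) late N n * (iter n (Op (lazyF F) (fun=> 1)) pos1 x -
                  iter n (Op (lazyF F) (fun=> 1)) pos1 (x - L)).
  apply: eq_bigr => n _; congr (_ * _).
  have b1 : bm (fun _ : R => 1 : R) by exact: bm_cst.
  by rewrite (iterB (lazyF F) n b1 bm_pos1 bsh) iter_shift.
have p0 := pi_gt0 R.
have WB : `|W - 2 / pi * (L * q)| <= (9 * eps + e1') * (L * q).
  have N1' : N%:R <= eta0 * A x by apply: le_trans N1 _; rewrite ler_wpM2r// ltW.
  have M1' : A x <= eta0 * M%:R by apply: le_trans M1 _; rewrite ler_wpM2r.
  have Lx2 : L <= x / 2 by clear -Lx x0; lra.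
  have := HW x L N M xxw (ltW L0) Lx2 N1' M1'; rewrite -WE => hw.
  have /andP[i1 i2] := HI x L xxi (ltW L0) (lexx _).
  have p42 : 4 / pi <= 2 :> R.
    by rewrite ler_pdivrMr//; have := pi_ge2 R; move: (pi : R) => p hp; clear -hp; lra.
  have p40 : 0 < 4 / pi :> R by rewrite divr_gt0.
  have B1 : `|4 / pi * (A x - A (x - L)) - 4 / pi * (L / 2 * q)| <= 2 * (8 * eps * (L / 2 * q)).
    rewrite -mulrBr normrM gtr0_norm//; apply: ler_pM => //; first exact: ltW.
    by rewrite ler_norml; apply/andP; split;
      [move: i1; rewrite mulrBl mul1r|move: i2; rewrite mulrDl mul1r]; rewrite -/q; move: (A x) (A (x - L)) (L / 2 * _) => a a' v hh; clear -hh; lra.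
  have -> : 2 / pi * (L * q) = 4 / pi * (L / 2 * q) by move: (pi : R) p0 => p p0; field; rewrite gt_eqF.
  have E1 : (e1' * (L / x) + eps ^+ 2) * A x = (e1' + eps) * (L * q).
    by rewrite /L /q; field; rewrite gt_eqF.
  rewrite E1 in hw.
  have -> : (9 * eps + e1') * (L * q) = (e1' + eps) * (L * q) + 2 * (8 * eps * (L / 2 * q)) by field.
  apply: le_trans (lerD hw B1).
  have -> : W - 4 / pi * (L / 2 * q) = (W - 4 / pi * (A x - A (x - L))) +
     (4 / pi * (A x - A (x - L)) - 4 / pi * (L / 2 * q)) by ring.
  exact: ler_normD.
pose t := 9 * eps + e1'.
have rhoL : rho <= eps * L / 2.
  move: xxr; rewrite ler_pdivrMr// => xxr; rewrite /L.
  have -> : eps * (eps * x) / 2 = x * eps ^+ 2 / 2 by ring.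
  clear -xxr; lra.
have epsL : eps * L <= 1/4 * L by rewrite ler_wpM2r// ltW.
(* A kernel centred in [0, L] has all its mass [m] inside the window enlarged by [rho] on both
   sides; elsewhere its nonnegativity suffices. *)
have lower : m * W <= (L + 2 * rho) * (D x + 2 * C * eps * q).
  have ab : - rho <= L + rho by clear -r0 L0; lra.
  apply: (@le_trans _ _ (Dl F N M (fun z => LI (- rho) (L + rho) (fun s => fej T (z - s))) x)).
    rewrite /W -DlZ//; apply: Dl_le; [exact: bmZ|exact: bm_LI_shift|].
    move=> z; rewrite LI_reflect//.
    have i0 : 0 <= LI (z - (L + rho)) (z - - rho) (fej T) by apply: LI_ge0 => s _; exact: fej_ge0.
    rewrite /pos1 subr_ge0.
    case: (boolP (0 <= z)) => z0; last first.
      apply: le_trans i0; rewrite mulr_ge0_le0//.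
      by case: (L <= z); rewrite /= ?subr0// sub0r oppr_le0.
    case: (boolP (L <= z)) => zL; first by rewrite subrr mulr0.
    rewrite subr0 mulr1; apply: mass_lower => //; rewrite -ltNge in zL; [clear -zL; lra|clear -z0; lra].
  rewrite Dl_LI//.
  have H s : - rho <= s <= L + rho -> `|D x - D (x - s)| <= 2 * C * eps * q.
    by move=> /andP[s1 s2]; apply: flatL; clear -s1 s2 rhoL epsL L0; apply/andP; split; lra.
  have /andP[_ h] := LI_near bD ab H.
  have e' : L + rho - - rho = L + 2 * rho by ring.
  by rewrite e' in h; exact: h.
(* The window is shrunk by r, so outside [0, L] the kernel integral is at most [2 / (T * r)]. This
   constant is summed over M indices, which is affordable since [M] is O(A x) while r is of order
   x. *)
have upper : (L - 2 * (eps * L / 4)) * (D x - 2 * C * eps * q) <= mu * W + M%:R * (2 / (T * (eps * L / 4))).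
  set r := eps * L / 4.
  have r'0 : 0 < r by rewrite divr_gt0// mulr_gt0.
  have rL : r <= L / 16 by rewrite /r; clear -epsL; lra.
  have ab : r <= L - r by clear -rL L0; lra.
  have H s : r <= s <= L - r -> `|D x - D (x - s)| <= 2 * C * eps * q.
    by move=> /andP[s1 s2]; apply: flatL; clear -s1 s2 r'0 L0; apply/andP; split; lra.
  have /andP[h _] := LI_near bD ab H.
  have e' : L - r - r = L - 2 * r by ring.
  rewrite e' in h; apply: le_trans h _.
  have w0 : 0 <= 2 / (T * r) by rewrite divr_ge0// mulr_ge0// ltW.
  apply: (@le_trans _ _ (mu * W + Dl F N M (fun=> 2 / (T * r)) x)); last by rewrite lerD2l Dl_cst_le.
  rewrite /W -DlZ// -DlD; [|exact: bmZ|exact: bm_cst].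
  rewrite /D -Dl_LI//; apply: Dl_le; [exact: bm_LI_shift|by apply: bmD; [exact: bmZ|exact: bm_cst]|].
  move=> z; rewrite LI_reflect//.
  have pq : z - (L - r) <= z - r by rewrite lerD2l lerN2.
  rewrite /pos1 subr_ge0; case: (boolP (0 <= z)) => z0; last first.
    rewrite -ltNge in z0; have -> : (L <= z) = false by apply/negbTE; rewrite -ltNge; exact: lt_trans L0.
    rewrite subr0 mulr0 add0r; apply: fej_far => //; right; clear -z0; lra.
  case: (boolP (L <= z)) => zL.
    by rewrite subrr mulr0 add0r; apply: fej_far => //; left; clear -zL; lra.
  rewrite subr0 mulr1; apply: (@le_trans _ _ mu); last by rewrite lerDl.
  exact: mass_upper.
have small : M%:R * (2 / (T * (eps * L / 4))) <= eps * (L * q).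
  have -> : M%:R * (2 / (T * (eps * L / 4))) = eta * M%:R * (8 / (eta * T * eps ^+ 2 * x)).
    by rewrite /L; field; rewrite !gt_eqF.
  have w0 : 0 <= 8 / (eta * T * eps ^+ 2 * x) by rewrite divr_ge0// ltW// !mulr_gt0.
  apply: le_trans (ler_wpM2r w0 M2) _.
  have -> : 2 * A x * (8 / (eta * T * eps ^+ 2 * x)) = X4 / 2 * (eps ^+ 2 * q) by rewrite /X4 /q; field; rewrite !gt_eqF.
  have -> : eps * (L * q) = x * (eps ^+ 2 * q) by rewrite /L; ring.
  apply: ler_wpM2r; first by rewrite mulr_ge0// ltW.
  have X40 : 0 <= X4 by rewrite divr_ge0// ltW// !mulr_gt0// exprn_gt0.
  by clear -xx4 X40; lra.
have p1 : 2 / pi <= 1 :> R by rewrite ler_pdivrMr// mul1r pi_ge2.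
have p20 : 0 <= 2 / pi :> R by rewrite divr_ge0// ltW.
have Lq : 0 < L * q by exact: mulr_gt0.
have DE : D x = D x / q * q by rewrite divfK// gt_eqF.
have D0 : 0 <= D x / q.
  rewrite divr_ge0//; last exact: ltW.
  apply: sumr_ge0 => n _; rewrite mulr_ge0 ?ler0n//.
  by apply: iter_ge0 => // y; exact: fej_ge0.
set d := D x / q in DE D0.
have Ce : 0 <= 2 * C * eps by rewrite !mulr_ge0// ltW.
have mt : m * t <= mu * t by rewrite ler_wpM2r// /t; clear -eps0 e10; lra.
have mut : mu * t + (mu + 4 * C + 1) * eps + e / 4 < e.
  rewrite /t; have : 0 <= eps * mu by rewrite mulr_ge0// ltW.
  by move: epsK; rewrite /K; clear -e1m e10 mu0 eps0 e0 C0 => h1 h2; lra.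
have /ler_normlP[W1 W2] := WB.
split; last exact: flat.
- rewrite -/(D x) DE ler_wpM2r ?(ltW q0)//.
  apply: (@lower_arith eps C m (2 / pi) t e d) => //; try exact: ltW.
    have : m * eps <= mu * eps by rewrite ler_wpM2r// ltW.
    by clear -mt mut eps0 e0 => h; lra.
  rewrite -(ler_pM2r Lq).
  have h1 : m * ((2 / pi - t) * (L * q)) <= m * W.
    rewrite ler_wpM2l//; move: W1; rewrite -/t mulrBl; move: (2 / pi * _) (t * _) => a b; clear; lra.
  have h2 : (L + 2 * rho) * (D x + 2 * C * eps * q) <= (1 + eps) * L * (D x + 2 * C * eps * q).
    apply: ler_wpM2r; last by clear -rhoL; lra.
    by rewrite DE -mulrDl mulr_ge0// ?(ltW q0)// addr_ge0.
  have := le_trans h1 (le_trans lower h2).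
  rewrite DE; have -> : (1 + eps) * L * (d * q + 2 * C * eps * q) = (1 + eps) * (d + 2 * C * eps) * (L * q) by ring.
  by move=> h3; rewrite -[leLHS]mulrA.
- rewrite -/(D x) DE ler_wpM2r ?(ltW q0)//.
  apply: (@upper_arith eps C mu (2 / pi) t e d) => //; try exact: ltW.
  rewrite -(ler_pM2r Lq).
  have h1 : mu * W <= mu * ((2 / pi + t) * (L * q)).
    apply: (ler_wpM2l (ltW mu0)); move: W2; rewrite -/t [(_ + t) * _]mulrDl; move: (2 / pi * _) (t * _) => a b; clear; lra.
  have := le_trans upper (lerD h1 small).
  rewrite DE; have -> : (L - 2 * (eps * L / 4)) * (d * q - 2 * C * eps * q) = (1 - eps / 2) * (d - 2 * C * eps) * (L * q) by field.
  by move=> h3; rewrite [leRHS]mulrDl -[X in _ <= X + _]mulrA.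
Qed.

End nonlattice_case.

Section nonlattice_theorem.
Context {R : realType}.
Implicit Types (F : probability (measurableTypeR R) R) (A f g : R -> R).

(* The shift by pi makes the numerators 1 - cos y and 1 + cos y add up to 2, so
   that the sum of two kernels has no zero. *)
Lemma fej_outer (T rho y : R) : 0 < T -> 0 < rho -> rho <= `|y| ->
  fej T y <= (1 + 4 / rho) ^+ 2 / T * (fej 1 y + fej 1 (y - pi)).
Proof.
move=> T0 r0 ry; have y0 : 0 < `|y| by exact: lt_le_trans ry.
have yn0 : y != 0 by rewrite -normr_gt0.
pose s := (`|y| + 4) ^+ 2.
have s0 : 0 < s by rewrite exprn_gt0// addr_gt0.
have le_s z : `|z| <= `|y| + 4 -> z ^+ 2 <= s.
  by move=> hz; rewrite -[z ^+ 2]real_normK ?num_real// /s lerXn2r// nnegrE// addr_ge0.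
have frac n z : 0 <= n -> z != 0 -> `|z| <= `|y| + 4 -> n / s <= n / (1 * z ^+ 2).
  move=> n0 z0 hz; rewrite mul1r ler_wpM2l// lef_pV2 ?posrE ?le_s//.
  by rewrite exprn_even_gt0.
have k1 : (1 - cos y) / s <= fej 1 y.
  rewrite (fejE ltr01)// mul1r; apply: frac; [by rewrite subr_ge0 cos_le1|exact: yn0|by rewrite lerDl].
have k2 : (1 + cos y) / s <= fej 1 (y - pi).
  have cy : cos (y - pi) = - cos y by rewrite cosB cospi sinpi mulr0 addr0 mulrN1.
  have [->|yp] := eqVneq y pi; first by rewrite cospi subrr mul0r; exact: fej_ge0.
  rewrite (fejE ltr01) ?subr_eq0// mul1r cy opprK.
  apply: frac; [|by rewrite subr_eq0|].
    by have := cos_geN1 y; move: (cos y) => c; clear => ?; lra.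
  apply: le_trans (ler_normB _ _) _; rewrite lerD2l ger0_norm ?pi_ge0//.
  by have := @pihalf_lt2 R; move: (pi : R) => p; clear => ?; lra.
have K : 2 / s <= fej 1 y + fej 1 (y - pi).
  apply: le_trans (lerD k1 k2); rewrite -mulrDl le_eqVlt; apply/orP; left; apply/eqP.
  by congr (_ / _); ring.
apply: le_trans (fej_decay T0 yn0) _.
have c0 : 0 <= (1 + 4 / rho) ^+ 2 / T by rewrite divr_ge0 ?sqr_ge0// ltW.
apply: le_trans (ler_wpM2l c0 K).
have sy : s <= (1 + 4 / rho) ^+ 2 * y ^+ 2.
  rewrite -[y ^+ 2]real_normK ?num_real// -exprMn /s lerXn2r ?nnegrE//.
  - by rewrite mulr_ge0// addr_ge0// divr_ge0// ltW.
  - by rewrite mulrDl mul1r lerD2l mulrAC ler_pdivlMr// ler_wpM2l.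
have y20 : 0 < y ^+ 2 by rewrite exprn_even_gt0.
have B0 : 0 <= (1 + 4 / rho) ^+ 2 by rewrite sqr_ge0.
move: (y ^+ 2) ((1 + 4 / rho) ^+ 2) y20 B0 sy => v B v0 B0 sy.
have -> : 2 / (T * v) = 2 / T * v^-1 by field; rewrite !gt_eqF.
have -> : B / T * (2 / s) = 2 / T * (B / s) by field; rewrite !gt_eqF.
rewrite ler_wpM2l ?divr_ge0 ?(ltW T0)//.
by rewrite ler_pdivlMr// mulrC ler_pdivrMr.
Qed.

Let upper_arith (p m rho g gam c h d e : R) : 0 <= p -> p <= 1 -> 0 < c -> c <= m -> 0 < h ->
  0 <= rho -> rho <= gam -> g <= c * gam -> 0 <= g -> gam <= 1 -> gam * (3 * h + 8) <= e ->
  m * d <= (h + 2 * rho) * (p * (m + g) + 2 * g) -> d <= p * h + e.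
Proof.
move=> p0 p1 c0 cm h0 r0 rg gc g0 g1 ge H.
have m0 : 0 < m by exact: lt_le_trans cm.
have gam0 : 0 <= gam by exact: le_trans rg.
have gm : g <= m * gam by apply: le_trans gc _; exact: ler_wpM2r.
rewrite -(ler_pM2l m0); apply: le_trans H _.
apply: (@le_trans _ _ ((h + 2 * gam) * (p * m + 3 * (m * gam)))).
  apply: ler_pM; [|by rewrite addr_ge0 ?mulr_ge0// addr_ge0// ltW| |].
  - by rewrite addr_ge0 ?mulr_ge0// ltW.
  - by clear -rg; lra.
  - have : p * g <= g by exact: ler_piMl.
    by rewrite mulrDr; clear -gm => h1; lra.
have -> : (h + 2 * gam) * (p * m + 3 * (m * gam)) = m * ((h + 2 * gam) * (p + 3 * gam)) by ring.
apply: (ler_wpM2l (ltW m0)).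
have h1 : gam * p <= gam by exact: ler_piMr.
have h2 : gam * gam <= gam by exact: ler_piMr.
by clear -h1 h2 ge; lra.
Qed.

Let lower_arith (p m M rho g gam c h d e : R) : p <= 1 -> 3 * gam <= p -> 0 < c -> c <= m -> 0 < h ->
  0 <= rho -> rho <= gam -> g <= c * gam -> 0 <= g -> 2 * gam <= h -> gam * (3 * h + 8) <= e ->
  m <= M -> M <= m + g ->
  (h - 2 * rho) * (p * m - 2 * g) - g <= M * d -> p * h - e <= d.
Proof.
move=> p1 gp c0 cm h0 r0 rg gc g0 gh ge mM Mm H.
have M0 : 0 < M by exact: lt_le_trans (lt_le_trans c0 cm) mM.
have gam0 : 0 <= gam by exact: le_trans rg.
have p0 : 0 <= p by apply: le_trans gp; rewrite mulr_ge0.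
have gm : g <= M * gam by apply: le_trans gc _; apply: ler_wpM2r => //; exact: le_trans mM.
rewrite -(ler_pM2l M0); apply: le_trans H.
have h1 : gam * p <= gam by exact: ler_piMr.
have h3 : 0 <= gam * gam by exact: mulr_ge0.
apply: (@le_trans _ _ (M * ((h - 2 * gam) * (p - 3 * gam)) - M * gam)).
  rewrite -mulrBr; apply: (ler_wpM2l (ltW M0)).
  by clear -h1 h3 ge gam0; lra.
apply: lerB => //.
have -> : M * ((h - 2 * gam) * (p - 3 * gam)) = (h - 2 * gam) * (p * M - 3 * (M * gam)) by ring.
apply: ler_pM.
- by clear -gh; lra.
- by have : 0 <= M * (p - 3 * gam) by [rewrite mulr_ge0 ?(ltW M0)//; clear -gp; lra]; clear => ?; lra.
- by clear -rg; lra.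
- have : p * M <= p * (m + g) by exact: ler_wpM2l.
  have : p * g <= g by exact: ler_piMl.
  by clear -gm => h2 h4; lra.
Qed.

(** For a window of fixed length h, a constant error outside it, summed over a number of indices of
    order [A x], would swamp [A x / x]. Instead the outer part of the kernel is dominated by [B / T]
    times a fixed kernel of band 1 ([fej_outer]), whose own late sum is O(A x / x) by
    [kernel_asymp]; T is then taken large. *)
Lemma nonarithmetic_srt F A (h : R) : half_tail F A -> L_dominated A -> 0 < h ->
  (forall th : R, 0 < th -> 0 < dec F th) -> lazy_srt F A h.
Proof.
move=> hF HL h0 decp; have rA := ht_rv hF; apply: lazy_srt_middle => // e e0.
have cFp := @cF_gt0 R; set c := cF in cFp.
have h38 : 0 < 3 * h + 8 by rewrite addr_gt0 ?mulr_gt0.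
pose gam := Num.min (1/8) (Num.min (h / 4) (e / (3 * h + 8))).
have gam0 : 0 < gam by rewrite !lt_min !divr_gt0.
have gam1 : gam <= 1/8 by rewrite ge_min lexx.
have gamh : gam <= h / 4 by rewrite !ge_min lexx orbT.
have game : gam * (3 * h + 8) <= e by rewrite -ler_pdivlMr// !ge_min lexx !orbT.
clearbody gam.
pose g := Num.min gam (c * gam).
have g0 : 0 < g by rewrite lt_min gam0 mulr_gt0.
have ggam : g <= gam by rewrite ge_min lexx.
have gc : g <= c * gam by rewrite ge_min lexx orbT.
clearbody g.
have [eta1 eta10 H1] := kernel_asymp hF HL decp (@ltr01 R) (@ltr01 R) (@ltr01 R) (lexx _).
pose c1 : R := 2 / pi * (mass 1 1 + 4 / (1 * 1)) + 1.
have p0 := pi_gt0 R.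
have p20 : 0 <= 2 / pi :> R by rewrite divr_ge0// ltW.
have p1 : 2 / pi <= 1 :> R by rewrite ler_pdivrMr// mul1r pi_ge2.
have p12 : 1/2 <= 2 / pi :> R.
  by rewrite ler_pdivlMr//; have := @pihalf_lt2 R; move: (pi : R) => p; clear => ?; lra.
have c10 : 0 <= c1.
  rewrite addr_ge0// mulr_ge0// addr_ge0//.
  by apply: LI_ge0 => s _; exact: fej_ge0.
pose B := (1 + 4 / g) ^+ 2; have B0 : 0 <= B by rewrite sqr_ge0.
(* The three terms ensure in turn that the mass within [g] is at least [cF], that the mass beyond is
   at most [g], and that the dominated outer part contributes at most [g * q]. *)
pose T := (2 * g)^-1 + 4 / (g * g) + B * (h * (2 * (c1 + 1))) / g.
have T1 : 0 < (2 * g)^-1 by rewrite invr_gt0 mulr_gt0.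
have T2 : 0 < 4 / (g * g) by rewrite divr_gt0// mulr_gt0.
have c10' : 0 <= 2 * (c1 + 1) by rewrite mulr_ge0// addr_ge0.
have T3 : 0 <= B * (h * (2 * (c1 + 1))) / g.
  by rewrite divr_ge0 ?(ltW g0)// mulr_ge0// mulr_ge0// ltW.
have T0 : 0 < T by rewrite /T; clear -T1 T2 T3; lra.
have Tg : (2 * T)^-1 <= g.
  rewrite -[leLHS]mul1r ler_pdivrMr ?mulr_gt0//.
  have : (2 * g)^-1 <= T by rewrite /T; clear -T2 T3; lra.
  by rewrite -[leLHS]mul1r ler_pdivrMr ?mulr_gt0// => hh; clear -hh; lra.
have Td : 4 / (T * g) <= g.
  rewrite ler_pdivrMr ?mulr_gt0//.
  have h1 : 4 / (g * g) <= T by rewrite /T; clear -T1 T2 T3; lra.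
  have -> : g * (T * g) = T * (g * g) by ring.
  by rewrite -ler_pdivrMr// mulr_gt0.
have TB : B / T * (h * (2 * (c1 + 1))) <= g.
  rewrite mulrAC ler_pdivrMr// [leRHS]mulrC -ler_pdivrMr//.
  by rewrite /T; clear -T1 T2 T3; lra.
clearbody T.
have g1 : g <= 1 by clear -ggam gam1; lra.
have [eta2 eta20 H2] := kernel_asymp hF HL decp T0 g0 g0 g1.
exists (Num.min eta1 eta2); first by rewrite lt_min eta10.
move=> eta; rewrite le_min => /andP[etap /andP[etal1 etal2]].
have [|C1 [x1 [C10 x11 {}H1]]] := H1 eta; first by rewrite etap.
have [|C2 [x2 [C20 x21 {}H2]]] := H2 eta; first by rewrite etap.
exists (Num.max (Num.max x1 x2) (Num.max (C1 * (h + 4)) (C2 * (h + g) / g))).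
  by rewrite !le_max x11.
move=> x N M; rewrite !ge_max => /andP[/andP[xx1 xx2] /andP[xC1 xC2]] a1 a2 a3 a4.
have mr : middle_range A eta x N M by [].
have [_ U1 F1] := H1 x N M xx1 mr; have [L2 U2 F2] := H2 x N M xx2 mr.
rewrite -/c1 in U1; clearbody c1.
have x0 : 0 < x by exact: lt_le_trans (lt_le_trans ltr01 x11) xx1.
have Ax := A_gt0 rA (ltW x0).
pose q := A x / x; have q0 : 0 < q by rewrite divr_gt0.
rewrite -/q in L2 U1 U2 *.
set m := mass T g in L2 U2.
have mc : c <= m by exact: mass_ge.
have m0 : 0 < m by exact: lt_le_trans mc.
pose Mm := m + 4 / (T * g).
have mM : m <= Mm by rewrite lerDl divr_ge0// ltW// mulr_gt0.
have Mg : Mm <= m + g by rewrite lerD2l.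
have b1 := @bm_fej R 1 ltr01; have bT := @bm_fej R T T0.
have bchi := @bm_chi R h.
pose D := Dl F N M; have DS : \sum_(n < M) late N n * Qn F h n x = D (chi h) x by [].
rewrite DS; set d := D (chi h) x / q.
have dq : D (chi h) x = d * q by rewrite divfK// gt_eqF.
have -> : D (chi h) x - 2 / pi * h * q = (d - 2 / pi * h) * q by rewrite dq mulrBl.
rewrite normrM (gtr0_norm q0) ler_wpM2r ?(ltW q0)//.
have qx : A x / x ^+ 2 = q / x by rewrite /q expr2 invfM mulrA.
rewrite qx in F1 F2.
have near : forall s : R, - g <= s <= h + g -> `|D (fej T) x - D (fej T) (x - s)| <= g * q.
  move=> s /andP[s1 s2]; apply: le_trans (F2 _) _.
  have -> : x - (x - s) = s by ring.
  have sh : `|s| <= h + g by rewrite ler_norml s2 andbT; clear -s1 h0; lra.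
  have -> : C2 * `|s| * (q / x) = C2 * `|s| / x * q by ring.
  rewrite ler_wpM2r ?(ltW q0)// ler_pdivrMr//.
  apply: (@le_trans _ _ (C2 * (h + g))); first by rewrite ler_wpM2l// ltW.
  by move: xC2; rewrite ler_pdivrMr// [g * x]mulrC.
have bD : bm (D (fej T)) by exact: bm_Dl.
have upper : d <= 2 / pi * h + e.
  apply: (@upper_arith (2 / pi) m g g gam c h d e) => //; try exact: ltW.
    by clear -gam1; lra.
  rewrite -(ler_pM2r q0) -mulrA -dq.
  have ab : - g <= h + g by clear -g0 h0; lra.
  have /andP[_] := LI_near bD ab near.
  have -> : h + g - - g = h + 2 * g by ring.
  move=> h1; apply: le_trans (le_trans _ h1) _; last first.
    rewrite -mulrA ler_wpM2l//; first by rewrite addr_ge0 ?mulr_ge0// ltW.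
    have : 2 / pi * (4 / (T * g)) <= 2 / pi * g by rewrite ler_wpM2l.
    move=> h2; have {}h2 := ler_wpM2r (ltW q0) h2.
    move: h2 U2; rewrite -/D; move: (2 / pi) (4 / (T * g)) (D _ x) => p v z; clear => h2 U2; lra.
  rewrite -Dl_LI// -DlZ//; apply: Dl_le; [exact: bmZ|exact: bm_LI_shift|].
  move=> z; rewrite LI_reflect// /chi.
  case: (boolP (0 <= z < h)) => [/andP[z0 zh]|_]; last first.
    by rewrite mulr0; apply: LI_ge0 => s _; exact: fej_ge0.
  by rewrite mulr1; apply: mass_lower => //; [clear -zh; lra|clear -z0; lra].
have lower : 2 / pi * h - e <= d.
  apply: (@lower_arith (2 / pi) m Mm g g gam c h d e) => //; try exact: ltW.
  - by move: p12 gam1; move: (pi : R) => p; clear => *; lra.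
  - by clear -gamh h0; lra.
  rewrite -(ler_pM2r q0) -[leRHS]mulrA -dq.
  have ab : g <= h - g by clear -ggam gamh h0; lra.
  have near' s : g <= s <= h - g -> `|D (fej T) x - D (fej T) (x - s)| <= g * q.
    by move=> /andP[s1 s2]; apply: near; apply/andP; split; clear -s1 s2 g0; lra.
  have /andP[h1 _] := LI_near bD ab near'.
  have eh : h - g - g = h - 2 * g by ring.
  rewrite {}eh in h1.
  (* Two shifted kernels of band 1: their arguments stay within [h + 4] of x, where flatness keeps
     the late sum below [(c1 + 1) * q]. *)
  pose K (y : R) := fej 1 y + fej 1 (y - pi).
  have bK2 : bm (fun y : R => fej 1 (y - pi)).
    have -> : (fun y : R => fej 1 (y - pi)) = fun y => fej 1 (pi - y).
      by apply/funext => y; rewrite -opprB fej_even.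
    exact: bm_shift.
  have bK : bm K by apply: bmD.
  have DK s : g <= s <= h - g -> D K (x - s) <= 2 * (c1 + 1) * q.
    move=> /andP[s1 s2]; rewrite /D DlD// (Dl_shift F N M (fej 1) (- pi)).
    have bnd y : `|x - y| <= h + 4 -> D (fej 1) y <= (c1 + 1) * q.
      move=> hy; have := F1 y; have : C1 * `|x - y| * (q / x) <= q.
        have -> : C1 * `|x - y| * (q / x) = C1 * `|x - y| / x * q by ring.
        rewrite ler_piMl ?(ltW q0)// ler_pdivrMr// mul1r; apply: le_trans xC1.
        by rewrite ler_wpM2l// ltW.
      rewrite [in X in _ -> _ -> X]mulrDl mul1r => u2; move: U1; rewrite -/D => u1; rewrite ler_norml => /andP[u3 u4].
      by clear -u1 u2 u3 u4; lra.
    have -> : 2 * (c1 + 1) * q = (c1 + 1) * q + (c1 + 1) * q by ring.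
    have P4 := @pihalf_lt2 R.
    apply: lerD; apply: bnd.
    - have -> : x - (x - s) = s by ring.
      by rewrite ler_norml; apply/andP; split; clear -s1 s2 g0 h0; lra.
    - have -> : x - (x - s + - pi) = s + pi by ring.
      by move: (pi : R) p0 P4 => p p0 P4; rewrite ler_norml; apply/andP; split; clear -s1 s2 g0 h0 p0 P4; lra.
  (* For z in [0, h[ the averaged kernel is at most [Mm]. For other z, every [z - s] with s in
     [g, h - g] is at distance at least [g] from 0, so [fej_outer] applies pointwise. *)
  have main : LI g (h - g) (fun s => D (fej T) (x - s)) <= Mm * D (chi h) x + B / T * LI g (h - g) (fun s => D K (x - s)).
    have bZ : bm (fun z : R => B / T * LI g (h - g) (fun s => K (z - s))) by apply: bmZ; exact: bm_LI_shift.
    rewrite /D -Dl_LI// -(Dl_LI F N M g (h - g) x bK) -!DlZ//; [|exact: bm_LI_shift].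
    rewrite -DlD//; [|exact: bmZ]; apply: Dl_le; [exact: bm_LI_shift|by apply: bmD => //; exact: bmZ|].
    move=> z; rewrite -LIZ; last exact: bm_shift.
    have K0 (s : R) : 0 <= B / T * K (z - s).
      by rewrite mulr_ge0 ?divr_ge0// ?(ltW T0)// addr_ge0//; exact: fej_ge0.
    rewrite {1}/chi; case: (boolP (0 <= z < h)) => zz.
      rewrite mulr1; apply: (@le_trans _ _ Mm); last by rewrite lerDl; exact: LI_ge0.
      by rewrite LI_reflect//; apply: mass_upper => //; rewrite lerD2l lerN2.
    rewrite mulr0 add0r; apply: LI_le; [exact: bm_shift|by apply: bmZ; exact: bm_shift|].
    move=> s /andP[s1 s2]; apply: fej_outer => //.
    rewrite ler_normr; apply/orP.
    case: (lerP 0 z) zz => /= [z0|z0] zz; [rewrite -leNgt in zz; left|right].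
      by clear -zz s2; lra.
    by clear -z0 s1; lra.
  have LK : B / T * LI g (h - g) (fun s => D K (x - s)) <= g * q.
    apply: (@le_trans _ _ (B / T * (h * (2 * (c1 + 1) * q)))).
      rewrite ler_wpM2l ?divr_ge0// ?(ltW T0)//.
      apply: (@le_trans _ _ (LI g (h - g) (fun=> 2 * (c1 + 1) * q))).
        by apply: LI_le; [apply: bm_shift; exact: bm_Dl|exact: bm_cst|exact: DK].
      rewrite LI_cst// mulrC; apply: ler_wpM2r; first by rewrite mulr_ge0// ltW.
      by clear -g0; lra.
    have -> : B / T * (h * (2 * (c1 + 1) * q)) = B / T * (h * (2 * (c1 + 1))) * q by rewrite -!mulrA.
    by apply: ler_wpM2r; first exact: ltW.
  have h2 := le_trans h1 (le_trans main (lerD (lexx _) LK)).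
  rewrite mulrBl lerBlDr; apply: le_trans h2; rewrite -mulrA; apply: ler_wpM2l.
    by clear -ab g0; lra.
  by move: L2; rewrite -/D !mulrBl => L2; clear -L2; lra.
by rewrite ler_norml; apply/andP; split; move: upper lower; move: (2 / pi * h) => u; clear; lra.
Qed.

End nonlattice_theorem.

(** * From the lazy law back to the random walk *)

Section walk_law.
Context {R : realType} {d : measure_display} {Omega : measurableType d}.
Context {P : probability Omega R} {F : probability (measurableTypeR R) R}.
Context {X : nat -> {RV P >-> measurableTypeR R}}.

Lemma measurable_walk n : measurable_fun [set: Omega] (random_walk X n : Omega -> measurableTypeR R).
Proof.
have -> : random_walk X n = fun w => \sum_(i < n) (X i w : R) by [].
apply: (@measurable_sum _ _ R) => i; have h := measurable_funPT (X i); exact: h.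
Qed.

HB.instance Definition _ n := isMeasurableFun.Build _ _ Omega (measurableTypeR R)
  (random_walk X n : Omega -> measurableTypeR R) (measurable_walk n).

Lemma random_walkS n w : random_walk X n.+1 w = random_walk X n w + (X n w : R).
Proof. by rewrite /random_walk big_ord_recr. Qed.

Let step_pair n (w : Omega) : measurableTypeR R * measurableTypeR R := (random_walk X n w, X n w).

Let measurable_step_pair n : measurable_fun [set: Omega] (step_pair n).
Proof. by apply/measurable_fun_pairP; split; [exact: measurable_walk|exact: measurable_funPT]. Qed.

Let rect (n : nat) (J : {fset nat}) (B : nat -> set (measurableTypeR R)) : set Omega :=
  \bigcap_(i in [set` J]) (X i @^-1` B i).

Let measurable_rect n J B : (forall i, measurable (B i)) -> measurable (rect n J B).
Proof.
move=> mB; apply: fin_bigcap_measurable; first exact: finite_fset.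
by move=> i _; rewrite -[X in measurable X]setTI; exact: measurable_funPT.
Qed.

Definition sum_preim (B : set (measurableTypeR R)) : set (measurableTypeR R * measurableTypeR R) :=
  [set p | B (p.1 + p.2 : R)].

Lemma measurable_sum_preim B : measurable B -> measurable (sum_preim B).
Proof.
move=> mB; have h : measurable_fun [set: measurableTypeR R * measurableTypeR R]
  (fun p => (p.1 + p.2 : R) : measurableTypeR R).
  by apply: measurable_funD; [exact: measurable_fst|exact: measurable_snd].
by rewrite -[X in measurable X]setTI; exact: h.
Qed.

Context (iidX : iid_with_law X F).

Let measurable_preim_walk n (B : set (measurableTypeR R)) : measurable B -> measurable (random_walk X n @^-1` B).
Proof. by move=> mB; rewrite -[X in measurable X]setTI; exact: measurable_walk. Qed.

(** Independence is given for products of events on the steps only. In the induction, the law of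
    (S_n, X_n) given the event [E] on later steps is a product on rectangles, hence the product
    measure, exactly as without conditioning; evaluating both on the event that the sum lies in C
    gives the claim. *)
Lemma walk_independent n (J : {fset nat}) (B : nat -> set (measurableTypeR R)) C :
  (forall i, measurable (B i)) -> measurable C -> (forall i, i \in J -> (n <= i)%N) ->
  P (random_walk X n @^-1` C `&` rect n J B) =
  (P (random_walk X n @^-1` C) * P (rect n J B))%E.
Proof.
have [indX _] := iidX.
elim: n J B C => [|n IH] J B C mB mC nJ.
  have S0 w : random_walk X 0 w = 0 by rewrite /random_walk big_ord0.
  have [c0|c0] := pselect (C (0 : R)).
    have -> : random_walk X 0 @^-1` C = setT by apply/seteqP; split => // w _; rewrite /preimage /= S0.
    by rewrite setTI probability_setT mul1e.
  have -> : random_walk X 0 @^-1` C = set0 by apply/seteqP; split => // w; rewrite /preimage /= S0.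
  by rewrite set0I measure0 mul0e.
have SE (C' : set (measurableTypeR R)) : random_walk X n.+1 @^-1` C' = step_pair n @^-1` sum_preim C'.
  by apply/seteqP; split => w; rewrite /preimage /= random_walkS.
set E := rect n.+1 J B; have mE : measurable E by exact: measurable_rect.
have rectE C1 C2 : measurable C1 -> measurable C2 ->
    P (random_walk X n @^-1` C1 `&` (X n @^-1` C2 `&` E)) =
    (P (random_walk X n @^-1` C1) * (P (X n @^-1` C2) * P E))%E.
  move=> m1 m2; pose B' i := if i == n then C2 else B i.
  have mB' i : measurable (B' i) by rewrite /B'; case: eqP.
  have nnJ : n \notin J by apply/negP => /nJ; rewrite ltnn.
  have EE : X n @^-1` C2 `&` E = rect n (n |` J)%fset B'.
    apply/seteqP; split => w.
      move=> [h1 h2] i /=; rewrite in_fset1U => /orP[/eqP->|iJ]; first by rewrite /B' eqxx.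
      rewrite /B'; case: eqP => [ein|_]; last exact: h2.
      by move: iJ; rewrite ein (negbTE nnJ).
    move=> h; split; first by have := h n; rewrite /B' eqxx; apply; rewrite /= fset1U1.
    move=> i /= iJ; have := h i; rewrite /B'; case: eqP => [ein|_]; last by apply; rewrite /= fset1Ur.
    by move: iJ; rewrite ein (negbTE nnJ).
  rewrite EE IH//; last first.
    by move=> i; rewrite in_fset1U => /orP[/eqP->//|/nJ]; exact: ltnW.
  congr (_ * _)%E; rewrite /rect indX// big_fsetU1//= /E /rect indX//.
  rewrite {1}/B' eqxx; congr (_ * _)%E; apply: eq_big_seq => i iJ.
  by rewrite /B'; case: eqP => // ein; move: iJ; rewrite ein (negbTE nnJ).
have PEfin : P E \is a fin_num by exact: fin_num_measure.
(* Conditioning on [E] divides by its probability, so null events are treated apart. *)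
have [PE0|PE0] := eqVneq (P E) 0%E.
  rewrite PE0 mule0; apply/eqP; rewrite eq_le measure_ge0 andbT -PE0.
  have mCE : measurable (random_walk X n.+1 @^-1` C `&` E).
    by apply: measurableI => //; exact: measurable_preim_walk.
  by apply: le_measure; rewrite ?inE//; exact: subIsetr.
pose c := fine (P E); have c0 : 0 < c.
  by rewrite lt_neqAle eq_sym fine_eq0// PE0/= fine_ge0.
have ci : 0 <= c^-1 by rewrite invr_ge0 ltW.
have cE : P E = c%:E by rewrite /c fineK.
pose lawS := distribution P (random_walk X n : {mfun Omega >-> measurableTypeR R}).
pose lawX := distribution P (X n).
have mY := measurable_step_pair n.
pose nu := measure_function_pushforward__canonical__measure_function_Measure
  (mscale (NngNum ci) (mrestr P mE)) mY.
pose nu0 := measure_function_pushforward__canonical__measure_function_Measure P mY.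
have mD := measurable_sum_preim mC.
have rect0 C1 C2 : measurable C1 -> measurable C2 ->
    P (random_walk X n @^-1` C1 `&` X n @^-1` C2) = (P (random_walk X n @^-1` C1) * P (X n @^-1` C2))%E.
  move=> m1 m2; have EE : X n @^-1` C2 = rect n [fset n]%fset (fun=> C2).
    apply/seteqP; split => w; first by move=> h i /= ; rewrite in_fset1 => /eqP->.
    by move=> h; apply: (h n); rewrite /= in_fset1.
  by rewrite EE IH//; move=> i; rewrite in_fset1 => /eqP->.
have e1 : (lawS \x lawX)%E (sum_preim C) = nu (sum_preim C).
  apply: (@product_measure_unique _ _ _ _ R lawS lawX nu) => // C1 C2 m1 m2.
  have -> : nu (C1 `*` C2) = ((c^-1)%:E * P (random_walk X n @^-1` C1 `&` (X n @^-1` C2 `&` E)))%E.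
    by rewrite /nu /= /pushforward /mscale /mrestr /= setIA.
  rewrite rectE// cE muleCA [X in (_ * X)%E]muleCA -EFinM mulVf ?gt_eqF// mule1.
  by [].
have e0 : (lawS \x lawX)%E (sum_preim C) = nu0 (sum_preim C).
  by apply: (@product_measure_unique _ _ _ _ R lawS lawX nu0) => // C1 C2 m1 m2; exact: rect0.
rewrite e0 in e1.
have {e1} : nu0 (sum_preim C) = ((c^-1)%:E * P (random_walk X n.+1 @^-1` C `&` E))%E.
  by rewrite e1 SE.
rewrite /nu0 /= /pushforward -SE => ->.
by rewrite cE muleAC -EFinM mulVf ?gt_eqF// mul1e.
Qed.

Lemma walk_step n C : measurable C ->
  P (random_walk X n.+1 @^-1` C) =
  (\int[F]_y P (random_walk X n @^-1` [set s : R | C (s + y)%R]))%E.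
Proof.
move=> mC; have [indX lawXF] := iidX.
pose lawS := distribution P (random_walk X n : {mfun Omega >-> measurableTypeR R}).
have mY := measurable_step_pair n.
pose nu0 := measure_function_pushforward__canonical__measure_function_Measure P mY.
have mD := measurable_sum_preim mC.
have e0 : (lawS \x F)%E (sum_preim C) = nu0 (sum_preim C).
  apply: (@product_measure_unique _ _ _ _ R lawS F nu0) => // C1 C2 m1 m2.
  transitivity (lawS C1 * distribution P (X n) C2)%E; last by congr (_ * _)%E; exact: lawXF.
  have EE : X n @^-1` C2 = rect n [fset n]%fset (fun=> C2).
    apply/seteqP; split => w; first by move=> h i /= ; rewrite in_fset1 => /eqP->.
    by move=> h; apply: (h n); rewrite /= in_fset1.
  transitivity (P (random_walk X n @^-1` C1 `&` X n @^-1` C2)) => //.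
  by rewrite [in LHS]EE walk_independent//= -?EE// => i; rewrite in_fset1 => /eqP->.
have e2 : (lawS \x F)%E (sum_preim C) = (lawS \x^ F)%E (sum_preim C).
  apply: (@product_measure_unique _ _ _ _ R lawS F (lawS \x^ F)%E) => // C1 C2 m1 m2.
  exact: product_measure2E.
have -> : P (random_walk X n.+1 @^-1` C) = nu0 (sum_preim C).
  by congr (P _); apply/seteqP; split => w; rewrite /preimage /= random_walkS.
rewrite -e0 e2 /product_measure2; apply: eq_integral => y _ /=.
rewrite /lawS /distribution /pushforward; congr (P (_ @^-1` _)).
by apply/seteqP; split => s; rewrite /ysection /sum_preim /= inE.
Qed.

(** The bridge between the random walk and the operators: each side satisfies the same one-step
    recursion. *)
Lemma walk_window n (h x : R) :
  P (random_walk X n @^-1` `]x - h, x]%classic) = (iter n (Op F (fun=> 1)) (chi h) x)%:E.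
Proof.
elim: n x => [|n IH] x.
  have S0 w : random_walk X 0 w = 0 by rewrite /random_walk big_ord0.
  rewrite /= /chi; case: (boolP (0 <= x < h)) => hx.
    have -> : random_walk X 0 @^-1` `]x - h, x]%classic = setT.
      by apply/seteqP; split => // w _; rewrite /preimage /= S0 in_itv /= subr_lt0 andbC.
    by rewrite probability_setT.
  have -> : random_walk X 0 @^-1` `]x - h, x]%classic = set0.
    apply/seteqP; split => // w; rewrite /preimage /= S0 in_itv /= subr_lt0 andbC => h1.
    by rewrite h1 in hx.
  by rewrite measure0.
have b1 : bm (fun _ : R => 1 : R) by exact: bm_cst.
have bi : bm (iter n (Op F (fun=> 1)) (chi h)) by apply: bm_iter => //; exact: bm_chi.
rewrite walk_step//= /Op EFin_J; last exact: bm_Op_body.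
apply: eq_integral => y _; rewrite mul1r -IH; congr (P (_ @^-1` _)).
apply/seteqP; split => s /=; rewrite !in_itv/= lerBrDr (addrAC x (- y)) -ltrBlDr; exact.
Qed.

End walk_law.

Section lazy_renewal.
Context {R : realType}.
Implicit Types (F : probability (measurableTypeR R) R) (A L f : R -> R).

Let b1 : bm (fun _ : R => 1 : R). Proof. exact: bm_cst. Qed.

Definition Cn F (h : R) n x : R := iter n (Op F (fun=> 1)) (chi h) x.

Lemma bm_Cn F h n : bm (Cn F h n).
Proof. by apply: bm_iter => //; exact: bm_chi. Qed.

Lemma Cn_ge0 F h n x : 0 <= Cn F h n x.
Proof. by apply: iter_ge0 => // y; exact: ler0n. Qed.

Lemma Op_lazy F f x : bm f -> Op (lazyF F) (fun=> 1) f x = 2^-1 * f x + 2^-1 * Op F (fun=> 1) f x.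
Proof.
move=> bf; rewrite /Op J_lazy; last exact: bm_Op_body.
by rewrite mul1r subr0.
Qed.

(** Formally [Q = (1 + C) / 2] gives (1 - Q)^-1 = 2 (1 - C)^-1. For partial sums this survives as an
    inequality in this direction, and with a remainder in the other ([sum_le_lazy]). *)
Lemma lazy_sum_le F h N x :
  \sum_(n < N) Qn F h n x <= 2 * \sum_(n < N) Cn F h n x.
Proof.
elim: N x => [|N IH] x; first by rewrite !big_ord0 mulr0.
pose G y := \sum_(n < N) Qn F h n y; pose U y := \sum_(n < N) Cn F h n y.
have bG : bm G by apply: bm_sum => n; exact: bm_Qn.
have bU : bm U by apply: bm_sum => n; exact: bm_Cn.
have GE : \sum_(n < N.+1) Qn F h n x = chi h x + Op (lazyF F) (fun=> 1) G x.
  by rewrite big_ord_recl Op_sum// => n; exact: bm_Qn.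
have UE : \sum_(n < N.+1) Cn F h n x = chi h x + Op F (fun=> 1) U x.
  by rewrite big_ord_recl Op_sum// => n; exact: bm_Cn.
have UU : U x <= \sum_(n < N.+1) Cn F h n x by rewrite big_ord_recr/= lerDl Cn_ge0.
have h1 : Op F (fun=> 1) G x <= 2 * Op F (fun=> 1) U x.
  have -> : 2 * Op F (fun=> 1) U x = Op F (fun=> 1) (fun y => 2 * U y) x by rewrite OpZ.
  by apply: Op_le => //; exact: bmZ.
have h2 : G x <= 2 * U x := IH x.
rewrite GE Op_lazy//; rewrite UE in UU *.
move: (G x) (U x) (Op _ _ G x) (Op _ _ U x) (chi h x) UU h1 h2 => g u og ou c.
by clear => UU h1 h2; lra.
Qed.

Lemma Op_le_lazy F f x : bm f -> (forall y, 0 <= f y) ->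
  Op F (fun=> 1) f x <= 2 * Op (lazyF F) (fun=> 1) f x.
Proof.
move=> bf f0; rewrite Op_lazy//; have := f0 x; have : 0 <= Op F (fun=> 1) f x by apply: Op_ge0.
by move: (Op _ _ _ _) (f x) => a b; clear => h1 h2; lra.
Qed.

Lemma iter_le_lazy F f k x : bm f -> (forall y, 0 <= f y) ->
  iter k (Op F (fun=> 1)) f x <= 2 ^+ k * iter k (Op (lazyF F) (fun=> 1)) f x.
Proof.
move=> bf f0; elim: k x => [|k IH] x; first by rewrite expr0 mul1r.
have bi : bm (iter k (Op (lazyF F) (fun=> 1)) f) by exact: bm_iter.
have bi' : bm (iter k (Op F (fun=> 1)) f) by exact: bm_iter.
apply: (@le_trans _ _ (Op F (fun=> 1) (fun y => 2 ^+ k * iter k (Op (lazyF F) (fun=> 1)) f y) x)).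
  by apply: Op_le => //; exact: bmZ.
rewrite OpZ//= exprSr -mulrA; apply: ler_wpM2l; first by rewrite exprn_ge0.
by apply: Op_le_lazy => // y; exact: iter_ge0.
Qed.

(* Iterating G = 2 (chi - Q^N chi) + C G bounds 2 U from above by G up to the
   terms C^k Q^N chi <= 2^k Q^(N+k) chi. *)
Lemma sum_le_lazy F h N K x :
  2 * \sum_(k < K) Cn F h k x <=
  \sum_(n < N) Qn F h n x + 2 * \sum_(k < K) 2 ^+ k * Qn F h (N + k) x.
Proof.
pose G y := \sum_(n < N) Qn F h n y.
have bG : bm G by apply: bm_sum => n; exact: bm_Qn.
have bQ : bm (Qn F h N) by exact: bm_Qn.
have bchi := @bm_chi R h.
have step y : G y = 2 * (chi h y - Qn F h N y) + Op F (fun=> 1) G y.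
  have GE : \sum_(n < N.+1) Qn F h n y = chi h y + Op (lazyF F) (fun=> 1) G y.
    by rewrite big_ord_recl Op_sum// => n; exact: bm_Qn.
  rewrite big_ord_recr/= -/(G y) Op_lazy// in GE.
  by move: (Op _ _ G y) (G y) (chi h y) (Qn _ _ _ y) GE => a b c e; clear => GE; lra.
have key : G x = 2 * (\sum_(k < K) Cn F h k x - \sum_(k < K) iter k (Op F (fun=> 1)) (Qn F h N) x)
    + iter K (Op F (fun=> 1)) G x.
  elim: K => [|K IH]; first by rewrite !big_ord0 subrr mulr0 add0r.
  rewrite {1}IH !big_ord_recr/=.
  have -> : iter K (Op F (fun=> 1)) G x = 2 * (Cn F h K x - iter K (Op F (fun=> 1)) (Qn F h N) x)
       + Op F (fun=> 1) (iter K (Op F (fun=> 1)) G) x.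
    have GE : G = fun y => 2 * (chi h y - Qn F h N y) + Op F (fun=> 1) G y by apply/funext.
    have bB : bm (fun y => chi h y - Qn F h N y) by exact: bmB.
    rewrite {1}GE iter_opD//; [|exact: bmZ|exact: bm_Op].
    by rewrite iterZ// iterB// -iterSr.
  by ring.
have iG : 0 <= iter K (Op F (fun=> 1)) G x.
  by apply: iter_ge0 => // y; apply: sumr_ge0 => n _; exact: Qn_ge0.
have le : \sum_(k < K) iter k (Op F (fun=> 1)) (Qn F h N) x <= \sum_(k < K) 2 ^+ k * Qn F h (N + k) x.
  apply: ler_sum => k _; apply: le_trans (iter_le_lazy F k x bQ (fun y => Qn_ge0 F h N y)) _.
  by rewrite ler_wpM2l ?exprn_ge0// /Qn -iterD addnC.
rewrite -/(G x) key.
move: (\sum_(k < K) Cn F h k x) (\sum_(k < K) iter k _ _ x) (\sum_(k < K) _ * _) (iter K _ G x) iG le => a b c e.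
by clear => h1 h2; lra.
Qed.

(** If every block of K terms after [N0] had sum above [e], disjoint blocks would exceed the bound
    [B]. It makes the remainder of [sum_le_lazy], a block of K late terms, as small as desired. *)
Lemma late_block_small (q : nat -> R) (B : R) N0 K (e : R) : (forall n, 0 <= q n) ->
  (forall N, \sum_(n < N) q n <= B) -> 0 < e ->
  exists2 N, (N0 <= N)%N & \sum_(k < K) q (N + k)%N <= e.
Proof.
move=> q0 qB e0; apply: contrapT => nex.
have big N : (N0 <= N)%N -> e < \sum_(k < K) q (N + k)%N.
  by move=> NN; rewrite ltNge; apply/negP => h; apply: nex; exists N.
have blocks j : j%:R * e <= \sum_(n < N0 + j * K) q n.
  elim: j => [|j IH]; first by rewrite mul0r sumr_ge0.
  rewrite mulSn [(K + _)%N]addnC addnA big_split_ord/= -addn1 natrD mulrDl mul1r.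
  by apply: lerD => //; apply/ltW/big; exact: leq_addr.
have [j Hj] : exists j : nat, B / e < j%:R.
  by exists (Num.truncn (B / e)).+1; exact: truncnS_gt.
have := le_trans (blocks j) (qB _); rewrite leNgt => /negP; apply.
by rewrite -ltr_pdivrMr.
Qed.

Lemma renewal_of_lazy F A h : rv_half A -> lazy_srt F A h -> forall e : R, 0 < e ->
  exists2 x1 : R, 1 <= x1 & forall x : R, x1 <= x -> exists u : R,
    (\sum_(0 <= n <oo) (Cn F h n x)%:E)%E = u%:E /\ `|u - h / pi * (A x / x)| <= e * (A x / x).
Proof.
move=> rA Hl e e0; have [x1 x11 H] := Hl e e0; exists x1 => // x xx1.
have x0 : 0 < x by exact: lt_le_trans (lt_le_trans ltr01 x11) xx1.
have Ax := A_gt0 rA (ltW x0); have q0 : 0 < A x / x by rewrite divr_gt0.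
have [N0 HN] := H x xx1.
pose t := h / pi * (A x / x); have t2 : 2 / pi * h * (A x / x) = 2 * t by rewrite /t; ring.
rewrite t2 in HN; rewrite -/t; set eq := e * (A x / x) in HN *.
have eq0 : 0 < eq by exact: mulr_gt0.
clearbody t eq.
pose GN N := \sum_(n < N) Qn F h n x; pose U K := \sum_(n < K) Cn F h n x.
have Gmono N M : (N <= M)%N -> GN N <= GN M.
  move=> NM; rewrite /GN -(subnKC NM) big_split_ord/= lerDl.
  by apply: sumr_ge0 => n _; exact: Qn_ge0.
have GB N : GN N <= 2 * t + eq.
  apply: le_trans (Gmono _ _ (leq_maxl N N0)) _.
  have := HN _ (leq_maxr N N0); rewrite ler_norml => /andP[_]; rewrite -/(GN _).
  by clear => ?; lra.
have Uup K : 2 * U K <= 2 * t + eq.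
  apply/ler_addgt0Pr => d d0.
  have d1 : 0 < d / (2 * 2 ^+ K) by rewrite divr_gt0// mulr_gt0// exprn_gt0.
  have [N NN hN] := late_block_small N0 K (fun n => Qn_ge0 F h n x) GB d1.
  apply: le_trans (sum_le_lazy F h N K x) _; apply: lerD; first exact: GB.
  apply: (@le_trans _ _ (2 * (2 ^+ K * \sum_(k < K) Qn F h (N + k)%N x))).
    rewrite ler_wpM2l// mulr_sumr; apply: ler_sum => k _.
    by rewrite ler_wpM2r ?Qn_ge0// ler_weXn2l ?ler1n// ltnW.
  by rewrite mulrA mulrC -ler_pdivlMr// mulr_gt0// exprn_gt0.
have Ulow : 2 * t - eq <= 2 * U N0.
  apply: le_trans (lazy_sum_le F h N0 x).
  by have := HN _ (leqnn N0); rewrite ler_norml => /andP[+ _]; clear => ?; lra.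
have C0 n : (0 <= (Cn F h n x)%:E)%E by rewrite lee_fin Cn_ge0.
set S := (\sum_(0 <= n <oo) _)%E.
have Sup : (S <= (t + eq / 2)%:E)%E.
  apply: lime_le; first by apply: is_cvg_nneseries => n _ _; exact: C0.
  apply: nearW => K; rewrite big_mkord sumEFin lee_fin; have := Uup K; rewrite /U.
  by move: (\sum_(n < K) _) => a; clear => ?; lra.
have Slow : ((t - eq / 2)%:E <= S)%E.
  apply: le_trans (nneseries_lim_ge (m := 0%N) (P := xpredT) N0 (fun n _ _ => C0 n)).
  rewrite big_mkord sumEFin lee_fin; move: Ulow; rewrite /U.
  by move: (\sum_(n < N0) _) => a; clear => ?; lra.
have Sfin : S \is a fin_num.
  rewrite fin_numE; apply/andP; split; apply/eqP => Se.
    by move: Slow; rewrite Se.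
  by move: Sup; rewrite Se.
exists (fine S); rewrite fineK//; split => //.
move: Sup Slow; rewrite -(fineK Sfin) !lee_fin ler_norml /=; move: (fine S) => a.
by clear -eq0 => h1 h2; apply/andP; split; lra.
Qed.

End lazy_renewal.

Section positive_part.
Context {R : realType}.
Implicit Types (F : probability (measurableTypeR R) R) (A L f g : R -> R).

Lemma asymp_equivP f g : asymp_equiv f g <->
  forall e : R, 0 < e -> exists2 x1 : R, 1 <= x1 & forall x : R, x1 <= x -> `|f x / g x - 1| <= e.
Proof.
split=> [/cvgrPdist_le H e e0|H].
  have [M [_ HM]] := H e e0; exists (Num.max 1 (M + 1)); first by rewrite le_max lexx.
  move=> x; rewrite ge_max => /andP[_ Mx]; rewrite distrC; apply: HM.
  by apply: lt_le_trans Mx; rewrite ltrDl.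
apply/cvgrPdist_le => e e0; have [x1 _ Hx] := H e e0.
by exists x1; split; [exact: num_real|move=> x /ltW /Hx; rewrite distrC].
Qed.

Lemma rv_half_intro A : (forall x : R, 0 <= x -> 0 < A x) ->
  (forall x y : R, 0 <= x -> x < y -> A x < A y) ->
  (forall s : R, 0 < s -> derivable A s 1) ->
  asymp_equiv A^`()%classic (fun s => 2^-1 * (A s / s)) -> rv_half A.
Proof.
move=> A0 Ai Ad /asymp_equivP Aas; split => // e e0.
have e20 : 0 < 2 * e by rewrite mulr_gt0.
have [s0 s01 H] := Aas _ e20; exists s0 => // s ss0.
have sp : 0 < s by exact: lt_le_trans (lt_le_trans ltr01 s01) ss0.
split; first exact: Ad.
have q0 : 0 < A s / s by rewrite divr_gt0// A0// ltW.
have h0 : 0 < 2^-1 * (A s / s) by rewrite mulr_gt0.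
have := H s ss0; rewrite ler_norml lerBrDr lerBlDr ler_pdivlMr// ler_pdivrMr//.
move: (A^`()%classic s) (A s / s) => a q /andP[h1 h2].
by clear -h1 h2; apply/andP; split; lra.
Qed.

Lemma half_tail_intro F A : rv_half A -> F `[0, +oo[%classic = 1%E ->
  asymp_equiv (tail F) (fun x => 1 / A x) -> half_tail F A.
Proof.
move=> rA F1 /asymp_equivP Ft.
have F0 : F `]-oo, 0[%classic = 0%E.
  have m1 : measurable (`[(0:R), +oo[%classic : set (measurableTypeR R)) by exact: measurable_itv.
  have -> : `]-oo, (0:R)[%classic = ~` `[(0:R), +oo[%classic by rewrite setCitvr.
  by have := probability_setC F m1; rewrite F1 subee.
split => // e e0.
have e20 : 0 < 2 * e by rewrite mulr_gt0.
have [x1 x11 H] := Ft _ e20; exists x1 => // x xx1.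
have x0 : 0 < x by exact: lt_le_trans (lt_le_trans ltr01 x11) xx1.
have Ax := A_gt0 rA (ltW x0).
have tE : tl F x = 2^-1 * tail F x.
  rewrite /tl J_lazy; last exact: bm_gt.
  rewrite ltNge (ltW x0) mulr0 add0r /tail; congr (_ * _).
  rewrite -J_indic//; congr (J _ _); apply/funext => y.
  by rewrite indicE/= mem_setE in_itv/= andbT.
have := H x xx1; rewrite tE ler_norml div1r invrK.
move: (tail F x) (A x) => a b /andP[h1 h2].
by clear -h1 h2; apply/andP; split; lra.
Qed.

Lemma sq_AL A L : (forall x : R, 0 < x -> A x = L x * Num.sqrt x) ->
  forall x : R, 0 < x -> A x ^+ 2 / x = L x ^+ 2.
Proof.
by move=> AL x x0; rewrite AL// exprMn sqr_sqrtr ?(ltW x0)// mulfK// gt_eqF.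
Qed.

Lemma le_running_sup A L : rv_half A -> (forall x : R, 0 < x -> A x = L x * Num.sqrt x) ->
  forall x s : R, 1 <= s -> s <= x -> L s <= running_sup L x.
Proof.
move=> rA AL x s s1 sx; apply: ub_le_sup; last by exists s => //; rewrite /= in_itv/= s1.
(* [L] is bounded on [1, x], as [sup] requires, since there [L z <= A z <= A x]. *)
exists (A x) => _ [z /= + <-]; rewrite in_itv/= => /andP[z1 zx].
have z0 : 0 < z by exact: lt_le_trans z1.
have Lz : 0 <= L z.
  have := A_gt0 rA (ltW z0); rewrite AL// pmulr_lgt0 ?sqrtr_gt0//.
  exact: ltW.
have sz : 1 <= Num.sqrt z by rewrite -sqrtr1 ler_wsqrtr.
apply: (@le_trans _ _ (A z)); last by apply: (A_le rA) => //; exact: ltW.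
by rewrite AL// ler_peMr.
Qed.

Lemma L_dominated_intro A L : rv_half A -> slowly_varying L ->
  (forall x : R, 0 < x -> A x = L x * Num.sqrt x) ->
  running_sup L =O_+oo L -> L_dominated A.
Proof.
move=> rA [L0 _] AL /eqO_exP [C C0 [M [_ HM]]].
exists (C ^+ 2), (Num.max 1 (M + 1)); split; [by rewrite exprn_gt0|by rewrite le_max lexx|].
move=> x z; rewrite ge_max => /andP[z1 Mz] zx.
have z0 : 0 < z by exact: lt_le_trans z1.
have x0 : 0 < x by exact: lt_le_trans zx.
rewrite !(sq_AL AL)// -exprMn.
have Lx := L0 x (ltW x0).
have h : running_sup L x <= C * L x.
  apply: le_trans (ler_norm _) _; rewrite -(gtr0_norm Lx); apply: HM.
  by apply: lt_le_trans (le_trans Mz zx); rewrite ltrDl.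
rewrite lerXn2r// ?nnegrE; [exact: ltW (L0 z (ltW z0))|by rewrite mulr_ge0 ?ltW|].
exact: le_trans (le_running_sup rA AL z1 zx) h.
Qed.

Lemma renewal_asymptotics_intro F A h (d : measure_display) (Omega : measurableType d)
    (P : probability Omega R) (X : nat -> {RV P >-> measurableTypeR R}) :
  rv_half A -> iid_with_law X F -> 0 < h -> lazy_srt F A h ->
  renewal_asymptotics A h (renewal_measure X).
Proof.
move=> rA iidX h0 Hl; apply/asymp_equivP => e e0.
have p0 := pi_gt0 R.
have e' : 0 < h / pi * e by rewrite mulr_gt0// divr_gt0.
have [x1 x11 H] := renewal_of_lazy rA Hl e'; exists x1 => // x xx1.
have x0 : 0 < x by exact: lt_le_trans (lt_le_trans ltr01 x11) xx1.
have [u [uE hu]] := H x xx1.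
have q0 : 0 < A x / x by rewrite divr_gt0// (A_gt0 rA (ltW x0)).
have -> : renewal_measure X `]x - h, x]%classic = u%:E.
  rewrite -uE /renewal_measure; apply: eq_eseriesr => n _.
  exact: (walk_window iidX n h x).
rewrite /= sin_pihalf; move: (A x / x) q0 hu => q q0 hu.
have c0 : 0 < 1 / pi * h * q by rewrite !mulr_gt0// invr_gt0.
have -> : u / (1 / pi * h * q) - 1 = (u - h / pi * q) / (1 / pi * h * q).
  by move: (pi : R) p0 {hu e' c0} => p p0; field; rewrite !gt_eqF.
rewrite normrM normfV (gtr0_norm c0) ler_pdivrMr//; apply: le_trans hu _.
rewrite le_eqVlt; apply/orP; left; apply/eqP.
by move: (pi : R) p0 {e' c0} => p p0; field; rewrite gt_eqF.
Qed.

Theorem SRT_of_dominated F A : half_tail F A -> L_dominated A -> SRT A F.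
Proof.
move=> hF HL d Omega P X iidX; have rA := ht_rv hF; split.
  move=> h [h0 Fh hmax]; apply: (renewal_asymptotics_intro rA iidX h0).
  exact: arithmetic_srt.
move=> nar h h0; apply: (renewal_asymptotics_intro rA iidX h0).
apply: nonarithmetic_srt => // th th0; rewrite ltNge; apply/negP => dth.
apply: nar; exists (2 * pi / th); first by rewrite divr_gt0// mulr_gt0// pi_gt0.
exact: dec_eq0_lattice.
Qed.

End positive_part.

(** * Independent sequences on the unit interval *)

(* u n is the tail P(X >= n): the n-th interval ]u n.+1, u n] is where the digit
   is n, and rescaling it onto ]0, 1] yields an independent uniform variable. *)
Record digit_scale (R : realType) (u : nat -> R) : Prop := DigitScale {
  dsc0 : u 0%N = 1;
  dsc_gt0 : forall n, 0 < u n;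
  dscS : forall n, u n.+1 < u n;
  dsc_lim : forall e : R, 0 < e -> exists n, u n < e }.

Section digits.
Context {R : realType} (u : nat -> R) (hu : digit_scale u).

Lemma dsc_mono m n : (m <= n)%N -> u n <= u m.
Proof.
elim: n => [|n IH]; first by rewrite leqn0 => /eqP->.
rewrite leq_eqVlt => /predU1P[->//|/IH h]; apply: le_trans h; exact: ltW (dscS hu n).
Qed.

Definition dint n : set (measurableTypeR R) := `]u n.+1, u n]%classic.

(** Outside ]0, 1] the default is 0, which is why the preimage of 0 is described in [digit_preim] as
    a complement. *)
Definition digit (w : measurableTypeR R) : nat := xget 0%N [set n | dint n w].

Lemma dint_inj m n w : dint m w -> dint n w -> m = n.
Proof.
wlog mn : m n / (m <= n)%N => [H hm hn|].
  by have [/H->//|/ltnW/H H'] := leqP m n; apply/esym; exact: H'.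
rewrite /dint /= !in_itv/= => /andP[h1 _] /andP[_ h2]; apply/eqP; rewrite eqn_leq mn/= leqNgt.
apply/negP => /dsc_mono h3; have := lt_le_trans h1 (le_trans h2 h3).
by rewrite ltxx.
Qed.

Lemma digitE n w : dint n w -> digit w = n.
Proof.
move=> h; rewrite /digit; case: xgetP => [m _ hm|]; first exact: (dint_inj hm h).
by move=> /(_ n).
Qed.

Lemma dint_digit w : 0 < w -> w <= 1 -> dint (digit w) w.
Proof.
move=> w0 w1; have ex : exists n, u n < w by exact: (dsc_lim hu).
have [[|n] hn hmin] := ex_minnP ex.
  by move: hn; rewrite (dsc0 hu) ltNge w1.
have hw : dint n w.
  by rewrite /dint /= in_itv/= hn leNgt; apply/negP => /hmin; rewrite ltnn.
by rewrite (digitE hw).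
Qed.

Lemma dint_itv n w : dint n w -> 0 < w <= 1.
Proof.
rewrite /dint /= in_itv/= => /andP[h1 h2]; rewrite (lt_trans (dsc_gt0 hu n.+1) h1)/=.
by apply: le_trans h2 _; rewrite -(dsc0 hu); exact: dsc_mono.
Qed.

Lemma digit_ge n w : 0 < w -> w <= 1 -> (n <= digit w)%N = (w <= u n).
Proof.
move=> w0 w1; have := dint_digit w0 w1; rewrite /dint /= in_itv/= => /andP[h1 h2].
apply/idP/idP => [/dsc_mono|h3]; first exact: le_trans.
rewrite leqNgt; apply/negP => /dsc_mono h4; have := lt_le_trans h1 (le_trans h3 h4).
by rewrite ltxx.
Qed.

Definition daff n (w : measurableTypeR R) : measurableTypeR R := (w - u n.+1) / (u n - u n.+1).

Definition rest (w : measurableTypeR R) : measurableTypeR R := daff (digit w) w.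

Lemma measurable_dint n : measurable (dint n).
Proof. exact: measurable_itv. Qed.

Lemma measurable_daff n : measurable_fun [set: measurableTypeR R] (daff n).
Proof.
have h1 := @measurable_funB _ _ R [set: measurableTypeR R] id (cst (u n.+1)).
have h2 := @measurable_funM _ _ R [set: measurableTypeR R] (fun w => w - u n.+1) (cst (u n - u n.+1)^-1).
by apply: h2; [apply: h1; [exact: measurable_id|exact: measurable_cst]|exact: measurable_cst].
Qed.

Lemma digit_preim n : digit @^-1` [set n] =
  if n == 0%N then ~` \bigcup_(k in [set k | k != 0%N]) dint k else dint n.
Proof.
apply/seteqP; case: eqP => [->|n0]; split => w /=.
- by move=> dw [k /= k0 /digitE]; rewrite dw => /eqP; rewrite eq_sym (negbTE k0).
- move=> nb; rewrite /digit; case: xgetP => // k _ hk.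
  by apply: contrapT => k0; apply: nb; exists k => //; apply/eqP.
- rewrite /digit; case: xgetP => [k _ hk <-//|_ h]; by case: n0.
- exact: digitE.
Qed.

Lemma measurable_digit1 n : measurable (digit @^-1` [set n] : set (measurableTypeR R)).
Proof.
rewrite digit_preim; case: eqP => _; last exact: measurable_dint.
by apply: measurableC; apply: bigcup_measurable => k _; exact: measurable_dint.
Qed.

Lemma measurable_digit (B : set nat) : measurable (digit @^-1` B : set (measurableTypeR R)).
Proof.
have -> : digit @^-1` B = \bigcup_(n in B) (digit @^-1` [set n]).
  by apply/seteqP; split => [w Bw|w [n Bn dw]]; [exists (digit w)|rewrite /preimage /= dw].
by apply: bigcup_measurable => n _; exact: measurable_digit1.
Qed.

Lemma measurable_rest : measurable_fun [set: measurableTypeR R] rest.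
Proof.
move=> _ E mE; rewrite setTI.
have -> : rest @^-1` E = \bigcup_n (digit @^-1` [set n] `&` daff n @^-1` E).
  apply/seteqP; split => [w Ew|w [n _ [dw Ew]]]; first by exists (digit w).
  by rewrite /preimage /= /rest dw.
apply: bigcup_measurable => n _; apply: measurableI; first exact: measurable_digit1.
by rewrite -[X in measurable X]setTI; exact: measurable_daff.
Qed.

Lemma lebesgue_daff n (E : set (measurableTypeR R)) : measurable E ->
  lebesgue_measure (daff n @^-1` E) = ((u n - u n.+1)%:E * lebesgue_measure E)%E.
Proof.
move=> mE; have d0 : 0 < u n - u n.+1 by rewrite subr_gt0 dscS.
have di : 0 <= (u n - u n.+1)^-1 by rewrite invr_ge0 ltW.
pose nu := measure_function_pushforward__canonical__measure_function_Measure
  (mscale (NngNum di) (@lebesgue_measure R)) (measurable_daff n).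
have : lebesgue_measure E = nu E.
  apply: (@lebesgue_measure_unique R nu) => // _ [[a b]] _ <-.
  rewrite /nu /= /pushforward /mscale /=.
  have -> : daff n @^-1` `]a, b]%classic =
      `]a * (u n - u n.+1) + u n.+1, b * (u n - u n.+1) + u n.+1]%classic.
    apply/seteqP; split => w; rewrite /daff /preimage /= !in_itv/= ltr_pdivlMr// ler_pdivrMr//;
      by rewrite ltrBrDr lerBlDr.
  rewrite !lebesgue_measure_itv/= !lte_fin ltrD2r ltr_pM2r//.
  case: ifP => _; last by rewrite mule0.
  by rewrite -!EFinB -EFinM; congr EFin; field; rewrite gt_eqF.
rewrite /nu /= /pushforward /mscale /= => ->.
by rewrite muleA -EFinM mulfV ?gt_eqF// mul1e.
Qed.

Definition P01 := mrestr (@lebesgue_measure R) (measurable_itv `](0:R), 1]).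

HB.instance Definition _ := Measure.on P01.

Let P01_setT : P01 setT = 1%E.
Proof. by rewrite /P01 /mrestr setTI lebesgue_measure_itv/= lte_fin ltr01 -EFinB subr0. Qed.

HB.instance Definition _ := Measure_isProbability.Build _ _ _ P01 P01_setT.

Lemma P01E (E : set (measurableTypeR R)) : P01 E = lebesgue_measure (E `&` `](0:R), 1]%classic).
Proof. by []. Qed.

Lemma P01_digit_rest1 n (E : set (measurableTypeR R)) : measurable E ->
  P01 (digit @^-1` [set n] `&` rest @^-1` E) = ((u n - u n.+1)%:E * P01 E)%E.
Proof.
move=> mE; have d0 : 0 < u n - u n.+1 by rewrite subr_gt0 dscS.
have mI : measurable (`](0:R), 1]%classic : set (measurableTypeR R)) by exact: measurable_itv.
rewrite !P01E -lebesgue_daff; last exact: measurableI.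
congr (lebesgue_measure _); apply/seteqP; split => w.
  move=> [[dw rw] /=]; rewrite in_itv/= => /andP[w0 w1]; split.
    by move: rw; rewrite /rest /preimage /= dw.
  have := dint_digit w0 w1; rewrite dw /dint /= !in_itv/= => /andP[h1 h2].
  rewrite /daff; apply/andP; split; first by rewrite divr_gt0// subr_gt0.
  by rewrite ler_pdivrMr// mul1r lerB.
move=> [Ew]; rewrite /daff /= in_itv/= ler_pdivrMr// mul1r lerD2r => /andP[].
rewrite pmulr_lgt0 ?invr_gt0// subr_gt0 => w1 w2.
have dw : dint n w by rewrite /dint /= in_itv/= w1.
split; last by have := dint_itv dw; rewrite /= in_itv.
by split; rewrite /preimage /= /rest (digitE dw).
Qed.

(** Each piece ]u n.+1, u n] is rescaled linearly onto ]0, 1], so the rest is uniform given the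
    digit. Iterating this independence makes the successive digits an i.i.d. sequence. *)
Lemma P01_digit_rest (B : set nat) (E : set (measurableTypeR R)) : measurable E ->
  P01 (digit @^-1` B `&` rest @^-1` E) = (P01 (digit @^-1` B) * P01 E)%E.
Proof.
move=> mE.
have key (E' : set (measurableTypeR R)) : measurable E' ->
    P01 (digit @^-1` B `&` rest @^-1` E') = (\sum_(n <oo) (if n \in B then (u n - u n.+1)%:E else 0) * P01 E')%E.
  move=> mE'; pose G n := if n \in B then digit @^-1` [set n] `&` rest @^-1` E' else set0.
  have mG n : measurable (G n).
    rewrite /G; case: ifP => // _; apply: measurableI; first exact: measurable_digit1.
    by rewrite -[X in measurable X]setTI; exact: measurable_rest.
  have -> : digit @^-1` B `&` rest @^-1` E' = \bigcup_n G n.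
    apply/seteqP; split => [w [Bw rw]|w [n _]].
      by exists (digit w) => //; rewrite /G mem_set.
    by rewrite /G; case: ifP => [/set_mem Bn [dw rw]|_ []]; split => //; rewrite /preimage /= dw.
  rewrite measure_bigcup//; last first.
    move=> i j _ _ [w []]; rewrite /G; case: ifP => _ [] //; case: ifP => _ [] //.
    by move=> di _ [dj _]; rewrite -di -dj.
  rewrite (eq_eseriesl (Q := xpredT)); last by move=> n; rewrite in_setT.
  apply: eq_eseriesr => n _; rewrite /G; case: ifP => _; last by rewrite measure0 mul0e.
  exact: P01_digit_rest1.
have mT : measurable [set: measurableTypeR R] by [].
have d0 n : (0 <= (if n \in B then (u n - u n.+1)%:E else 0))%E.
  by case: ifP => // _; rewrite lee_fin subr_ge0 ltW// dscS.
rewrite key//; have := key _ mT; rewrite preimage_setT setIT => ->.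
have -> : P01 [set: measurableTypeR R] = 1%E by exact: probability_setT.
have Pf : P01 E \is a fin_num by exact: fin_num_measure.
rewrite -(fineK Pf); under eq_eseriesr do rewrite muleC.
rewrite nneseriesZl//.
by rewrite muleC; congr (_ * _)%E; apply: eq_eseriesr => n _; rewrite mule1.
Qed.

Definition dseq i (w : measurableTypeR R) : measurableTypeR R := (digit (iter i rest w))%:R.

Lemma measurable_iter_rest i : measurable_fun [set: measurableTypeR R] (iter i rest).
Proof.
elim: i => [|i IH]; first exact: measurable_id.
by apply: (measurableT_comp measurable_rest IH).
Qed.

Lemma measurable_dseq i : measurable_fun [set: measurableTypeR R] (dseq i).
Proof.
move=> _ B mB; rewrite setTI.
have -> : dseq i @^-1` B = iter i rest @^-1` (digit @^-1` [set n | B (n%:R : R)]) by [].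
by rewrite -[X in measurable X]setTI; apply: measurable_iter_rest => //; exact: measurable_digit.
Qed.

HB.instance Definition _ i := isMeasurableFun.Build _ _ (measurableTypeR R) (measurableTypeR R)
  (dseq i) (measurable_dseq i).

Definition dRV i : {RV P01 >-> measurableTypeR R} := dseq i : {mfun _ >-> _}.

Definition dlaw := distribution P01 (dRV 0).

HB.instance Definition _ := Probability.on dlaw.

Lemma P01_rest (E : set (measurableTypeR R)) : measurable E -> P01 (rest @^-1` E) = P01 E.
Proof.
move=> mE; have := P01_digit_rest setT mE; rewrite preimage_setT setTI => ->.
by rewrite probability_setT mul1e.
Qed.

Lemma dseq_law i (B : set (measurableTypeR R)) : measurable B ->
  P01 (dseq i @^-1` B) = P01 (dseq 0 @^-1` B).
Proof.
move=> mB; elim: i => // i IH; rewrite -IH.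
have -> : dseq i.+1 @^-1` B = rest @^-1` (dseq i @^-1` B).
  by apply/seteqP; split => w; rewrite /preimage /= /dseq iterSr.
by rewrite P01_rest// -[X in measurable X]setTI; exact: measurable_dseq.
Qed.

Lemma dseq_rect N (B : nat -> set (measurableTypeR R)) : (forall i, measurable (B i)) ->
  P01 (\bigcap_(i < N) (dseq i @^-1` B i)) = (\prod_(i < N) P01 (dseq 0 @^-1` B i))%E.
Proof.
elim: N B => [|N IH] B mB; first by rewrite bigcap_mkord !big_ord0 probability_setT.
rewrite big_ord_recl -(IH (fun i => B i.+1))//.
have -> : \bigcap_(i < N.+1) (dseq i @^-1` B i) =
    digit @^-1` [set n | B 0%N (n%:R : R)] `&` rest @^-1` (\bigcap_(i < N) (dseq i @^-1` B i.+1)).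
  apply/seteqP; split => [w H|w [h0 H] [|i] iN].
  - split; first exact: (H 0%N).
    by move=> i iN; have := H i.+1 iN; rewrite /preimage /= /dseq iterSr.
  - exact: h0.
  - by have := H i iN; rewrite /preimage /= /dseq iterSr.
rewrite P01_digit_rest//; apply: fin_bigcap_measurable; first exact: finite_II.
by move=> i _; rewrite -[X in measurable X]setTI; exact: measurable_dseq.
Qed.

Lemma dseq_iid : iid_with_law dRV dlaw.
Proof.
split=> [J B mB|i B mB]; last exact: dseq_law.
pose N := (\max_(i <- J) i).+1.
have JN i : i \in J -> (i < N)%N by move=> iJ; rewrite ltnS; exact: leq_bigmax_seq.
clearbody N.
pose B' i := if i \in J then B i else setT.
have mB' i : measurable (B' i) by rewrite /B'; case: ifP.
have -> : \bigcap_(i in [set` J]) (dRV i @^-1` B i) = \bigcap_(i < N) (dseq i @^-1` B' i).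
  apply/seteqP; split => w H i.
    by move=> _; rewrite /B'; case: ifP => // iJ; exact: H.
  by move=> iJ; have := H i (JN i iJ); rewrite /B' iJ.
transitivity (\prod_(i < N) P01 (dseq 0 @^-1` B' i))%E; first exact: dseq_rect.
transitivity (\prod_(i <- iota 0 N) P01 (dseq 0 @^-1` B' i))%E; first by rewrite -(big_mkord xpredT (fun i => P01 (dseq 0 @^-1` B' i))) /index_iota subn0.
rewrite (bigID (fun i => i \in J))/= [X in (_ * X)%E]big1 ?mule1; last first.
  by move=> i iJ; rewrite /B' (negbTE iJ) preimage_setT probability_setT.
rewrite -big_filter; transitivity (\prod_(i <- J) P01 (dseq 0 @^-1` B' i))%E.
  apply: perm_big; apply: uniq_perm; [by apply: filter_uniq; exact: iota_uniq|exact: fset_uniq|].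
  by move=> i; rewrite mem_filter mem_iota add0n leq0n/=; case: (boolP (i \in J)) => // /JN ->.
by apply: eq_big_seq => i iJ; rewrite /B' iJ -(dseq_law i)//.
Qed.

Lemma dlawE (B : set (measurableTypeR R)) :
  dlaw B = P01 (digit @^-1` [set n | B (n%:R : R)]).
Proof. by []. Qed.

Lemma P01_digit_ge n : P01 (digit @^-1` [set m | (n <= m)%N]) = (u n)%:E.
Proof.
have -> : P01 (digit @^-1` [set m | (n <= m)%N]) = lebesgue_measure (`]0, u n]%classic : set R).
  rewrite P01E; congr (lebesgue_measure _); apply/seteqP; split => w.
    by move=> [/= h]; rewrite !in_itv/= => /andP[w0 w1]; rewrite w0/= -digit_ge.
  rewrite /= !in_itv/= => /andP[w0 w1].
  have w1' : w <= 1 by apply: le_trans w1 _; rewrite -(dsc0 hu); exact: dsc_mono.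
  by rewrite w0 w1'; split => //=; rewrite digit_ge.
by rewrite lebesgue_measure_itv/= lte_fin (dsc_gt0 hu) -EFinB subr0.
Qed.

Lemma P01_digit n : P01 (digit @^-1` [set n]) = (u n - u n.+1)%:E.
Proof.
have mT : measurable [set: measurableTypeR R] by [].
by have := P01_digit_rest1 n mT; rewrite preimage_setT setIT probability_setT mule1.
Qed.

Lemma dlaw1 n : dlaw [set (n%:R : R)] = (u n - u n.+1)%:E.
Proof.
rewrite dlawE -P01_digit; congr (P01 (digit @^-1` _)); apply/seteqP; split => m /=.
  by move=> /eqP; rewrite eqr_nat => /eqP.
by move->.
Qed.

Lemma dlaw_ge0 : dlaw `[0, +oo[%classic = 1%E.
Proof.
rewrite dlawE; have -> : [set n | (`[(0:R), +oo[%classic : set R) n%:R] = setT.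
  by apply/seteqP; split => // n _ /=; rewrite in_itv/= ler0n.
by rewrite preimage_setT probability_setT.
Qed.

Lemma dlaw_tail x : 0 <= x -> tail dlaw x = u (Num.truncn x).+1.
Proof.
move=> x0; rewrite /tail.
change (fine (P01 (digit @^-1` [set n | (`]x, +oo[%classic : set R) n%:R])) = u (Num.truncn x).+1).
have -> : [set n | (`]x, +oo[%classic : set R) n%:R] = [set m | ((Num.truncn x).+1 <= m)%N].
  by apply/seteqP; split => n /=; rewrite in_itv/= andbT -truncn_lt_nat.
by rewrite P01_digit_ge.
Qed.

(** The atom at 1 is positive because [u] decreases strictly, so 1 belongs to any lattice carrying
    the law. *)
Lemma dlaw_span : is_arithmetic_span dlaw 1.
Proof.
split => //.
  change (P01 (digit @^-1` [set n : nat | lattice (1 : R) n%:R]) = 1%E).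
  have -> : [set n : nat | lattice (1 : R) n%:R] = setT.
    by apply/seteqP; split => // n _; exists (n%:Z) => //; rewrite mulr1.
  by rewrite preimage_setT probability_setT.
move=> h h0 hs.
have l1 : lattice h (1 : R).
  apply: contrapT => nl.
  have mL := measurable_lattice h.
  have h1 : (dlaw [set 1%R : R] <= dlaw (~` lattice h))%E.
    apply: le_measure; rewrite ?inE//; [exact: measurableC|by move=> _ ->].
  have h2 : dlaw (~` lattice h) = 0%E by rewrite probability_setC// hs subee.
  move: h1; rewrite h2 (dlaw1 1) lee_fin leNgt subr_gt0 => /negP; apply.
  exact: (dscS hu).
case: l1 => k _ k1.
have k0 : 0 < k%:~R :> R by rewrite -(pmulr_lgt0 _ h0) k1.
have k1' : 1 <= k%:~R :> R by rewrite ler1z -gtz0_ge1 -(ltr0z R).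
by rewrite -k1 ler_peMl// ltW.
Qed.

End digits.

(** * The counterexample *)

Section one_big_jump.
Context {R : realType} (F : probability (measurableTypeR R) R).
Context (F0 : F `]-oo, 0[%classic = 0%E).
Implicit Types (f : R -> R).

Let b1 : bm (fun _ : R => 1 : R). Proof. exact: bm_cst. Qed.

Let p1 (y : R) : (0 : R) <= (fun=> 1) y. Proof. exact: ler01. Qed.

(* Exactly one of the first n steps is a jump of size at least m: if w < 2 m, then
   after it the walk has no room for another one. *)
Lemma one_jump_lower f (m w : R) n : bm f -> (forall y, 0 <= f y) ->
  (forall v, v < 0 -> f v = 0) -> w < 2 * m ->
  n.+1%:R * Op F (fun y => (m <= y)%R%:R) (iter n (Op F (fun=> 1)) f) w <= iter n.+1 (Op F (fun=> 1)) f w.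
Proof.
move=> bf f0 fN wm.
pose pg (y : R) : R := (m <= y)%R%:R; pose pl (y : R) : R := (y < m)%R%:R.
have bg : bm pg by exact: bm_ge.
have bl : bm pl by exact: bm_lt.
have g0 y : 0 <= pg y by exact: ler0n.
have l0 y : 0 <= pl y by exact: ler0n.
have bi k : bm (iter k (Op F (fun=> 1)) f) by exact: bm_iter.
have i0 k y : 0 <= iter k (Op F (fun=> 1)) f y by apply: iter_ge0.
have split1 h : bm h -> Op F (fun=> 1) h = fun x => Op F pg h x + Op F pl h x.
  move=> bh; rewrite -OpDp//; congr (Op F _ h); apply/funext => y.
  by rewrite /pg /pl leNgt; case: (y < m); rewrite ?addr0 ?add0r.
have low k v : v < m -> Op F pl (iter k (Op F (fun=> 1)) f) v = iter k.+1 (Op F (fun=> 1)) f v.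
  move=> vm; rewrite iterS split1//.
  have -> : Op F pg (iter k (Op F (fun=> 1)) f) v = 0; last by rewrite add0r.
  transitivity (J F (fun=> 0)); last by rewrite J_cst mul0r.
  congr (J _ _); apply/funext => y; rewrite /pg.
  case: leP => my; last by rewrite mul0r.
  by rewrite iter_neg// ?mulr0// subr_lt0 (lt_le_trans vm).
rewrite -/pg; elim: n w wm => [|n IH] w wm.
  by rewrite mul1r; apply: Op_lep => // y; rewrite lern1 leq_b1.
have bgi : bm (Op F pg (iter n (Op F (fun=> 1)) f)) by exact: bm_Op.
have -> : iter n.+2 (Op F (fun=> 1)) f w = Op F (fun=> 1) (iter n.+1 (Op F (fun=> 1)) f) w by [].
rewrite split1// -natr1 mulrDl mul1r [leRHS]addrC lerD2r.
apply: (@le_trans _ _ (Op F pl (fun v => n.+1%:R * Op F pg (iter n (Op F (fun=> 1)) f) v) w)); last first.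
  apply: (Op_le_loc F0) => //; first exact: bmZ.
  by move=> v vw; apply: IH; exact: le_lt_trans vw wm.
rewrite (OpZ F n.+1%:R bl bgi) (Op_comm F F bl bg (bi n)).
apply: ler_wpM2l; first exact: ler0n.
apply: J_le; [exact: bm_Op_body|by apply: bm_Op_body => //; exact: bm_Op|].
move=> y; rewrite /pg; case: (leP m y) => my; last by rewrite !mul0r.
by rewrite !mul1r low//; clear -my wm; lra.
Qed.

Lemma clamp_lip (Z z y : R) : 0 <= Z -> clamp Z z - clamp Z y <= clamp Z (z - y).
Proof.
move=> Z0; rewrite lerBlDr.
have /andP[c0 c1] := clamp_bounds (z - y) Z0.
have [y0|y0] := leP y 0.
  have -> : clamp Z y = 0 by rewrite /clamp (max_idPr y0) (min_idPl Z0).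
  rewrite addr0 /clamp; apply: le_min2 => //; apply: le_max2 => //.
  by rewrite lerBrDr gerDl.
have [yZ|Zy] := leP y Z; last first.
  have -> : clamp Z y = Z by rewrite /clamp (max_idPl (ltW y0)) (min_idPr (ltW Zy)).
  by have /andP[_ h] := clamp_bounds z Z0; clear -h c0; lra.
rewrite [clamp Z y]clampE ?(ltW y0)//.
have [zy|zy] := leP (z - y) 0.
  have zy' : clamp Z z <= y.
    rewrite /clamp ge_min; apply/orP; left; rewrite ge_max (ltW y0) andbT.
    by clear -zy; lra.
  by clear -zy' c0; lra.
have z0 : 0 < z by clear -zy y0; lra.
rewrite /clamp (max_idPl (ltW z0)) (max_idPl (ltW zy)) -lerBlDr.
rewrite le_min; apply/andP; split; rewrite lerBlDr ge_min; apply/orP; [left|right].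
  by rewrite subrK.
by rewrite lerDl ltW.
Qed.

(** Markov's inequality with a truncated mean: [clamp Z z / Z] is at most the indicator for z <= Z,
    equals 1 at Z, and by [clamp_lip] loses on average at most [J F (clamp Z) / Z] per step. *)
Lemma iter_window_lower (Z : R) n : 0 < Z ->
  1 - n%:R * (J F (clamp Z) / Z) <= iter n (Op F (fun=> 1)) (chi (Z + 1)) Z.
Proof.
move=> Z0; pose rho z := clamp Z z / Z; pose k := J F (clamp Z) / Z.
have bc := bm_clamp (ltW Z0).
have br : bm rho.
  have -> : rho = fun z => Z^-1 * clamp Z z by apply/funext => z; rewrite /rho mulrC.
  exact: bmZ.
have key z : rho z - n%:R * k <= iter n (Op F (fun=> 1)) rho z.
  elim: n z => [|n IH] z; first by rewrite mul0r subr0.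
  have bi : bm (iter n (Op F (fun=> 1)) rho) by exact: bm_iter.
  have E : rho z - n.+1%:R * k = J F (fun y => (rho z - n%:R * k) - Z^-1 * clamp Z y).
    rewrite JB; [|exact: bm_cst|exact: bmZ]; rewrite J_cst J_prob1 JZ// -natr1 /k; ring.
  rewrite E iterS; apply: J_le; [by apply: bmB; [exact: bm_cst|exact: bmZ]|exact: bm_Op_body|].
  move=> y; rewrite mul1r; apply: le_trans (IH (z - y)).
  rewrite /rho; have := clamp_lip z y (ltW Z0).
  rewrite -(ler_pM2r (_ : 0 < Z^-1)) ?invr_gt0//.
  by move: (n%:R * k) => a; rewrite mulrBl [_^-1 * _]mulrC; clear => ?; lra.
have r1 : rho Z = 1 by rewrite /rho clampE ?lexx ?(ltW Z0)// divff// gt_eqF.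
have := key Z; rewrite r1 => h; apply: le_trans h _.
apply: (iter_le_loc F0) => //; first exact: bm_chi.
move=> v vZ; rewrite /chi /rho.
have vZ1 : v < Z + 1 by clear -vZ; lra.
rewrite vZ1 andbT; case: (leP 0 v) => v0.
  by rewrite clampE ?v0// ler_pdivrMr// mul1r.
by rewrite /clamp (max_idPr (ltW v0)) (min_idPl (ltW Z0)) mul0r.
Qed.

Lemma chiE (h t : R) : 0 <= h -> chi h t = (0 <= t)%R%:R - (h <= t)%R%:R.
Proof.
move=> h0; rewrite /chi; case: (leP 0 t) => t0; case: (ltP t h) => th /=; rewrite ?subrr ?subr0//.
by have := le_lt_trans (le_trans h0 th) t0; rewrite ltxx.
Qed.

Lemma sum_Cn_window n (Z : nat) :
  \sum_(w < Z.+1) Cn F 1 n w%:R = iter n (Op F (fun=> 1)) (chi (Z%:R + 1)) Z%:R.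
Proof.
have bchi := @bm_chi R 1.
pose g (w : nat) (z : R) := chi 1 (z + (w%:R - Z%:R)).
have bg w : bm (g w).
  have -> : g w = fun z => (Z%:R - w%:R <= z)%R%:R - (1 + (Z%:R - w%:R) <= z)%R%:R.
    apply/funext => z; rewrite /g chiE//; congr (_%:R - _%:R); congr nat_of_bool.
      by rewrite -[RHS]subr_ge0; congr (_ <= _); ring.
    by rewrite -[LHS]subr_ge0 -[RHS]subr_ge0; congr (_ <= _); ring.
  by apply: bmB; exact: bm_ge.
have -> : chi (Z%:R + 1) = fun z : R => \sum_(w < Z.+1) g w z.
  apply/funext => z; rewrite -(big_mkord xpredT (fun w => g w z)).
  pose f (i : nat) : R := (1 <= z + (i%:R - Z%:R))%R%:R.
  rewrite (eq_bigr (fun i => f i.+1 - f i)); last first.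
    move=> i _; rewrite /f /g chiE//; congr (_%:R - _); congr nat_of_bool.
    by rewrite -natr1 -[RHS]subr_ge0; congr (_ <= _); ring.
  rewrite telescope_sumr// /f chiE ?addr_ge0//; congr (_%:R - _%:R); congr nat_of_bool.
    by rewrite -natr1 -[RHS]subr_ge0; congr (_ <= _); ring.
  by rewrite -[LHS]subr_ge0 -[RHS]subr_ge0; congr (_ <= _); ring.
rewrite iter_sum//.
apply: eq_bigr => w _; rewrite iter_shift /Cn; congr (iter _ _ _ _); ring.
Qed.

(** One jump of size X - w with w <= Z, the n other steps adding up to w. The latter sum to at most
    Z with probability at least 1/2, which gives q/2 for each of the n + 1 positions of the jump,
    and the sum of n + 1 for n < N is at least N^2/2. The condition [2 * Z < X] makes that jump the
    only one of size at least X - Z. *)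
Lemma local_lower (X Z N : nat) (q : R) : (0 < Z)%N -> (2 * Z < X)%N -> 0 <= q ->
  (forall w : nat, (w <= Z)%N -> q <= fine (F [set ((X - w)%N%:R : R)])) ->
  N%:R * (J F (clamp Z%:R) / Z%:R) <= 1 / 2 ->
  q * (N%:R ^+ 2 / 4) <= \sum_(n < N) Cn F 1 n.+1 X%:R.
Proof.
move=> Z0 ZX q0 hq hN; have Zr : 0 < Z%:R :> R by rewrite ltr0n.
have ZX' w : (w < Z.+1)%N -> (w <= X)%N.
  by rewrite ltnS => h; apply: leq_trans h (leq_trans _ (ltnW ZX)); rewrite mul2n -addnn leq_addr.
have bchi := @bm_chi R 1.
set k := J F _ / _ in hN.
have k0 : 0 <= k.
  rewrite divr_ge0//.
  by apply: J_ge0 => y; case/andP: (clamp_bounds y (ltW Zr)).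
pose pg (y : R) : R := (X%:R - Z%:R <= y)%R%:R.
have bg : bm pg by exact: bm_ge.
have step n : (n < N)%N -> n.+1%:R * (q / 2) <= Cn F 1 n.+1 X%:R.
  move=> nN; have bi := bm_Cn F 1 n.
  have XZ : X%:R < 2 * (X%:R - Z%:R) :> R.
    by move: ZX; rewrite -(ltr_nat R) natrM; clear => ?; lra.
  apply: le_trans (one_jump_lower n bchi _ _ XZ); last 2 first.
  - by move=> y; exact: ler0n.
  - by move=> v v0; rewrite /chi leNgt v0.
  apply: ler_wpM2l => //.
  apply: (@le_trans _ _ (\sum_(w < Z.+1) q * Cn F 1 n w%:R)).
    rewrite -mulr_sumr sum_Cn_window; apply: ler_wpM2l => //.
    apply: le_trans (iter_window_lower n Zr); rewrite -/k.
    have : n%:R * k <= N%:R * k by rewrite ler_wpM2r// ler_nat ltnW.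
    by move: hN; clear => h1 h2; lra.
  apply: (@le_trans _ _ (\sum_(w < Z.+1) J F (fun y => Cn F 1 n w%:R * \1_[set ((X - w)%N%:R : R)] y))).
    apply: ler_sum => w _; rewrite JZ ?J_indic//; last exact: bm_indic.
    by rewrite [leRHS]mulrC ler_wpM2r ?Cn_ge0// hq// -ltnS.
  rewrite -J_sum; last by move=> w; apply: bmZ; exact: bm_indic.
  apply: J_le; [by apply: bm_sum => w; apply: bmZ; exact: bm_indic|exact: bm_Op_body|].
  move=> y.
  have [[w yw]|nw] := pselect (exists w : 'I_Z.+1, y = (X - w)%N%:R).
    have wX : (w <= X)%N by exact: (ZX' _ (ltn_ord w)).
    rewrite (bigD1 w)//= big1 ?addr0; last first.
      move=> v vw; rewrite indicE /= memNset ?mulr0// => /= e; move: vw; rewrite -val_eqE /=.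
      have vX : (v <= X)%N by exact: (ZX' _ (ltn_ord v)).
      have /eqP := e; rewrite yw eqr_nat => /eqP e'.
      by rewrite -(subKn vX) -(subKn wX) e' eqxx.
    rewrite indicE mem_set//= mulr1 /pg yw natrB// lerD2l lerN2 ler_nat -ltnS ltn_ord mul1r.
    by rewrite opprB addrCA subrr addr0.
  rewrite big1; first by rewrite mulr_ge0 ?ler0n// Cn_ge0.
  by move=> w _; rewrite indicE memNset ?mulr0// => /= e; apply: nw; exists w.
apply: (@le_trans _ _ (\sum_(n < N) n.+1%:R * (q / 2))); last by apply: ler_sum => n _; exact: step.
rewrite -mulr_suml.
have S : N%:R ^+ 2 / 2 <= \sum_(n < N) (n.+1%:R : R).
  elim: N {hN step} => [|M IH]; first by rewrite big_ord0 expr0n/= mul0r.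
  rewrite big_ord_recr/=; have M0 : 0 <= M%:R :> R by [].
  have -> : M.+1%:R ^+ 2 / 2 = M%:R ^+ 2 / 2 + (M%:R + 1 / 2) :> R by rewrite -natr1; field.
  by apply: lerD => //; rewrite -[M.+1%:R]natr1 lerD2l ler_pdivrMr// mul1r ler1n.
have := ler_wpM2r (divr_ge0 q0 (ler0n R 2)) S; apply: le_trans.
by rewrite le_eqVlt; apply/orP; left; apply/eqP; field.
Qed.

End one_big_jump.

Section windows.
Context {R : realType}.
Implicit Types (A L : R -> R).

Lemma unbounded_ratio A L : rv_half A -> slowly_varying L ->
  (forall x : R, 0 < x -> A x = L x * Num.sqrt x) -> ~ (running_sup L =O_+oo L) ->
  forall K S0 : R, 1 <= K -> 1 <= S0 ->
  exists s x : R, [/\ S0 <= s, s <= x & K * L x < L s].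
Proof.
move=> rA [L0 _] AL nO K S0 K1 S1.
have S0p : 0 < S0 by exact: lt_le_trans S1.
have LS := L0 S0 (ltW S0p).
have AS := A_gt0 rA (ltW S0p).
(* The supremum may be approached at some s below [S0]. Then [L s <= A S0], and the second term of
   the maximum makes [S0] itself a suitable point. *)
pose C := Num.max K (K * A S0 / L S0).
have K0 : 0 < K by exact: lt_le_trans K1.
have C0 : 0 < C by rewrite lt_max K0.
have [x [xS hx]] : exists x : R, S0 <= x /\ C * L x < running_sup L x.
  apply: contrapT => nex; apply: nO; apply/eqO_exP; exists C => //.
  exists S0; split; first exact: num_real.
  move=> x /ltW Sx; have x0 : 0 <= x by apply: le_trans Sx; exact: ltW.
  have Lx := L0 x x0.
  have r0 : 0 <= running_sup L x.
    apply: le_trans (ltW (L0 1 ler01)) _.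
    exact: (le_running_sup rA AL (lexx 1) (le_trans S1 Sx)).
  rewrite ger0_norm// gtr0_norm// leNgt; apply/negP => h.
  by apply: nex; exists x.
have [_ [s /= sx <-] hs] : exists2 y, [set L s | s in `[1, x]%classic] y & C * L x < y.
  apply: contrapT => nex; move: hx; rewrite ltNge => /negP; apply.
  apply: ge_sup; first by exists (L 1), 1 => //=; rewrite in_itv/= lexx (le_trans S1).
  by move=> y hy; rewrite leNgt; apply/negP => h; apply: nex; exists y.
move: sx; rewrite in_itv/= => /andP[s1 sx].
have Lx : 0 < L x by apply: L0; apply: le_trans xS; exact: ltW.
have [Ss|sS] := leP S0 s.
  exists s, x; split => //; apply: le_lt_trans hs.
  by rewrite ler_wpM2r ?(ltW Lx)// le_max lexx.
exists S0, x; split => //.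
have s0 : 0 < s by exact: lt_le_trans s1.
have LsA : L s <= A S0.
  apply: (@le_trans _ _ (A s)); last exact: (A_le rA (ltW s0) (ltW sS)).
  rewrite AL// ler_peMr//; first exact: ltW (L0 s (ltW s0)).
  by rewrite -sqrtr1 ler_wsqrtr.
have : K * A S0 / L S0 * L x < A S0.
  apply: lt_le_trans LsA; apply: le_lt_trans hs.
  by rewrite ler_wpM2r ?(ltW Lx)// le_max lexx orbT.
have -> : K * A S0 / L S0 * L x = K * L x / L S0 * A S0 by ring.
by rewrite gtr_pMl// ltr_pdivrMr// mul1r.
Qed.

(* L(x)^2, when A(x) = L(x) sqrt x. *)
Definition ratio A (x : R) : R := A x ^+ 2 / x.

(** Squaring the factor [4 * K] leaves at least [16 * K], enough to round s up and x down to
    integers, each costing at most a factor 2. Since [A] increases, the ratio also forces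
    [16 * s <= x], so the window is short compared with its position. *)
Lemma unbounded_nat A L : rv_half A -> slowly_varying L ->
  (forall x : R, 0 < x -> A x = L x * Num.sqrt x) -> ~ (running_sup L =O_+oo L) ->
  forall (K : R) (n0 : nat), 1 <= K ->
  exists p : nat * nat, [/\ (n0 < p.1)%N, (4 * p.1 <= p.2)%N & K * ratio A p.2%:R <= ratio A p.1%:R].
Proof.
move=> rA svL AL nO K n0 K1; have [L0 _] := svL.
have K16 : 1 <= 4 * K by clear -K1; lra.
have S1 : 1 <= n0.+1%:R :> R by rewrite ler1n.
have [s [x [Ss sx hL]]] := unbounded_ratio rA svL AL nO K16 S1.
have s1 : 1 <= s by exact: le_trans Ss.
have s0 : 0 < s by exact: lt_le_trans s1.
have x0 : 0 < x by exact: lt_le_trans sx.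
have r2 y : 0 < y -> ratio A y = L y ^+ 2 by move=> y0; exact: (sq_AL AL).
have hr : 16 * K * ratio A x <= ratio A s.
  rewrite !r2//; apply: (@le_trans _ _ ((4 * K * L x) ^+ 2)).
    rewrite !exprMn; apply: ler_wpM2r; first exact: sqr_ge0.
    by rewrite -natrX ler_wpM2l// expr2 ler_peMl// (le_trans ler01).
  rewrite lerXn2r// ?nnegrE ?mulr_ge0// ?ltW// ?L0 ?(ltW x0) ?(ltW s0)//.
  exact: lt_le_trans K1.
have As := A_gt0 rA (ltW s0); have Ax := A_gt0 rA (ltW x0).
have K0 : 0 < K by exact: lt_le_trans K1.
have s16 : 16 * s <= x.
  have h1 : 16 * K * (A s ^+ 2 / x) <= A s ^+ 2 / s.
    apply: le_trans hr; apply: ler_wpM2l; first by rewrite mulr_ge0// ltW.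
    rewrite /ratio ler_wpM2r ?invr_ge0 ?(ltW x0)// lerXn2r ?nnegrE ?(ltW As) ?(ltW Ax)//.
    by apply: (A_le rA) => //; exact: ltW.
  have A2 : 0 < A s ^+ 2 by rewrite exprn_gt0.
  move: h1; rewrite mulrCA ler_pM2l// ler_pdivrMr// [leRHS]mulrC ler_pdivlMr// => h1.
  by apply: le_trans h1; rewrite mulrAC ler_peMr// mulr_ge0// ltW.
have /andP[t1 t2] := truncn_itv (ltW s0); have /andP[v1 v2] := truncn_itv (ltW x0).
set Z := (Num.truncn s).+1 in t2; set X := Num.truncn x in v1 v2.
have Zs : Z%:R <= 2 * s by rewrite /Z -natr1; clear -t1 s1; lra.
have X0 : 0 < X%:R :> R by move: v2; rewrite -natr1; clear -s16 s1; lra.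
have X1 : 1 <= X%:R :> R by move: X0; rewrite ltr0n ler1n.
have X2 : x <= 2 * X%:R by move: v2; rewrite -natr1; clear -X1; lra.
have Z0 : 0 < Z%:R :> R by rewrite ltr0n.
exists (Z, X); split => /=.
- by rewrite ltnS; rewrite truncn_ge_nat ?(ltW s0)//; apply: le_trans Ss; rewrite ler_nat.
- by rewrite -(ler_nat R) natrM; clear -Zs s16 X2; lra.
- apply: (@le_trans _ _ (ratio A s / 2)).
    apply: (@le_trans _ _ (K * (2 * ratio A x))); last first.
      by rewrite ler_pdivlMr//; move: hr; have : 0 <= K * ratio A x; [rewrite mulr_ge0 ?(ltW K0)// r2// sqr_ge0|clear => h1 h2; lra].
    rewrite ler_wpM2l ?(ltW K0)// /ratio.
    have -> : 2 * (A x ^+ 2 / x) = A x ^+ 2 * (2 / x) by ring.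
    apply: ler_pM; [exact: sqr_ge0|by rewrite invr_ge0 ltW| |].
      by rewrite lerXn2r ?nnegrE ?(ltW (A_gt0 rA _)) ?(ltW X0) ?(ltW x0)//; apply: (A_le rA) => //; exact: ltW.
    by rewrite -[leLHS]mul1r ler_pdivrMr// mulrAC ler_pdivlMr// mul1r.
  rewrite /ratio -mulrA -invfM; apply: ler_pM; [exact: sqr_ge0|by rewrite invr_ge0 mulr_ge0// ltW| |].
    by rewrite lerXn2r ?nnegrE ?(ltW (A_gt0 rA _)) ?(ltW s0) ?(ltW Z0)//; apply: (A_le rA); exact: ltW.
  by rewrite lef_pV2 ?posrE ?mulr_gt0// mulrC.
Qed.

(** [ratio] is L squared, so [4 ^+ k] stands for a factor [2 ^+ k] in L. The bound on [A (X k)]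
    keeps the added tail at most 1/2 in total. *)
Definition bad_windows A (Z X : nat -> nat) : Prop := forall k,
  [/\ (k < Z k)%N, (4 * Z k <= X k)%N, 4 <= A (X k)%:R &
      4 ^+ k * ratio A (X k)%:R <= ratio A (Z k)%:R].

Lemma bad_windows_exist A L : rv_half A -> slowly_varying L ->
  (forall x : R, 0 < x -> A x = L x * Num.sqrt x) -> ~ (running_sup L =O_+oo L) ->
  exists Z X, bad_windows A Z X.
Proof.
move=> rA svL AL nO.
have [x1 x11 H1] := A_large rA 4.
have K1 k : 1 <= 4 ^+ k :> R by rewrite exprn_ege1// ler1n.
have H k := unbounded_nat rA svL AL nO (k + (Num.truncn x1).+1)%N (K1 k).
have [p Hp] := choice H.
exists (fun k => (p k).1), (fun k => (p k).2) => k; have [h1 h2 h3] := Hp k; split => //.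
  by apply: leq_ltn_trans h1; exact: leq_addr.
have xX : x1 <= (p k).2%:R.
  have x10 : 0 <= x1 by exact: le_trans x11.
  have /andP[_ t2] := truncn_itv x10; apply: le_trans (ltW t2) _; rewrite ler_nat.
  apply: leq_trans h2; apply: leq_trans (leq_pmull _ _) => //.
  by apply: leq_trans (ltnW h1); exact: leq_addl.
by have [] := H1 _ xX.
Qed.

(* A weighted series of nonnegative bounded terms, as the supremum of its partial sums. *)
Definition wsum (a : nat -> R) : R := sup (range (fun N => \sum_(k < N) 2^-1 ^+ k * a k)).

Lemma half_geo K N : \sum_(k < N) ((K <= k)%N%:R * 2^-1 ^+ k) <= 2 * 2^-1 ^+ K :> R.
Proof.
have h N' : \sum_(k < N') ((K <= k)%N%:R * 2^-1 ^+ k) <= 2 * 2^-1 ^+ K - 2 * 2^-1 ^+ (maxn K N') :> R.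
  elim: N' => [|M IH]; first by rewrite big_ord0 maxn0 subrr.
  rewrite big_ord_recr/=; case: (leqP K M) => KM; last first.
    rewrite mul0r addr0; apply: le_trans IH _.
    by rewrite (maxn_idPl (ltnW KM)) (maxn_idPl KM).
  rewrite (maxn_idPr KM) in IH; rewrite (maxn_idPr (leqW KM)) exprS mul1r.
  by move: (2^-1 ^+ M) (\sum_(k < M) _) (2 * 2^-1 ^+ K) IH => a b c; clear => IH; lra.
apply: le_trans (h N) _; rewrite gerBl mulr_ge0// exprn_ge0// invr_ge0//.
Qed.

Section weighted_sums.
Context (M : R).
Implicit Types (a b : nat -> R).

Lemma wsum_le a K : (forall k, 0 <= a k <= M) -> (forall k, (k < K)%N -> a k = 0) ->
  forall N, \sum_(k < N) 2^-1 ^+ k * a k <= M * (2 * 2^-1 ^+ K).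
Proof.
move=> aM a0 N; have M0 : 0 <= M by have /andP[h1 h2] := aM 0%N; exact: le_trans h2.
apply: (@le_trans _ _ (\sum_(k < N) M * ((K <= k)%N%:R * 2^-1 ^+ k))).
  apply: ler_sum => k _; case: (leqP K k) => Kk; last by rewrite a0// !mulr0 mul0r mulr0.
  rewrite mul1r mulrC ler_wpM2r ?exprn_ge0 ?invr_ge0//.
  by case/andP: (aM k).
by rewrite -mulr_sumr ler_wpM2l// half_geo.
Qed.

Lemma wsum_has_sup a : (forall k, 0 <= a k <= M) -> has_sup (range (fun N => \sum_(k < N) 2^-1 ^+ k * a k)).
Proof.
move=> aM; split; first by exists (\sum_(k < 0) 2^-1 ^+ k * a k), 0%N.
exists (M * (2 * 2^-1 ^+ 0)) => _ [N _ <-]; exact: wsum_le.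
Qed.

Lemma partial_le_wsum a N : (forall k, 0 <= a k <= M) -> \sum_(k < N) 2^-1 ^+ k * a k <= wsum a.
Proof. by move=> aM; apply: ub_le_sup; [have [] := wsum_has_sup aM|exists N]. Qed.

Lemma wsum_le_bound a B : (forall N, \sum_(k < N) 2^-1 ^+ k * a k <= B) -> wsum a <= B.
Proof.
move=> H; apply: ge_sup; first by exists (\sum_(k < 0) 2^-1 ^+ k * a k), 0%N.
by move=> _ [N _ <-].
Qed.

Lemma wsum_gap a b j : (forall k, 0 <= a k <= M) -> (forall k, 0 <= b k) -> (forall k, b k <= a k) ->
  wsum b <= wsum a - 2^-1 ^+ j * (a j - b j).
Proof.
move=> aM b0 ba; apply: wsum_le_bound => N; rewrite lerBrDr.
have h0 k : 0 <= 2^-1 ^+ k :> R by rewrite exprn_ge0// invr_ge0.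
pose N' := maxn N j.+1; have jN : (j < N')%N by exact: leq_maxr.
apply: le_trans (partial_le_wsum N' aM).
apply: (@le_trans _ _ (\sum_(k < N') 2^-1 ^+ k * b k + 2^-1 ^+ j * (a j - b j))).
  rewrite lerD2r /N' -(subnKC (leq_maxl N j.+1)) big_split_ord/= lerDl.
  by apply: sumr_ge0 => k _; exact: mulr_ge0.
rewrite (bigD1 (Ordinal jN))//= [leRHS](bigD1 (Ordinal jN))//=.
have : \sum_(k < N' | k != Ordinal jN) 2^-1 ^+ k * b k <= \sum_(k < N' | k != Ordinal jN) 2^-1 ^+ k * a k.
  by apply: ler_sum => k _; exact: ler_wpM2l.
move: (\sum_(k < N' | _) _ * b k) (\sum_(k < N' | _) _ * a k) => c d; rewrite mulrBr.
by move: (_ * a j) (_ * b j) => e f; clear => ?; lra.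
Qed.

End weighted_sums.

(* The proportion of the window [X - Z, X] to the right of n; X - n is truncated. *)
Definition phi (Z X n : nat) : R := Num.min 1 ((X - n)%N%:R / Z.+1%:R).

Lemma phi_bounds Z X n : 0 <= phi Z X n <= 1.
Proof. by rewrite /phi le_min ler01 divr_ge0//= ge_min lexx. Qed.

Lemma phi_out Z X n : (X <= n)%N -> phi Z X n = 0.
Proof. by rewrite /phi -subn_eq0 => /eqP->; rewrite mul0r (min_idPr _). Qed.

Lemma phi_mono Z X n : phi Z X n.+1 <= phi Z X n.
Proof.
apply: le_min2 => //; rewrite ler_wpM2r ?invr_ge0// ler_nat.
exact: leq_sub2l.
Qed.

Lemma phi_gap Z X n : (n < X)%N -> (X <= n + Z.+1)%N ->
  phi Z X n - phi Z X n.+1 = Z.+1%:R^-1.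
Proof.
move=> nX XZ; have Z0 : 0 < Z.+1%:R :> R by rewrite ltr0n.
have i1 : (X - n)%N%:R / Z.+1%:R <= 1 :> R.
  by rewrite ler_pdivrMr// mul1r ler_nat leq_subLR.
have i2 : (X - n.+1)%N%:R / Z.+1%:R <= 1 :> R.
  by apply: le_trans i1; rewrite ler_wpM2r ?invr_ge0// ler_nat leq_sub2l.
rewrite /phi (min_idPr i1) (min_idPr i2) -mulrBl.
by rewrite -(subnSK nX) -[(X - n.+1).+1%:R]natr1 addrAC subrr add0r mul1r.
Qed.

Lemma A_floor A (e : R) : rv_half A -> 0 < e -> e <= 1/4 -> exists2 x1 : R, 1 <= x1 &
  forall x : R, x1 <= x -> (1 - e) * A x <= A (Num.truncn x)%:R.
Proof.
move=> rA e0 e1; have [x1 x11 H] := A_increment rA e0 e1.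
exists (Num.max x1 (2 / e)); first by rewrite le_max x11.
move=> x; rewrite ge_max => /andP[xx1 xe].
have x0 : 0 < x by exact: lt_le_trans (lt_le_trans ltr01 x11) xx1.
have /andP[t1 t2] := truncn_itv (ltW x0); set m := (Num.truncn x)%:R in t1 *.
rewrite -natr1 -/m in t2.
have Ax := A_gt0 rA (ltW x0).
have ex2 : 2 <= e * x by move: xe; rewrite ler_pdivrMr// mulrC.
have l0 : 0 <= x - m by rewrite subr_ge0.
have l1 : x - m <= 1 by clear -t2; lra.
have le : x - m <= e * x by clear -ex2 l1; lra.
have /andP[_ h] := H x (x - m) xx1 l0 le.
rewrite subKr in h.
have h1 : (1 + 8 * e) * ((x - m) / 2 * (A x / x)) <= 2 * (A x / x).
  rewrite mulrA; apply: ler_wpM2r; first by rewrite divr_ge0// ltW.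
  have : (1 + 8 * e) * ((x - m) / 2) <= 3 * (1 / 2).
    by apply: ler_pM; [clear -e0; lra|rewrite divr_ge0|clear -e1; lra|clear -l1; lra].
  by clear => ?; lra.
have h2 : 2 * (A x / x) <= e * A x.
  by rewrite mulrCA [leRHS]mulrC ler_wpM2l ?(ltW Ax)// ler_pdivrMr.
by rewrite mulrBl mul1r; move: h h1 h2; move: (A x) (A m) (_ * (_ / 2 * _)) (2 * _) => a b c d; clear => *; lra.
Qed.

Section counterexample.
Context (A : R -> R) (rA : rv_half A) (Z X : nat -> nat) (bw : bad_windows A Z X).

Definition extra n k : R := phi (Z k) (X k) n / A (X k)%:R.

(** The 2 makes the first term smaller than 1/2 already at n = 0; with the added tail at most 1/2,
    the whole is below 1. *)
Definition bad_tail n : R := (A n%:R + 2)^-1 + wsum (extra n).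

(** [bad_tail n] is the probability of exceeding n, whereas a [digit_scale] records that of being at
    least n: hence the shift. *)
Definition bad_scale n : R := if n is m.+1 then bad_tail m else 1.

Let An n : 0 < A n%:R. Proof. exact: (A_gt0 rA). Qed.

Lemma extra_bounds n k : 0 <= extra n k <= 1/4.
Proof.
have [_ _ A4 _] := bw k; have /andP[p0 p1] := phi_bounds (Z k) (X k) n.
have AX := An (X k); rewrite /extra; apply/andP; split; first by rewrite divr_ge0// ltW.
by rewrite ler_pdivrMr//; apply: le_trans p1 _; lra.
Qed.

(** The k-th extra term vanishes from [X k] on, and before that [A n%:R] is at most [A (X k)%:R]:
    the added mass is always comparable with the tail already present. *)
Lemma extra_le n k : 0 <= extra n k <= (A n%:R)^-1.
Proof.
have /andP[e0 _] := extra_bounds n k; rewrite e0/=.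
have [Xn|nX] := leqP (X k) n; first by rewrite /extra phi_out// mul0r invr_ge0 ltW.
have /andP[p0 p1] := phi_bounds (Z k) (X k) n.
rewrite /extra; apply: (@le_trans _ _ (1 / A (X k)%:R)); first by rewrite ler_wpM2r// invr_ge0 ltW.
rewrite mul1r lef_pV2 ?posrE//; apply: (A_le rA) => //.
by rewrite ler_nat ltnW.
Qed.

Lemma extra_mono n k : extra n.+1 k <= extra n k.
Proof. by rewrite /extra ler_wpM2r ?invr_ge0 ?(ltW (An _))// phi_mono. Qed.

Lemma bad_scale_gap k w : (w <= Z k)%N ->
  2^-1 ^+ k / (A (X k)%:R * (Z k).+1%:R) <= bad_scale (X k - w)%N - bad_scale (X k - w).+1.
Proof.
move=> wZ; have [kZ ZX _ _] := bw k.
have wX : (w < X k)%N.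
  by apply: leq_ltn_trans wZ (leq_trans _ ZX); rewrite -[X in (X < _)%N]mul1n ltn_pmul2r// (leq_ltn_trans _ kZ).
have [n nE] : exists n, (X k - w)%N = n.+1 by exists (X k - w).-1; rewrite prednK// subn_gt0.
rewrite nE /= /bad_tail.
have nX : (n < X k)%N by rewrite -ltnS -nE ltnS leq_subr.
have XZ : (X k <= n + (Z k).+1)%N.
  by rewrite addnS -addSn -nE; apply: leq_trans (leq_add (leqnn _) wZ); rewrite subnK// ltnW.
have h := wsum_gap k (extra_bounds n) (fun j => proj1 (andP (extra_bounds n.+1 j))) (extra_mono n).
have e : extra n k - extra n.+1 k = (A (X k)%:R * (Z k).+1%:R)^-1.
  by rewrite /extra -mulrBl phi_gap// invfM mulrC.
rewrite e in h.
have b : (A n.+1%:R + 2)^-1 <= (A n%:R + 2)^-1.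
  rewrite lef_pV2 ?posrE ?addr_gt0// lerD2r; apply: (A_le rA) => //.
  by rewrite ler_nat.
by move: h b; move: (wsum _) (wsum _) (_^-1) (_^-1) => c d f g; clear => h b; lra.
Qed.

(** Past the first K windows only terms of weight [2^-1 ^+ k] with k >= K survive, so the
    perturbation is negligible against 1/A. *)
Lemma bad_tail_extra K n : (forall k, (k < K)%N -> (X k <= n)%N) ->
  0 <= wsum (extra n) <= (A n%:R)^-1 * (2 * 2^-1 ^+ K).
Proof.
move=> XK; apply/andP; split.
  have := partial_le_wsum 0 (extra_bounds n); by rewrite big_ord0.
apply: wsum_le_bound; apply: wsum_le; first exact: extra_le.
by move=> k /XK h; rewrite /extra phi_out// mul0r.
Qed.

Lemma bad_scale_digit : digit_scale bad_scale.
Proof.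
have w0 n : 0 <= wsum (extra n) by have /andP[] := @bad_tail_extra 0 n (fun k h => ltac:(by [])).
have t0 n : 0 < bad_tail n by rewrite ltr_wpDr// invr_gt0 addr_gt0.
split => //; first by case.
  case=> [|n] /=.
    have h : wsum (extra 0) <= 1/4 * (2 * 2^-1 ^+ 0).
      by apply: wsum_le_bound; apply: wsum_le => //; exact: extra_bounds.
    have h2 : (A 0%:R + 2)^-1 < 2^-1.
      by rewrite ltf_pV2 ?posrE ?addr_gt0// ltrDr.
    by move: h h2; rewrite expr0 mulr1 /bad_tail; move: (wsum _) ((_ + 2)^-1) => a b h h2; lra.
  rewrite /bad_tail ltr_leD//.
    rewrite ltf_pV2 ?posrE ?addr_gt0// ltrD2r; apply: (A_incr rA) => //.
    by rewrite ltr_nat.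
  have h := wsum_gap 0 (extra_bounds n) (fun j => proj1 (andP (extra_bounds n.+1 j))) (extra_mono n).
  apply: le_trans h _; rewrite gerBl mulr_ge0//; last by rewrite subr_ge0 extra_mono.
move=> e e0; have [x1 x11 H] := A_large rA (3 / e + 1).
have [n nx] : exists n : nat, x1 <= n%:R.
  by exists (Num.truncn x1).+1; apply: ltW; exact: truncnS_gt.
have [hA _ _] := H _ nx; exists n.+1 => /=.
have /andP[_ h] := @bad_tail_extra 0 n (fun k h => ltac:(by [])).
apply: (@le_lt_trans _ _ (3 / A n%:R)).
  have h2 : (A n%:R + 2)^-1 <= (A n%:R)^-1 by rewrite lef_pV2 ?posrE ?addr_gt0// lerDl.
  by move: h h2; rewrite expr0 mulr1 /bad_tail; move: (wsum _) ((_ + _)^-1) (_^-1) => a b c h h2; clear -h h2 a b c; lra.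
rewrite ltr_pdivrMr// mulrC -ltr_pdivrMr//; apply: lt_le_trans hA.
by rewrite ltrDl.
Qed.

Let F : probability (measurableTypeR R) R := dlaw bad_scale_digit : probability _ _.

Lemma bad_law_tail : asymp_equiv (tail F) (fun x => 1 / A x).
Proof.
apply/asymp_equivP => e e0.
pose d := Num.min (1/4) (e / 8).
have d0 : 0 < d by rewrite lt_min !divr_gt0.
have d1 : d <= 1/4 by rewrite ge_min lexx.
have d2 : 8 * d <= e.
  have : d <= e / 8 by rewrite ge_min lexx orbT.
  by rewrite ler_pdivlMr// mulrC.
clearbody d.
have [x1 x11 H1] := A_floor rA d0 d1.
have [x2 x21 H2] := A_large rA (2 / d).
have [K HK] : exists K : nat, 2 * 2^-1 ^+ K <= d.
  have [K hK] : exists K : nat, 2 / d <= K%:R.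
    by exists (Num.truncn (2 / d)).+1; apply: ltW; exact: truncnS_gt.
  exists K; rewrite exprVn ler_pdivrMr ?exprn_gt0// mulrC -ler_pdivrMr//.
  apply: le_trans hK _; rewrite -natrX ler_nat; apply: ltnW; exact: ltn_expl.
pose B := (\max_(k < K) X k)%N.
exists (Num.max (Num.max x1 x2) (B%:R + 1)); first by rewrite !le_max x11.
move=> x; rewrite !ge_max => /andP[/andP[xx1 xx2] xB].
have x0 : 0 <= x by apply: le_trans (le_trans ler01 x11) xx1.
have Ax := A_gt0 rA x0.
have [hA _ _] := H2 _ xx2.
rewrite /F dlaw_tail//= /bad_tail; set m := Num.truncn x.
have hm := H1 _ xx1; rewrite -/m in hm.
have mx : A m%:R <= A x.
  by apply: (A_le rA) => //; have /andP[] := truncn_itv x0.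
have XK k : (k < K)%N -> (X k <= m)%N.
  move=> kK; apply: (@leq_trans B); first exact: (@leq_bigmax _ (fun k : 'I_K => X k) (Ordinal kK)).
  rewrite truncn_ge_nat//; apply: le_trans xB; by rewrite lerDl.
have /andP[w0 w1] := @bad_tail_extra K m XK.
have Am := An m.
rewrite div1r invrK.
have i1 : (A m%:R + 2)^-1 * A x <= 1 + 2 * d.
  apply: (@le_trans _ _ ((A m%:R)^-1 * A x)).
    by rewrite ler_wpM2r ?(ltW Ax)// lef_pV2 ?posrE ?addr_gt0// lerDl.
  rewrite mulrC ler_pdivrMr//; apply: (@le_trans _ _ ((1 + 2 * d) * ((1 - d) * A x))).
    rewrite mulrA ler_peMl ?(ltW Ax)//.
    have : 0 <= d * (1 - 2 * d) by rewrite mulr_ge0 ?(ltW d0)//; clear -d1 d2 x11; lra.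
    by clear -w1; lra.
  by rewrite ler_wpM2l//; clear -e0 d0 x11; lra.
have i2 : 1 - d <= (A m%:R + 2)^-1 * A x.
  rewrite [leRHS]mulrC ler_pdivlMr ?addr_gt0//.
  have h : (1 - d) * (A m%:R + 2) <= (1 - d) * (A x + 2).
    by apply: ler_wpM2l; [(clear -d1 d2 x11; lra)|rewrite lerD2r].
  apply: le_trans h _.
  have : 2 <= d * A x by move: hA; rewrite ler_pdivrMr// mulrC.
  by move: (A x) d0 => a d0 h; clear -e0 d0 a h; lra.
have i3 : wsum (extra m) * A x <= 2 * d.
  apply: (@le_trans _ _ ((A m%:R)^-1 * d * A x)).
    apply: ler_wpM2r; first exact: ltW.
    by apply: le_trans w1 _; apply: ler_wpM2l HK; rewrite invr_ge0 ltW.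
  have -> : (A m%:R)^-1 * d * A x = d * (A x / A m%:R) by ring.
  rewrite [leRHS]mulrC; apply: ler_wpM2l; first exact: ltW.
  rewrite ler_pdivrMr//; have : d * A x <= 1/4 * A x by rewrite ler_wpM2r// ltW.
  by clear -hm mx; lra.
have i4 : 0 <= wsum (extra m) * A x by rewrite mulr_ge0// ltW.
rewrite mulrDl ler_norml; move: i1 i2 i3 i4.
move: (_ * A x) (_ * A x) => a b h1 h2 h3 h4.
by apply/andP; split; clear -d2 h1 h2 h3 h4; lra.
Qed.

Lemma bad_law_no_SRT : ~ SRT A F.
Proof.
have ar1 (a n : R) : 16 <= a -> a / 8 < n + 1 -> a / 16 <= n by move=> *; lra.
have ar2 (a c : R) : 2^-1 * a <= 2 * c -> a <= 2 * (2 * c) by move=> *; lra.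
have ar3 (p : R) : 2 <= p -> (1 / 2 + 1) * 1 <= 1 * p by move=> *; lra.
have ar5 : ~ (1 : R) <= 1 / 2 by lra.
move=> srt.
have F1 : F `[0, +oo[%classic = 1%E by exact: dlaw_ge0.
have hF := half_tail_intro rA F1 bad_law_tail.
have F0 := ht_neg hF.
have [asy _] := srt _ _ _ _ (dseq_iid bad_scale_digit).
have h2 : 0 < 1 / 2 :> R by rewrite divr_gt0.
have [x1 x11 H1] := (asymp_equivP _ _).1 (asy 1 (dlaw_span bad_scale_digit)) _ h2.
have [z1 z11 H2] := tau_asymp hF ltr01 (lexx _).
have [z2 z21 H3] := A_large rA 16.
(* 12 makes [2 ^+ k] exceed [2 ^+ 11 = 2 * (16 * 16 * 4)], the product of all constants lost below;
   the rest of the sum makes the asymptotic estimates applicable. *)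
pose k := (12 + ((Num.truncn x1).+1 + ((Num.truncn z1).+1 + (Num.truncn z2).+1)))%N.
have k12 : (12 <= k)%N by exact: leq_addr.
have [kx1 kz1 kz2] : [/\ x1 <= k%:R, z1 <= k%:R & z2 <= k%:R].
  have trk (t : R) : ((Num.truncn t).+1 <= k)%N -> t <= k%:R.
    by move=> h; apply: le_trans (ltW (truncnS_gt t)) _; rewrite ler_nat.
  split; apply: trk; rewrite /k.
  - by rewrite addnCA leq_addr.
  - by rewrite addnA addnCA leq_addr.
  - by rewrite addnA addnA leq_addl.
clearbody k.
have [kZ ZX _ rk] := bw k.
set x := X k in ZX rk; set z := Z k in kZ ZX rk.
have z0 : (0 < z)%N by exact: leq_ltn_trans kZ.
have zr : 0 < z%:R :> R by rewrite ltr0n.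
have kz : k%:R <= z%:R :> R by rewrite ler_nat ltnW.
have zx : z%:R <= x%:R :> R by rewrite ler_nat (leq_trans _ ZX)// leq_pmull.
have xr : 0 < x%:R :> R by exact: lt_le_trans zx.
have [Az16 _ _] := H3 _ (le_trans kz2 kz).
have Az := An z; have Ax := An x.
(* The truncated mean of F over [z] is at most [4 / A z%:R], so N such steps stay below [z] with
   probability at least 1/2. *)
pose N := Num.truncn (A z%:R / 8).
have Az8 : 0 <= A z%:R / 8 by rewrite divr_ge0// ltW.
have /andP[N1 N2] := truncn_itv Az8; rewrite -/N in N1 N2.
have N16 : A z%:R / 16 <= N%:R by apply: ar1 => //; rewrite natr1.
pose q := 2^-1 ^+ k / (A x%:R * z.+1%:R).
have z1r : 0 < z.+1%:R :> R by rewrite ltr0n.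
have q0 : 0 < q by rewrite divr_gt0 ?exprn_gt0 ?invr_gt0 ?mulr_gt0.
have zx2 : (2 * z < x)%N by apply: leq_trans ZX; rewrite ltn_pmul2r.
have hq w : (w <= z)%N -> q <= fine (F [set ((x - w)%N%:R : R)]).
  by move=> wz; rewrite /F /= dlaw1 /=; exact: bad_scale_gap.
have hk : N%:R * (J F (clamp z%:R) / z%:R) <= 1 / 2.
  have zr0 := ltW zr.
  have bc := bm_clamp zr0.
  have c1 : J (lazyF F) (clamp z%:R) <= 2 * (z%:R / A z%:R).
    apply: le_trans (layer_cake F zr0) _.
    have /andP[_ h] := H2 _ (le_trans kz1 kz).
    by rewrite (_ : 2 = 1 + 1 :> R).
  rewrite J_lazy// clampE ?lexx ?zr0// mulr0 add0r in c1.
  have c2 : J F (clamp z%:R) / z%:R <= 4 / A z%:R.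
    rewrite ler_pdivrMr//.
    have -> : 4 / A z%:R * z%:R = 2 * (2 * (z%:R / A z%:R)) by ring.
    exact: ar2.
  apply: (@le_trans _ _ (A z%:R / 8 * (4 / A z%:R))).
    apply: ler_pM => //; rewrite divr_ge0//.
    by apply: J_ge0 => y; case/andP: (clamp_bounds y zr0).
  by rewrite le_eqVlt; apply/orP; left; apply/eqP; field; rewrite gt_eqF.
have low := local_lower F0 z0 zx2 (ltW q0) hq hk.
have hx := H1 x%:R (le_trans kx1 (le_trans kz zx)).
pose V := (\sum_(0 <= n <oo) (Cn F 1 n x%:R)%:E)%E.
have UE : renewal_measure (dRV bad_scale_digit) `]x%:R - 1, x%:R]%classic = V.
  by apply: eq_eseriesr => n _; exact: (walk_window (dseq_iid bad_scale_digit) n 1 x%:R).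
rewrite UE sin_pihalf mulr1 in hx.
have V0 n : (0 <= (Cn F 1 n x%:R)%:E)%E by rewrite lee_fin Cn_ge0.
have Vlow : ((q * (N%:R ^+ 2 / 4))%:E <= V)%E.
  apply: le_trans (nneseries_lim_ge (m := 0%N) (P := xpredT) N.+1 (fun n _ _ => V0 n)).
  rewrite big_mkord sumEFin lee_fin big_ord_recl/=; apply: le_trans low _.
  by rewrite lerDr; exact: ler0n.
have p0 := pi_gt0 R; have p2 := pi_ge2 R.
have qx0 : 0 < A x%:R / x%:R by rewrite divr_gt0.
(* The theorem's asymptotics with relative error 1/2 would give at most 3/(2 pi) times this, and 3/2
   is less than pi. *)
have Vup : fine V <= A x%:R / x%:R.
  have c0 : 0 < 1 / pi * (A x%:R / x%:R) by rewrite mulr_gt0// divr_gt0.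
  move: hx; rewrite ler_norml => /andP[_]; rewrite lerBlDr ler_pdivrMr// => h.
  apply: le_trans h _; rewrite (mulrA (1 / 2 + 1)) ler_piMl ?(ltW qx0)//.
  by rewrite mulrA ler_pdivrMr//; exact: ar3.
have Vfin : V \is a fin_num.
  rewrite fin_numE; apply/andP; split; apply/eqP => Ve.
    by move: Vlow; rewrite Ve.
  by move: hx; rewrite Ve /= mul0r sub0r normrN normr1 => /ar5.
have main : q * (N%:R ^+ 2 / 4) <= A x%:R / x%:R.
  by apply: le_trans Vup; rewrite -lee_fin fineK.
have N2' : (A z%:R / 16) ^+ 2 <= N%:R ^+ 2.
  by rewrite lerXn2r ?nnegrE// divr_ge0// ltW.
have : 2^-1 ^+ k * 4 ^+ k / (2 * (16 * 16 * 4)) * (A x%:R / x%:R) <= A x%:R / x%:R.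
  apply: le_trans main; apply: (@le_trans _ _ (q * ((A z%:R / 16) ^+ 2 / 4))); last first.
    by rewrite ler_wpM2l ?(ltW q0)// ler_wpM2r.
  apply: (@le_trans _ _ (2^-1 ^+ k / ((2 * (16 * 16 * 4)) * A x%:R) * ratio A z%:R)).
    have -> : 2^-1 ^+ k * 4 ^+ k / (2 * (16 * 16 * 4)) * (A x%:R / x%:R) = 2^-1 ^+ k / ((2 * (16 * 16 * 4)) * A x%:R) * (4 ^+ k * ratio A x%:R).
      by rewrite /ratio; move: (2^-1 ^+ k) (4 ^+ k) => a c; field; rewrite !gt_eqF.
    apply: ler_wpM2l rk.
    by rewrite divr_ge0 ?exprn_ge0 ?invr_ge0// mulr_ge0// ltW.
  have -> : q * ((A z%:R / 16) ^+ 2 / 4) = 2^-1 ^+ k / ((16 * 16 * 4) * A x%:R) * (A z%:R ^+ 2 / z.+1%:R).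
    by rewrite /q; move: (2^-1 ^+ k) => a; field; rewrite !gt_eqF.
  have -> : 2^-1 ^+ k / ((2 * (16 * 16 * 4)) * A x%:R) * ratio A z%:R = 2^-1 ^+ k / ((16 * 16 * 4) * A x%:R) * (A z%:R ^+ 2 / (2 * z%:R)).
    by rewrite /ratio; move: (2^-1 ^+ k) => a; field; rewrite !gt_eqF.
  apply: ler_wpM2l; first by rewrite divr_ge0 ?exprn_ge0 ?invr_ge0// mulr_ge0// ltW.
  apply: ler_wpM2l; first exact: sqr_ge0.
  rewrite lef_pV2 ?posrE ?mulr_gt0// -natr1.
  have : 1 <= z%:R :> R by rewrite ler1n.
  by clear -N2'; lra.
apply/negP; rewrite -ltNge ltr_pMl// ltr_pdivlMr// mul1r -exprMn.
have -> : 2^-1 * 4 = 2 :> R by field.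
have -> : 2 * (16 * 16 * 4) = 2 ^+ 11 :> R by ring.
by rewrite ltr_eXn2l// ltr1n.
Qed.

End counterexample.

End windows.

Theorem theorem1p7 (R : realType) (A L : R -> R)
  (A_rv : regularly_varying (2^-1) A)
  (A_diff : differentiable_on_nonneg A)
  (A_incr : forall x y : R, 0 <= x -> x < y -> A x < A y)
  (A_deriv : asymp_equiv A^`()%classic (fun s => 2^-1 * (A s / s)))
  (L_sv : slowly_varying L)
  (AL : forall x : R, 0 < x -> A x = L x * Num.sqrt x) :
  (running_sup L =O_+oo L ->
     forall F : probability (measurableTypeR R) R,
       F `[0, +oo[%classic = 1%E ->
       asymp_equiv (tail F) (fun x => 1 / A x) ->
       SRT A F) /\
  (~ (running_sup L =O_+oo L) ->
     exists F : probability (measurableTypeR R) R,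
       [/\ F `[0, +oo[%classic = 1%E,
           asymp_equiv (tail F) (fun x => 1 / A x) &
           ~ SRT A F]).
Proof.
have rA : rv_half A by apply: rv_half_intro => //; [case: A_rv|case: A_diff].
split=> [hO F F1 Ft|nO].
  apply: SRT_of_dominated; first exact: half_tail_intro.
  exact: (L_dominated_intro rA L_sv AL).
have [Z [X bw]] := bad_windows_exist rA L_sv AL nO.
exists (dlaw (bad_scale_digit rA bw)); split.
- exact: dlaw_ge0.
- exact: bad_law_tail.
- exact: bad_law_no_SRT.
Qed.
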